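(* Assume conditions (A1)–(A6) below hold, that $2m>d+1$, and that the (possibly random) penalty parameters $\lambda=\lambda_n>0$ satisfy (i) $\lambda = \log^{3/2}(n)\, O_{\mathbb{P}}\big(n^{-\frac{2m}{2m+d}} + \max_{1\le j\le p}\operatorname{diam}^{2\kappa}(A_j)\big)$, and (ii) $\lambda^{-1}\log^{3/2}(n)\big(n^{-\frac{2m}{2m+d}} + \max_{1\le j\le p}\operatorname{diam}^{2\kappa}(A_j)\big) = O_{\mathbb{P}}(1)$, where $\kappa$ is the constant in (A3). Let $\widehat\beta_n$ be a solution of $$\widehat\beta_n\in\operatorname*{arg\,min}_{\beta\in\mathcal{H}^m(\mathbb{R}^d)}\Big[\frac1n\sum_{i=1}^n\rho\Big(Y_i-\sum_{j=1}^pX_i(\mathbf t_j)\beta(\mathbf t_j)\mu(A_j)\Big)+\lambda J_m^2(\beta)\Big]$$ (i.e. the estimator with scale $\widehat\sigma_n=1$). Then, as $n\to\infty$, $$\|\widehat\beta_n-\beta_0\|_{n,p}=O_{\mathbb{P}}\Big(\log^2(n)\Big\{n^{-\frac{m}{2m+d}}+\max_{1\le j\le p}\operatorname{diam}^{\kappa}(A_j)\Big\}\Big)\quad\text{and}\quad J_m(\widehat\beta_n)=O_{\mathbb{P}}(1).$$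
   Context: Setting: $d\ge1$, $m\ge1$ integers; $\mathcal I\subset\mathbb{R}^d$ a bounded open set with Lebesgue measure $\mu$; $X=\{X(\mathbf t),\mathbf t\in\mathcal I\}$ a real random field with $\mathbb{E}\|X\|^2<\infty$ ($\|\cdot\|$, $\langle\cdot,\cdot\rangle$ the $L^2(\mathcal I)$ norm and inner product). Data $(X_i,Y_i)$, $i=1,\dots,n$, with $X_i$ i.i.d. copies of $X$ and $Y_i=\alpha_0+\int_{\mathcal I}X_i(\mathbf t)\beta_0(\mathbf t)\,d\mathbf t+\epsilon_i$, where $\epsilon_1,\dots,\epsilon_n$ are i.i.d. and independent of the $X_i$. Standing assumption: $\alpha_0=0$ (centered responses; the intercept is not estimated), and $\beta_0\in\mathcal H^m(\mathbb{R}^d)$. $\mathcal H^m(\mathbb{R}^d)$ is the space of $f:\mathbb{R}^d\to\mathbb{R}$ whose partial derivatives of total order $m$ exist and with $I_m^2(f)=\sum_{m_1+\dots+m_d=m}\binom{m}{m_1,\dots,m_d}\int_{\mathbb{R}^d}\big(\partial^m f/\partial t_1^{m_1}\cdots\partial t_d^{m_d}\big)^2d\mathbf t<\infty$. Discretization: points $\mathbf t_1,\dots,\mathbf t_p\in\mathcal I$ and a partition $A_1,\dots,A_p$ of $\mathcal I$ into disjoint measurable sets with $\mathbf t_j\in A_j$ and $\mu(A_j)=\mu(\mathcal I)/p$; $p=p_n$, the points and partition may depend on $n$. Penalty: $J_m^2(\beta)=\sum_{j=1}^p|\beta(\mathbf t_j)|^2\mu(A_j)+I_m^2(\beta)$.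 $\operatorname{diam}(A)=\sup_{\mathbf x,\mathbf y\in A}\|\mathbf x-\mathbf y\|_{\mathbb{R}^d}$. Semi-norm: $\|\beta\|_{n,p}^2=\frac{\mu(\mathcal I)}{np^2}\sum_{i=1}^n\big|\sum_{j=1}^pX_i(\mathbf t_j)\beta(\mathbf t_j)\big|^2$. (A1) $\mathcal I$ is a bounded open set whose boundary satisfies the uniform cone condition (Adams–Fournier, Sobolev Spaces, 2003): there exist a locally finite open cover $\{U_j\}$ of $\partial\mathcal I$ and finite cones $C_j$, each congruent to a fixed finite cone $C$, such that the $U_j$ have uniformly bounded diameters, $\{\mathbf x\in\mathcal I:\operatorname{dist}(\mathbf x,\partial\mathcal I)<\delta\}\subset\bigcup_jU_j$ for some $\delta>0$, $Q_j:=\bigcup_{\mathbf x\in\mathcal I\cap U_j}(\mathbf x+C_j)\subset\mathcal I$ for all $j$, and for some finite $R$ every collection of $R+1$ of the sets $Q_j$ has empty intersection. (A2) With $h_{\max}=\sup_{\mathbf t\in\mathcal I}\min_j\|\mathbf t-\mathbf t_j\|_{\mathbb{R}^d}$ and $h_{\min}=\min_{j\ne k}\|\mathbf t_j-\mathbf t_k\|_{\mathbb{R}^d}$, there is a finite $B$ with $h_{\max}/h_{\min}\le B$ for all large $n$ and $p$. (A3) There is $t\in(0,1)$ with $\mathbb{E}\{e^{t\|X\|_\infty^2}\}<\infty$, and $C_1>0$, $\kappa\in(0,1]$ with $\mathbb{E}|X(\mathbf t)-X(\mathbf s)|^2\le C_1\|\mathbf t-\mathbf s\|_{\mathbb{R}^d}^{2\kappa}$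 for all $\mathbf t,\mathbf s\in\mathcal I$. (A4) $\rho:\mathbb{R}\to[0,\infty)$ is convex and Lipschitz: $|\rho(x)-\rho(y)|\le C_2|x-y|$. (A5) $g(t):=\mathbb{E}\{\rho(\epsilon_1+t)\}$ is uniquely minimized at $t=0$ and is twice differentiable with uniformly bounded second derivative. (A6) There is $\varepsilon>0$ such that $g(t)-g(0)\ge\varepsilon t^2$ for all $|t|\le\varepsilon$. *)

(* Defs.v *)
From HB Require Import structures.
From mathcomp Require Import all_boot all_order all_algebra.
From mathcomp Require Import all_classical all_reals all_analysis.
From mathcomp Require Import measurable_realfun.
Set Implicit Arguments. Unset Strict Implicit. Unset Printing Implicit Defensive.
Import Order.TTheory GRing.Theory Num.Theory.
Import numFieldNormedType.Exports.
Local Open Scope classical_set_scope.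
Local Open Scope ring_scope.

Section Defs.
Variable R : realType.
Variable d : nat.

Definition Rd := g_sigma_algebraType (@open 'rV[R]_d).

Definition eucl_norm (x : 'rV[R]_d) : R := Num.sqrt (\sum_i x 0 i ^+ 2).
Definition eucl_dist (x y : 'rV[R]_d) : R := eucl_norm (x - y).

(** Lebesgue measure on the Borel sets of R^d: the (unique) Borel measure giving
    closed boxes their volume. *)
Definition is_lebesgue_Rd (mu : {measure set Rd -> \bar R}) : Prop :=
  forall a b : 'rV[R]_d, (forall i, a 0 i <= b 0 i) ->
    mu [set x : Rd | forall i, a 0 i <= x 0 i <= b 0 i] = (\prod_i (b 0 i - a 0 i))%:E.

(** A is Lebesgue measurable (Borel up to a Borel null set) with Lebesgue measure v. *)
Definition leb_measure_is (mu : {measure set Rd -> \bar R}) (A : set 'rV[R]_d) (v : \bar R) : Prop :=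
  exists (B N : set Rd), measurable B /\ measurable N /\ mu N = 0%E /\
    ((A `\` B) `|` (B `\` A)) `<=` N /\ mu B = v.

Definition ebasis (i : 'I_d) : 'rV[R]_d := delta_mx 0 i.
Definition pder (i : 'I_d) (f : 'rV[R]_d -> R) : 'rV[R]_d -> R :=
  fun x => derive f x (ebasis i).
Fixpoint iter_pder (s : seq 'I_d) (f : 'rV[R]_d -> R) : 'rV[R]_d -> R :=
  match s with [::] => f | i :: s' => pder i (iter_pder s' f) end.
Fixpoint iter_pderivable (s : seq 'I_d) (f : 'rV[R]_d -> R) : Prop :=
  match s with
  | [::] => True
  | i :: s' => iter_pderivable s' f /\ forall x, derivable (iter_pder s' f) x (ebasis i)
  end.
(* the multi-index a = (m_1,...,m_d) as the sequence of directions to differentiate in *)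
Definition mi_seq (a : 'I_d -> nat) : seq 'I_d :=
  flatten [seq nseq (a i) i | i <- enum 'I_d].
Definition multinom (m : nat) (a : 'I_d -> nat) : R :=
  (m`!)%:R / (\prod_i (a i)`!)%:R.

Definition Im2 (mu : {measure set Rd -> \bar R}) (m : nat) (f : 'rV[R]_d -> R) : \bar R :=
  (\sum_(a : {ffun 'I_d -> 'I_m.+1} | (\sum_i (a i : nat) == m)%N)
     (multinom m (fun i => a i))%:E *
     \int[mu]_(x in [set: Rd]) ((iter_pder (mi_seq (fun i => a i)) f x) ^+ 2)%:E)%E.

Definition inHm (mu : {measure set Rd -> \bar R}) (m : nat) (f : 'rV[R]_d -> R) : Prop :=
  (forall a : {ffun 'I_d -> 'I_m.+1}, (\sum_i (a i : nat) = m)%N ->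
     iter_pderivable (mi_seq (fun i => a i)) f) /\
  (Im2 mu m f < +oo)%E.

Definition bounded_Rd (I : set 'rV[R]_d) := exists M : R, forall x, I x -> eucl_norm x <= M.
Definition set_diam (A : set 'rV[R]_d) : R := sup [set eucl_dist x y | x in A & y in A].
Definition set_boundary (I : set 'rV[R]_d) := closure I `\` interior I.

(* finite cone with vertex 0 (Adams--Fournier): B(0,r) intersected with the set of
   positive multiples of points of an open ball B(z,s) not containing 0 *)
Definition finite_cone0 (C : set 'rV[R]_d) : Prop :=
  exists (r s : R) (z : 'rV[R]_d), 0 < r /\ 0 < s /\ s <= eucl_norm z /\
    C = [set x | eucl_norm x < r /\ exists (l : R) (y : 'rV[R]_d), 0 < l /\ eucl_dist y z < s /\ x = l *: y].
Definition congruent0 (C C' : set 'rV[R]_d) : Prop :=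
  exists f : 'rV[R]_d -> 'rV[R]_d,
    (forall x y, eucl_dist (f x) (f y) = eucl_dist x y) /\ f 0 = 0 /\ C' = f @` C.

Definition uniform_cone_condition (I : set 'rV[R]_d) : Prop :=
  exists (J : Type) (U : J -> set 'rV[R]_d) (C : set 'rV[R]_d) (Cj : J -> set 'rV[R]_d)
         (M delta : R) (Rn : nat),
    (forall j, open (U j)) /\
    set_boundary I `<=` \bigcup_j U j /\
    (forall x : 'rV[R]_d, exists N, nbhs x N /\ finite_set [set j | U j `&` N !=set0]) /\
    finite_cone0 C /\ (forall j, congruent0 C (Cj j)) /\
    (forall j x y, U j x -> U j y -> eucl_dist x y <= M) /\
    0 < delta /\
    [set x | I x /\ exists y, set_boundary I y /\ eucl_dist x y < delta] `<=` \bigcup_j U j /\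
    (forall j, \bigcup_(x in I `&` U j) [set x + c | c in Cj j] `<=` I) /\
    (forall f : 'I_Rn.+1 -> J, injective f ->
       \bigcap_k (\bigcup_(x in I `&` U (f k)) [set x + c | c in Cj (f k)]) = set0).

Definition design_np (mu : {measure set Rd -> \bar R}) (I : set 'rV[R]_d) (p : nat)
    (t : 'I_p -> 'rV[R]_d) (A : 'I_p -> set 'rV[R]_d) : Prop :=
  (0 < p)%N /\
  (forall j k, j != k -> A j `&` A k = set0) /\
  \bigcup_j A j = I /\
  (forall j, A j (t j)) /\
  (forall j, leb_measure_is mu (A j) ((fine (mu I) / p%:R)%:E)).

Definition hmax (I : set 'rV[R]_d) (p : nat) (t : 'I_p -> 'rV[R]_d) : \bar R :=
  ereal_sup [set (\big[Order.min/+oo%E]_(j < p) (eucl_dist x (t j))%:E) | x in I].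
Definition hmin (p : nat) (t : 'I_p -> 'rV[R]_d) : \bar R :=
  \big[Order.min/+oo%E]_(j < p) \big[Order.min/+oo%E]_(k < p | k != j) (eucl_dist (t j) (t k))%:E.

Definition maxdiam (p : nat) (A : 'I_p -> set 'rV[R]_d) : R :=
  \big[Num.max/0]_(j < p) set_diam (A j).

End Defs.

Section Prob.
Variables (R : realType) (d : nat) (dO : measure_display) (Omega : measurableType dO).
Variable (P : probability Omega R).

(** stochastic big-O: Z_n = O_P(r_n); the event is bounded through a measurable
    superset (i.e. outer probability), so no measurability of Z_n is presupposed *)
Definition bigO_in_prob (Z : nat -> Omega -> R) (r : nat -> R) : Prop :=
  forall e : R, 0 < e -> exists M : R, 0 < M /\ exists N : nat, forall n, (N <= n)%N ->
    exists E : set Omega, measurable E /\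
      [set w | M * r n < `|Z n w|] `<=` E /\ (P E <= e%:E)%E.

Definition joint_random_field (X : Omega -> 'rV[R]_d -> R) : Prop :=
  measurable_fun [set: (Omega * Rd R d)%type] (fun z : Omega * Rd R d => X z.1 z.2).

Definition same_fdd (X X' : Omega -> 'rV[R]_d -> R) : Prop :=
  forall (s : seq ('rV[R]_d * set R)), all (fun tb => `[< measurable tb.2 >]) s ->
    P (\big[setI/setT]_(tb <- s) [set w : Omega | tb.2 (X w tb.1)]) =
    P (\big[setI/setT]_(tb <- s) [set w : Omega | tb.2 (X' w tb.1)]).

Definition data_sigma (Xs : nat -> Omega -> 'rV[R]_d -> R) (eps : nat -> Omega -> R)
    (k : nat + nat) : set (set Omega) :=
  match k with
  | inl i => <<s [set [set w | B (Xs i w t)] | t in [set: 'rV[R]_d] & B in [set B : set R | measurable B]] >>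
  | inr i => <<s [set [set w | B (eps i w)] | B in [set B : set R | measurable B]] >>
  end.

Definition mutually_independent (Xs : nat -> Omega -> 'rV[R]_d -> R) (eps : nat -> Omega -> R) : Prop :=
  forall (s : seq (nat + nat)) (E : nat + nat -> set Omega), uniq s ->
    (forall k, k \in s -> data_sigma Xs eps k (E k)) ->
    P (\big[setI/setT]_(k <- s) E k) = (\prod_(k <- s) P (E k))%E.

Definition iid_data (X : Omega -> 'rV[R]_d -> R) (Xs : nat -> Omega -> 'rV[R]_d -> R)
    (eps : nat -> Omega -> R) : Prop :=
  (forall i, joint_random_field (Xs i)) /\
  (forall i, measurable_fun [set: Omega] (eps i)) /\
  (forall i, same_fdd (Xs i) X) /\
  (forall i (B : set R), measurable B -> P (eps i @^-1` B) = P (eps 0%N @^-1` B)) /\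
  mutually_independent Xs eps.

End Prob.

Definition convex_real_fun (R : realType) (f : R -> R) : Prop :=
  forall x y a : R, 0 <= a <= 1 -> f (a * x + (1 - a) * y) <= a * f x + (1 - a) * f y.

Section Estimator.
Variables (R : realType) (d : nat) (dO : measure_display) (Omega : measurableType dO).
Variable mu : {measure set Rd R d -> \bar R}.
Variable I : set 'rV[R]_d.

Definition cellvol (p : nat) : R := fine (mu I) / p%:R.

(** responses Y_i = int_I X_i(t) beta0(t) dt + eps_i  (alpha_0 = 0) *)
Definition response (Xs : nat -> Omega -> 'rV[R]_d -> R) (eps : nat -> Omega -> R)
    (beta0 : 'rV[R]_d -> R) (i : nat) (w : Omega) : R :=
  fine (\int[mu]_(t in (I : set (Rd R d))) (Xs i w t * beta0 t)%:E) + eps i w.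

Definition Jm2 (m p : nat) (t : 'I_p -> 'rV[R]_d) (beta : 'rV[R]_d -> R) : \bar R :=
  ((\sum_(j < p) beta (t j) ^+ 2 * cellvol p)%:E + Im2 mu m beta)%E.
Definition Jm (m p : nat) (t : 'I_p -> 'rV[R]_d) (beta : 'rV[R]_d -> R) : R :=
  Num.sqrt (fine (Jm2 m t beta)).

Definition objective (rho : R -> R) (m n p : nat) (t : 'I_p -> 'rV[R]_d)
    (Xs : nat -> Omega -> 'rV[R]_d -> R) (Y : nat -> Omega -> R) (lam : R) (w : Omega)
    (beta : 'rV[R]_d -> R) : \bar R :=
  ((n%:R^-1 * \sum_(i < n) rho (Y i w - \sum_(j < p) Xs i w (t j) * beta (t j) * cellvol p))%:E
   + lam%:E * Jm2 m t beta)%E.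

Definition norm_np (n p : nat) (t : 'I_p -> 'rV[R]_d) (Xs : nat -> Omega -> 'rV[R]_d -> R)
    (w : Omega) (beta : 'rV[R]_d -> R) : R :=
  Num.sqrt (fine (mu I) / (n%:R * p%:R ^+ 2) *
            \sum_(i < n) (\sum_(j < p) Xs i w (t j) * beta (t j)) ^+ 2).

End Estimator.

(* Main.v *)
(* The estimator minimises a convex objective, so comparing it with beta0 and using convexity
   along the segment from beta0 reduces both claims to a lower bound, uniform over a ball of radius
   K of the penalty, for the excess empirical loss of a perturbation: quadratic growth of g, minus a
   remainder of order K * log^(3/2) n * (n^(-2m/(2m+d)) + diam^(2 kappa)).

   The remainder comes from chaining.  Only pure derivatives of order m are used: interpolation on a
   cube by tensor Lagrange polynomials (Bramble--Hilbert together with an inverse inequality) shows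
   that on a grid of side 2^-k the values at the design points lie within 2^(-mk) K of a linear space
   of dimension O(2^(kd)), whence explicit finite nets.  Quasi-uniformity of the design bounds the
   number of design points in a cube.  Each chain link is controlled by a conditional exponential
   inequality for the noise given the covariates, which are bounded by O(sqrt(log n)) with high
   probability; the chain is stopped at the level where 2^(kd)/n balances 2^(-2mk).

   The discretisation error of the responses is first replaced, at cost 1/n, by a finite linear
   combination of values of X_i, so that it is measurable for the sigma-algebra generated by the
   evaluations of X_i, which is the one for which independence from the noise is assumed. *)
Require Import Defs.
From HB Require Import structures.
From mathcomp Require Import all_boot all_order all_algebra.
From mathcomp Require Import all_classical all_reals all_analysis.
From mathcomp Require Import measurable_realfun.
Import Order.TTheory GRing.Theory Num.Theory.
Import numFieldNormedType.Exports.
From mathcomp Require Import lra ring zify.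
Set Implicit Arguments. Unset Strict Implicit. Unset Printing Implicit Defensive.
Local Open Scope classical_set_scope.
Local Open Scope ring_scope.

(** Membership in [inHm] gives derivatives along coordinate lines only: neither joint continuity nor
    integrability of lower order derivatives comes with it. The analysis therefore runs line by
    line: measurability from separate continuity, the fundamental theorem of calculus as an
    inequality, and a Sobolev embedding obtained from the dyadic decay of bad sets, followed by an
    upgrade from almost every point to every point.

    The risk [g] is curved only near zero. Convexity leaves curvature of order [1/T] on [[-T, T]],
    and perturbations in the ball of radius [K] reach [T] of order [K sqrt(log n)]. This [T], times
    the [log n] due to entropy and confidence level, is the origin of [log^(3/2) n]. The parameter
    of the exponential inequality is taken proportional to [1/T]: the empirical variance is then
    absorbed by the curvature, and the remainder is linear in [K]. Linearity closes the
    localisation, since the squared size of a perturbation is affine in the penalty, so that a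
    quadratic quantity is compared with a linear one and the constants do not depend on [K]. *)

Lemma integral_mfrestr (R : realType) d1 (T : measurableType d1) (m : {measure set T -> \bar R})
   (D : set T) (mD : measurable D) (moo : (m D < +oo)%E)
   (F : T -> \bar R) : measurable_fun setT F -> (forall x, 0 <= F x)%E ->
   (\int[mfrestr mD moo]_x F x = \int[m]_(x in D) F x)%E.
Proof.
  move=> mF F0.
  have mDC : measurable (~` D) by exact: measurableC.
  have dD : [disjoint D & ~` D] by exact/disj_setPCl.
  have mFU : measurable_fun (D `|` ~` D) F by rewrite setUv.
  rewrite -[in LHS](setUv D) (ge0_integral_setU _ mD mDC mFU)//.
  rewrite [X in (_ + X)%E]null_set_integral ?adde0//; last 2 first.
  - exact: measurable_funS mF.
  - by change (m (~` D `&` D) = 0%E); rewrite setICl measure0.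
  by apply: eq_measure_integral => A mA AD; rewrite -[LHS]/(m (A `&` D)) setIidl.
Qed.

Lemma sq_ge0E (T : Type) (R : realType) (f : T -> R) x : (0 <= ((f x) ^+ 2)%:E :> \bar R)%E.
Proof. by rewrite lee_fin sqr_ge0. Qed.

(** * Integrals of nonnegative functions *)

Section NonnegIntegral.
Context d1 (T : measurableType d1) (R : realType) (m : {measure set T -> \bar R}).
Variables (D : set T).
Hypothesis mD : measurable D.
Local Open Scope ereal_scope.

Lemma le_int (f g : T -> \bar R) : measurable_fun setT f -> measurable_fun setT g ->
  (forall x, D x -> 0 <= f x) -> (forall x, D x -> f x <= g x) ->
  \int[m]_(x in D) f x <= \int[m]_(x in D) g x.
Proof. by move=> mf mg f0 fg; apply: ge0_le_integral => //; exact: measurable_funTS. Qed.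

Lemma int_add (f g : T -> \bar R) : measurable_fun setT f -> measurable_fun setT g ->
  (forall x, 0 <= f x) -> (forall x, 0 <= g x) ->
  \int[m]_(x in D) (f x + g x) = \int[m]_(x in D) f x + \int[m]_(x in D) g x.
Proof. by move=> mf mg f0 g0; apply: ge0_integralD => //; exact: measurable_funTS. Qed.

Lemma int_scale (k : R) (f : T -> \bar R) : (0 <= k)%R -> measurable_fun setT f -> (forall x, 0 <= f x) ->
  \int[m]_(x in D) (k%:E * f x) = k%:E * \int[m]_(x in D) f x.
Proof. by move=> k0 mf f0; apply: ge0_integralZl_EFin => //; exact: measurable_funTS. Qed.

Lemma int_sum (I : Type) (s : seq I) (f : I -> T -> \bar R) : (forall i, measurable_fun setT (f i)) ->
  (forall i x, 0 <= f i x) ->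
  \int[m]_(x in D) (\sum_(i <- s) f i x) = \sum_(i <- s) \int[m]_(x in D) f i x.
Proof. by move=> mf f0; apply: ge0_integral_sum => // n; exact: measurable_funTS. Qed.

Lemma int_sub (A : set T) (f : T -> \bar R) : measurable A -> measurable_fun setT f -> (forall x, 0 <= f x) ->
  A `<=` D -> \int[m]_(x in A) f x <= \int[m]_(x in D) f x.
Proof. by move=> mA mf f0 AD; apply: ge0_subset_integral => //; exact: measurable_funTS. Qed.

Lemma meas_sq (f : T -> R) : measurable_fun setT f -> measurable_fun setT (fun x => ((f x) ^+ 2)%:E).
Proof. by move=> mf; apply/measurable_EFinP; exact: measurable_funX. Qed.

End NonnegIntegral.

(** * Coordinate updates, boxes, and Lebesgue measure on boxes *)

Section Euclidean.
Variables (R : realType) (d : nat).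
Implicit Types (x y z a b : 'rV[R]_d) (i j : 'I_d).

Definition upd i x (v : R) : 'rV[R]_d := \row_j (if j == i then v else x 0 j).
(** Moves from [x] (at [k = 0]) to [z] (at [k = d]), so that statements in several variables can be
    proved one coordinate at a time by induction on [k]. *)
Definition mix z (k : nat) x : 'rV[R]_d :=
  \row_j (if (j < k)%N then z 0 j else x 0 j).
Definition box a b : set (Rd R d) := [set x | forall i, a 0 i <= x 0 i <= b 0 i].
Definition cube a (h : R) : set (Rd R d) :=
  [set x | forall i, a 0 i <= x 0 i <= a 0 i + h].

Lemma updE i x v : (upd i x v) 0 i = v. Proof. by rewrite mxE eqxx. Qed.
Lemma updNE i x v j : j != i -> (upd i x v) 0 j = x 0 j.
Proof. by move=> ji; rewrite mxE (negbTE ji). Qed.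
Lemma upd_id i x : upd i x (x 0 i) = x.
Proof. by apply/rowP => j; rewrite mxE; case: eqP => // ->. Qed.
Lemma upd_upd i x u v : upd i (upd i x u) v = upd i x v.
Proof. by apply/rowP => j; rewrite !mxE; case: eqP. Qed.
Lemma updC i j x u v : i != j -> upd i (upd j x u) v = upd j (upd i x v) u.
Proof.
move=> ij; apply/rowP => k; rewrite !mxE; case: eqP => [->|//].
by rewrite (negbTE ij).
Qed.
Lemma mix0 z x : mix z 0 x = x. Proof. by apply/rowP => j; rewrite mxE. Qed.
Lemma mixd z x : mix z d x = z. Proof. by apply/rowP => j; rewrite mxE ltn_ord. Qed.
Lemma mix_upd z i x v : mix z i (upd i x v) = upd i (mix z i x) v.
Proof.
apply/rowP => j; rewrite !mxE; case: ifP => //.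
by case: eqP => // -> ; rewrite ltnn.
Qed.
Lemma mixS z i x : mix z i.+1 x = upd i (mix z i x) (z 0 i).
Proof.
apply/rowP => j; rewrite !mxE ltnS leq_eqVlt.
by case: (eqVneq j i) => [->|ji]; rewrite ?eqxx//= (inj_eq val_inj) (negbTE ji).
Qed.

Lemma cubeE a h : cube a h = box a (a + const_mx h).
Proof. by apply/seteqP; split => x /= H i; move: (H i); rewrite !mxE. Qed.

Lemma cube_upd a h i x v : cube a h x -> a 0 i <= v <= a 0 i + h -> cube a h (upd i x v).
Proof. by move=> Hx Hv j; rewrite mxE; case: eqP => [->//|_]; exact: Hx. Qed.

Lemma measurable_coord j : measurable_fun setT (fun x : Rd R d => x 0 j : R).
Proof.
apply: (measurability _ (RGenOpens.measurableE R)) => _ [_ [a [b ->] <-]].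
rewrite setTI; apply: sub_sigma_algebra.
by apply: open_comp; [move=> x _; exact: coord_continuous|exact: interval_open].
Qed.

Lemma measurable_box a b : measurable (box a b).
Proof.
rewrite (_ : box a b = \bigcap_(i in [set: 'I_d]) (fun x : Rd R d => x 0 i) @^-1` `[a 0 i, b 0 i]%classic).
  apply: fin_bigcap_measurable => // i _; rewrite -[X in measurable X]setTI.
  exact: measurable_coord.
apply/seteqP; split => x /=; first by move=> H i _ /=; rewrite in_itv/=; exact: H.
by move=> H i; have := H i Logic.I; rewrite /= in_itv.
Qed.

Lemma measurable_cube a h : measurable (cube a h).
Proof. by rewrite cubeE; exact: measurable_box. Qed.

(** Rational centres and radii [1/(n+1)] index a countable base. Hence boxes generate the Borel
    sets, and a map into R^d is measurable as soon as its coordinates are. *)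
Lemma open_bigcup_box (U : set 'rV[R]_d) : open U ->
  U = \bigcup_(q in [set q : 'rV[rat]_d * nat |
        box (map_mx ratr q.1 - const_mx q.2.+1%:R^-1) (map_mx ratr q.1 + const_mx q.2.+1%:R^-1) `<=` U])
      box (map_mx ratr q.1 - const_mx q.2.+1%:R^-1) (map_mx ratr q.1 + const_mx q.2.+1%:R^-1).
Proof.
move=> oU; apply/seteqP; split => [x Ux|x [q /= qU qx]]; last exact: qU.
have [B HB BU] := oU _ Ux.
(* Twice the radius: the rational centre is itself within [1/(n+1)] of [x], so the whole box stays
   within [2/(n+1)] of it. *)
have [n Hn] : exists n : nat, forall i (y : R), `|y - x 0 i| <= 2 * n.+1%:R^-1 -> B 0 i y.
  have H i : exists n : nat, forall y : R, `|y - x 0 i| <= 2 * n.+1%:R^-1 -> B 0 i y.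
    have /nbhs_ballP[e /= e0 He] := HB 0 i.
    exists (Num.truncn (2 / e)) => y yx; apply: He; rewrite /ball/= distrC.
    apply: le_lt_trans yx _; rewrite ltr_pdivrMr//.
    by rewrite mulrC -ltr_pdivrMr//; exact: truncnS_gt.
  pose N i := projT1 (cid (H i)).
  exists (\max_i N i)%N => i y yx; apply: (projT2 (cid (H i))).
  apply: le_trans yx _; rewrite ler_pM2l// lef_pV2 ?posrE// ler_nat ltnS.
  exact: (leq_bigmax i).
have /choice[q Hq] : forall i : 'I_d, exists q : rat, `|ratr q - x 0 i| < n.+1%:R^-1.
  move=> i; have ne : (`]x 0 i - n.+1%:R^-1, x 0 i + n.+1%:R^-1[%classic : set R) !=set0.
    by exists (x 0 i) => /=; rewrite in_itv/= ltrBlDr !ltrDl invr_gt0 ltr0n.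
  have [|z [/= + [q _ qz]]] := dense_rat ne; first by apply: interval_open.
  rewrite -qz in_itv/= => Hq; exists q.
  by rewrite distrC ltr_distlC.
exists (\row_i q i, n) => /=.
  move=> y /= Hy; apply: BU => i j; rewrite (ord1 i); apply: Hn.
  have := Hy j; have := Hq j; rewrite !mxE => h1 h2.
  move: h1 h2; rewrite ltr_distl ler_distl; move: (n.+1%:R^-1) => e /andP[? ?] /andP[? ?]; apply/andP; split; lra.
by move=> i; have := Hq i; rewrite !mxE ltr_distl; move: (n.+1%:R^-1) => e /andP[? ?]; apply/andP; split; lra.
Qed.

Lemma measurable_Rd_box : @measurable _ (Rd R d) = <<s [set box a b | a in setT & b in setT] >>.
Proof.
apply/seteqP; split.
  apply: smallest_sub; first exact: smallest_sigma_algebra.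
  move=> U oU; rewrite (open_bigcup_box oU).
  have -> : forall (T : countType) (D : set T) (F : T -> set (Rd R d)), \bigcup_(q in D) F q =
     \bigcup_n (if pickle_inv n is Some q then (if q \in D then F q else set0) else set0).
    move=> T D F; apply/seteqP; split => x [].
      by move=> q Dq Fq; exists (pickle q) => //; rewrite pickleK_inv mem_set.
    move=> n _; case: (pickle_inv n) => // q; case: ifPn => // /set_mem ? ?.
    by exists q.
  apply: sigma_algebra_bigcup => n.
  case: (pickle_inv n) => [q|]; last exact: sigma_algebra0.
  case: ifPn => _; last exact: sigma_algebra0.
  by apply: sub_sigma_algebra; eexists => //; eexists.
apply: smallest_sub; first exact: sigma_algebra_measurable.
by move=> _ [a _ [b _ <-]]; exact: measurable_box.
Qed.

Lemma measurable_to_Rd d0 (T : measurableType d0) (f : T -> Rd R d) :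
  (forall j, measurable_fun setT (fun t => f t 0 j : R)) -> measurable_fun setT f.
Proof.
move=> mf; apply: (measurability _ measurable_Rd_box) => _ [_ [a _ [b _ <-]] <-].
rewrite setTI (_ : f @^-1` box a b =
  \bigcap_(i in [set: 'I_d]) (fun t => f t 0 i) @^-1` `[a 0 i, b 0 i]%classic).
  apply: fin_bigcap_measurable => // i _; rewrite -[X in measurable X]setTI.
  exact: mf.
apply/seteqP; split => x /=; first by move=> H i _ /=; rewrite in_itv/=; exact: H.
by move=> H i; have := H i Logic.I; rewrite /= in_itv.
Qed.

Lemma measurable_upd i : measurable_fun setT (fun z : Rd R d * measurableTypeR R => upd i z.1 z.2 : Rd R d).
Proof.
apply: measurable_to_Rd => j; rewrite /upd.
under eq_fun do rewrite mxE.
case: eqP => _; first exact: measurable_snd.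
exact: (measurableT_comp (measurable_coord j) measurable_fst).
Qed.

Lemma measurable_upd1 i v : measurable_fun setT (fun x : Rd R d => upd i x v : Rd R d).
Proof.
apply: measurable_to_Rd => j; rewrite /upd.
under eq_fun do rewrite mxE.
by case: eqP => _; [exact: measurable_cst|exact: measurable_coord].
Qed.

Lemma measurable_mix z k : measurable_fun setT (fun x : Rd R d => mix z k x : Rd R d).
Proof.
apply: measurable_to_Rd => j; rewrite /mix.
under eq_fun do rewrite mxE.
by case: (j < k)%N; [exact: measurable_cst|exact: measurable_coord].
Qed.

Lemma measurable_upd_line i x : measurable_fun setT (fun v : R => upd i x v : Rd R d).
Proof.
apply: measurable_to_Rd => j; rewrite /upd.
under eq_fun do rewrite mxE.
by case: eqP => _; [exact: measurable_id|exact: measurable_cst].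
Qed.

Section measure.
Variable mu : {measure set Rd R d -> \bar R}.
Hypothesis leb : is_lebesgue_Rd mu.

Lemma box_measure a b : (0 < d)%N ->
  mu (box a b) = (\prod_i Num.max 0 (b 0 i - a 0 i))%:E.
Proof.
move=> d0; have [ab|] := pselect (forall i, a 0 i <= b 0 i).
  rewrite /box leb//; congr EFin; apply: eq_bigr => i _.
  by rewrite max_r// subr_ge0.
move/existsNP => [i /negP]; rewrite -ltNge => ba.
rewrite (_ : box a b = set0) ?measure0; last first.
  by apply/seteqP; split => // x /(_ i) /andP[h1 h2]; move: (le_trans h1 h2); rewrite leNgt ba.
by rewrite (bigD1 i)//= max_l ?mul0r// subr_le0 ltW.
Qed.

Lemma boxI a b a' b' : box a b `&` box a' b' =
  box (\row_i Num.max (a 0 i) (a' 0 i)) (\row_i Num.min (b 0 i) (b' 0 i)).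
Proof.
apply/seteqP; split => x /=.
  move=> [H H'] i; rewrite !mxE ge_max le_min.
  by move: (H i) (H' i) => /andP[h1 h2] /andP[h3 h4]; apply/andP; split; apply/andP.
by move=> H; split => i; move: (H i); rewrite !mxE ge_max le_min =>
  /andP[/andP[h1 h2] /andP[h3 h4]]; apply/andP.
Qed.

Lemma box_measure_lty a b : (0 < d)%N -> (mu (box a b) < +oo)%E.
Proof. by move=> d0; rewrite box_measure// ltry. Qed.

Lemma cube_measure a h : (0 < d)%N -> 0 <= h -> mu (cube a h) = (h ^+ d)%:E.
Proof.
move=> d0 h0; rewrite cubeE box_measure//; congr EFin.
under eq_bigr do rewrite !mxE addrAC subrr add0r max_r//.
by rewrite prodr_const card_ord.
Qed.

(** Boxes are stable under intersection, generate the Borel sets and contain a sequence exhausting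
    the space, which is what uniqueness of measures requires. *)
Lemma measure_unique_box (m1 m2 : {measure set Rd R d -> \bar R}) :
  (forall a b, m1 (box a b) = m2 (box a b)) ->
  (forall a b, (m1 (box a b) < +oo)%E) ->
  forall A, measurable A -> m1 A = m2 A.
Proof.
move=> m12 m1oo A mA.
apply: (measure_unique [set box a b | a in setT & b in setT]
  (fun n => box (const_mx (- n%:R)) (const_mx n%:R))) => //.
- exact: measurable_Rd_box.
- move=> _ _ [a _ [b _ <-]] [a' _ [b' _ <-]]; rewrite boxI.
  by eexists => //; eexists.
- by move=> n; eexists => //; eexists.
- apply/seteqP; split => // x _.
  exists (Num.truncn (\sum_i `|x 0 i|)).+1 => // i; rewrite !mxE.
  rewrite -ler_norml; apply: le_trans (ltW (truncnS_gt _)).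
  by rewrite (bigD1 i)//= lerDl sumr_ge0.
- by move=> _ [a _ [b _ <-]].
Qed.

(** * Replacing one coordinate by an independent uniform value *)

Section resample.
Variables (a : 'rV[R]_d) (h : R) (i : 'I_d).
Hypotheses (d0 : (0 < d)%N) (h0 : 0 < h).
Let J : set R := `[a 0 i, a 0 i + h]%classic.
Let leb1 : {measure set (measurableTypeR R) -> \bar R} := @lebesgue_measure R.

Let muQoo : (mu (cube a h) < +oo)%E.
Proof. by rewrite cubeE box_measure_lty. Qed.
Let muJoo : (leb1 J < +oo)%E.
Proof. rewrite -[leb1 J]/(@lebesgue_measure R `[a 0 i, (a 0 i + h)%R]%classic) lebesgue_measure_itv/= lte_fin; case: ifP; rewrite ?ltry// -EFinB ltry. Qed.

Let mJ : @measurable _ (measurableTypeR R) J. Proof. exact: measurable_itv. Qed.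
(** Restrictions to the cube and to the interval are finite measures, to which Tonelli's theorem
    applies; [mu] itself is a bare measure. *)
Let muQ : {finite_measure set (Rd R d) -> \bar R} := mfrestr (measurable_cube a h) muQoo.
Let muJ : {finite_measure set (measurableTypeR R) -> \bar R} := mfrestr mJ muJoo.

Let nu1 := measure_function_pushforward__canonical__measure_function_Measure
  ((muQ \x muJ)%E : {measure set (Rd R d * measurableTypeR R)%type -> \bar R}) (measurable_upd i).
Let hnng : {nonneg R} := NngNum (ltW h0).
Let nu2 : {measure set (Rd R d) -> \bar R} := mscale hnng muQ.

(** Replacing coordinate [i] of a point of the cube by an independent value of the interval
    reproduces [h] times the measure of the cube. It suffices to compare boxes, where both sides are
    explicit products. This takes the place of a decomposition of R^d as a product space. *)
Let nu12 (A : set (Rd R d)) : measurable A -> nu1 A = nu2 A.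
Proof.
have PE A1 B1 : measurable A1 -> measurable B1 ->
    (muQ \x muJ)%E (A1 `*` B1) = (muQ A1 * muJ B1)%E.
  by move=> mA1 mB1; rewrite product_measure1E.
have Poo : ((muQ \x muJ)%E setT < +oo)%E.
  rewrite -setXTT PE// /muQ /muJ /= /mfrestr /mrestr !setTI.
  by rewrite lte_mul_pinfty// ge0_fin_numE.
apply: measure_unique_box => [b c|b c]; last first.
  rewrite /nu1 /= /pushforward; apply: le_lt_trans Poo.
  apply: le_measure; rewrite ?inE//.
  by rewrite -[X in measurable X]setTI; apply: measurable_upd => //; exact: measurable_box.
pose b' : 'rV[R]_d := \row_j (if j == i then a 0 i else b 0 j).
pose c' : 'rV[R]_d := \row_j (if j == i then a 0 i + h else c 0 j).
rewrite /nu1 /= /pushforward.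
have -> : (fun z : Rd R d * measurableTypeR R => upd i z.1 z.2) @^-1` box b c =
   [set x : Rd R d | forall j, j != i -> b 0 j <= x 0 j <= c 0 j] `*` `[b 0 i, c 0 i]%classic.
  apply/seteqP; split => -[x v] /=.
    move=> H; split; first by move=> j ji; have := H j; rewrite updNE.
    by have := H i; rewrite updE in_itv.
  move=> [H]; rewrite in_itv/= => Hv j.
  by case: (eqVneq j i) => [->|ji]; rewrite ?updE ?updNE//; exact: H.
have mS : measurable [set x : Rd R d | forall j, j != i -> b 0 j <= x 0 j <= c 0 j].
  rewrite (_ : mkset _ = \bigcap_(j in [set j | j != i]) (fun x : Rd R d => x 0 j) @^-1` `[b 0 j, c 0 j]%classic).
    apply: fin_bigcap_measurable => [|j _].
      by apply: (@sub_finite_set _ _ [set: 'I_d]) => //.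
    rewrite -[X in measurable X]setTI; exact: measurable_coord.
  apply/seteqP; split => x /=; first by move=> H j ji /=; rewrite in_itv/=; exact: H.
  by move=> H j ji; have := H j ji; rewrite /= in_itv.
have mI : @measurable _ (measurableTypeR R) `[b 0 i, c 0 i]%classic by exact: measurable_itv.
rewrite PE//.
rewrite /nu2 /mscale /= /mfrestr /mrestr.
have -> : [set x : Rd R d | forall j, j != i -> b 0 j <= x 0 j <= c 0 j] `&` cube a h =
    box b' c' `&` cube a h.
  apply/seteqP; split => x /= [H Hc]; split => // j.
    by rewrite !mxE; case: eqP => [->|/eqP ji]; [exact: Hc|exact: H].
  by move=> ji; have := H j; rewrite !mxE (negbTE ji).
rewrite cubeE !boxI !box_measure//.
rewrite (_ : `[b 0 i, c 0 i]%classic `&` J =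
  `[Num.max (b 0 i) (a 0 i), Num.min (c 0 i) (a 0 i + h)]%classic); last first.
  apply/seteqP; split => x; rewrite /J /= !in_itv/= ge_max le_min.
    by move=> [/andP[-> ->] /andP[-> ->]].
  by move=> /andP[/andP[-> ->] /andP[-> ->]].
rewrite /leb1 lebesgue_measure_itv/=.
rewrite (bigD1 i)//= [in RHS](bigD1 i)//= !mxE eqxx.
rewrite maxxx minxx addrAC subrr add0r (max_r (ltW h0)).
have -> : (if ((Num.max (b 0 i) (a 0 i))%:E < (Num.min (c 0 i) (a 0 i + h))%:E)%E
     then ((Num.min (c 0 i) (a 0 i + h))%:E - (Num.max (b 0 i) (a 0 i))%:E)%E else 0%E) =
   (Num.max 0 (Num.min (c 0 i) (a 0 i + h) - Num.max (b 0 i) (a 0 i)))%:E.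
  rewrite lte_fin; move: (Num.min _ _) (Num.max (b 0 i) _) => u v.
  case: ltP => H; first by rewrite -EFinB max_r// subr_ge0 ltW.
  by rewrite max_l// subr_le0.
rewrite -!EFinM; congr EFin.
rewrite -mulrA; congr (_ * _); rewrite mulrC; congr (_ * _).
by apply: eq_bigr => j ji; rewrite !mxE (negbTE ji).
Qed.

Let GG (G : Rd R d -> \bar R) (z : Rd R d * measurableTypeR R) := G (upd i z.1 z.2).
Let mGG G : measurable_fun setT G -> measurable_fun setT (GG G).
Proof. by move=> mG; exact: (measurableT_comp mG (measurable_upd i)). Qed.

Let GG0 G : (forall x, 0 <= G x)%E -> forall w, (0 <= GG G w)%E.
Proof. by move=> G0 w; exact: G0. Qed.

Lemma resample_inner_line (G : Rd R d -> \bar R) : measurable_fun setT G -> (forall x, 0 <= G x)%E ->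
  measurable_fun setT (fun x : Rd R d => \int[leb1]_(v in J) G (upd i x v))%E.
Proof.
move=> mG G0.
have -> : (fun x : Rd R d => \int[leb1]_(v in J) G (upd i x v))%E = (fun x => \int[muJ]_v GG G (x, v))%E.
  apply/funext => x; rewrite integral_mfrestr//; last by move=> v; exact: GG0.
  exact: (measurableT_comp mG (measurable_upd_line _ _)).
by apply: (@measurable_fun_fubini_tonelli_F _ _ _ _ _ muJ (GG G)) => //; [exact: mGG|exact: GG0].
Qed.

Lemma resample_inner_cube (G : Rd R d -> \bar R) : measurable_fun setT G -> (forall x, 0 <= G x)%E ->
  measurable_fun setT (fun v : measurableTypeR R => \int[mu]_(x in cube a h) G (upd i x v))%E.
Proof.
move=> mG G0.
have -> : (fun v : measurableTypeR R => \int[mu]_(x in cube a h) G (upd i x v))%E = (fun v => \int[muQ]_x GG G (x, v))%E.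
  apply/funext => v; rewrite integral_mfrestr//; last by move=> y; exact: GG0.
  exact: (measurableT_comp mG (measurable_upd1 _ _)).
by apply: (@measurable_fun_fubini_tonelli_G _ _ _ _ _ muQ (GG G)) => //; [exact: mGG|exact: GG0].
Qed.

Lemma resample_swap (G : Rd R d -> \bar R) : measurable_fun setT G -> (forall x, 0 <= G x)%E ->
  (\int[leb1]_(v in J) \int[mu]_(x in cube a h) G (upd i x v) =
   \int[mu]_(x in cube a h) \int[leb1]_(v in J) G (upd i x v))%E.
Proof.
move=> mG G0.
transitivity (\int[muJ]_v \int[muQ]_x GG G (x, v))%E.
  rewrite integral_mfrestr.
  - apply: eq_integral => v _; rewrite integral_mfrestr//; last by move=> y; exact: GG0.
    exact: (measurableT_comp mG (measurable_upd1 _ _)).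
  - by apply: (@measurable_fun_fubini_tonelli_G _ _ _ _ _ muQ (GG G)) => //; [exact: mGG|exact: GG0].
  - by move=> v; apply: integral_ge0 => x _; exact: G0.
transitivity (\int[muQ]_x \int[muJ]_v GG G (x, v))%E.
  by apply/esym; apply: (@fubini_tonelli _ _ _ _ _ muQ muJ (GG G)) => //; [exact: mGG|exact: GG0].
rewrite integral_mfrestr.
- apply: eq_integral => x _; rewrite integral_mfrestr//; last by move=> v; exact: GG0.
  exact: (measurableT_comp mG (measurable_upd_line _ _)).
- by apply: (@measurable_fun_fubini_tonelli_F _ _ _ _ _ muJ (GG G)) => //; [exact: mGG|exact: GG0].
- by move=> x; apply: integral_ge0 => v _; exact: G0.
Qed.

(** Tonelli along direction [i], read off from the pushforward identity [nu12]. It turns estimates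
    on every coordinate line into estimates on the cube. *)
Lemma resample (G : Rd R d -> \bar R) : measurable_fun setT G -> (forall x, 0 <= G x)%E ->
  (\int[mu]_(x in cube a h) \int[leb1]_(v in J) G (upd i x v) = h%:E * \int[mu]_(x in cube a h) G x)%E.
Proof.
move=> mG G0.
pose HH (z : Rd R d * measurableTypeR R) := G (upd i z.1 z.2).
have HH0 w : (0 <= HH w)%E by exact: G0.
have mHH : measurable_fun setT HH.
  exact: (measurableT_comp mG (measurable_upd i)).
transitivity (\int[muQ]_x \int[muJ]_v G (upd i x v))%E.
  rewrite integral_mfrestr.
  - by apply: eq_integral => x _; rewrite integral_mfrestr//; apply: (measurableT_comp mG (measurable_upd_line _ _)).
  - exact: (@measurable_fun_fubini_tonelli_F _ _ _ _ _ muJ HH).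
  - by move=> x; apply: integral_ge0.
rewrite -[LHS](@fubini_tonelli1 _ _ _ _ _ muQ muJ HH)//.
transitivity (\int[nu1]_x G x)%E.
  by rewrite -[RHS]/(\int[pushforward (muQ \x muJ)%E (fun z : Rd R d * measurableTypeR R => upd i z.1 z.2 : Rd R d)]_x G x)%E (@ge0_integral_pushforward _ _ _ _ _ _ (measurable_upd i) (muQ \x muJ)%E).
rewrite (eq_measure_integral nu2); last by move=> A mA _; exact: nu12.
by rewrite ge0_integral_mscale//= integral_mfrestr.
Qed.
End resample.
End measure.
End Euclidean.

Lemma nneseries_le_bound (R : realType) (F : nat -> \bar R) c :
  (forall k, 0 <= F k)%E -> (forall n, \sum_(0 <= k < n) F k <= c)%E ->
  (\sum_(k <oo) F k <= c)%E.
Proof.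
move=> F0 H; apply: lime_le; first exact: is_cvg_nneseries.
by near=> n; exact: H.
Unshelve. all: by end_near. Qed.

Lemma nneseries_ge_partial (R : realType) (F : nat -> \bar R) n :
  (forall k, 0 <= F k)%E -> (\sum_(0 <= k < n) F k <= \sum_(k <oo) F k)%E.
Proof. by move=> F0; apply: nneseries_lim_ge => k _ _; exact: F0. Qed.

(** * Increments bounded by the integral of the derivative *)

Section OneDim.
Variable R : realType.
Let leb : {measure set (measurableTypeR R) -> \bar R} := @lebesgue_measure R.

(** Continuous induction. The set of points where the bound holds contains its supremum, because [f]
    is continuous and [G] monotone ([G] may jump); the step hypothesis would then go beyond a
    supremum smaller than [b]. *)
Lemma creep (f : R -> R) (G : R -> \bar R) (a b : R) : a <= b -> continuous f ->
  (forall x y, a <= x -> x <= y -> (G x <= G y)%E) -> (0 <= G a)%E ->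
  (forall s, a <= s < b -> exists2 eta, 0 < eta &
     forall y, s < y < s + eta -> y <= b -> ((f y - f s)%:E + G s <= G y)%E) ->
  ((f b - f a)%:E <= G b)%E.
Proof.
move=> ab cf Gmon Ga0 Gstep.
pose S := [set x | a <= x <= b /\ ((f x - f a)%:E <= G x)%E].
have Sa : S a by rewrite /S/= lexx ab subrr.
have ubS : ubound S b by move=> x [/andP[]].
have hsS : has_sup S by split; [exists a|exists b].
pose s := sup S.
have as_ : a <= s by exact: sup_upper_bound.
have sb : s <= b by apply: ge_sup => //; exists a.
have Ss : S s.
  split; first by rewrite as_ sb.
  rewrite leNgt; apply/negP => Gs.
  have Gs0 : (0 <= G s)%E by exact: le_trans Ga0 (Gmon _ _ _ _).
  have [r Gr] : exists r, G s = r%:E.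
    by move: Gs Gs0; case: (G s) => // r _ _; exists r.
  move: Gs; rewrite Gr lte_fin => Gs.
  have /cvgrPdist_lt/(_ (f s - f a - r)) := cf s.
  rewrite subr_gt0 => /(_ Gs) /nbhs_ballP[e /= e0 He].
  have [x Sx xs] := sup_adherent e0 hsS.
  have xles : x <= s by exact: sup_upper_bound.
  have [/andP[ax xb] fx] := Sx.
  have := le_trans fx (Gmon _ _ ax xles); rewrite Gr lee_fin => fxr.
  have /He : ball s e x by rewrite /ball/= ger0_norm ?subr_ge0// ltrBlDr -ltrBlDl.
  by move=> /(le_lt_trans (ler_norm _)); lra.
have [<-|sltb] := eqVneq s b; first by case: Ss.
have {}sltb : s < b by rewrite lt_neqAle sltb.
have [|eta eta0 Heta] := Gstep s; first by rewrite as_.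
pose y := s + Num.min (eta / 2) (b - s).
have m0 : 0 < Num.min (eta / 2) (b - s) by rewrite lt_min divr_gt0//= subr_gt0.
have sy : s < y by rewrite ltrDl.
have yb : y <= b by rewrite /y -lerBrDl ge_min lexx orbT.
have ye : y < s + eta.
  rewrite ltrD2l; apply: (@le_lt_trans _ _ (eta / 2)); first by rewrite ge_min lexx.
  by rewrite ltr_pdivrMr// ltr_pMr// ltr1n.
have Sy : S y.
  split; first by rewrite yb (le_trans as_ (ltW sy)).
  apply: le_trans (Heta y _ yb); last by rewrite sy.
  have [_ Hs] := Ss.
  rewrite (_ : f y - f a = (f y - f s) + (f s - f a)); last by rewrite addrA subrK.
  by rewrite EFinD leeD2l.
by have : y <= s := sup_upper_bound hsS Sy; rewrite leNgt sy.
Qed.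

(** The derivative exists everywhere but may be neither continuous nor integrable, so the usual
    fundamental theorem does not apply. As in the Vitali--Caratheodory argument, [g] is dominated
    from above by a lower semicontinuous step function of almost the same integral, and [creep]
    compares [f] with the primitive of that function. *)
Lemma rough_ftc_pos (f g : R -> R) (a b : R) : a <= b ->
  (forall x, derivable f x 1) -> (forall x, `|derive1 f x| <= g x) ->
  measurable_fun setT g ->
  ((f b - f a)%:E <= \int[leb]_(x in `[a, b]) (g x)%:E)%E.
Proof.
move=> ab df fg mg.
have cf : continuous f by move=> x; apply: differentiable_continuous; exact/derivable1_diffP.
have g0 x : 0 <= g x by exact: le_trans (fg x).
pose J : set R := `[a, b]%classic.
have mJ : measurable J by exact: measurable_itv.
have lebJ : leb J = (b - a)%:E.
  rewrite -[leb J]/(@lebesgue_measure R `[a, b]%classic) lebesgue_measure_itv/= lte_fin.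
  by case: ltgtP ab => [|//|<-]; rewrite ?subrr.
apply/lee_addgt0Pr => e0 e0_gt0.
(* Budget: [e (b - a)] for the linear term of [G], [e (b - a)] for rounding [g] to multiples of [e],
   and at most [e] for the excess measure of the open sets. *)
pose e := e0 / (2 * (b - a) + 2).
have D0 : 0 < 2 * (b - a) + 2 by lra.
have e_gt0 : 0 < e by rewrite divr_gt0.
have {e0_gt0} -> : e0 = e * (2 * (b - a) + 2) by rewrite /e divfK// gt_eqF.
pose E k := J `&` [set x | k%:R * e < g x].
have mE k : measurable (E k).
  apply: measurableI => //.
  rewrite (_ : mkset _ = g @^-1` `]k%:R * e, +oo[%classic).
    by rewrite -[X in measurable X]setTI; apply: mg => //; exact: measurable_itv.
  by apply/seteqP; split => x /=; rewrite in_itv/= andbT.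
have Eoo k : (leb (E k) < +oo)%E.
  apply: le_lt_trans (_ : leb J < +oo)%E; last by rewrite lebJ ltry.
  by apply: le_measure; rewrite ?inE; [exact: mE|exact: mJ|move=> z []].
have /choice[U HU] : forall k, exists U : set R, [/\ open U , E k `<=` U & (leb (U `\` E k) < ((1 / 2) ^+ k.+1)%:E)%E].
  move=> k; apply: lebesgue_regularity_outer; [exact: mE|exact: Eoo|].
  by rewrite exprn_gt0// divr_gt0.
have mU k : measurable (U k) by case: (HU k) => /open_measurable.
(* The slope of [G] to the right of [s] is at least [e] plus [e] times the number of open sets [U k]
   containing [s]. With [q] the integer part of [g s / e], the sets of index below [q] all contain
   [s], so this slope is at least [q.+1 * e], which exceeds [g s]. *)
pose G x : \bar R := ((e * (x - a))%:E + e%:E * \sum_(k <oo) leb (`[a, x]%classic `&` U k))%E.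
have mIU x y k : measurable (`[x, y]%classic `&` U k) by apply: measurableI => //; exact: measurable_itv.
have mIU' x y k : measurable (`]x, y]%classic `&` U k) by apply: measurableI => //; exact: measurable_itv.
have step : ((f b - f a)%:E <= G b)%E.
  apply: creep => //.
  - move=> x y ax xy; rewrite /G leeD ?lee_fin ?ler_wpM2l ?lerD2r//; first exact: ltW.
    apply: lee_wpmul2l; first by rewrite lee_fin ltW.
    apply: lee_nneseries => // k _; apply: le_measure; rewrite ?inE; [exact: mIU|exact: mIU|].
    by apply: setSI; apply: subset_itvl.
  - rewrite /G subrr mulr0 add0e mule_ge0 ?lee_fin ?(ltW e_gt0)//.
    exact: nneseries_ge0.
  - move=> s /andP[as_ sb].
    pose q := Num.truncn (g s / e).
    have gq : g s < q.+1%:R * e by rewrite -ltr_pdivrMr// truncnS_gt.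
    have qg : q%:R * e <= g s.
      by rewrite -ler_pdivlMr// truncn_le// divr_ge0// ltW.
    have Us k : (k < q)%N -> U k s.
      move=> kq; have [_ + _] := HU k; apply; split => /=.
        by rewrite /J/= in_itv/= as_ ltW.
      by apply: lt_le_trans qg; rewrite ltr_pM2r// ltr_nat.
    have [e1 e10 He1] : exists2 e1, 0 < e1 & forall y, `|s - y| < e1 -> forall k, (k < q)%N -> U k y.
      elim: q Us {gq qg} => [|q IH] Us; first by exists 1.
      have [|e1 e10 He1] := IH; first by move=> k kq; apply: Us; rewrite ltnS ltnW.
      have [oU _ _] := HU q.
      have /nbhs_ballP[e2 /= e20 He2] := open_nbhs_nbhs (conj oU (Us q (ltnSn q))).
      exists (Num.min e1 e2) => [|y]; first by rewrite lt_min e10.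
      rewrite lt_min => /andP[y1 y2] k; rewrite ltnS leq_eqVlt => /orP[/eqP->|kq].
        exact: He2.
      exact: He1.
    have sl0 : 0 < q.+1%:R * e - g s by rewrite subr_gt0.
    have [e2 e20 He2] : exists2 e2, 0 < e2 & forall y, s < y < s + e2 ->
        f y - f s <= q.+1%:R * e * (y - s).
      have /cvgrPdist_lt/(_ _ sl0) := df s.
      move=> /nbhs_ballP[e2 /= e20 He2]; exists e2 => // y /andP[sy ye].
      have ys0 : 0 < y - s by rewrite subr_gt0.
      have b2 : ball 0 e2 (y - s) by rewrite /ball/= sub0r normrN gtr0_norm// ltrBlDl.
      have := He2 _ b2 (lt0r_neq0 ys0).
      rewrite -[lim _]/(derive f s 1) -derive1E [_ *: 1]mulr1 subrK.
      move: (fg s); rewrite ler_norml ltr_distlC => /andP[_ f1] /andP[_].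
      rewrite -[_ *: _]/((y - s)^-1 * (f y - f s)) => f2.
      rewrite -ler_pdivrMr// mulrC; apply: ltW; apply: lt_le_trans f2 _.
      by rewrite addrCA gerDl subr_le0.
    exists (Num.min e1 e2) => [|y]; first by rewrite lt_min e10.
    move=> /andP[sy]; rewrite -ltrBlDl lt_min => /andP[ye1 ye2] yb.
    have fy : f y - f s <= q.+1%:R * e * (y - s) by apply: He2; rewrite sy -ltrBlDl.
    have Gy : G y = (G s + ((e * (y - s))%:E + e%:E * \sum_(k <oo) leb (`]s, y]%classic `&` U k)))%E.
      have splitU k : leb (`[a, y]%classic `&` U k) =
          (leb (`[a, s]%classic `&` U k) + leb (`]s, y]%classic `&` U k))%E.
        have -> : `[a, y]%classic `&` U k = (`[a, s]%classic `&` U k) `|` (`]s, y]%classic `&` U k).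
          rewrite -setIUl; congr (_ `&` _).
          apply/seteqP; split => z /=; rewrite !in_itv/=.
            by move=> /andP[-> ->]; case: (leP z s); [left|right].
          move=> [/andP[-> zs]|/andP[sz ->]]; first exact: (le_trans zs (ltW sy)).
          by rewrite andbT (le_trans as_ (ltW sz)).
        apply: measureU; [exact: mIU|exact: mIU'|].
        apply/seteqP; split => // z /= [[+ _] [+ _]]; rewrite !in_itv/= => /andP[_ h1] /andP[h2 _].
        by move: (lt_le_trans h2 h1); rewrite ltxx.
      rewrite /G; under eq_eseriesr do rewrite splitU.
      rewrite nneseriesD// ge0_muleDr; [|exact: nneseries_ge0|exact: nneseries_ge0].
      rewrite [RHS]addeACA; congr (_ + _)%E.
      by rewrite -EFinD; congr EFin; ring.
    rewrite Gy addeC leeD2l//.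
    apply: le_trans (_ : (e * (y - s))%:E + e%:E * (q%:R * (y - s))%:E <= _)%E.
      by rewrite -EFinM -EFinD lee_fin; move: fy; rewrite -natr1; lra.
    rewrite leeD2l// lee_wpmul2l ?lee_fin ?(ltW e_gt0)//.
    apply: le_trans (nneseries_ge_partial q _) => //.
    rewrite (eq_big_nat _ _ (F2 := fun=> (y - s)%:E)).
      by rewrite sumEFin sumr_const_nat subn0 mulr_natl.
    move=> k /andP[_ kq]; rewrite setIidl.
      rewrite -[leb _]/(@lebesgue_measure R `]s, y]%classic) lebesgue_measure_itv/= lte_fin.
      by rewrite sy.
    move=> z /=; rewrite in_itv/= => /andP[sz zy]; apply: He1 => //.
    by rewrite distrC gtr0_norm ?subr_gt0//; apply: le_lt_trans ye1; rewrite lerD2r.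
apply: le_trans step _.
rewrite /G -/J.
have partial n : (e%:E * \sum_(0 <= k < n) leb (E k) <= \int[leb]_(x in J) (g x)%:E + (e * (b - a))%:E)%E.
  have -> : (\int[leb]_(x in J) (g x)%:E + (e * (b - a))%:E = \int[leb]_(x in J) ((g x)%:E + e%:E))%E.
    have mgE : measurable_fun J (fun x => (g x)%:E).
      by apply/measurable_EFinP; exact: measurable_funTS.
    have g0E x : J x -> (0 <= (g x)%:E)%E by rewrite lee_fin.
    have e0E x : J x -> (0 <= e%:E)%E by rewrite lee_fin ltW.
    have /= -> := ge0_integralD leb mJ g0E mgE e0E (measurable_cst _).
    by rewrite integral_cst// lebJ EFinM.
  have m1 k : measurable_fun J (fun x => (\1_(E k) x : R)%:E).
    by apply/measurable_EFinP; exact: measurable_indic.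
  have p1 k x : J x -> (0 <= (\1_(E k) x : R)%:E)%E by rewrite lee_fin.
  have ms : measurable_fun J (fun x => \sum_(0 <= k < n) (\1_(E k) x : R)%:E)%E by apply: emeasurable_sum.
  have ps x : J x -> (0 <= \sum_(0 <= k < n) (\1_(E k) x : R)%:E)%E by move=> Jx; apply: sume_ge0 => k _; exact: p1.
  have Es : (\int[leb]_(x in J) (\sum_(0 <= k < n) (\1_(E k) x : R)%:E) = \sum_(0 <= k < n) leb (E k))%E.
    rewrite (ge0_integral_sum leb mJ m1 p1); apply: eq_bigr => k _.
    by rewrite (integral_indic leb mJ (mE k)) setIidl// => z [].
  rewrite -Es -(ge0_integralZl_EFin leb mJ ps ms (ltW e_gt0)).
  apply: ge0_le_integral => //.
  - by move=> x Jx; rewrite mule_ge0 ?lee_fin ?(ltW e_gt0)//; apply: ps.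
  - by apply: emeasurable_funM.
  - by apply: emeasurable_funD => //; apply/measurable_EFinP; exact: measurable_funTS.
  move=> x Jx; rewrite sumEFin -EFinM lee_fin.
  have bn j : e * \sum_(0 <= k < j) \1_(E k) x <= j%:R * e.
    rewrite mulrC ler_wpM2r ?(ltW e_gt0)//.
    rewrite -[leRHS]mulr1 mulr_natl -[j in leRHS]subn0 -sumr_const_nat.
    by apply: ler_sum => k _; rewrite indicE; case: (_ \in _).
  elim: n {ms ps Es} => [|n IH]; first by rewrite big_geq// mulr0 addr_ge0// ltW.
  have [ng|ng] := ltP (n%:R * e) (g x).
    by apply: le_trans (bn _) _; rewrite -natr1 mulrDl mul1r lerD2r ltW.
  rewrite big_nat_recr//= indicE (memNset _) ?addr0//.
  by move=> [_ /=]; rewrite ltNge ng.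
apply: le_trans (_ : (e * (b - a))%:E + ((\int[leb]_(x in J) (g x)%:E + (e * (b - a))%:E) + e%:E) <= _)%E.
  rewrite leeD2l//.
  rewrite -nneseriesZl ?lee_fin ?(ltW e_gt0)//.
  apply: nneseries_le_bound => [k|n]; first by rewrite mule_ge0 ?lee_fin ?(ltW e_gt0).
  apply: le_trans (_ : \sum_(0 <= k < n) (e%:E * leb (E k) + (e * (1 / 2) ^+ k.+1)%:E) <= _)%E.
    apply: lee_sum => k _.
    have -> : (e%:E * leb (E k) + (e * (1 / 2) ^+ k.+1)%:E = e%:E * (leb (E k) + ((1 / 2) ^+ k.+1)%:E))%E.
      by rewrite ge0_muleDr ?EFinM// lee_fin exprn_ge0.
    rewrite lee_wpmul2l ?lee_fin ?(ltW e_gt0)//.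
    have mD1 : measurable (U k `\` E k) by apply: measurableD; [exact: mU|exact: mE].
    apply: (@le_trans _ _ (leb (E k `|` (U k `\` E k)))).
      apply: le_measure; rewrite ?inE; [|exact: (measurableU _ _ (mE k) mD1)|].
        by apply: measurableI; [exact: mJ|exact: mU].
      by move=> z [_ Uz]; have [?|?] := pselect (E k z); [left|right].
    apply: (le_trans (measureU2 leb (mE k) mD1)).
    by rewrite leeD2l// ltW//; case: (HU k).
  rewrite big_split/= -ge0_sume_distrr//; apply: leeD; first exact: partial.
  rewrite sumEFin lee_fin -mulr_sumr ler_piMr ?(ltW e_gt0)//.
  have -> : \sum_(0 <= k < n) (1 / 2 : R) ^+ k.+1 = 1 - (1/2) ^+ n.
    elim: n => [|n IH]; first by rewrite big_geq// expr0 subrr.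
    by rewrite big_nat_recr//= IH !exprS; lra.
  by rewrite gerBl exprn_ge0.
move: (\int[leb]_(x in J) (g x)%:E)%E => I.
case: I => [r| |] //=; rewrite -!EFinD lee_fin; lra.
Qed.
End OneDim.

(** * Lagrange interpolation at separated nodes *)

Section Lagrange.
Variable R : realType.

Section basis.
Variables (m : nat) (v : 'I_m -> R).
Hypothesis vinj : injective v.
Definition lag (k : 'I_m) : {poly R} :=
  \prod_(l < m | l != k) ((v k - v l)^-1 *: ('X - (v l)%:P)).

Lemma lagE k x : (lag k).[x] = \prod_(l < m | l != k) ((x - v l) / (v k - v l)).
Proof.
rewrite /lag horner_prod; apply: eq_bigr => l _.
by rewrite hornerZ hornerXsubC mulrC.
Qed.

Lemma lag_diag k l : (lag k).[v l] = (l == k)%:R.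
Proof.
rewrite lagE; case: (eqVneq l k) => [->|lk].
  rewrite big1// => j jk; rewrite divff// subr_eq0; apply: contraNneq jk => /vinj ->.
  by rewrite eqxx.
by rewrite (bigD1 l)//= subrr mul0r mul0r.
Qed.

Lemma size_lag k : (size (lag k) <= m)%N.
Proof.
have H (P : pred 'I_m) : (size (\prod_(l < m | P l) ((v k - v l)^-1 *: ('X - (v l)%:P)))%R <= (\sum_(l < m | P l) 1).+1)%N.
  elim/big_ind2: _ => [|p1 n1 p2 n2 h1 h2|l _]; first by rewrite size_poly1.
    apply: leq_trans (size_polyMleq _ _) _.
    by move: h1 h2; lia.
  by apply: leq_trans (size_scale_leq _ _) _; rewrite size_XsubC.
apply: leq_trans (H _) _; rewrite sum1_card cardC1 card_ord.
by case: m k {H} => // -[].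
Qed.

Lemma lag_interp (q : {poly R}) : (size q <= m)%N -> q = \sum_k q.[v k] *: lag k.
Proof.
move=> sq; apply/eqP; rewrite -subr_eq0; apply/negPn/negP => nz.
have sz : (size (q - \sum_k q.[v k] *: lag k)%R <= m)%N.
  apply: leq_trans (size_polyD _ _) _; rewrite geq_max sq size_polyN.
  apply: leq_trans (size_sum _ _ _) _; apply/bigmax_leqP => k _.
  by apply: leq_trans (size_scale_leq _ _) _; exact: size_lag.
have := max_poly_roots nz (rs := [seq v k | k <- enum 'I_m]).
rewrite size_map size_enum_ord ltnNge sz => H; suff: false by []; apply: H.
  apply/allP => _ /mapP[k _ ->]; rewrite rootE !hornerE horner_sum.
  rewrite (bigD1 k)//= hornerZ lag_diag eqxx mulr1 big1 ?addr0 ?subrr// => l lk.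
  by rewrite hornerZ lag_diag eq_sym (negbTE lk) mulr0.
by rewrite map_inj_uniq ?enum_uniq.
Qed.

(** Each factor has a numerator of size at most [h] and a denominator of size at least [h / (2m)].
    The bound depends neither on [h] nor on the position of the nodes, which keeps all later
    constants scale free. *)
Lemma lag_bound (a h : R) k x : 0 < h -> (forall l, a <= v l <= a + h) -> a <= x <= a + h ->
  (forall l, l != k -> h / (2 * m)%:R <= `|v k - v l|) ->
  `|(lag k).[x]| <= (2 * m)%:R ^+ m.
Proof.
move=> h0 Hv Hx sep.
have m0 : (0 < m)%N by case: m k {sep} v Hv vinj => // -[].
have m2 : 1 <= (2 * m)%:R :> R by rewrite ler1n muln_gt0.
rewrite lagE normr_prod.
apply: le_trans (_ : \prod_(l < m | l != k) (2 * m)%:R <= _).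
  apply: ler_prod => l lk; rewrite normr_ge0/= normrM normfV.
  have s0 := sep _ lk.
  have s1 : 0 < `|v k - v l|.
    by apply: lt_le_trans s0; rewrite divr_gt0// (lt_le_trans ltr01).
  rewrite ler_pdivrMr//; apply: le_trans (_ : h <= _).
    by rewrite ler_norml; move: Hx (Hv l) => /andP[? ?] /andP[? ?]; apply/andP; split; lra.
  by rewrite mulrC -ler_pdivrMr// (lt_le_trans ltr01).
rewrite prodr_const; apply: ler_weXn2l => //.
by rewrite -[X in (_ <= X)%N]card_ord max_card.
Qed.
End basis.

Lemma poly_bounded (q : {poly R}) (B : R) : exists C, 0 <= C /\ forall x, `|x| <= B -> `|q.[x]| <= C.
Proof.
exists (\sum_(i < size q) `|q`_i| * `|B| ^+ i); split.
  by apply: sumr_ge0 => i _; rewrite mulr_ge0// exprn_ge0.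
move=> x xB; rewrite horner_coef; apply: le_trans (ler_norm_sum _ _ _) _.
apply: ler_sum => i _; rewrite normrM normrX ler_wpM2l// lerXn2r ?nnegrE//.
by apply: le_trans xB _; rewrite ler_norm.
Qed.

End Lagrange.

(** * Taylor remainders and interpolation error in one variable *)

Section Taylor.
Variable R : realType.
Let leb : {measure set (measurableTypeR R) -> \bar R} := @lebesgue_measure R.

Lemma rough_ftc (f : R -> R) (a h x y : R) : 0 <= h -> a <= x <= a + h -> a <= y <= a + h ->
  (forall z, derivable f z 1) -> measurable_fun setT (derive1 f) ->
  (`|f y - f x|%:E <= \int[leb]_(z in `[a, (a + h)%R]) `|derive1 f z|%:E)%E.
Proof.
move=> h0; wlog xy : x y / x <= y.
  move=> H Hx Hy df mf; case: (leP x y) => xy; first exact: H.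
  by rewrite distrC; apply: H => //; exact: ltW.
move=> Hx Hy df mf.
have mg : measurable_fun setT (fun z => `|derive1 f z|) by exact: measurableT_comp.
have sub : (\int[leb]_(z in `[x, y]) `|derive1 f z|%:E <= \int[leb]_(z in `[a, (a + h)%R]) `|derive1 f z|%:E)%E.
  apply: ge0_subset_integral => //.
  - by apply/measurable_EFinP; exact: measurable_funTS.
  - by apply: subset_itv; rewrite bnd_simp; [case/andP: Hx|case/andP: Hy].
apply: le_trans sub.
have [fxy|fxy] := leP 0 (f y - f x).
  by rewrite ger0_norm//; exact: rough_ftc_pos.
rewrite ltr0_norm// opprB.
have -> : f x - f y = - f y - - f x by rewrite opprK addrC.
have d' z : derivable (- f) z 1 by exact: derivableN.
have e' z : derive1 (- f) z = - derive1 f z by rewrite !derive1E deriveN.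
apply: (@rough_ftc_pos R (- f) (fun z => `|derive1 f z|)) => // z.
by rewrite e' normrN.
Qed.

Definition taylor (phi : nat -> R -> R) (m : nat) (x : R) : {poly R} :=
  \sum_(j < m) (phi j x / j`!%:R) *: ('X - x%:P) ^+ j.

Lemma size_taylor phi m x : (size (taylor phi m x) <= m)%N.
Proof.
apply: leq_trans (size_sum _ _ _) _; apply/bigmax_leqP => j _.
apply: leq_trans (size_scale_leq _ _) _; rewrite size_exp_XsubC; exact: ltn_ord.
Qed.

Lemma taylor_x phi m x : (0 < m)%N -> (taylor phi m x).[x] = phi 0 x.
Proof.
case: m => // m _; rewrite /taylor horner_sum big_ord_recl/= expr0 fact0 divr1 hornerZ hornerC mulr1.
rewrite big1 ?addr0// => j _; rewrite hornerZ horner_exp hornerXsubC subrr.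
by rewrite expr0n/= mulr0.
Qed.

Lemma taylorS_deriv phi m x : (taylor phi m.+1 x)^`() = taylor (fun j => phi j.+1) m x.
Proof.
rewrite /taylor raddf_sum big_ord_recl/= expr0 derivZ derivC scaler0 add0r.
apply: eq_bigr => j _; rewrite derivZ deriv_exp derivXsubC mul1r /bump/= add1n /=.
rewrite add0n -[(_ ^+ _) *+ _]scaler_nat scalerA; congr (_ *: _).
rewrite factS natrM; field.
by rewrite nat1r !pnatr_eq0 -lt0n fact_gt0.
Qed.

Lemma taylor_deriv_x phi m x : (1 < m)%N -> (taylor phi m x)^`().[x] = phi 1 x.
Proof. by case: m => // m m0; rewrite taylorS_deriv taylor_x. Qed.

(** Induction on the order: the derivative of the remainder is the remainder of the shifted
    sequence, and the mean value theorem adds a factor [h]. The base case is [rough_ftc], so the top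
    derivative only has to be measurable. The derivatives are given as a sequence [phi] because they
    will be slices of partial derivatives. *)
Lemma taylor_rem (phi : nat -> R -> R) (m : nat) (a h E : R) : 0 <= h ->
  (forall j, (j <= m)%N -> forall z : R, is_derive z (1 : R) (phi j) (phi j.+1 z)) ->
  measurable_fun setT (phi m.+1) ->
  (\int[leb]_(z in `[a, (a + h)%R]) `|phi m.+1 z|%:E <= E%:E)%E ->
  forall x u, a <= x <= a + h -> a <= u <= a + h ->
  `|phi 0 u - (taylor phi m.+1 x).[u]| <= h ^+ m * E.
Proof.
move=> h0; elim: m phi => [|m IH] phi dphi mphi Eint x u Hx Hu.
  rewrite expr0 mul1r /taylor big_ord1 expr0 fact0 divr1 hornerZ hornerC mulr1.
  rewrite -lee_fin; apply: le_trans Eint.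
  have e1 : phi 1%N = derive1 (phi 0%N).
    by apply/funext => z; rewrite derive1E; have [_ ->] := dphi 0%N (leqnn _) z.
  rewrite e1; apply: rough_ftc => //; last by rewrite -e1.
  by move=> z; have [] := dphi 0%N (leqnn _) z.
pose r (w : R) := phi 0%N w - (taylor phi m.+2 x).[w].
have dr z : is_derive z (1 : R) r (phi 1%N z - (taylor (fun j => phi j.+1) m.+1 x).[z]).
  rewrite -taylorS_deriv; apply: is_deriveB; first exact: dphi.
have rx : r x = 0 by rewrite /r taylor_x// subrr.
have Hr w : a <= w <= a + h -> `|phi 1%N w - (taylor (fun j => phi j.+1) m.+1 x).[w]| <= h ^+ m * E.
  by move=> Hw; apply: (IH (fun j => phi j.+1)) => // j jm z; apply: dphi.
have E0 : 0 <= h ^+ m * E by apply: le_trans (Hr x Hx).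
have cr : continuous r.
  by move=> z; apply: differentiable_continuous; apply/derivable1_diffP; case: (dr z).
have MV y z : y <= z -> a <= y <= a + h -> a <= z <= a + h -> `|r z - r y| <= h ^+ m.+1 * E.
  move=> yz Hy Hz.
  have [c Hc ->] := MVT_segment yz (fun w _ => dr w) (continuous_subspaceT cr).
  rewrite normrM exprS mulrAC -mulrA mulrC; apply: ler_pM => //.
    by rewrite ger0_norm ?subr_ge0//; move: Hy Hz => /andP[? ?] /andP[? ?]; lra.
  rewrite mulrC; apply: Hr; move: Hc; rewrite in_itv/= => /andP[? ?].
  by move: Hy Hz => /andP[? ?] /andP[? ?]; apply/andP; split; lra.
rewrite -/(r u) -[r u]subr0 -rx.
by case: (leP x u) => xu; [exact: MV|rewrite distrC; apply: MV => //; exact: ltW].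
Qed.

Lemma L1_L2_bound (f : R -> R) (a h S : R) : 0 < h -> 0 <= S -> measurable_fun setT f ->
  (\int[leb]_(z in `[a, (a + h)%R]) ((f z) ^+ 2)%:E <= S%:E)%E ->
  (\int[leb]_(z in `[a, (a + h)%R]) `|f z|%:E <= (Num.sqrt (h * S))%:E)%E.
Proof.
move=> h0 S0 mf fS.
apply/lee_addgt0Pr => e e0.
(* Adding [e] keeps the weight positive when [S = 0]. *)
pose s := Num.sqrt (h * S) + e.
have s0 : 0 < s by rewrite ltr_wpDl ?sqrtr_ge0.
have mI : measurable (`[a, a + h]%classic : set (measurableTypeR R)) by exact: measurable_itv.
have mf2 : measurable_fun `[a, a + h]%classic (fun z => ((f z) ^+ 2)%:E).
  by apply/measurable_EFinP; apply: measurable_funTS; exact: measurable_funX.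
have lebJ : leb `[a, a + h]%classic = h%:E.
  rewrite -[leb _]/(@lebesgue_measure R `[a, a + h]%classic) lebesgue_measure_itv/= lte_fin.
  by rewrite ltrDl h0 -EFinD addrAC subrr add0r.
(* AM-GM with weight s/h *)
apply: le_trans (_ : \int[leb]_(z in `[a, (a + h)%R]) ((s / (2 * h))%:E + (h / (2 * s))%:E * ((f z) ^+ 2)%:E) <= _)%E.
  apply: ge0_le_integral => //.
  - by apply/measurable_EFinP; apply: measurable_funTS; exact: measurableT_comp.
  - by apply: emeasurable_funD => //; apply: emeasurable_funM.
  move=> z _; rewrite -EFinM -EFinD lee_fin.
  rewrite -subr_ge0 -[f z ^+ 2]real_normK ?num_real//; set t := `|f z|.
  have -> : s / (2 * h) + h / (2 * s) * t ^+ 2 - t = (s - h * t) ^+ 2 / (2 * s * h).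
    by field; rewrite !gt_eqF.
  by rewrite divr_ge0 ?sqr_ge0// !mulr_ge0// ltW.
have p1 z : `[a, a + h]%classic z -> (0 <= (s / (2 * h))%:E)%E.
  by rewrite lee_fin divr_ge0 ?mulr_ge0// ltW.
have p2 z : `[a, a + h]%classic z -> (0 <= (h / (2 * s))%:E * ((f z) ^+ 2)%:E)%E.
  by move=> _; rewrite -EFinM lee_fin mulr_ge0 ?sqr_ge0// divr_ge0 ?mulr_ge0// ltW.
have p3 z : `[a, a + h]%classic z -> (0 <= ((f z) ^+ 2)%:E)%E by rewrite lee_fin sqr_ge0.
have m2 : measurable_fun `[a, a + h]%classic (fun z => (h / (2 * s))%:E * ((f z) ^+ 2)%:E)%E.
  by apply: emeasurable_funM.
have /= -> := ge0_integralD leb mI p1 (measurable_cst _) p2 m2.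
have hs0 : 0 <= h / (2 * s) by rewrite divr_ge0 ?mulr_ge0// ltW.
have /= -> := ge0_integralZl_EFin leb mI p3 mf2 hs0.
rewrite integral_cst// lebJ.
apply: le_trans (_ : ((s / (2 * h))%:E * h%:E + (h / (2 * s))%:E * S%:E <= _)%E).
  by rewrite leeD2l// lee_wpmul2l.
rewrite -!EFinM -!EFinD lee_fin -/s.
have hS : h * S <= s ^+ 2.
  rewrite -[h * S]sqr_sqrtr ?mulr_ge0 ?(ltW h0)// lerXn2r ?nnegrE ?sqrtr_ge0 ?(ltW s0)//.
  by rewrite lerDl ltW.
have -> : s / (2 * h) * h + h / (2 * s) * S = s / 2 + (h * S) / (2 * s).
  by field; rewrite !gt_eqF.
rewrite -lerBrDl ler_pdivrMr ?mulr_gt0//.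
have -> : (s - s / 2) * (2 * s) = s ^+ 2 by field.
exact: hS.
Qed.

(** Interpolation reproduces the Taylor polynomial at [x], whose value at [x] is [phi 0 x]. The
    error is therefore a combination of the Taylor remainders at the nodes, with coefficients
    controlled by [lag_bound]. *)
Lemma lag_error (phi : nat -> R -> R) (m : nat) (v : 'I_m.+1 -> R) (a h S : R) : 0 < h -> 0 <= S ->
  (forall j, (j <= m)%N -> forall z : R, is_derive z (1 : R) (phi j) (phi j.+1 z)) ->
  measurable_fun setT (phi m.+1) ->
  (\int[leb]_(z in `[a, (a + h)%R]) ((phi m.+1 z) ^+ 2)%:E <= S%:E)%E ->
  injective v -> (forall l, a <= v l <= a + h) ->
  (forall k l, l != k -> h / (2 * m.+1)%:R <= `|v k - v l|) ->
  forall x, a <= x <= a + h ->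
  (phi 0%N x - \sum_k (lag v k).[x] * phi 0%N (v k)) ^+ 2 <=
   (m.+1%:R * (2 * m.+1)%:R ^+ m.+1) ^+ 2 * h ^+ (2 * m).+1 * S.
Proof.
move=> h0 S0 dphi mphi HS vinj Hv sep x Hx.
pose E := Num.sqrt (h * S).
have HE := L1_L2_bound h0 S0 mphi HS.
have rem u := taylor_rem (ltW h0) dphi mphi HE Hx (u := u).
pose T := taylor phi m.+1 x.
have Tx : phi 0%N x = \sum_k (lag v k).[x] * T.[v k].
  have TL : T = \sum_k T.[v k] *: lag v k := lag_interp vinj (size_taylor phi m.+1 x).
  rewrite -(taylor_x phi x (ltn0Sn m)) -/T {1}TL horner_sum.
  by apply: eq_bigr => k _; rewrite hornerZ mulrC.
rewrite Tx -sumrB.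
have bnd : `|\sum_k ((lag v k).[x] * T.[v k] - (lag v k).[x] * phi 0%N (v k))| <=
     m.+1%:R * (2 * m.+1)%:R ^+ m.+1 * (h ^+ m * E).
  apply: le_trans (ler_norm_sum _ _ _) _.
  apply: le_trans (_ : \sum_(k < m.+1) (2 * m.+1)%:R ^+ m.+1 * (h ^+ m * E) <= _); last first.
    by rewrite sumr_const card_ord -[_ *+ m.+1]mulr_natl mulrA.
  apply: ler_sum => k _.
  rewrite -mulrBr normrM; apply: ler_pM => //; first exact: (lag_bound vinj h0 Hv Hx (sep k)).
  by rewrite distrC; exact: rem.
have A0 : 0 <= m.+1%:R * (2 * m.+1)%:R ^+ m.+1 * (h ^+ m * E).
  by apply: le_trans bnd; rewrite normr_ge0.
move: bnd; rewrite -ler_sqr ?nnegrE// real_normK ?num_real// => /le_trans; apply.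
rewrite exprMn (exprMn 2 (h ^+ m)) sqr_sqrtr ?mulr_ge0 ?(ltW h0)// -mulrA.
by rewrite ler_wpM2l ?sqr_ge0// -exprM mulnC exprSr mulrA.
Qed.
End Taylor.

(** * Pure derivatives along coordinate lines and their measurability *)

Section Slices.
Variables (R : realType) (d : nat).
Implicit Types (f : 'rV[R]_d -> R).
Local Notation V := 'rV[R]_d.

Definition Dn (i : 'I_d) (j : nat) f : V -> R := iter_pder (nseq j i) f.
Definition pdiff (m : nat) f := forall i : 'I_d, iter_pderivable (nseq m i) f.

Lemma ebasis_upd (i : 'I_d) (x : V) (s h : R) : h *: ebasis R i + upd i x s = upd i x (h + s).
Proof.
apply/rowP => j; rewrite !mxE eqxx/=; case: eqP => _ /=; first by rewrite mulr1.
by rewrite mulr0 add0r.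
Qed.

Lemma slice_is_derive (i : 'I_d) f (x : V) (s : R) : derivable f (upd i x s) (ebasis R i) ->
  is_derive s 1 (fun u => f (upd i x u)) (pder i f (upd i x s)).
Proof.
move=> H.
have E : (fun h : R => h^-1 *: ((fun u => f (upd i x u)) (h *: 1 + s) - f (upd i x s))) =
         (fun h : R => h^-1 *: (f (h *: ebasis R i + upd i x s) - f (upd i x s))).
  apply/funext => h; rewrite ebasis_upd; congr (_ *: (f (upd i x _) - _)).
  by rewrite [h *: 1]mulr1.
apply: DeriveDef; first by rewrite /derivable; move: H; rewrite /derivable -E.
by rewrite /pder /derive -E.
Qed.

Lemma iter_pderivable_nseq (i : 'I_d) m f : iter_pderivable (nseq m i) f ->
  forall j, (j < m)%N -> forall x, derivable (Dn i j f) x (ebasis R i).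
Proof.
elim: m => // m IH /= [H1 H2] j; rewrite ltnS leq_eqVlt => /orP[/eqP->//|jm]; exact: IH.
Qed.

Lemma Dn_slice m f (i : 'I_d) (x : V) (j : nat) (s : R) : pdiff m f -> (j < m)%N ->
  is_derive s 1 (fun u => Dn i j f (upd i x u)) (Dn i j.+1 f (upd i x s)).
Proof. by move=> pf jm; apply: slice_is_derive; exact: (iter_pderivable_nseq (pf i)). Qed.

Lemma slice_continuous m f (i : 'I_d) (x : V) : (0 < m)%N -> pdiff m f ->
  continuous (fun u => f (upd i x u)).
Proof.
move=> m0 pf s; apply: differentiable_continuous; apply/derivable1_diffP.
by have [] := Dn_slice i x s pf m0.
Qed.

Lemma measurable_countable_glue d0 (T : measurableType d0) (N : T -> int) (F : int -> T -> R) :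
  (forall z, measurable [set t | N t = z]) -> (forall z, measurable_fun setT (F z)) ->
  measurable_fun setT (fun t => F (N t) t).
Proof.
move=> mN mF _ B mB; rewrite setTI.
have -> : (fun t => F (N t) t) @^-1` B = \bigcup_n
   (if pickle_inv n is Some z then [set t | N t = z] `&` (F z @^-1` B) else set0).
  apply/seteqP; split => t /=.
    by move=> FB; exists (pickle (N t)); [exact: Logic.I|rewrite pickleK_inv].
  by move=> [n _]; case: (pickle_inv n) => // z [/= ->].
apply: bigcupT_measurable => n; case: (pickle_inv n) => [z|]; last exact: measurable0.
apply: measurableI; first exact: mN.
by rewrite -[X in measurable X]setTI; exact: mF.
Qed.

Lemma measurable_floor_level d0 (T : measurableType d0) (h : T -> R) (z : int) :
  measurable_fun setT h -> measurable [set t | Num.floor (h t) = z].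
Proof.
move=> mh.
rewrite (_ : [set t | _] = h @^-1` `[z%:~R, (z + 1)%:~R[%classic).
  by rewrite -[X in measurable X]setTI; apply: mh => //; exact: measurable_itv.
apply/seteqP; split => t /=; rewrite in_itv/=.
  by move=> <-; rewrite floor_le_tmp//= floorD1_gt.
by move=> H; apply/eqP; rewrite floor_eq.
Qed.

(** Coordinates are released one at a time. Rounding the new coordinate to multiples of [1/(n+1)]
    gives countably many measurable pieces, and continuity in that single coordinate lets [n] tend
    to infinity. *)
Lemma sep_cont_measurable f : (forall i x, continuous (fun u => f (upd i x u))) ->
  measurable_fun setT (f : Rd R d -> R).
Proof.
move=> cf.
suff H k : (k <= d)%N -> forall z, measurable_fun setT (fun x : Rd R d => f (mix x k z)).
  have := H d (leqnn _) 0; apply: eq_measurable_fun => x _.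
  by rewrite mixd.
elim: k => [|k IH] kd z.
  rewrite (_ : (fun x => _) = cst (f z)); first exact: measurable_cst.
  by apply/funext => x; rewrite mix0.
pose i := Ordinal kd.
pose q (n : nat) (s : R) : R := (Num.floor (n.+1%:R * s))%:~R / n.+1%:R.
apply: (@measurable_fun_cvg _ _ _ _ (fun n (x : Rd R d) => f (mix x k (upd i z (q n (x 0 i)))))).
- move=> n.
  apply: (@measurable_countable_glue _ _ (fun x : Rd R d => Num.floor (n.+1%:R * x 0 i))
     (fun zz x => f (mix x k (upd i z (zz%:~R / n.+1%:R))))).
    move=> zz; apply: measurable_floor_level; apply: measurable_funM => //; exact: measurable_coord.
  by move=> zz; apply: IH; exact: ltnW.
- move=> x _; rewrite (_ : k.+1 = i.+1)// mixS.
  under eq_fun do rewrite (mix_upd x i z).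
  have qx : q n (x 0 i) @[n --> \oo] --> x 0 i.
    apply/cvgrPdist_le => e e0; near=> n.
    have n0 : 0 < n.+1%:R :> R by [].
    have -> : x 0 i - q n (x 0 i) = (n.+1%:R * x 0 i - (Num.floor (n.+1%:R * x 0 i))%:~R) / n.+1%:R.
      by rewrite /q; field.
    rewrite normrM normfV (gtr0_norm n0) ler_pdivrMr//.
    have h1 := floor_le_tmp (n.+1%:R * x 0 i); have h2 := floorD1_gt (n.+1%:R * x 0 i).
    rewrite intrD in h2.
    apply: le_trans (_ : 1 <= _); first by rewrite ger0_norm; lra.
    rewrite mulrC -ler_pdivrMr//; near: n; exists (Num.truncn (1 / e)) => // n /= Hn.
    apply: ltW; apply: lt_le_trans (truncnS_gt _) _; rewrite ler_nat ltnS//.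
  exact: (continuous_cvg _ (cf i (mix x i z) (x 0 i)) qx).
Unshelve. all: by end_near. Qed.

Lemma measurable_shift_coord (i : 'I_d) (c : R) :
  measurable_fun setT (fun x : Rd R d => upd i x (x 0 i + c) : Rd R d).
Proof.
apply: measurable_to_Rd => j.
under eq_fun do rewrite mxE.
case: eqP => _; last exact: measurable_coord.
by apply: measurable_funD => //; exact: measurable_coord.
Qed.

(** Each pure derivative is the pointwise limit of the difference quotients of the preceding one
    with steps [1/(n+1)]. *)
Lemma Dn_measurable m f (i : 'I_d) j : (0 < m)%N -> pdiff m f -> (j <= m)%N ->
  measurable_fun setT (Dn i j f : Rd R d -> R).
Proof.
move=> m0 pf; elim: j => [|j IH] jm.
  apply: (@sep_cont_measurable f) => k x; exact: (slice_continuous m0 pf).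
have mj := IH (ltnW jm).
apply: (@measurable_fun_cvg _ _ _ _ (fun n (x : Rd R d) =>
   (n.+1%:R^-1)^-1 * (Dn i j f (upd i x (x 0 i + n.+1%:R^-1)) - Dn i j f x))).
- move=> n; apply: measurable_funM => //; apply: measurable_funB => //.
  exact: (measurableT_comp mj (measurable_shift_coord i _)).
move=> x _; have [dx dE] := Dn_slice i x (x 0 i) pf jm.
rewrite upd_id in dE; rewrite -dE.
move: dx => /cvg_ex[l Hl].
have -> : derive (fun u => Dn i j f (upd i x u)) (x 0 i) 1 = l by exact: (cvg_lim _ Hl).
have pre : (forall n, (n.+1%:R^-1 : R) != 0) /\ ((n.+1%:R^-1 : R) @[n --> \oo] --> (0 : R)).
  by split; [move=> n; rewrite invr_eq0 pnatr_eq0|exact: cvg_harmonic].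
have /cvgr_dnbhsP/(_ (fun n => n.+1%:R^-1))/(_ pre) := Hl.
move=> H; apply: cvg_trans H; apply: near_eq_cvg; near=> n.
rewrite -[LHS]/(n.+1%:R^-1^-1 * (Dn i j f (upd i x (n.+1%:R^-1 * 1 + x 0 i)) - Dn i j f (upd i x (x 0 i)))).
by rewrite mulr1 upd_id (addrC (x 0 i)).
Unshelve. all: by end_near. Qed.

Lemma Dn_line_measurable m f (i : 'I_d) j (x : V) : (0 < m)%N -> pdiff m f -> (j <= m)%N ->
  measurable_fun setT (fun u : measurableTypeR R => Dn i j f (upd i x u)).
Proof.
move=> m0 pf jm; exact: (measurableT_comp (Dn_measurable i m0 pf jm) (measurable_upd_line i x)).
Qed.

Lemma DnB m f g (i : 'I_d) : pdiff m f -> pdiff m g ->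
  iter_pderivable (nseq m i) (f - g) /\
  forall j, (j <= m)%N -> Dn i j (f - g) = Dn i j f - Dn i j g.
Proof.
move=> pf pg.
have H j : (j <= m)%N -> Dn i j (f - g) = Dn i j f - Dn i j g.
  elim: j => // j IH jm; apply/funext => x; rewrite /Dn/= -/(Dn i j (f - g)) (IH (ltnW jm)).
  rewrite /pder deriveB//; exact: (iter_pderivable_nseq (_ : iter_pderivable (nseq m i) _)).
split => //.
have K j : (j <= m)%N -> iter_pderivable (nseq j i) (f - g).
  elim: j => // j IH jm /=; split; first exact: IH (ltnW jm).
  move=> x; rewrite -/(Dn i j (f - g)) (H _ (ltnW jm)).
  by apply: derivableB; exact: (iter_pderivable_nseq (_ : iter_pderivable (nseq m i) _)).
exact: K.
Qed.
Lemma pdiffB m f g : pdiff m f -> pdiff m g -> pdiff m (f - g).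
Proof. by move=> pf pg i; have [] := DnB i pf pg. Qed.
End Slices.

(** * Separated cells and an inverse inequality in one variable *)

Section PolyAverage.
Variable R : realType.
Let leb : {measure set (measurableTypeR R) -> \bar R} := @lebesgue_measure R.
Variable m : nat.
Let M : R := (2 * m.+1)%:R.

(** The interval is cut into [2(m+1)] equal pieces, and node [k] will lie in the piece of index
    [2k]. The pieces left empty separate the nodes, while each node keeps a whole interval of
    possible positions. *)
Definition cell_lo (a h : R) (k : 'I_m.+1) : R := a + (2 * k)%:R * (h / M).
Definition cell_hi (a h : R) (k : 'I_m.+1) : R := a + (2 * k).+1%:R * (h / M).

Let M0 : 0 < M. Proof. by rewrite /M ltr0n. Qed.

Lemma cell_width (a h : R) k : cell_hi a h k - cell_lo a h k = h / M.
Proof. by rewrite /cell_hi /cell_lo -natr1; ring. Qed.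

Lemma cell_sub (a h v : R) k : 0 <= h -> cell_lo a h k <= v <= cell_hi a h k -> a <= v <= a + h.
Proof.
move=> h0 /andP[v1 v2]; have s0 : 0 <= h / M by rewrite divr_ge0// ltW.
apply/andP; split.
  by apply: le_trans v1; rewrite /cell_lo lerDl mulr_ge0.
apply: le_trans v2 _; rewrite /cell_hi lerD2l.
have -> : h = M * (h / M) by rewrite mulrC divfK// gt_eqF.
have -> : M * (h / M) / M = h / M by field; rewrite gt_eqF.
rewrite ler_wpM2r// /M ler_nat; have := ltn_ord k; lia.
Qed.

Lemma cell_sep (a h : R) (v : 'I_m.+1 -> R) : 0 <= h ->
  (forall k, cell_lo a h k <= v k <= cell_hi a h k) ->
  forall k l, l != k -> h / M <= `|v k - v l|.
Proof.
move=> h0 Hv; have s0 : 0 <= h / M by rewrite divr_ge0// ltW.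
have H (k l : 'I_m.+1) : (k < l)%N -> h / M <= v l - v k.
  move=> kl; have /andP[_ h1] := Hv k; have /andP[h2 _] := Hv l.
  have e : h / M <= (2 * l)%:R * (h / M) - (2 * k).+1%:R * (h / M).
    rewrite lerBrDl -[X in _ + X]mul1r -mulrDl natr1 ler_wpM2r// ler_nat; lia.
  apply: le_trans e _; have := lerB h2 h1.
  by rewrite /cell_lo /cell_hi opprD addrACA subrr add0r.
move=> k l lk; have : (k < l)%N || (l < k)%N by rewrite -neq_ltn eq_sym.
move=> /orP[/H h1|/H h1]; last by apply: le_trans h1 (ler_norm _).
by rewrite distrC; apply: le_trans h1 (ler_norm _).
Qed.

Lemma cell_inj (a h : R) (v : 'I_m.+1 -> R) : 0 < h ->
  (forall k, cell_lo a h k <= v k <= cell_hi a h k) -> injective v.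
Proof.
move=> h0 Hv k l vkl; apply/eqP/negPn/negP => kl.
have := cell_sep (ltW h0) Hv (k := l) (l := k) kl.
by rewrite vkl subrr normr0 leNgt divr_gt0.
Qed.

Lemma leb_itv (x y : R) : x <= y -> leb `[x, y]%classic = (y - x)%:E.
Proof.
move=> xy; rewrite -[leb _]/(@lebesgue_measure R `[x, y]%classic) lebesgue_measure_itv/= lte_fin.
by case: ltgtP xy => [|//|<-]; rewrite ?subrr.
Qed.

Lemma sum_sqr_le (n : nat) (c x : 'I_n -> R) (B : R) : (forall k, `|c k| <= B) ->
  (\sum_k c k * x k) ^+ 2 <= n%:R * B ^+ 2 * \sum_k (x k) ^+ 2.
Proof.
move=> cB.
have CS (y : 'I_n -> R) : (\sum_k y k) ^+ 2 <= n%:R * \sum_k (y k) ^+ 2.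
  elim: n y {c x cB} => [|n IH] y; first by rewrite !big_ord0 expr0n mul0r.
  rewrite !big_ord_recr/=; set s := \sum_(_ < _) _; set t := \sum_(_ < _) _; set z := y ord_max.
  have h1 : s ^+ 2 <= n%:R * t by exact: IH.
  have [/eqP n0|n0] := boolP (n == 0%N).
    subst n; have s0 : s = 0 by rewrite /s big_ord0.
    have t0 : t = 0 by rewrite /t big_ord0.
    by rewrite s0 t0 !add0r mul1r.
  have n1 : 0 < n%:R :> R by rewrite ltr0n lt0n.
  have h2 : 2 * (s * z) <= s ^+ 2 / n%:R + n%:R * z ^+ 2.
    rewrite -subr_ge0.
    have -> : s ^+ 2 / n%:R + n%:R * z ^+ 2 - 2 * (s * z) = (s - n%:R * z) ^+ 2 / n%:R.
      by field; rewrite gt_eqF.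
    by rewrite divr_ge0 ?sqr_ge0// ltW.
  have h3 : s ^+ 2 / n%:R <= t by rewrite ler_pdivrMr// mulrC.
  rewrite sqrrD mulr2n -natr1 mulrDl mul1r mulrDr.
  have -> : s * z + s * z = 2 * (s * z) by ring.
  lra.
apply: le_trans (CS _) _; rewrite -mulrA ler_wpM2l// mulr_sumr; apply: ler_sum => k _.
rewrite exprMn ler_wpM2r ?sqr_ge0// -real_normK ?num_real// lerXn2r ?nnegrE//.
by apply: le_trans (cB k).
Qed.

(** The nodes are minimisers of [q^2] on the cells, so the values there are at most averages;
    Lagrange interpolation carries the bound to any point of the interval. *)
Lemma poly_average (q : {poly R}) (a h z : R) : (size q <= m.+1)%N -> 0 < h -> a <= z <= a + h ->
  ((q.[z] ^+ 2)%:E <= (m.+1%:R * (M ^+ m.+1) ^+ 2 * m.+1%:R * M / h)%:E *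
     \int[leb]_(v in `[a, (a + h)%R]) ((q.[v]) ^+ 2)%:E)%E.
Proof.
move=> sq h0 Hz.
have cq : continuous (fun v : R => q.[v] ^+ 2).
  have -> : (fun v : R => q.[v] ^+ 2) = horner (q ^+ 2) by apply/funext => v; rewrite horner_exp.
  exact: continuous_horner.
have mq : measurable_fun setT (fun v : measurableTypeR R => (q.[v] ^+ 2)%:E).
  by apply/measurable_EFinP; exact: continuous_measurable_fun.
have w0 : 0 < h / M by rewrite divr_gt0.
have Hc k : exists v, cell_lo a h k <= v <= cell_hi a h k /\
   ((q.[v] ^+ 2)%:E <= (M / h)%:E * \int[leb]_(v in `[a, (a + h)%R]) ((q.[v]) ^+ 2)%:E)%E.
  have lohi : cell_lo a h k <= cell_hi a h k by rewrite -subr_ge0 cell_width ltW.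
  have [v Hv vmin] := EVT_min lohi (continuous_subspaceT cq).
  exists v; split; first by move: Hv; rewrite in_itv.
  have := le_trans _ (int_sub leb (measurable_itv `[a, a + h]) (measurable_itv `[cell_lo a h k, cell_hi a h k]) mq (sq_ge0E _) _).
  move=> /(_ (q.[v] ^+ 2 * (h / M))%:E) H.
  have -> : q.[v] ^+ 2 = M / h * (q.[v] ^+ 2 * (h / M)) by field; rewrite !gt_eqF.
  rewrite EFinM lee_wpmul2l ?lee_fin ?divr_ge0 ?(ltW M0) ?(ltW h0)//; apply: H.
    have <- : (\int[leb]_(u in `[cell_lo a h k, cell_hi a h k]) (q.[v] ^+ 2)%:E = (q.[v] ^+ 2 * (h / M))%:E)%E.
      by rewrite integral_cst// leb_itv// cell_width EFinM.
    apply: le_int => //; first by move=> u _; rewrite lee_fin sqr_ge0.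
  by move=> u /=; rewrite !in_itv/=; exact: (cell_sub (ltW h0)).
have /choice[v Hv] := Hc.
have vc k : cell_lo a h k <= v k <= cell_hi a h k by have [] := Hv k.
have vinj := cell_inj h0 vc.
have vJ k : a <= v k <= a + h by exact: cell_sub (ltW h0) (vc k).
have sep := cell_sep (ltW h0) vc.
have lagb k : `|(lag v k).[z]| <= M ^+ m.+1 by exact: (lag_bound vinj h0 vJ Hz (sep k)).
rewrite {1}(lag_interp vinj sq) horner_sum.
under eq_bigr do rewrite hornerZ mulrC.
apply: le_trans (_ : (m.+1%:R * (M ^+ m.+1) ^+ 2 * \sum_k (q.[v k]) ^+ 2)%:E <= _)%E.
  by rewrite lee_fin; exact: sum_sqr_le.
have -> : m.+1%:R * (M ^+ m.+1) ^+ 2 * m.+1%:R * M / h = (m.+1%:R * (M ^+ m.+1) ^+ 2) * (m.+1%:R * (M / h)).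
  by rewrite !mulrA.
set A := m.+1%:R * (M ^+ m.+1) ^+ 2.
have A0 : 0 <= A by rewrite mulr_ge0 ?sqr_ge0.
rewrite EFinM (EFinM A) -muleA; apply: lee_wpmul2l; first by rewrite lee_fin.
rewrite -sumEFin.
set I0 := integral _ _ _.
apply: (@le_trans _ _ (\sum_(k < m.+1) ((M / h)%:E * I0))%E).
  by apply: lee_sum => k _; have [] := Hv k.
have : (0 <= I0)%E by apply: integral_ge0 => v' _; rewrite lee_fin sqr_ge0.
case: I0 => [r| |]// _; last first.
  have c0 : (0 < (m.+1%:R * (M / h))%:E)%E by rewrite lte_fin mulr_gt0// divr_gt0.
  by rewrite (gt0_muley c0) leey.
rewrite -!EFinM sumEFin sumr_const card_ord lee_fin le_eqVlt; apply/orP; left; apply/eqP.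
by rewrite -[LHS]mulr_natl mulrA.
Qed.
End PolyAverage.

Lemma sqrD_le2 (R : realDomainType) (u w : R) : (u + w) ^+ 2 <= 2 * u ^+ 2 + 2 * w ^+ 2.
Proof.
rewrite -subr_ge0; have -> : 2 * u ^+ 2 + 2 * w ^+ 2 - (u + w) ^+ 2 = (u - w) ^+ 2 by ring.
exact: sqr_ge0.
Qed.

(** * Polynomial approximation and inverse inequality on a cube *)

Section BrambleHilbert.
Variables (R : realType) (d : nat) (mu : {measure set Rd R d -> \bar R}).
Hypothesis leb : is_lebesgue_Rd mu.
Hypothesis d0 : (0 < d)%N.
Let leb1 : {measure set (measurableTypeR R) -> \bar R} := @lebesgue_measure R.
Variable m : nat.
Let M : R := (2 * m.+1)%:R.
Let M0 : 0 < M. Proof. by rewrite /M ltr0n. Qed.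

(** Along each line in direction [i] the coefficients may depend arbitrarily on the other
    coordinates. This weak form is what interpolation in a single direction produces. *)
Definition cp1 (i : 'I_d) (P : 'rV[R]_d -> R) :=
  forall x, exists q : {poly R}, (size q <= m.+1)%N /\ forall v, P (upd i x v) = q.[v].
Definition cp (P : 'rV[R]_d -> R) := forall i, cp1 i P.
Definition energy i f (a : 'rV[R]_d) (h : R) : \bar R :=
  (\int[mu]_(x in cube a h) ((Dn i m.+1 f x) ^+ 2)%:E)%E.
Definition lagop (i : 'I_d) (v : 'I_m.+1 -> R) (P : 'rV[R]_d -> R) (x : 'rV[R]_d) : R :=
  \sum_k (lag v k).[x 0 i] * P (upd i x (v k)).

Lemma measurable_lagop i v (P : Rd R d -> R) : measurable_fun setT P ->
  measurable_fun setT (lagop i v P : Rd R d -> R).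
Proof.
move=> mP; apply: measurable_sum => k; apply: measurable_funM.
  have mq : measurable_fun setT (fun u : R => (lag v k).[u]).
    by apply: continuous_measurable_fun; exact: continuous_horner.
  exact: (measurableT_comp mq (measurable_coord i)).
exact: (measurableT_comp mP (measurable_upd1 i (v k))).
Qed.

Section cubes.
Variables (a : 'rV[R]_d) (h : R) (i : 'I_d).
Hypothesis h0 : 0 < h.
Let Q := cube a h.
Let mQ : measurable Q. Proof. exact: measurable_cube. Qed.

(** [lag_error] holds on every line in direction [i] with the energy of that line. Integration by
    [resample] contributes one more factor [h], which completes the exponent [2 * m.+1]. *)
Lemma lagop_error f (v : 'I_m.+1 -> R) : pdiff m.+1 f -> injective v ->
  (forall l, a 0 i <= v l <= a 0 i + h) ->
  (forall k l, l != k -> h / M <= `|v k - v l|) ->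
  (\int[mu]_(x in Q) ((f x - lagop i v f x) ^+ 2)%:E <=
   ((m.+1%:R * M ^+ m.+1) ^+ 2 * h ^+ (2 * m.+1))%:E * energy i f a h)%E.
Proof.
move=> pf vinj vJ sep.
have mf : measurable_fun setT (f : Rd R d -> R) by exact: (Dn_measurable i (ltn0Sn m) pf (leq0n _)).
have mD := meas_sq (Dn_measurable i (ltn0Sn m) pf (leqnn _)).
pose C := (m.+1%:R * M ^+ m.+1) ^+ 2 * h ^+ (2 * m).+1.
have C0 : 0 < C by rewrite mulr_gt0 ?exprn_gt0 ?mulr_gt0 ?exprn_gt0.
pose S x := (\int[leb1]_(u in `[(a 0 i)%R, (a 0 i + h)%R]) ((Dn i m.+1 f (upd i x u)) ^+ 2)%:E)%E.
have mS : measurable_fun setT (S : Rd R d -> \bar R).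
  exact: (resample_inner_line a h i mD (sq_ge0E (Dn i m.+1 f))).
have S0 x : (0 <= S x)%E by apply: integral_ge0 => u _; exact: sq_ge0E.
apply: le_trans (_ : \int[mu]_(x in Q) (C%:E * S x) <= _)%E.
  apply: le_int => //.
  - by apply: meas_sq; apply: measurable_funB => //; exact: measurable_lagop.
  - by apply: emeasurable_funM.
  - by move=> x _; exact: sq_ge0E.
  move=> x Qx; case E : (S x) (S0 x) => [r| |] // r0; last by rewrite gt0_muley ?lte_fin// leey.
  rewrite -EFinM lee_fin.
  have := @lag_error R (fun j u => Dn i j f (upd i x u)) m v (a 0 i) h r h0 _ _ _ _ vinj vJ sep (x 0 i) (Qx i).
  rewrite /= /Dn/= upd_id; apply => //.
  - by move=> j jm z; apply: Dn_slice pf _.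
  - exact: (Dn_line_measurable i x (ltn0Sn m) pf (leqnn _)).
  - by rewrite -E.
rewrite (int_scale mu mQ (ltW C0) mS S0).
rewrite /S (resample leb _ _ d0 h0 mD (sq_ge0E _)) muleA -EFinM.
by rewrite /C -mulrA -exprSr mulnS.
Qed.

(** A function bounded only in mean square need not be small on a given hyperplane. If every
    hyperplane through a cell, of width [h / M], carried more than [2 M A], the total would be at
    least [2 h A], whereas it is at most [h A]. *)
Lemma choose_nodes (E : Rd R d -> R) (A : R) : measurable_fun setT E -> 0 < A ->
  (\int[mu]_(x in Q) ((E x) ^+ 2)%:E <= A%:E)%E ->
  exists v : 'I_m.+1 -> R, (forall k, cell_lo (a 0 i) h k <= v k <= cell_hi (a 0 i) h k) /\
   forall k, (\int[mu]_(x in Q) ((E (upd i x (v k))) ^+ 2)%:E <= (2 * M * A)%:E)%E.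
Proof.
move=> mE A0 EA.
have mE2 := meas_sq mE.
pose H (v : measurableTypeR R) := (\int[mu]_(x in Q) ((E (upd i x v)) ^+ 2)%:E)%E.
have mH : measurable_fun setT H.
  exact: (resample_inner_cube leb _ _ _ d0 mE2 (sq_ge0E _)).
have H0 v : (0 <= H v)%E by apply: integral_ge0 => x _; exact: sq_ge0E.
have HJ : (\int[leb1]_(v in `[(a 0 i)%R, (a 0 i + h)%R]) H v <= (h * A)%:E)%E.
  rewrite /H (resample_swap leb _ _ _ d0 mE2 (sq_ge0E _)) (resample leb _ _ d0 h0 mE2 (sq_ge0E _)).
  by rewrite EFinM lee_wpmul2l// lee_fin ltW.
suff Hk : forall k : 'I_m.+1, exists v, cell_lo (a 0 i) h k <= v <= cell_hi (a 0 i) h k /\ (H v <= (2 * M * A)%:E)%E.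
  have /choice[v Hv] := Hk; exists v; split => k; by have [] := Hv k.
move=> k; apply: contrapT => no.
have w0 : 0 < h / M by rewrite divr_gt0.
have lohi : cell_lo (a 0 i) h k <= cell_hi (a 0 i) h k by rewrite -subr_ge0 cell_width ltW.
have : ((2 * M * A * (h / M))%:E <= (h * A)%:E)%E.
  apply: le_trans HJ.
  apply: le_trans (_ : \int[leb1]_(v in `[(cell_lo (a 0 i) h k)%R, (cell_hi (a 0 i) h k)%R]) (2 * M * A)%:E <= _)%E.
    by rewrite integral_cst// -/leb1 leb_itv// cell_width EFinM.
  apply: le_trans (_ : \int[leb1]_(v in `[(cell_lo (a 0 i) h k)%R, (cell_hi (a 0 i) h k)%R]) H v <= _)%E.
    apply: le_int => //; first by move=> v _; rewrite lee_fin !mulr_ge0// ltW.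
    move=> v /=; rewrite in_itv/= => Hv; rewrite leNgt; apply/negP => Hlt; apply: no.
    by exists v; split => //; exact: ltW.
  apply: int_sub => //.
  by move=> u /=; rewrite !in_itv/=; exact: (cell_sub (ltW h0)).
rewrite lee_fin.
have -> : 2 * M * A * (h / M) = 2 * (h * A) by field; rewrite gt_eqF.
have : 0 < h * A by rewrite mulr_gt0.
lra.
Qed.

Lemma lagop_L2 (E : Rd R d -> R) (v : 'I_m.+1 -> R) : measurable_fun setT E -> injective v ->
  (forall l, a 0 i <= v l <= a 0 i + h) ->
  (forall k l, l != k -> h / M <= `|v k - v l|) ->
  (\int[mu]_(x in Q) ((lagop i v E x) ^+ 2)%:E <=
   (m.+1%:R * (M ^+ m.+1) ^+ 2)%:E * \sum_k \int[mu]_(x in Q) ((E (upd i x (v k))) ^+ 2)%:E)%E.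
Proof.
move=> mE vinj vJ sep.
have mk k : measurable_fun setT (fun x : Rd R d => ((E (upd i x (v k))) ^+ 2)%:E).
  by apply: meas_sq; exact: (measurableT_comp mE (measurable_upd1 i (v k))).
have p0 k x : (0 <= ((E (upd i x (v k))) ^+ 2)%:E)%E by rewrite lee_fin sqr_ge0.
have c0 : 0 <= m.+1%:R * (M ^+ m.+1) ^+ 2 by rewrite mulr_ge0 ?sqr_ge0.
have ms : measurable_fun setT (fun x : Rd R d => \sum_k ((E (upd i x (v k))) ^+ 2)%:E)%E by exact: emeasurable_sum.
have s0 x : (0 <= \sum_k ((E (upd i x (v k))) ^+ 2)%:E)%E by apply: sume_ge0.
rewrite -(int_sum mu mQ (index_enum _) mk p0) -(int_scale mu mQ c0 ms s0).
apply: le_int => //.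
- by apply: meas_sq; exact: measurable_lagop.
- by apply: emeasurable_funM => //; exact: emeasurable_sum.
- by move=> x _; exact: sq_ge0E.
move=> x Qx; rewrite sumEFin -EFinM lee_fin; apply: sum_sqr_le => k.
exact: (lag_bound vinj h0 vJ (Qx i) (sep k)).
Qed.
End cubes.

Lemma cp1_lagop_same i v P : cp1 i (lagop i v P).
Proof.
move=> x; exists (\sum_k P (upd i x (v k)) *: lag v k); split.
  apply: leq_trans (size_sum _ _ _) _; apply/bigmax_leqP => k _.
  by apply: leq_trans (size_scale_leq _ _) _; exact: size_lag.
move=> u; rewrite /lagop horner_sum; apply: eq_bigr => k _.
by rewrite hornerZ updE upd_upd mulrC.
Qed.

Lemma cp1_lagop i j v P : j != i -> cp1 j P -> cp1 j (lagop i v P).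
Proof.
move=> ji cP x; have /choice[q Hq] := fun k : 'I_m.+1 => cP (upd i x (v k)).
exists (\sum_k (lag v k).[x 0 i] *: q k); split.
  apply: leq_trans (size_sum _ _ _) _; apply/bigmax_leqP => k _.
  by apply: leq_trans (size_scale_leq _ _) _; have [] := Hq k.
move=> u; rewrite /lagop horner_sum; apply: eq_bigr => k _.
rewrite hornerZ updNE 1?eq_sym//; congr (_ * _).
by rewrite updC 1?eq_sym//; have [_ ->] := Hq k.
Qed.

(** The recursion met when interpolating in one more direction: the fresh interpolation error of [f]
    plus the amplified earlier error, both doubled by [sqrD_le2]. *)
Fixpoint bh_const (n : nat) : R :=
  if n is n'.+1 then 2 * (m.+1%:R * M ^+ m.+1) ^+ 2 +
     2 * (m.+1%:R * (M ^+ m.+1) ^+ 2) * m.+1%:R * (2 * M) * bh_const n' else 1.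

Lemma bh_const_gt0 n : 0 < bh_const n.
Proof.
elim: n => //= n IH; rewrite addr_gt0// ?mulr_gt0// ?exprn_gt0// ?mulr_gt0// ?exprn_gt0//.
Qed.

(** One direction after the other, by splitting [f - lagop P] into [f - lagop f], which involves
    only the pure derivative in that direction, and [lagop (f - P)]. Polynomiality in the directions
    already treated survives by [cp1_lagop]. *)
Lemma bramble_hilbert f (a : 'rV[R]_d) (h B : R) : pdiff m.+1 f -> 0 < h -> 0 < B ->
  (forall i, energy i f a h <= B%:E)%E ->
  exists P, [/\ cp P, measurable_fun setT (P : Rd R d -> R) &
    (\int[mu]_(x in cube a h) ((f x - P x) ^+ 2)%:E <= (bh_const d * h ^+ (2 * m.+1) * B)%:E)%E].
Proof.
move=> pf h0 B0 HB.
have mf : measurable_fun setT (f : Rd R d -> R).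
  by have i := Ordinal d0; exact: (Dn_measurable i (ltn0Sn m) pf (leq0n _)).
suff H (s : seq 'I_d) : exists P, [/\ forall i, i \in s -> cp1 i P, measurable_fun setT (P : Rd R d -> R) &
    (\int[mu]_(x in cube a h) ((f x - P x) ^+ 2)%:E <= (bh_const (size s) * h ^+ (2 * m.+1) * B)%:E)%E].
  have [P [cP mP IP]] := H (enum 'I_d); exists P; split => //.
    by move=> i; apply: cP; rewrite mem_enum.
  by rewrite size_enum_ord in IP.
have hp : 0 < h ^+ (2 * m.+1) by rewrite exprn_gt0.
elim: s => [|i s [P [cP mP IP]]].
  exists f; split => //.
  under eq_integral do rewrite subrr expr0n/=.
  by rewrite integral0 lee_fin !mulr_ge0// ltW.
set A := bh_const (size s) * h ^+ (2 * m.+1) * B in IP.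
have A0 : 0 < A by rewrite !mulr_gt0// bh_const_gt0.
have mE : measurable_fun setT (fun x : Rd R d => f x - P x) by exact: measurable_funB.
(* The nodes are adapted to the current error [f - P], which must stay small on the hyperplanes
   where it will be sampled. *)
have [v [vc vI]] := choose_nodes i h0 mE A0 IP.
have vinj := cell_inj h0 vc.
have vJ k : a 0 i <= v k <= a 0 i + h by exact: cell_sub (ltW h0) (vc k).
have sep := cell_sep (ltW h0) vc.
exists (lagop i v P); split.
- move=> j; rewrite inE => /orP[/eqP->|js]; first exact: cp1_lagop_same.
  have [->|ji] := eqVneq j i; first exact: cp1_lagop_same.
  by apply: cp1_lagop => //; exact: cP.
- exact: measurable_lagop.
have e1 := lagop_error h0 pf vinj vJ sep.
have e2 := lagop_L2 h0 mE vinj vJ sep.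
pose C1 : R := (m.+1%:R * M ^+ m.+1) ^+ 2 * h ^+ (2 * m.+1).
pose C2 : R := m.+1%:R * (M ^+ m.+1) ^+ 2.
have C10 : 0 <= C1 by rewrite mulr_ge0 ?sqr_ge0// ltW.
have C20 : 0 <= C2 by rewrite mulr_ge0 ?sqr_ge0.
have m1 : measurable_fun setT (fun x : Rd R d => f x - lagop i v f x).
  by apply: measurable_funB => //; exact: measurable_lagop.
have m2 : measurable_fun setT (lagop i v (fun x => f x - P x) : Rd R d -> R) by exact: measurable_lagop.
apply: le_trans (_ : \int[mu]_(x in cube a h) (2%:E * ((f x - lagop i v f x) ^+ 2)%:E +
     2%:E * ((lagop i v (fun x => f x - P x) x) ^+ 2)%:E) <= _)%E.
  apply: le_int.
  - exact: measurable_cube.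
  - by apply: meas_sq; apply: measurable_funB => //; exact: measurable_lagop.
  - by apply: emeasurable_funD; apply: emeasurable_funM => //; exact: meas_sq.
  - by move=> x _; exact: sq_ge0E.
  move=> x _; rewrite -!EFinM -EFinD lee_fin.
  have -> : f x - lagop i v P x = (f x - lagop i v f x) + lagop i v (fun x => f x - P x) x.
    have -> : lagop i v (fun x => f x - P x) x = lagop i v f x - lagop i v P x.
      by rewrite /lagop -sumrB; apply: eq_bigr => k _; rewrite mulrBr.
    by rewrite addrA subrK.
  exact: sqrD_le2.
have p2 (g : Rd R d -> R) x : (0 <= 2%:E * ((g x) ^+ 2)%:E)%E by rewrite -EFinM lee_fin mulr_ge0 ?sqr_ge0.
have mQ := measurable_cube a h.
have mm (g : Rd R d -> R) : measurable_fun setT g -> measurable_fun setT (fun x => 2%:E * ((g x) ^+ 2)%:E)%E.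
  by move=> mg; apply: emeasurable_funM => //; exact: meas_sq.
have two0 : 0 <= 2 :> R by [].
rewrite (int_add mu mQ (mm _ m1) (mm _ m2) (p2 _) (p2 _)).
rewrite (int_scale mu mQ two0 (meas_sq m1) (sq_ge0E _)) (int_scale mu mQ two0 (meas_sq m2) (sq_ge0E _)).
apply: le_trans (_ : 2%:E * (C1%:E * B%:E) + 2%:E * (C2%:E * (m.+1%:R * (2 * M * A))%:E) <= _)%E.
  apply: leeD; apply: lee_wpmul2l => //.
    by apply: le_trans e1 _; apply: lee_wpmul2l.
  apply: le_trans e2 _; apply: lee_wpmul2l => //.
  apply: le_trans (_ : \sum_(k < m.+1) (2 * M * A)%:E <= _)%E; first by apply: lee_sum => k _; exact: vI.
  by rewrite sumEFin sumr_const card_ord lee_fin -[X in X <= _]mulr_natl.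
rewrite -!EFinM -EFinD lee_fin le_eqVlt; apply/orP; left; apply/eqP.
rewrite /C1 /C2 /A /=; ring.
Qed.

Let c0 : R := m.+1%:R * (M ^+ m.+1) ^+ 2 * m.+1%:R * M.
Definition inv_const : R := c0 ^+ d.
Lemma inv_const_gt0 : 0 < inv_const.
Proof. by rewrite exprn_gt0// !mulr_gt0// exprn_gt0// exprn_gt0. Qed.

(** The coordinates of the integration variable are frozen at those of [z] one by one; each freezing
    is [poly_average] on lines followed by [resample] and costs a factor [c0]. *)
Lemma inverse_inequality P (a z : 'rV[R]_d) (h : R) : cp P -> measurable_fun setT (P : Rd R d -> R) ->
  0 < h -> cube a h z ->
  (((P z) ^+ 2)%:E * (h ^+ d)%:E <= inv_const%:E * \int[mu]_(x in cube a h) ((P x) ^+ 2)%:E)%E.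
Proof.
move=> cP mP h0 Qz.
have c00 : 0 < c0 by rewrite !mulr_gt0// exprn_gt0// exprn_gt0.
have mk k : measurable_fun setT (fun x : Rd R d => P (mix z k x)) by exact: (measurableT_comp mP (measurable_mix z k)).
have H k : (k <= d)%N -> (\int[mu]_(x in cube a h) ((P (mix z k x)) ^+ 2)%:E <=
    (c0 ^+ k)%:E * \int[mu]_(x in cube a h) ((P x) ^+ 2)%:E)%E.
  elim: k => [|k IH] kd.
    rewrite expr0 mul1e le_eqVlt; apply/orP; left; apply/eqP.
    by apply: eq_integral => x _; rewrite mix0.
  pose i := Ordinal kd.
  pose G (x : Rd R d) := ((P (mix z k x)) ^+ 2)%:E.
  have mG : measurable_fun setT G by exact: meas_sq.
  have G0 x : (0 <= G x)%E by exact: sq_ge0E.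
  apply: le_trans (_ : \int[mu]_(x in cube a h) ((c0 / h)%:E * \int[leb1]_(v in `[(a 0 i)%R, (a 0 i + h)%R]) G (upd i x v)) <= _)%E.
    apply: le_int.
    - exact: measurable_cube.
    - exact: meas_sq.
    - by apply: emeasurable_funM => //; exact: (resample_inner_line _ _ _ mG G0).
    - by move=> x _; exact: sq_ge0E.
    move=> x Qx; rewrite (_ : k.+1 = i.+1)// mixS.
    have [q [sq Hq]] := cP i (mix z i x).
    rewrite Hq; apply: le_trans (poly_average sq h0 (Qz i)) _.
    apply: lee_wpmul2l; first by rewrite lee_fin divr_ge0// ltW.
    rewrite le_eqVlt; apply/orP; left; apply/eqP; apply: eq_integral => v _.
    by rewrite /G (mix_upd z i) Hq.
  have ch0 : 0 <= c0 / h by rewrite divr_ge0// ltW.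
  rewrite (int_scale mu (measurable_cube a h) ch0 (resample_inner_line _ _ _ mG G0)); last first.
    by move=> x; apply: integral_ge0.
  rewrite (resample leb _ _ d0 h0 mG G0) muleA -EFinM divfK ?gt_eqF//.
  rewrite (exprS c0 k) (EFinM c0) -muleA; apply: lee_wpmul2l; first by rewrite lee_fin ltW.
  by apply: IH; exact: ltnW.
have := H d (leqnn _); apply: le_trans.
under eq_integral do rewrite mixd.
rewrite integral_cst; last exact: measurable_cube.
by rewrite (cube_measure leb)// ltW.
Qed.
End BrambleHilbert.

Lemma le_meas d1 (T : measurableType d1) (R : realType) (m : {measure set T -> \bar R}) (A B : set T) :
  measurable A -> measurable B -> A `<=` B -> (m A <= m B)%E.
Proof. by move=> mA mB AB; apply: le_measure; rewrite ?inE. Qed.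

Lemma measure_cover d1 (T : measurableType d1) (R : realType) (m : {measure set T -> \bar R})
    (J : finType) (S : set T) (A : J -> set T) : measurable S -> (forall j, measurable (A j)) ->
  S `<=` \bigcup_j A j -> (m S <= \sum_j m (A j))%E.
Proof.
move=> mS mA SA.
suff H (s : seq J) : measurable (\big[setU/set0]_(j <- s) A j) /\
    (m (\big[setU/set0]_(j <- s) A j) <= \sum_(j <- s) m (A j))%E.
  have [mU Ule] := H (index_enum J).
  apply: le_trans Ule; apply: le_meas => //.
  by move=> x /SA[j _ Aj]; rewrite (bigD1 j)//=; left.
elim: s => [|j s [IH1 IH2]]; first by rewrite !big_nil measure0.
rewrite !big_cons; split; first exact: measurableU.
apply: (@le_trans _ _ (m (A j) + m (\big[setU/set0]_(j <- s) A j))%E); first exact: measureU2.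
by rewrite leeD2l.
Qed.

Lemma int_sqrD_le d1 (T : measurableType d1) (R : realType) (mu : {measure set T -> \bar R})
    (D : set T) (f g : T -> R) : measurable D -> measurable_fun setT f -> measurable_fun setT g ->
  (\int[mu]_(x in D) ((f x + g x) ^+ 2)%:E <=
   2%:E * \int[mu]_(x in D) ((f x) ^+ 2)%:E + 2%:E * \int[mu]_(x in D) ((g x) ^+ 2)%:E)%E.
Proof.
move=> mD mf mg.
have two0 : 0 <= 2 :> R by [].
have mm (k : T -> R) : measurable_fun setT k -> measurable_fun setT (fun x => 2%:E * ((k x) ^+ 2)%:E)%E.
  by move=> mk; apply: emeasurable_funM => //; exact: meas_sq.
have p2 (k : T -> R) x : (0 <= 2%:E * ((k x) ^+ 2)%:E)%E by rewrite -EFinM lee_fin mulr_ge0 ?sqr_ge0.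
rewrite -(int_scale mu mD two0 (meas_sq mf) (sq_ge0E _)) -(int_scale mu mD two0 (meas_sq mg) (sq_ge0E _)).
rewrite -(int_add mu mD (mm _ mf) (mm _ mg) (p2 _) (p2 _)).
apply: le_int => //.
- by apply: meas_sq; exact: measurable_funD.
- by apply: emeasurable_funD; exact: mm.
- by move=> y _; exact: sq_ge0E.
by move=> y _; rewrite -!EFinM -EFinD lee_fin; exact: sqrD_le2.
Qed.

(** * From almost every point to every point *)

Section SeparatelyContinuous.
Variables (R : realType) (d : nat) (mu : {measure set Rd R d -> \bar R}).
Hypothesis leb : is_lebesgue_Rd mu.
Hypothesis d0 : (0 < d)%N.
Let leb1 : {measure set (measurableTypeR R) -> \bar R} := @lebesgue_measure R.

(** [N k] collects the points that violate the bound after their first [k] coordinates are replaced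
    by those of [z]. A violation at stage [k.+1] persists, by continuity in one coordinate, on an
    interval at stage [k], so nullity passes from [N k] to [N k.+1] by integration along lines. If
    [z] violated the bound, [N d] would be the whole cube. *)
Lemma ae_le_everywhere (g : 'rV[R]_d -> R) (a z : 'rV[R]_d) (h T : R) : 0 < h ->
  measurable_fun setT (g : Rd R d -> R) ->
  (forall i x, continuous (fun u => g (upd i x u))) ->
  mu [set x | cube a h x /\ T < g x] = 0%E -> cube a h z -> g z <= T.
Proof.
move=> h0 mg cg N0 Qz; rewrite leNgt; apply/negP => Tg.
pose N k : set (Rd R d) := [set x | cube a h x /\ T < g (mix z k x)].
have mN k : measurable (N k).
  apply: measurableI; first exact: measurable_cube.
  have mgk : measurable_fun setT (fun x : Rd R d => g (mix z k x)) by exact: (measurableT_comp mg (measurable_mix z k)).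
  rewrite (_ : (fun x => _) = (fun x : Rd R d => g (mix z k x)) @^-1` `]T, +oo[%classic).
    by rewrite -[X in measurable X]setTI; exact: mgk.
  by apply/seteqP; split => x /=; rewrite in_itv/= andbT.
suff H k : (k <= d)%N -> mu (N k) = 0%E.
  have := H d (leqnn _).
  rewrite (_ : N d = cube a h).
    rewrite (cube_measure leb)// ?ltW// => /eqP; rewrite eqe => /eqP h'.
    by have := exprn_gt0 d h0; rewrite h' ltxx.
  by apply/seteqP; split => x /=; [case|rewrite /N/= mixd].
elim: k => [|k IH] kd.
  rewrite -N0; congr (mu _); apply/seteqP; by split => x; rewrite /N/= mix0.
have {}IH := IH (ltnW kd).
pose i := Ordinal kd.
pose G (x : Rd R d) : \bar R := (\1_(N k) x)%:E.
have mG : measurable_fun setT G by apply/measurable_EFinP; exact: measurable_indic.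
have G0 x : (0 <= G x)%E by rewrite lee_fin.
pose F (x : Rd R d) := (\int[leb1]_(v in `[(a 0 i)%R, (a 0 i + h)%R]) G (upd i x v))%E.
have mF : measurable_fun setT F by exact: (resample_inner_line a h i mG G0).
have F0 x : (0 <= F x)%E by apply: integral_ge0.
have IF0 : (\int[mu]_(x in cube a h) F x = 0)%E.
  rewrite /F (resample leb _ i d0 h0 mG G0).
  have -> : (\int[mu]_(x in cube a h) G x = 0)%E; last by rewrite mule0.
  rewrite /G integral_indic//; last exact: measurable_cube.
  apply/eqP; rewrite eq_le measure_ge0 andbT -IH.
  apply: (le_meas mu _ (mN k) (@subIsetl _ _ _)).
  by apply: measurableI => //; exact: measurable_cube.
have mQ := measurable_cube a h.
have : ae_eq mu (cube a h) F (cst 0%E).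
  apply/ae_eq_integral_abs => //; first exact: measurable_funTS.
  by under eq_integral do rewrite gee0_abs//.
move=> [A [mA A0 sA]].
apply/eqP; rewrite eq_le measure_ge0 andbT -A0.
apply: le_meas => // x [Qx Tx].
apply: sA => /= /(_ Qx) Fx0.
have := cg i (mix z i x) (z 0 i).
move=> /cvgrPdist_lt /(_ (g (mix z k.+1 x) - T)); rewrite subr_gt0 => /(_ Tx).
move=> [/= e e0 He].
(* The part inside the cube of the interval of radius [e / 2] around [z 0 i], where continuity keeps
   the violation alive. *)
pose lo := Num.max (a 0 i) (z 0 i - e / 2).
pose hi := Num.min (a 0 i + h) (z 0 i + e / 2).
have /andP[z1 z2] := Qz i.
have e2 : 0 < e / 2 by rewrite divr_gt0.
have lohi : lo < hi.
  rewrite /lo /hi gt_max !lt_min; apply/andP; split; apply/andP; split; lra.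
have : ((hi - lo)%:E <= F x)%E.
  rewrite -(leb_itv (ltW lohi)).
  rewrite -[X in (X <= _)%E]mul1e -integral_cst//.
  apply: le_trans (_ : \int[leb1]_(v in `[lo, hi]) G (upd i x v) <= _)%E.
    apply: ge0_le_integral => //.
    - by apply: measurable_funTS; exact: (measurableT_comp mG (measurable_upd_line i x)).
    move=> v /=; rewrite in_itv/= => /andP[v1 v2].
    have va : a 0 i <= v by apply: le_trans v1; rewrite /lo le_max lexx.
    have vz1 : z 0 i - e / 2 <= v by apply: le_trans v1; rewrite /lo le_max lexx orbT.
    have vb : v <= a 0 i + h by apply: le_trans v2 _; rewrite /hi ge_min lexx.
    have vz2 : v <= z 0 i + e / 2 by apply: le_trans v2 _; rewrite /hi ge_min lexx orbT.
    rewrite /G lee_fin indicE mem_set// /N/=; split.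
      by apply: cube_upd => //; rewrite va vb.
    rewrite (mix_upd z i).
    have : ball (z 0 i) e v by rewrite /ball/= ltr_norml; apply/andP; split; lra.
    move=> /He/=; rewrite -mixS => /(le_lt_trans (ler_norm _)); lra.
  apply: int_sub => //.
    exact: (measurableT_comp mG (measurable_upd_line i x)).
  by move=> v /=; rewrite !in_itv/= /lo /hi ge_max le_min => /andP[/andP[-> _] /andP[-> _]].
by rewrite Fx0 lee_fin subr_le0 leNgt lohi.
Qed.
End SeparatelyContinuous.

(** * Uniform approximation by local polynomials *)

Section SupBound.
Variables (R : realType) (d : nat) (mu : {measure set Rd R d -> \bar R}).
Hypothesis leb : is_lebesgue_Rd mu.
Hypothesis d0 : (0 < d)%N.
Variable m : nat.
Hypothesis md : (d + 2 <= 2 * m.+1)%N.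
Let bh : R := bh_const R m d.
Let iv : R := inv_const R d m.
Let r := (2 * m.+1 - d)%N.
Let bh0 : 0 < bh. Proof. exact: bh_const_gt0. Qed.
Let iv0 : 0 < iv. Proof. exact: inv_const_gt0. Qed.

Definition half_corner (a : 'rV[R]_d) (h : R) (e : {ffun 'I_d -> bool}) : 'rV[R]_d :=
  \row_i (a 0 i + (if e i then h / 2 else 0)).

Lemma half_cube_sub a h e : 0 < h -> cube (half_corner a h e) (h / 2) `<=` cube a h.
Proof.
move=> h0 x Hx i; move: (Hx i); rewrite !mxE => /andP[]; have h2 : 0 < h / 2 by rewrite divr_gt0.
by case: (e i); move: (x 0 i) (a 0 i) => u v; rewrite ?addr0 => *; apply/andP; split; lra.
Qed.

Lemma half_cube_cover a h : cube a h `<=` \bigcup_(e : {ffun 'I_d -> bool}) cube (half_corner a h e) (h / 2).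
Proof.
move=> x Hx; exists [ffun i => a 0 i + h / 2 < x 0 i] => // i; move: (Hx i); rewrite !mxE ffunE.
case: ifP => [H /andP[_ H2]|/negbT]; rewrite -?leNgt; last by move=> H /andP[H1 _]; rewrite addr0 H1 H.
by rewrite (ltW H)/=; move: H2; move: (x 0 i) (a 0 i) => *; lra.
Qed.

Variables (f : 'rV[R]_d -> R) (B : R).
Hypotheses (pf : pdiff m.+1 f) (B0 : 0 < B).
Let mf : measurable_fun setT (f : Rd R d -> R).
Proof. exact: (Dn_measurable (Ordinal d0) (ltn0Sn m) pf (leq0n _)). Qed.

(** [u h] is the natural size of [f - P] on a cube of side [h]. [C1 * u h] bounds the difference of
    the polynomials of a cube and of one of its halves: [iv] comes from the inverse inequality,
    [2 ^+ d] from the smaller volume, and [4 * bh] from the two mean square errors. *)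
Let u (h : R) := Num.sqrt (B * h ^+ r).
Let C1 := Num.sqrt (iv * 2 ^+ d * 4 * bh).

Let u0 h : 0 < h -> 0 < u h. Proof. by move=> h0; rewrite sqrtr_gt0 mulr_gt0// exprn_gt0. Qed.
Let u2 h : 0 < h -> u h ^+ 2 = B * h ^+ r.
Proof. by move=> h0; rewrite sqr_sqrtr// mulr_ge0 ?(ltW B0)// exprn_ge0// ltW. Qed.
Let C10 : 0 <= C1. Proof. exact: sqrtr_ge0. Qed.
Let C12 : C1 ^+ 2 = iv * 2 ^+ d * 4 * bh.
Proof. by rewrite sqr_sqrtr// !mulr_ge0// ?(ltW iv0) ?(ltW bh0). Qed.
Let hr h : h ^+ (2 * m.+1) = h ^+ r * h ^+ d :> R.
Proof. by rewrite -exprD /r subnK//; move: md; lia. Qed.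

(** Uses [r >= 2], that is, the full strength of [md]: halving a cube at least halves the local
    scale. *)
Let u_half h : 0 < h -> 2 * u (h / 2) <= u h.
Proof.
move=> h0; have h2 : 0 < h / 2 by rewrite divr_gt0.
rewrite -(@ler_pXn2r _ 2)// ?nnegrE ?mulr_ge0 ?(ltW (u0 _))//.
rewrite exprMn !u2// exprMn.
have r2 : r = (r - 2).+2 by rewrite /r; move: md; lia.
have -> : (2 : R)^-1 ^+ r = 2^-1 * (2^-1 * 2^-1 ^+ (r - 2)) by rewrite -!exprS -r2.
have : (2 : R)^-1 ^+ (r - 2) <= 1 by rewrite exprn_ile1 ?invr_ge0// invf_le1 ?ler1n.
have : 0 < B * h ^+ r by rewrite mulr_gt0// exprn_gt0.
have -> : 2 ^+ 2 * (B * (h ^+ r * (2^-1 * (2^-1 * 2^-1 ^+ (r - 2))))) = B * h ^+ r * (2 : R)^-1 ^+ (r - 2).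
  by field.
by move=> p0 le1; rewrite ger_pMr.
Qed.

Let bad a h (T : R) (P : 'rV[R]_d -> R) : set (Rd R d) := [set x | cube a h x /\ T < `|f x - P x|].
Let mbad a h T P : measurable_fun setT (P : Rd R d -> R) -> measurable (bad a h T P).
Proof.
move=> mP; apply: measurableI; first exact: measurable_cube.
have mg : measurable_fun setT (fun x : Rd R d => `|f x - P x|).
  by apply: measurableT_comp => //; exact: measurable_funB.
rewrite (_ : (fun x => _) = (fun x : Rd R d => `|f x - P x|) @^-1` `]T, +oo[%classic).
  by rewrite -[X in measurable X]setTI; exact: mg.
by apply/seteqP; split => x /=; rewrite in_itv/= andbT.
Qed.

Let good a h P := [/\ cp m P, measurable_fun setT (P : Rd R d -> R) &
  (\int[mu]_(x in cube a h) ((f x - P x) ^+ 2)%:E <= (bh * h ^+ (2 * m.+1) * B)%:E)%E].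

(** On a half cube the polynomial [P] is replaced by the one adapted to that half, at the price
    [C1 * u h]. As [u (h / 2) <= u h / 2], the remaining excess [(C1 + s) u h] is at least
    [(2 C1 + 2 s) u (h / 2)]: the same form with [s] doubled. Each subdivision thus divides the
    measure bound by four, starting from Chebyshev's inequality. *)
Lemma bad_decay k : forall a h s P, 0 < h -> 0 < s -> (forall i, energy mu m i f a h <= B%:E)%E ->
  good a h P -> (mu (bad a h ((2 * C1 + s) * u h) P) <= (bh * h ^+ d / (s ^+ 2 * 4 ^+ k))%:E)%E.
Proof.
elim: k => [|k IH] a h s P h0 s0 HB [cP mP IP].
  have mQ := measurable_cube a h.
  set S := bad _ _ _ _; have mS : measurable S by exact: mbad.
  have mE : measurable_fun setT (fun x : Rd R d => f x - P x) by exact: measurable_funB.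
  have k0 : 0 < s ^+ 2 * u h ^+ 2 by rewrite mulr_gt0 ?exprn_gt0// u0.
  have H : ((s ^+ 2 * u h ^+ 2)%:E * mu S <= (bh * h ^+ (2 * m.+1) * B)%:E)%E.
    apply: le_trans IP; rewrite -integral_cst//.
    apply: (@le_trans _ _ (\int[mu]_(x in S) ((f x - P x) ^+ 2)%:E)%E).
      apply: le_int => //.
      - exact: meas_sq.
      - by move=> x _; rewrite lee_fin ltW.
      move=> x [_ Tx]; rewrite lee_fin -exprMn -[X in _ <= X]real_normK ?num_real//.
      rewrite lerXn2r ?nnegrE ?mulr_ge0 ?(ltW s0) ?(ltW (u0 h0))//.
      apply: le_trans (ltW Tx); rewrite ler_wpM2r ?(ltW (u0 h0))// lerDr mulr_ge0//.
    by apply: (int_sub mu mQ mS (meas_sq mE) (sq_ge0E _)) => x [].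
  have -> : bh * h ^+ d / (s ^+ 2 * 4 ^+ 0) = (s ^+ 2 * u h ^+ 2)^-1 * (bh * h ^+ (2 * m.+1) * B).
    rewrite expr0 mulr1 u2// hr; field.
    by rewrite !gt_eqF// exprn_gt0.
  by rewrite EFinM lee_pdivlMl.
have h2 : 0 < h / 2 by rewrite divr_gt0.
set S := bad _ _ _ _; have mS : measurable S by exact: mbad.
pose Q e := cube (half_corner a h e) (h / 2).
have mQ e : measurable (Q e) by exact: measurable_cube.
apply: (@le_trans _ _ (\sum_(e : {ffun 'I_d -> bool}) mu (S `&` Q e))%E).
  apply: measure_cover => //; first by move=> e; exact: measurableI.
  by move=> x Sx; have [e _ Qx] := half_cube_cover (proj1 Sx); exists e.
have He e : (mu (S `&` Q e) <= (bh * (h / 2) ^+ d / ((2 * s) ^+ 2 * 4 ^+ k))%:E)%E.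
  have HBe i : (energy mu m i f (half_corner a h e) (h / 2) <= B%:E)%E.
    apply: le_trans (HB i); apply: (int_sub mu (measurable_cube a h) (mQ e)).
    - exact: meas_sq (Dn_measurable i (ltn0Sn m) pf (leqnn _)).
    - exact: sq_ge0E.
    - exact: half_cube_sub.
  have [Pe [cPe mPe IPe]] := bramble_hilbert leb d0 pf h2 B0 HBe.
  have s20 : 0 < 2 * s by rewrite mulr_gt0.
  apply: le_trans (IH (half_corner a h e) (h / 2) (2 * s) Pe h2 s20 HBe _); last by split.
  apply: le_meas; [exact: measurableI|exact: mbad|].
  move=> x [[Qx Tx] Qex]; split => //.
  have cD : cp m (P - Pe).
    move=> i y; have [q [sq Hq]] := cP i y; have [q' [sq' Hq']] := cPe i y.
    exists (q - q'); split; first by rewrite (leq_trans (size_polyD _ _))// size_polyN geq_max sq.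
    by move=> v; rewrite hornerD hornerN -Hq -Hq'.
  have mD : measurable_fun setT (P - Pe : Rd R d -> R) by exact: measurable_funB.
  have ID : (\int[mu]_(x in Q e) (((P - Pe) x) ^+ 2)%:E <= (4 * bh * h ^+ (2 * m.+1) * B)%:E)%E.
    have m1 : measurable_fun setT (fun y : Rd R d => P y - f y) by exact: measurable_funB.
    have m2 : measurable_fun setT (fun y : Rd R d => f y - Pe y) by exact: measurable_funB.
    have -> : (\int[mu]_(y in Q e) (((P - Pe) y) ^+ 2)%:E =
      \int[mu]_(y in Q e) (((P y - f y) + (f y - Pe y)) ^+ 2)%:E)%E.
      by apply: eq_integral => y _; rewrite !fctE addrA subrK.
    apply: le_trans (int_sqrD_le mu (mQ e) m1 m2) _.
    apply: (@le_trans _ _ (2%:E * (bh * h ^+ (2 * m.+1) * B)%:E + 2%:E * (bh * h ^+ (2 * m.+1) * B)%:E)%E).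
      apply: leeD; apply: lee_wpmul2l => //.
        apply: le_trans IP; under [leRHS]eq_integral do rewrite -sqrrN opprB.
        apply: (int_sub mu (measurable_cube a h) (mQ e) (meas_sq m1) (sq_ge0E _)).
        exact: half_cube_sub.
      apply: le_trans IPe _; rewrite lee_fin ler_wpM2r ?(ltW B0)// ler_wpM2l ?(ltW bh0)//.
      by rewrite lerXn2r ?nnegrE ?(ltW h0) ?(ltW h2)// ler_pdivrMr// ler_peMr// ?(ltW h0)// ler1n.
    by rewrite -!EFinM -EFinD lee_fin le_eqVlt; apply/orP; left; apply/eqP; ring.
  have := inverse_inequality leb d0 cD mD h2 Qex.
  move=> /le_trans /(_ (lee_wpmul2l _ ID)); rewrite lee_fin => /(_ (ltW iv0)).
  rewrite -!EFinM lee_fin -ler_pdivlMr ?exprn_gt0// => HD.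
  have {}HD : `|P x - Pe x| <= C1 * u h.
    rewrite -(@ler_pXn2r _ 2)// ?nnegrE ?mulr_ge0 ?(ltW (u0 h0))// real_normK ?num_real//.
    apply: le_trans HD _; rewrite [X in _ <= X]exprMn C12 u2// hr expr_div_n -/iv le_eqVlt; apply/orP; left; apply/eqP.
    by field; rewrite !gt_eqF ?exprn_gt0.
  have t1 : `|f x - P x| <= `|f x - Pe x| + `|P x - Pe x|.
    have -> : f x - P x = (f x - Pe x) - (P x - Pe x) by ring.
    exact: ler_normB.
  have hu := u_half h0.
  have : (2 * C1 + 2 * s) * u (h / 2) <= (C1 + s) * u h.
    have -> : (2 * C1 + 2 * s) * u (h / 2) = (C1 + s) * (2 * u (h / 2)) by ring.
    by rewrite ler_wpM2l// addr_ge0// ltW.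
  move: Tx t1 HD; rewrite !mulrDl.
  by move: (u h) (u (h / 2)) (`|f x - P x|) (`|f x - Pe x|) (`|P x - Pe x|) => *; lra.
apply: le_trans (lee_sum _ (fun e _ => He e)) _.
rewrite sumEFin sumr_const card_ffun card_bool card_ord -[X in (X%:E <= _)%E]mulr_natl lee_fin.
have -> : (2 * s) ^+ 2 = 4 * s ^+ 2 by ring.
rewrite natrX expr_div_n (exprS 4) le_eqVlt; apply/orP; left; apply/eqP.
by field; rewrite !gt_eqF ?exprn_gt0.
Qed.

Definition sup_const : R := (2 * C1 + 1) ^+ 2.

(** By [bad_decay] with [s = 1] and all [k] the bad set is null, and separate continuity of [f - P]
    excludes it altogether. This plays the role of the Sobolev embedding. *)
Lemma sup_bound a h : 0 < h -> (forall i, energy mu m i f a h <= B%:E)%E ->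
  exists P, [/\ cp m P, measurable_fun setT (P : Rd R d -> R),
    (\int[mu]_(x in cube a h) ((f x - P x) ^+ 2)%:E <= (bh * h ^+ (2 * m.+1) * B)%:E)%E &
    forall x, cube a h x -> (f x - P x) ^+ 2 <= sup_const * (B * h ^+ r)].
Proof.
move=> h0 HB; have [P [cP mP IP]] := bramble_hilbert leb d0 pf h0 B0 HB.
exists P; split => // z Qz.
suff H : `|f z - P z| <= (2 * C1 + 1) * u h.
  rewrite -(u2 h0) -exprMn -[X in X <= _]real_normK ?num_real//.
  by rewrite lerXn2r ?nnegrE// mulr_ge0 ?(ltW (u0 h0))// addr_ge0// mulr_ge0.
apply: (@ae_le_everywhere R d mu leb d0 (fun x => `|f x - P x|) a z h _ h0 _ _ _ Qz).
- by apply: measurableT_comp => //; exact: measurable_funB.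
- move=> i x v.
  have cf : {for v, continuous (fun w => f (upd i x w))} by exact: (slice_continuous (ltn0Sn m) pf).
  have cP' : {for v, continuous (fun w => P (upd i x w))}.
    have [q [_ Hq]] := cP i x.
    rewrite (_ : (fun _ => _) = horner q); first exact: continuous_horner.
    by apply/funext => w; rewrite Hq.
  exact: (cvg_norm (cvgB cf cP')).
apply/eqP; rewrite eq_le measure_ge0 andbT.
have H k : (mu (bad a h ((2 * C1 + 1) * u h) P) <= (bh * h ^+ d / 4 ^+ k)%:E)%E.
  by have := @bad_decay k a h 1 P h0 ltr01 HB (And3 cP mP IP); rewrite expr1n mul1r.
rewrite -/(bad _ _ _ _); move: (mu _) H => -[t| |] H; [|by have := H 0%N|by rewrite leNye].
rewrite lee_fin leNgt; apply/negP => t0.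
have c0 : 0 < bh * h ^+ d by rewrite mulr_gt0// exprn_gt0.
have := H (Num.truncn (bh * h ^+ d / t)).+1; rewrite lee_fin ler_pdivlMr ?exprn_gt0//.
apply/negP; rewrite -ltNge -ltr_pdivrMl// mulrC.
apply: lt_le_trans (truncnS_gt _) _; rewrite -natrX ler_nat.
by apply: ltnW; exact: ltn_expl.
Qed.
End SupBound.

(** * Coordinatewise polynomials form a finite dimensional space *)

Section CoordinatePolynomials.
Variables (R : realType) (d m : nat).

Definition box_bounded (g : 'rV[R]_d -> R) := forall (a : 'rV[R]_d) (h : R),
  exists C, forall x, cube a h x -> `|g x| <= C.

Lemma box_bounded_sum (T : finType) (g : T -> 'rV[R]_d -> R) (c : T -> R) :
  (forall t, box_bounded (g t)) -> box_bounded (fun x => \sum_t c t * g t x).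
Proof.
move=> bg a h; have /choice[C HC] := fun t => bg t a h.
exists (\sum_t `|c t| * C t) => x Qx; apply: le_trans (ler_norm_sum _ _ _) _.
by apply: ler_sum => t _; rewrite normrM ler_wpM2l//; exact: HC.
Qed.

(** Interpolation at the nodes [0, ..., m] in each coordinate in turn gives products of Lagrange
    polynomials. The family [phi] is fixed before [P], as a linear space valid for all functions at
    once is required. *)
Lemma cp_basis k : (k <= d)%N -> exists (T : finType) (phi : T -> 'rV[R]_d -> R),
  [/\ #|T| = (m.+1 ^ k)%N, forall t, box_bounded (phi t) &
   forall P, cp m P -> forall y, exists c : T -> R, forall x, P (mix x k y) = \sum_t c t * phi t x].
Proof.
elim: k => [|k IH] kd.
  exists unit, (fun _ _ => 1); split; first by rewrite card_unit expn0.
    by move=> _ a h; exists 1 => x _; rewrite normr1.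
  move=> P cP y; exists (fun=> P y) => x.
  by rewrite (big_pred1 tt) ?mix0 ?mulr1// => -[].
have [T [phi [cT bphi HP]]] := IH (ltnW kd).
pose i := Ordinal kd.
pose v (l : 'I_m.+1) : R := l%:R.
have vinj : injective v by move=> k1 k2 /eqP; rewrite eqr_nat => /eqP /val_inj.
exists ('I_m.+1 * T)%type, (fun (t : 'I_m.+1 * T) (x : 'rV[R]_d) => (lag v t.1).[x 0 i] * phi t.2 x); split.
- by rewrite card_prod card_ord cT expnS.
- move=> [l t] a h; have [C HC] := bphi t a h.
  have [L [L0 HL]] := poly_bounded (lag v l) (`|a 0 i| + `|h|).
  exists (L * `|C|) => x Qx /=; rewrite normrM; apply: ler_pM => //.
    apply: HL; have /andP[x1 x2] := Qx i.
    rewrite ler_norml; apply/andP; split.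
      have := ler_norm (- a 0 i); rewrite normrN; have := normr_ge0 h; move: x1; move: (x 0 i) (a 0 i) (`|a 0 i|) (`|h|) => *; lra.
    have := ler_norm (a 0 i); have := ler_norm h; move: x2; move: (x 0 i) (a 0 i) (`|a 0 i|) (`|h|) => *; lra.
  exact: le_trans (HC x Qx) (ler_norm _).
move=> P cP y.
have /choice[c Hc] := fun l : 'I_m.+1 => HP P cP (upd i y (v l)).
exists (fun t => c t.1 t.2) => x.
rewrite (_ : k.+1 = i.+1)// mixS.
have [q [sq Hq]] := cP i (mix x i y).
rewrite Hq (lag_interp vinj sq) horner_sum.
rewrite -(pair_big xpredT xpredT (fun l t => c l t * ((lag v l).[x 0 i] * phi t x)))/=.
apply: eq_bigr => l _; rewrite hornerZ -Hq -mix_upd Hc mulr_suml.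
by apply: eq_bigr => t _; ring.
Qed.

Lemma cp_box_bounded P : cp m P -> box_bounded P.
Proof.
have [T [phi [_ bphi HP]]] := cp_basis (leqnn d).
move=> cP; have [c Hc] := HP P cP 0.
have -> : P = fun x => \sum_t c t * phi t x by apply/funext => x; rewrite -Hc mixd.
exact: box_bounded_sum.
Qed.
End CoordinatePolynomials.

(** * Oscillation of a function on a cube *)

Section Oscillation.
Variables (R : realType) (d : nat) (mu : {measure set Rd R d -> \bar R}).
Hypothesis leb : is_lebesgue_Rd mu.
Hypothesis d0 : (0 < d)%N.
Let leb1 : {measure set (measurableTypeR R) -> \bar R} := @lebesgue_measure R.
Variable m : nat.
Hypothesis md : (d + 2 <= 2 * m.+1)%N.

Lemma pdiff_le (k l : nat) (f : 'rV[R]_d -> R) : (k <= l)%N -> pdiff l f -> pdiff k f.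
Proof.
move=> kl pf i; have {pf} := pf i; elim: l kl => [|l IH]; first by rewrite leqn0 => /eqP->.
by rewrite leq_eqVlt => /orP[/eqP->//|kl] [/(IH kl)].
Qed.

Lemma energy_bounded f (a : 'rV[R]_d) h (B : R) : pdiff m.+1 f -> 0 < h ->
  (forall i, energy mu m i f a h <= B%:E)%E -> exists C, forall x, cube a h x -> `|f x| <= C.
Proof.
move=> pf h0 HB; have B1 : 0 < `|B| + 1 by rewrite ltr_wpDl.
have HB1 i : (energy mu m i f a h <= (`|B| + 1)%:E)%E.
  by apply: le_trans (HB i) _; rewrite lee_fin (le_trans (ler_norm _))// lerDl.
have [P [cP _ _ sP]] := sup_bound leb d0 md pf B1 h0 HB1.
have [C HC] := cp_box_bounded cP a h.
set S := sup_const _ _ _ * _ in sP.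
exists (Num.sqrt S + C) => x Qx.
have -> : f x = (f x - P x) + P x by rewrite subrK.
apply: le_trans (ler_normD _ _) _; apply: lerD; last exact: HC.
by rewrite -sqrtr_sqr; apply: ler_wsqrtr; exact: sP.
Qed.

Definition osc_const : R := 2 * sup_const R d m + 4 * inv_const R d m * (bh_const R m d + bh_const R 0 d).

(** Compares [f] with [P] uniformly by [sup_bound], then [P] with the approximation [P0] of order
    one; the inverse inequality makes the second comparison uniform. *)
Lemma oscillation f (a : 'rV[R]_d) h (B B1 : R) : pdiff m.+1 f -> 0 < h -> 0 < B -> 0 < B1 ->
  (forall i, energy mu m i f a h <= B%:E)%E -> (forall i, energy mu 0 i f a h <= B1%:E)%E ->
  exists c, forall x, cube a h x ->
    (f x - c) ^+ 2 <= osc_const * ((h ^+ (2 * m.+1) * B + h ^+ 2 * B1) / h ^+ d).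
Proof.
move=> pf h0 B0 B10 HB HB1.
have [P [cP mP IP sP]] := sup_bound leb d0 md pf B0 h0 HB.
have [P0 [cP0 mP0 IP0]] := bramble_hilbert leb d0 (pdiff_le (ltn0Sn m) pf) h0 B10 HB1.
(* At order one each restriction to a coordinate line has size at most one, so [P0] is constant
   along every line and hence constant. *)
have P0c x y : P0 x = P0 y.
  suff H k : (k <= d)%N -> P0 (mix y k x) = P0 x by rewrite -(H d)// mixd.
  elim: k => [|k IH] kd; first by rewrite mix0.
  pose i := Ordinal kd; rewrite (_ : k.+1 = i.+1)// mixS -(IH (ltnW kd)).
  have [q [sq Hq]] := cP0 i (mix y i x); rewrite Hq.
  have := Hq ((mix y i x) 0 i); rewrite upd_id => ->.
  by rewrite (size1_polyC sq) !hornerC.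
exists (P0 a) => x Qx.
have cD : cp m (fun y => P y - P0 a).
  move=> i y; have [q [sq Hq]] := cP i y.
  exists (q - (P0 a)%:P); split.
    rewrite (leq_trans (size_polyD _ _))// size_polyN geq_max sq/=.
    by apply: leq_trans (size_polyC_leq1 _) _.
  by move=> v; rewrite hornerD hornerN hornerC Hq.
have mD : measurable_fun setT (fun y : Rd R d => P y - P0 a) by exact: measurable_funB.
have mf : measurable_fun setT (f : Rd R d -> R) by exact: (Dn_measurable (Ordinal d0) (ltn0Sn m) pf (leq0n _)).
have hd : 0 < h ^+ d by rewrite exprn_gt0.
have HI : (\int[mu]_(y in cube a h) ((P y - P0 a) ^+ 2)%:E <=
   (2 * (bh_const R m d * h ^+ (2 * m.+1) * B) + 2 * (bh_const R 0 d * h ^+ 2 * B1))%:E)%E.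
  have -> : (\int[mu]_(y in cube a h) ((P y - P0 a) ^+ 2)%:E =
     \int[mu]_(y in cube a h) (((P y - f y) + (f y - P0 y)) ^+ 2)%:E)%E.
    by apply: eq_integral => y _; rewrite addrA subrK (P0c y a).
  have m1 : measurable_fun setT (fun y : Rd R d => P y - f y) by exact: measurable_funB.
  have m2 : measurable_fun setT (fun y : Rd R d => f y - P0 y) by exact: measurable_funB.
  apply: le_trans (int_sqrD_le mu (measurable_cube a h) m1 m2) _.
  rewrite [leRHS]EFinD; apply: leeD; rewrite [leRHS]EFinM; apply: lee_wpmul2l => //.
  by under eq_integral do rewrite -sqrrN opprB.
have bm0 : 0 < bh_const R m d by exact: bh_const_gt0.
have b00 : 0 < bh_const R 0 d by exact: bh_const_gt0.
have iv0 : 0 < inv_const R d m by exact: inv_const_gt0.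
have := inverse_inequality leb d0 cD mD h0 Qx.
move=> /le_trans /(_ (lee_wpmul2l _ HI)); rewrite lee_fin => /(_ (ltW iv0)).
rewrite -!EFinM lee_fin => H.
have -> : f x - P0 a = (f x - P x) + (P x - P0 a) by rewrite addrA subrK.
apply: le_trans (sqrD_le2 _ _) _.
have H1 := sP x Qx.
have e1 : B * h ^+ (2 * m.+1 - d) = h ^+ (2 * m.+1) * B / h ^+ d.
  have -> : h ^+ (2 * m.+1) = h ^+ (2 * m.+1 - d) * h ^+ d by rewrite -exprD subnK// (leq_trans _ md)// leq_addr.
  by field; rewrite gt_eqF.
rewrite e1 in H1; move: H; rewrite -ler_pdivlMr// => H.
have hB : 0 < h ^+ (2 * m.+1) * B by rewrite mulr_gt0// exprn_gt0.
have hB1 : 0 < h ^+ 2 * B1 by rewrite mulr_gt0// exprn_gt0.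
have s0 : 0 <= sup_const R d m by exact: sqr_ge0.
move: H1 H hB hB1; rewrite /osc_const -(mulrA (bh_const R m d)) -(mulrA (bh_const R 0 d)).
have W0 : 0 < (h ^+ d)^-1 by rewrite invr_gt0.
move: s0 bm0 b00 iv0 W0; move: (sup_const _ _ _) (inv_const _ _ _) (bh_const _ m _) (bh_const _ 0 _).
move: (h ^+ (2 * m.+1) * B) (h ^+ 2 * B1) (h ^+ d)^-1 ((f x - P x) ^+ 2) ((P x - P0 a) ^+ 2).
move=> X Y W e1' e2' s iv b b' s0 bm0 b00 iv0 W0 H1 H2 X0 Y0.
apply: (@le_trans _ _ (2 * (s * (X * W)) + 2 * (iv * (2 * (b * X) + 2 * (b' * Y)) * W))).
  by apply: lerD; rewrite ler_pM2l.
rewrite -subr_ge0.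
have -> : (2 * s + 4 * iv * (b + b')) * ((X + Y) * W) - (2 * (s * (X * W)) + 2 * (iv * (2 * (b * X) + 2 * (b' * Y)) * W)) =
  (2 * (s * Y) + 4 * (iv * (b * Y)) + 4 * (iv * (b' * X))) * W by ring.
by rewrite mulr_ge0 ?(ltW W0)// !addr_ge0// !mulr_ge0// ltW.
Qed.

(** The penalty controls derivatives of top order only. At [x] the first derivative of [f] is that
    of its Taylor polynomial, whose values at fixed nodes are those of [f] up to the remainder;
    Lagrange interpolation then bounds it by the bound on [f] and the top order energy of the
    line. *)
Lemma first_energy_finite f (a : 'rV[R]_d) h (B b : R) : (0 < m)%N -> pdiff m.+1 f -> 0 < h ->
  (forall i, energy mu m i f a h <= B%:E)%E -> (forall x, cube a h x -> `|f x| <= b) ->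
  exists B1, 0 < B1 /\ forall i, (energy mu 0 i f a h <= B1%:E)%E.
Proof.
move=> m0 pf h0 HB fb.
suff H i : exists B1, 0 < B1 /\ (energy mu 0 i f a h <= B1%:E)%E.
  have /choice[B1 HB1] := H; exists (1 + \sum_i B1 i); split.
    by rewrite ltr_pwDl// sumr_ge0// => i _; apply: ltW; exact: (proj1 (HB1 i)).
  move=> i; apply: le_trans (proj2 (HB1 i)) _; rewrite lee_fin (bigD1 i)//=.
  rewrite addrCA lerDl addr_ge0// sumr_ge0// => j _; apply: ltW; exact: (proj1 (HB1 j)).
pose v (l : 'I_m.+1) : R := a 0 i + h * (l%:R / m.+1%:R).
have m10 : 0 < m.+1%:R :> R by rewrite ltr0n.
have vinj : injective v.
  move=> k l /addrI /(mulfI (lt0r_neq0 h0)) /(mulIf (invr_neq0 (lt0r_neq0 m10))) /eqP.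
  by rewrite eqr_nat => /eqP /val_inj.
have vJ l : a 0 i <= v l <= a 0 i + h.
  rewrite /v lerDl lerD2l ger_pMr// mulr_ge0 ?(ltW h0) ?divr_ge0//=.
  by rewrite ler_pdivrMr// mul1r ler_nat ltnW// ltn_ord.
have /choice[L HL] := fun l : 'I_m.+1 => poly_bounded (lag v l)^`() (`|a 0 i| + h).
pose LL := \sum_l L l + 1.
have LL0 : 0 < LL by rewrite ltr_wpDl// sumr_ge0// => l _; exact: (proj1 (HL l)).
have lagb l u : a 0 i <= u <= a 0 i + h -> `|(lag v l)^`().[u]| <= LL.
  move=> /andP[u1 u2]; apply: le_trans (proj2 (HL l) u _) _.
    have := ler_norm (- a 0 i); rewrite normrN; have := ler_norm (a 0 i).
    by rewrite ler_norml; move: u1 u2; move: (a 0 i) (`|a 0 i|) => *; apply/andP; split; lra.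
  rewrite /LL (bigD1 l)//= -addrA lerDl addr_ge0// sumr_ge0// => j _; exact: (proj1 (HL j)).
have mD := meas_sq (Dn_measurable i (ltn0Sn m) pf (leqnn _)).
pose S x := (\int[leb1]_(u in `[(a 0 i)%R, (a 0 i + h)%R]) ((Dn i m.+1 f (upd i x u)) ^+ 2)%:E)%E.
have mS : measurable_fun setT (S : Rd R d -> \bar R).
  exact: (resample_inner_line a h i mD (sq_ge0E (Dn i m.+1 f))).
have S0 x : (0 <= S x)%E by apply: integral_ge0 => u _; exact: sq_ge0E.
pose c1 := 2 * (m.+1%:R * LL) ^+ 2 * (h ^+ m) ^+ 2 * h.
pose c2 := 2 * (m.+1%:R * LL) ^+ 2 * b ^+ 2.
have c10 : 0 < c1 by rewrite !mulr_gt0 ?exprn_gt0 ?mulr_gt0.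
have c20 : 0 <= c2 by rewrite mulr_ge0 ?sqr_ge0// mulr_ge0 ?sqr_ge0.
have mQ := measurable_cube a h.
have key x : cube a h x -> (((Dn i 1 f x) ^+ 2)%:E <= c1%:E * S x + c2%:E)%E.
  move=> Qx; case E : (S x) (S0 x) => [s| |]// s0; last by rewrite gt0_muley ?lte_fin// addye ?leey.
  rewrite -EFinM -EFinD lee_fin; rewrite lee_fin in s0.
  pose phi j u := Dn i j f (upd i x u).
  have dphi j : (j <= m)%N -> forall z : R, is_derive z (1 : R) (phi j) (phi j.+1 z).
    by move=> jm z; exact: Dn_slice pf _.
  have mphi : measurable_fun setT (phi m.+1) by exact: (Dn_line_measurable i x (ltn0Sn m) pf (leqnn _)).
  have L1 := L1_L2_bound h0 s0 mphi (eq_ind_r (fun z => (z <= s%:E)%E) (lexx _) E).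
  have rem := taylor_rem (ltW h0) dphi mphi L1 (Qx i).
  set q := taylor phi m.+1 (x 0 i) in rem.
  have -> : Dn i 1 f x = q^`().[x 0 i] by rewrite taylor_deriv_x// /phi upd_id.
  have qv l : `|q.[v l]| <= b + h ^+ m * Num.sqrt (h * s).
    have -> : q.[v l] = f (upd i x (v l)) - (phi 0 (v l) - q.[v l]) by rewrite /phi /Dn/=; ring.
    apply: le_trans (ler_normB _ _) _; apply: lerD; last exact: rem.
    by apply: fb; exact: cube_upd.
  have : `|q^`().[x 0 i]| <= m.+1%:R * LL * (b + h ^+ m * Num.sqrt (h * s)).
    have sq : (size q <= m.+1)%N by exact: size_taylor.
    rewrite {1}(lag_interp vinj sq) raddf_sum/= horner_sum.
    apply: le_trans (ler_norm_sum _ _ _) _.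
    set T := _ * LL * _; have -> : T = \sum_(l < m.+1) LL * (b + h ^+ m * Num.sqrt (h * s)).
      by rewrite sumr_const card_ord -[RHS]mulr_natl mulrA.
    apply: ler_sum => l _.
    rewrite derivZ hornerZ normrM mulrC; apply: ler_pM => //; exact: lagb.
  move=> H; rewrite -[X in X <= _]real_normK ?num_real//.
  have p0 : 0 <= b + h ^+ m * Num.sqrt (h * s) by apply: le_trans (qv ord0).
  apply: (@le_trans _ _ ((m.+1%:R * LL * (b + h ^+ m * Num.sqrt (h * s))) ^+ 2)).
    by rewrite lerXn2r ?nnegrE// !mulr_ge0// ltW.
  rewrite exprMn.
  apply: (@le_trans _ _ ((m.+1%:R * LL) ^+ 2 * (2 * b ^+ 2 + 2 * (h ^+ m * Num.sqrt (h * s)) ^+ 2))).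
    by rewrite ler_wpM2l ?sqr_ge0//; exact: sqrD_le2.
  rewrite [(h ^+ m * _) ^+ 2]exprMn sqr_sqrtr ?mulr_ge0 ?(ltW h0)//.
  by rewrite /c1 /c2 le_eqVlt; apply/orP; left; apply/eqP; ring.
exists (c1 * (h * `|B|) + c2 * h ^+ d + 1); split.
  have t1 : 0 <= c1 * (h * `|B|) by rewrite (mulr_ge0 (ltW c10))// mulr_ge0// ltW.
  have t2 : 0 <= c2 * h ^+ d by rewrite (mulr_ge0 c20)// exprn_ge0// ltW.
  exact: (ltr_wpDl (addr_ge0 t1 t2) ltr01).
have m1 : measurable_fun setT (fun x : Rd R d => c1%:E * S x)%E by apply: emeasurable_funM.
have p1 x : (0 <= c1%:E * S x)%E by apply: mule_ge0 => //; rewrite lee_fin ltW.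
have p2 (x : Rd R d) : (0 <= c2%:E)%E by rewrite lee_fin.
apply: (@le_trans _ _ (\int[mu]_(x in cube a h) (c1%:E * S x + c2%:E))%E).
  apply: le_int => //.
  - by apply: meas_sq; exact: (Dn_measurable i (ltn0Sn m) pf).
  - by apply: emeasurable_funD.
  - by move=> x _; exact: sq_ge0E.
rewrite (int_add mu mQ m1 (measurable_cst _) p1 p2) (int_scale mu mQ (ltW c10) mS S0).
rewrite /S (resample leb a i d0 h0 mD (sq_ge0E _)) integral_cst// (cube_measure leb)// ?(ltW h0)//.
rewrite -[leRHS]/(((c1 * (h * `|B|) + c2 * h ^+ d) + 1)%:E).
apply: (@le_trans _ _ ((c1 * (h * `|B|))%:E + (c2 * h ^+ d)%:E)%E).
  rewrite [X in (_ <= _ + X)%E]EFinM leeD2r// !EFinM; apply: lee_wpmul2l; first by rewrite lee_fin ltW.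
  apply: lee_wpmul2l; first by rewrite lee_fin ltW.
  by apply: le_trans (HB i) _; rewrite lee_fin ler_norm.
by rewrite -EFinD lee_fin lerDl.
Qed.
End Oscillation.

(** * Finite nets near a linear subspace *)

Section GramSchmidt.
Variables (R : realType) (p : nat).
Local Notation V := 'rV[R]_p.
Implicit Types (u v w : V).

Definition ip u v : R := p%:R^-1 * \sum_j u 0 j * v 0 j.
Definition nrm2 v : R := ip v v.

Lemma ipC u v : ip u v = ip v u.
Proof. by rewrite /ip; congr (_ * _); apply: eq_bigr => j _; rewrite mulrC. Qed.
Lemma ipDl u v w : ip (u + v) w = ip u w + ip v w.
Proof. by rewrite /ip -mulrDr -big_split/=; congr (_ * _); apply: eq_bigr => j _; rewrite mxE mulrDl. Qed.
Lemma ipZl a u v : ip (a *: u) v = a * ip u v.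
Proof. by rewrite /ip mulrCA [in RHS]mulr_sumr; congr (_ * _); apply: eq_bigr => j _; rewrite mxE mulrA. Qed.
Lemma ipDr u v w : ip u (v + w) = ip u v + ip u w.
Proof. by rewrite ipC ipDl !(ipC u). Qed.
Lemma ipZr a u v : ip u (a *: v) = a * ip u v.
Proof. by rewrite ipC ipZl ipC. Qed.
Lemma ip0l v : ip 0 v = 0.
Proof. by rewrite -(scale0r (0 : V)) ipZl mul0r. Qed.
Lemma ipNl u v : ip (- u) v = - ip u v.
Proof. by rewrite -scaleN1r ipZl mulN1r. Qed.
Lemma ip_suml (I : Type) (r : seq I) (P : pred I) (F : I -> V) v :
  ip (\sum_(i <- r | P i) F i) v = \sum_(i <- r | P i) ip (F i) v.
Proof.
elim/big_rec2: _ => [|i x y _ IH]; first exact: ip0l.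
by rewrite ipDl IH.
Qed.
Lemma nrm2_ge0 v : 0 <= nrm2 v.
Proof. by rewrite /nrm2 /ip mulr_ge0// ?invr_ge0// sumr_ge0// => j _; rewrite -expr2 sqr_ge0. Qed.
Lemma nrm2Z a v : nrm2 (a *: v) = a ^+ 2 * nrm2 v.
Proof. by rewrite /nrm2 ipZl ipZr mulrA -expr2. Qed.
Lemma nrm2N v : nrm2 (- v) = nrm2 v.
Proof. by rewrite -scaleN1r nrm2Z sqrrN expr1n mul1r. Qed.
Lemma nrm2D u v : nrm2 (u + v) = nrm2 u + 2 * ip u v + nrm2 v.
Proof. by rewrite /nrm2 ipDl !ipDr (ipC v u); ring. Qed.
Lemma nrm2D_le u v : nrm2 (u + v) <= 2 * nrm2 u + 2 * nrm2 v.
Proof.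
have := nrm2_ge0 (u - v); rewrite !nrm2D nrm2N ipC ipNl ipC; lra.
Qed.
Lemma nrm2_sum_sqr v : nrm2 v = p%:R^-1 * \sum_j v 0 j ^+ 2.
Proof. by []. Qed.
Lemma nrm2_eq0 v : (0 < p)%N -> nrm2 v = 0 -> v = 0.
Proof.
move=> p0 /eqP; rewrite /nrm2 /ip mulf_eq0 invr_eq0 pnatr_eq0 gtn_eqF//=.
rewrite psumr_eq0; last by move=> j _; rewrite -expr2 sqr_ge0.
move=> /allP H; apply/rowP => j; rewrite mxE.
by have := H j (mem_index_enum _); rewrite mulf_eq0 orbb => /eqP.
Qed.

Hypothesis p0 : (0 < p)%N.

(* zero vectors are allowed in the orthonormal family, so that no dimension has to be tracked *)
Lemma gram_schmidt (D : nat) (b : nat -> V) : exists e : nat -> V,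
  [/\ forall i j, (i < D)%N -> (j < D)%N -> i != j -> ip (e i) (e j) = 0,
      forall i, (i < D)%N -> e i = 0 \/ nrm2 (e i) = 1 &
      forall k, (k < D)%N -> b k = \sum_(i < D) ip (b k) (e i) *: e i].
Proof.
elim: D => [|D [e [eo en eb]]]; first by exists (fun=> 0).
pose w := b D - \sum_(i < D) ip (b D) (e i) *: e i.
have en' i v : (i < D)%N -> ip v (e i) * nrm2 (e i) = ip v (e i).
  by move=> iD; have [->|->] := en i iD; rewrite ?mulr1// ipC ip0l mul0r.
have wo i : (i < D)%N -> ip w (e i) = 0.
  move=> iD; rewrite /w ipDl ipNl ip_suml (bigD1 (Ordinal iD))//= ipZl en'// big1 ?addr0 ?subrr//.
  by move=> j ji; rewrite ipZl eo ?mulr0.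
pose eD := (Num.sqrt (nrm2 w))^-1 *: w.
have eDo i : (i < D)%N -> ip eD (e i) = 0 by move=> iD; rewrite /eD ipZl wo ?mulr0.
have eDn : eD = 0 \/ nrm2 eD = 1.
  have [/eqP w0|wn] := eqVneq (nrm2 w) 0.
    by left; rewrite /eD (nrm2_eq0 p0 (eqP w0)) scaler0.
  right; rewrite /eD nrm2Z exprVn sqr_sqrtr ?nrm2_ge0// mulVf//.
exists (fun i => if (i < D)%N then e i else eD); split.
- move=> i j; rewrite !ltnS => iD jD.
  case: ltnP => iD'; case: ltnP => jD' ij.
  + exact: eo.
  + by rewrite ipC eDo.
  + by rewrite eDo.
  + by move: ij; rewrite (_ : i = j) ?eqxx//; apply/eqP; rewrite eqn_leq (leq_trans iD jD') (leq_trans jD iD').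
- by move=> i _; case: ifP => // iD; exact: en.
- move=> k; rewrite ltnS => kD; rewrite big_ord_recr/= ltnn.
  rewrite (eq_bigr (fun i : 'I_D => ip (b k) (e i) *: e i)); last by move=> i _; rewrite ltn_ord.
  move: kD; rewrite leq_eqVlt => /orP[/eqP->|kD].
    have -> : ip (b D) eD *: eD = w.
      have bw : ip (b D) w = nrm2 w.
        have -> : b D = w + \sum_(i < D) ip (b D) (e i) *: e i by rewrite /w subrK.
        rewrite ipDl ip_suml big1 ?addr0// => i _; rewrite ipZl (ipC (e i)) wo ?mulr0//.
      have [w0|wn] := eqVneq (nrm2 w) 0.
        by rewrite /eD (nrm2_eq0 p0 w0) !scaler0.
      rewrite /eD ipZr bw scalerA.
      have s0 : Num.sqrt (nrm2 w) != 0 by rewrite sqrtr_eq0 -ltNge lt_neqAle eq_sym wn nrm2_ge0.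
      have -> : (Num.sqrt (nrm2 w))^-1 * nrm2 w / Num.sqrt (nrm2 w) = 1.
        have sq := sqr_sqrtr (nrm2_ge0 w).
        by set s := Num.sqrt (nrm2 w) in s0 sq *; rewrite -sq; field.
      by rewrite scale1r.
    by rewrite /w addrC subrK.
  rewrite -eb// -[LHS]addr0; congr (_ + _).
  rewrite (eb k kD) ip_suml big1 ?scale0r// => i _.
  by rewrite ipZl (ipC (e i)) eDo ?mulr0.
Qed.

(** The net consists of grid points of step [K / Z] in the coordinates of an orthonormal family. The
    condition on [Z] makes the squared rounding error at most [eta^2]; the projection error is also
    at most [eta^2], and adding the two doubles each. *)
Lemma subspace_net (D : nat) (b : nat -> V) (K eta : R) (Z : nat) :
  0 < K -> 0 <= eta -> (0 < Z)%N -> D%:R * K ^+ 2 <= (eta * Z%:R) ^+ 2 ->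
  exists s : seq V, (size s <= (2 * Z).+1 ^ D)%N /\
    forall v, nrm2 v <= K ^+ 2 ->
      (exists c : nat -> R, nrm2 (v - \sum_(k < D) c k *: b k) <= eta ^+ 2) ->
      exists2 a, a \in s & nrm2 (v - a) <= 4 * eta ^+ 2.
Proof.
move=> K0 eta0 Z0 HZ; have [e [eo en eb]] := gram_schmidt D b.
have en' i v : (i < D)%N -> ip v (e i) * nrm2 (e i) = ip v (e i).
  by move=> iD; have [->|->] := en i iD; rewrite ?mulr1// ipC ip0l mul0r.
have en1 i : (i < D)%N -> nrm2 (e i) <= 1.
  by move=> iD; have [->|->] := en i iD; rewrite // /nrm2 ip0l ler01.
pose P v := \sum_(i < D) ip v (e i) *: e i.
pose g := K / Z%:R.
have g0 : 0 < g by rewrite divr_gt0// ltr0n.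
pose N (z : {ffun 'I_D -> 'I_(2 * Z).+1}) : V := \sum_(i < D) (g * ((z i)%:R - Z%:R)) *: e i.
have sumo (c c' : 'I_D -> R) : ip (\sum_(i < D) c i *: e i) (\sum_(i < D) c' i *: e i) =
    \sum_(i < D) c i * c' i * nrm2 (e i).
  rewrite ip_suml; apply: eq_bigr => i _; rewrite ipZl ipC ip_suml (bigD1 i)//= big1 ?addr0.
    by rewrite ipZl mulrA.
  by move=> j ji; rewrite ipZl eo ?mulr0.
have Po v i : (i < D)%N -> ip (v - P v) (e i) = 0.
  move=> iD; rewrite ipDl ipNl ip_suml (bigD1 (Ordinal iD))//= ipZl en'// big1 ?addr0 ?subrr//.
  by move=> j ji; rewrite ipZl eo ?mulr0.
exists [seq N z | z <- enum {ffun 'I_D -> 'I_(2 * Z).+1}]; split.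
  by rewrite size_map -cardE card_ffun !card_ord.
move=> v vK [c vc].
have PD : nrm2 (v - P v) <= eta ^+ 2.
  apply: le_trans vc; set u := \sum_(k < D) _.
  have -> : v - u = (v - P v) + \sum_(i < D) (ip v (e i) - ip u (e i)) *: e i.
    have -> : u = P u.
      rewrite /P; under eq_bigr do rewrite {1}/u ip_suml scaler_suml.
      rewrite exchange_big/= {1}/u; apply: eq_bigr => k _.
      rewrite [in LHS]eb// scaler_sumr; apply: eq_bigr => i _.
      by rewrite ipZl scalerA.
    under eq_bigr do rewrite scalerBl.
    rewrite sumrB -/(P v) addrA subrK.
    have PP : P (P u) = P u.
      apply: eq_bigr => i _; congr (_ *: _); apply/eqP; rewrite eq_sym -subr_eq0.
      by rewrite -ipNl -ipDl Po.
    by rewrite -[in RHS]/(P (P u)) PP.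
  rewrite [leRHS]nrm2D ipC ip_suml big1 ?mulr0 ?addr0 ?lerDl ?nrm2_ge0// => i _.
  by rewrite ipZl (ipC (e i)) Po ?mulr0.
have cs i : (i < D)%N -> `|ip v (e i)| <= K.
  move=> iD; rewrite -ler_sqr ?nnegrE ?(ltW K0)// real_normK ?num_real//.
  apply: le_trans vK.
  have := nrm2_ge0 (v - ip v (e i) *: e i).
  rewrite nrm2D nrm2N nrm2Z ipC ipNl ipZl (ipC (e i) v).
  have := en' i v iD; set x := ip v (e i); set y := nrm2 (e i) => xy.
  have -> : x ^+ 2 * y = x ^+ 2 by rewrite expr2 -mulrA xy.
  have := nrm2_ge0 v; lra.
have /choice[z Hz] : forall i : 'I_D, exists z : 'I_(2 * Z).+1, `|ip v (e i) - g * (z%:R - Z%:R)| <= g.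
  move=> i; pose y := ip v (e i) / g + Z%:R.
  have yb : 0 <= y <= (2 * Z)%:R.
    have := cs i (ltn_ord i); rewrite ler_norml => /andP[c1 c2].
    have gZ : g * Z%:R = K by rewrite /g divfK// pnatr_eq0 gtn_eqF.
    have h1 : - Z%:R <= ip v (e i) / g by rewrite ler_pdivlMr// mulNr mulrC gZ.
    have h2 : ip v (e i) / g <= Z%:R by rewrite ler_pdivrMr// mulrC gZ.
    by rewrite /y natrM; apply/andP; split; lra.
  move/andP: yb => [y0 y2].
  have yZ : (Num.truncn y < (2 * Z).+1)%N by rewrite ltnS -(ler_nat R); apply: le_trans y2; rewrite truncn_le.
  exists (Ordinal yZ) => /=.
  have -> : ip v (e i) - g * ((Num.truncn y)%:R - Z%:R) = g * (y - (Num.truncn y)%:R).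
    by rewrite /y; field; rewrite gt_eqF.
  rewrite normrM gtr0_norm// ler_piMr// ?(ltW g0)//.
  have := truncn_itv y0; rewrite -natr1 => /andP[h1 h2].
  by rewrite ger0_norm; lra.
exists (N (finfun z)); first by apply: map_f; rewrite mem_enum.
have -> : v - N (finfun z) = (v - P v) + (P v - N (finfun z)) by rewrite addrA subrK.
apply: le_trans (nrm2D_le _ _) _.
have -> : 4 * eta ^+ 2 = 2 * eta ^+ 2 + 2 * eta ^+ 2 by ring.
apply: lerD; rewrite ler_pM2l//.
rewrite /P /N -sumrB; under eq_bigr do rewrite -scalerBl ffunE.
rewrite /nrm2 sumo; apply: le_trans (_ : \sum_(i < D) g ^+ 2 <= _).
  apply: ler_sum => i _; rewrite -[leRHS]mulr1; apply: ler_pM; rewrite ?nrm2_ge0 ?en1//.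
    by rewrite -expr2 sqr_ge0.
  by rewrite -expr2 -real_normK ?num_real// lerXn2r ?nnegrE// ltW.
rewrite sumr_const card_ord -mulr_natl /g expr_div_n mulrA ler_pdivrMr; last by rewrite exprn_gt0// ltr0n.
by rewrite -exprMn.
Qed.
End GramSchmidt.

(** * Overlapping families of sets, grids, and counting of design points *)

Section Overlap.
Context d1 (T : measurableType d1) (R : realType) (m : {measure set T -> \bar R}).

Lemma sum_const_ge0 (J : finType) (A : {pred J}) (y : \bar R) : (0 <= y)%E ->
  (\sum_(j in A) y = (#|A|%:R)%:E * y)%E.
Proof.
move=> y0; rewrite big_const.
elim: #|A| => [|n IH] /=; first by rewrite mul0e.
by rewrite IH -natr1 EFinD ge0_muleDl ?lee_fin// mul1e addeC.
Qed.

Lemma overlap_le (J : finType) (A : J -> set T) (D : set T) (g : T -> \bar R) (N : R) :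
  measurable D -> (forall j, measurable (A j)) -> (forall j, A j `<=` D) ->
  measurable_fun setT g -> (forall x, 0 <= g x)%E -> 0 <= N ->
  (forall x, D x -> #|[pred j | x \in A j]|%:R <= N) ->
  (\sum_j \int[m]_(x in A j) g x <= N%:E * \int[m]_(x in D) g x)%E.
Proof.
move=> mD mA AD mg g0 N0 HN.
have E j : (\int[m]_(x in A j) g x = \int[m]_(x in D) ((g \_ (A j)) x))%E.
  by rewrite -integral_mkcondr setIidr//; exact: AD.
under eq_bigr do rewrite E.
have mp j : measurable_fun setT (g \_ (A j)).
  by apply/(measurable_restrictT _ _).1 => //; exact: measurable_funTS.
have p0 j x : (0 <= (g \_ (A j)) x)%E by rewrite patchE; case: ifP.
rewrite -(int_sum m mD (index_enum J) mp p0) -(int_scale m mD N0 mg g0).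
apply: le_int => //.
- by apply: emeasurable_sum.
- by apply: emeasurable_funM.
- by move=> x _; apply: sume_ge0.
move=> x Dx; under eq_bigr do rewrite patchE.
rewrite -big_mkcond/= (eq_bigl (fun j => j \in [pred j | x \in A j]))//.
rewrite sum_const_ge0//; apply: lee_wpmul2r => //; rewrite lee_fin; exact: HN.
Qed.
End Overlap.

Section Grid.
Variables (R : realType) (d : nat).

Definition corner (a : 'rV[R]_d) (h : R) N (z : {ffun 'I_d -> 'I_N}) : 'rV[R]_d :=
  \row_i (a 0 i + (z i)%:R * h).

Lemma grid_line (y h : R) N : (0 < N)%N -> 0 <= y <= N%:R * h ->
  exists n : 'I_N, n%:R * h <= y <= n%:R * h + h.
Proof.
elim: N => // -[_ _ /andP[y0 yN]|N IH _ /andP[y0 yN]].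
  by exists ord0; rewrite /= mul0r add0r y0/=; move: yN; rewrite mul1r.
have [yN'|yN'] := leP y (N.+1%:R * h).
  have [//|n Hn] := IH isT; first by rewrite y0.
  by exists (widen_ord (leqnSn _) n).
by exists ord_max => /=; rewrite (ltW yN')/= -[X in _ + X]mul1r -mulrDl natr1.
Qed.

Lemma grid_cover (a : 'rV[R]_d) (H : R) N x : (0 < N)%N -> cube a H x ->
  exists z : {ffun 'I_d -> 'I_N}, cube (corner a (H / N%:R) z) (H / N%:R) x.
Proof.
move=> N0 Hx.
have /choice[z Hz] i : exists n : 'I_N, n%:R * (H / N%:R) <= x 0 i - a 0 i <= n%:R * (H / N%:R) + H / N%:R.
  apply: grid_line => //; have /andP[x1 x2] := Hx i.
  by rewrite subr_ge0 x1/= mulrC divfK ?pnatr_eq0 -?lt0n// lerBlDl.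
exists [ffun i => z i] => i; rewrite mxE ffunE.
have /andP[h1 h2] := Hz i; move: h1 h2; rewrite lerBrDl lerBlDl addrA => -> h2.
by [].
Qed.

Lemma corner_cube (a : 'rV[R]_d) (H : R) N (z : {ffun 'I_d -> 'I_N}) : 0 < H ->
  cube (corner a (H / N%:R) z) (H / N%:R) `<=` cube a H.
Proof.
move=> H0 x Hx i; have /andP[x1 x2] := Hx i; move: x1 x2; rewrite mxE.
have N0 : 0 < N%:R :> R by rewrite ltr0n; case: (z i) => k; lia.
have h0 : 0 < H / N%:R by rewrite divr_gt0.
have h1 : 0 <= (z i)%:R * (H / N%:R) by rewrite mulr_ge0// ltW.
have h2 : (z i)%:R * (H / N%:R) + H / N%:R <= H.
  rewrite -[X in _ + X]mul1r -mulrDl natr1 -[leRHS](divfK (lt0r_neq0 N0)) [leRHS]mulrC.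
  by rewrite ler_wpM2r ?(ltW h0)// ler_nat ltn_ord.
by move: (x 0 i) (a 0 i) => u v *; apply/andP; split; lra.
Qed.

Lemma grid_line_overlap (y h : R) N : 0 < h ->
  (#|[pred n : 'I_N | (n%:R * h <= y <= n%:R * h + h)%R]| <= 2)%N.
Proof.
move=> h0; case: N => [|N]; first by rewrite eq_card0// => -[].
pose q := Num.truncn (y / h).
apply: (@leq_trans #|[set (inord q : 'I_N.+1); inord q.-1]%SET|); last by rewrite cards2; case: eqP.
apply/subset_leq_card/fintype.subsetP => n; rewrite inE finset.in_set2 => /andP[n1 n2].
have q0 : 0 <= y / h by rewrite divr_ge0// ?(ltW h0)// (le_trans _ n1)// mulr_ge0// ltW.
have nq : (n <= q)%N by rewrite /q truncn_ge_nat// ler_pdivlMr.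
have qn : (q <= n.+1)%N.
  rewrite -(ler_nat R); have /andP[q1 _] := truncn_itv q0; apply: le_trans q1 _.
  by rewrite ler_pdivrMr// -natr1 mulrDl mul1r.
have [<-|nq'] := eqVneq (n : nat) q; first by rewrite inord_val eqxx.
have -> : q.-1 = n by lia.
by rewrite inord_val eqxx orbT.
Qed.

Lemma grid_overlap (a : 'rV[R]_d) (h : R) N x : 0 < h ->
  (#|[pred z : {ffun 'I_d -> 'I_N} | x \in (cube (corner a h z) h : set 'rV[R]_d)]| <= 2 ^ d)%N.
Proof.
move=> h0.
pose F (i : 'I_d) : pred 'I_N := fun n => n%:R * h <= x 0 i - a 0 i <= n%:R * h + h.
have F2 i : (#|F i| <= 2)%N by exact: grid_line_overlap.
apply: (@leq_trans #|family F|).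
  apply/subset_leq_card/fintype.subsetP => z; rewrite !inE => Hz; apply/familyP => i.
  have := Hz i; rewrite mxE => /andP[h1 h2].
  suff : F i (z i) by [].
  by rewrite /F lerBrDl h1/= lerBlDl addrA.
have H (s : seq 'I_d) : (foldr muln 1 [seq #|F i| | i <- s] <= 2 ^ size s)%N.
  by elim: s => //= i s IH; rewrite expnS leq_mul.
by rewrite card_family; have := H (enum 'I_d); rewrite size_enum_ord.
Qed.
End Grid.

Section Spread.
Variables (R : realType) (d : nat).
Implicit Types x y : 'rV[R]_d.

Lemma coord_le_eucl x i : `|x 0 i| <= eucl_norm x.
Proof.
rewrite -sqrtr_sqr; apply: ler_wsqrtr; rewrite (bigD1 i)//= lerDl.
by apply: sumr_ge0 => j _; exact: sqr_ge0.
Qed.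

Lemma eucl_le_coord x (s : R) : (0 < d)%N -> 0 <= s -> (forall i, `|x 0 i| <= s) -> eucl_norm x <= d%:R * s.
Proof.
move=> d0 s0 H; have ds : 0 <= d%:R * s by rewrite mulr_ge0.
rewrite /eucl_norm -(ger0_norm ds) -sqrtr_sqr; apply: ler_wsqrtr.
apply: (@le_trans _ _ (\sum_(i < d) s ^+ 2)).
  by apply: ler_sum => i _; rewrite -[leLHS]real_normK ?num_real// lerXn2r ?nnegrE.
rewrite sumr_const card_ord -[leLHS]mulr_natl exprMn ler_wpM2r ?sqr_ge0// -natrX ler_nat.
by rewrite -mulnn leq_pmulr.
Qed.

(** The term [p h^d] is the order of the count for evenly spread points, and the added one allows
    for cubes finer than the mesh. *)
Definition well_spread (C : R) p (t : 'I_p -> 'rV[R]_d) := forall a (h : R), 0 < h ->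
  #|[pred j | t j \in (cube a h : set 'rV[R]_d)]|%:R <= C * (1 + p%:R * h ^+ d).

Variable mu : {measure set Rd R d -> \bar R}.
Hypothesis leb : is_lebesgue_Rd mu.
Hypothesis d0 : (0 < d)%N.
Variables (I : set 'rV[R]_d) (v B : R).
Hypotheses (mI : measurable (I : set (Rd R d))) (vI : mu I = v%:E) (v0 : 0 < v).

Definition spread_const : R := 2 ^+ d * (1 + (4 * d%:R * `|B|) ^+ d / v).

Lemma spread_const_gt0 : 0 < spread_const.
Proof.
by rewrite mulr_gt0 ?exprn_gt0// ltr_wpDr// divr_ge0 ?(ltW v0)// exprn_ge0// !mulr_ge0.
Qed.

(** Cubes of half side [B r] around the design points, with [r = hmin t], cover [I], so
    [v <= p (2 B r)^d] bounds [r] from below. Since distinct points are at distance at least [r], a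
    cube of side [h] contains [O((1 + h/r)^d)] of them. *)
Lemma design_spread p (t : 'I_p -> 'rV[R]_d) : (0 < p)%N -> (forall j, I (t j)) ->
  (hmax I t <= B%:E * hmin t)%E -> well_spread spread_const t.
Proof.
move=> p0 It HB a h h0.
have ph0 : 0 <= p%:R * h ^+ d by rewrite mulr_ge0// exprn_ge0// ltW.
have C0 := spread_const_gt0.
have C1 : 1 <= spread_const.
  rewrite -[leLHS]mul1r; apply: ler_pM => //; first by rewrite exprn_ege1// ler1n.
  by rewrite lerDl divr_ge0 ?(ltW v0)// exprn_ge0// !mulr_ge0.
(* With a single point the minimum in [hmin] runs over no pair and equals [+oo]; this case is
   counted directly. *)
have [p1|p1] := leqP p 1.
  apply: (@le_trans _ _ 1).
    by rewrite lern1 (leq_trans (max_card _))// card_ord.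
  by rewrite -[leLHS]mul1r; apply: ler_pM => //; rewrite lerDl.
pose j0 : 'I_p := Ordinal p0; pose j1 : 'I_p := Ordinal p1.
have dist0 x y : 0 <= eucl_dist x y by exact: sqrtr_ge0.
have hmin_le j k : k != j -> (hmin t <= (eucl_dist (t j) (t k))%:E)%E.
  move=> kj; rewrite /hmin; apply: (@le_trans _ _ (\big[Order.min/+oo%E]_(k < p | k != j) (eucl_dist (t j) (t k))%:E)).
    exact: bigmin_le.
  exact: bigmin_le_cond.
have hmin0 : (0 <= hmin t)%E.
  rewrite /hmin; apply: le_bigmin; first exact: leey.
  move=> j _; apply: le_bigmin; first exact: leey.
  by move=> k _; rewrite lee_fin.
have [r Er] : exists r, hmin t = r%:E.
  have := hmin_le j0 j1 isT; move: hmin0; case: (hmin t) => // r _ _; by exists r.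
rewrite Er in hmin0 HB hmin_le; rewrite lee_fin in hmin0.
have near x : I x -> exists j, eucl_dist x (t j) <= B * r.
  move=> Ix.
  have [j _ Ej] := @eq_bigmin _ _ _ (+oo%E : \bar R) j0 xpredT (fun j : 'I_p => (eucl_dist x (t j))%:E) isT (fun j _ => leey _).
  exists j; rewrite -lee_fin EFinM; apply: le_trans HB.
  by rewrite -Ej; apply: ereal_sup_ubound; exists x.
have Br0 : 0 <= B * r by have [j] := near _ (It j0); exact: le_trans.
have vol : v <= p%:R * (2 * (B * r)) ^+ d.
  rewrite -lee_fin -vI.
  pose Q (j : 'I_p) := cube (t j - const_mx (B * r)) (2 * (B * r)).
  apply: (@le_trans _ _ (\sum_j mu (Q j))%E).
    apply: measure_cover => //; first by move=> j; exact: measurable_cube.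
    move=> x Ix; have [j Hj] := near x Ix; exists j => // i; rewrite !mxE.
    have := le_trans (coord_le_eucl (x - t j) i) Hj; rewrite !mxE ler_norml => /andP[].
    by move: (x 0 i) (t j 0 i) (B * r) => *; apply/andP; split; lra.
  have Brr : 0 <= 2 * (B * r) by rewrite mulr_ge0.
  under eq_bigr do rewrite /Q (cube_measure leb _ d0 Brr).
  by rewrite sumEFin sumr_const card_ord -[X in (X%:E <= _)%E]mulr_natl.
have Brp : 0 < B * r.
  rewrite lt_neqAle Br0 andbT; apply/negP => /eqP E0.
  by move: vol; rewrite -E0 mulr0 expr0n gtn_eqF// mulr0 leNgt v0.
have rp : 0 < r.
  by rewrite lt_neqAle hmin0 andbT; apply/negP => /eqP E0; move: Brp; rewrite -E0 mulr0 ltxx.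
have Bp : 0 < B by move: Brp; rewrite pmulr_lgt0.
have dp : 0 < d%:R :> R by rewrite ltr0n.
(* Two points in the same cell of side [s] would be at distance at most [d s = r / 2], below the
   separation. *)
pose s := r / (2 * d%:R); have s0 : 0 < s by rewrite divr_gt0// mulr_gt0.
pose q j i := Num.truncn ((t j 0 i - a 0 i) / s).
pose N := Num.truncn (h / s).
pose F (j : 'I_p) : {ffun 'I_d -> 'I_N.+1} := [ffun i => inord (q j i)].
have qN j i : t j \in (cube a h : set 'rV[R]_d) -> (q j i < N.+1)%N /\ 0 <= (t j 0 i - a 0 i) / s.
  rewrite inE => /(_ i)/andP[t1 t2]; split; last by rewrite divr_ge0 ?(ltW s0)// subr_ge0.
  by rewrite ltnS; apply: le_truncn; rewrite ler_pM2r ?invr_gt0// lerBlDl.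
have Finj : {in [pred j | t j \in (cube a h : set 'rV[R]_d)] &, injective F}.
  move=> j k Hj Hk /ffunP Fjk; apply/eqP/negPn/negP => jk.
  have := hmin_le k j jk; rewrite lee_fin leNgt => /negP; apply.
  apply: (@le_lt_trans _ _ (d%:R * s)); last first.
    have -> : d%:R * s = r / 2 by rewrite /s; field; rewrite gt_eqF.
    by rewrite ltr_pdivrMr// ltr_pMr// ltr1n.
  apply: eucl_le_coord => //; first exact: ltW.
  move=> i; have := Fjk i; rewrite !ffunE.
  have [qj tj] := qN j i Hj; have [qk tk] := qN k i Hk.
  move=> /(congr1 val); rewrite /= !inordK// => qq.
  have /andP[a1 a2] := truncn_itv tj; have /andP[b1 b2] := truncn_itv tk.
  rewrite -/(q j i) in a1 a2; rewrite -/(q k i) -qq in b1 b2.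
  have : `|(t k 0 i - a 0 i) / s - (t j 0 i - a 0 i) / s| <= 1.
    move: a1 a2 b1 b2; rewrite -natr1; move: (_ / s) (_ / s) (q j i)%:R => *.
    by rewrite ler_norml; apply/andP; split; lra.
  rewrite -mulrBl opprB addrA subrK normrM (gtr0_norm (_ : 0 < s^-1)) ?invr_gt0//.
  by rewrite ler_pdivrMr// mul1r !mxE.
have cardN : (#|[pred j | t j \in (cube a h : set 'rV[R]_d)]| <= N.+1 ^ d)%N.
  rewrite -(card_in_imset Finj); apply: leq_trans (max_card _) _.
  by rewrite card_ffun !card_ord.
have x0 : 0 <= h / s by rewrite divr_ge0// ltW.
apply: (@le_trans _ _ ((1 + h / s) ^+ d)).
  apply: (@le_trans _ _ ((N.+1 ^ d)%:R)); first by rewrite ler_nat.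
  rewrite natrX lerXn2r ?nnegrE ?addr_ge0// -natr1 addrC lerD2l.
  by have /andP[] := truncn_itv x0.
have pow2 (x : R) : 0 <= x -> (1 + x) ^+ d <= 2 ^+ d * (1 + x ^+ d).
  move=> x00; have [x1|x1] := leP x 1.
    apply: (@le_trans _ _ (2 ^+ d)).
      by rewrite lerXn2r ?nnegrE ?addr_ge0//; move: x1; lra.
    by rewrite ler_peMr ?exprn_ge0// lerDl exprn_ge0.
  apply: (@le_trans _ _ ((2 * x) ^+ d)).
    by rewrite lerXn2r ?nnegrE ?addr_ge0 ?mulr_ge0//; move: x1; lra.
  by rewrite exprMn ler_wpM2l ?exprn_ge0// lerDr.
apply: le_trans (pow2 _ x0) _.
rewrite /spread_const -[leRHS]mulrA ler_wpM2l ?exprn_ge0//.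
set X := (_ / v).
have X0 : 0 <= X by rewrite /X divr_ge0 ?(ltW v0)// exprn_ge0// !mulr_ge0.
apply: (@le_trans _ _ (1 + X * (p%:R * h ^+ d))); last first.
  move: X0 ph0; move: X (_ * _) => X' Y X0 Y0; rewrite -subr_ge0.
  have -> : (1 + X') * (1 + Y) - (1 + X' * Y) = X' + Y by ring.
  exact: addr_ge0.
rewrite lerD2l /X mulrAC ler_pdivlMr//.
apply: (@le_trans _ _ ((h / s) ^+ d * (p%:R * (2 * (B * r)) ^+ d))).
  by rewrite ler_wpM2l// exprn_ge0.
rewrite (gtr0_norm Bp) mulrCA [leRHS]mulrCA ler_wpM2l// -!exprMn lerXn2r ?nnegrE//.
- by rewrite !mulr_ge0// ?(ltW h0) ?(ltW Bp) ?(ltW rp)// invr_ge0 ltW.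
- by rewrite !mulr_ge0// ?(ltW h0) ?(ltW Bp).
by rewrite /s le_eqVlt; apply/orP; left; apply/eqP; field; rewrite !gt_eqF.
Qed.
End Spread.

(** * Approximation of functions sampled at the design points *)

Section Approximation.
Variables (R : realType) (d : nat) (mu : {measure set Rd R d -> \bar R}).
Hypothesis leb : is_lebesgue_Rd mu.
Hypothesis d0 : (0 < d)%N.

(** Pure derivatives have multinomial weight one in [Im2], so each of these integrals is bounded by
    the penalty. *)
Definition dirichlet (m : nat) (f : 'rV[R]_d -> R) (D : set (Rd R d)) : \bar R :=
  (\sum_(i < d) \int[mu]_(x in D) ((Dn i m f x) ^+ 2)%:E)%E.

Lemma dirichlet_ge0 m f D : (0 <= dirichlet m f D)%E.
Proof. by apply: sume_ge0 => i _; apply: integral_ge0 => x _; exact: sq_ge0E. Qed.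

Lemma dirichlet_overlap m f (J : finType) (A : J -> set (Rd R d)) (D : set (Rd R d)) (N : R) :
  pdiff m.+1 f -> forall l, (l <= m.+1)%N -> measurable D -> (forall j, measurable (A j)) ->
  (forall j, A j `<=` D) -> 0 <= N -> (forall x, D x -> #|[pred j | x \in A j]|%:R <= N) ->
  (\sum_j dirichlet l f (A j) <= N%:E * dirichlet l f D)%E.
Proof.
move=> pf l lm mD mA AD N0 HN; rewrite /dirichlet exchange_big/=.
rewrite ge0_sume_distrr; last by move=> i _; apply: integral_ge0 => x _; exact: sq_ge0E.
apply: lee_sum => i _; apply: overlap_le => //.
- by apply: meas_sq; exact: (Dn_measurable i (ltn0Sn m) pf).
- exact: sq_ge0E.
Qed.

(** The estimates on cubes ask for strictly positive energy bounds. Each local energy is therefore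
    increased by [E / (#|J| + 1)], which adds at most [E] to the sum. *)
Lemma local_bounds m f (J : finType) (A : J -> set (Rd R d)) (D : set (Rd R d)) (N E : R) :
  pdiff m.+1 f -> forall l, (l <= m.+1)%N -> measurable D -> (forall j, measurable (A j)) ->
  (forall j, A j `<=` D) -> 0 <= N -> (forall x, D x -> #|[pred j | x \in A j]|%:R <= N) ->
  0 < E -> (dirichlet l f D <= E%:E)%E ->
  exists B : J -> R, [/\ forall j, 0 < B j, \sum_j B j <= (N + 1) * E &
    forall j i, (\int[mu]_(x in A j) ((Dn i l f x) ^+ 2)%:E <= (B j)%:E)%E].
Proof.
move=> pf l lm mD mA AD N0 HN E0 HE.
have fin j : dirichlet l f (A j) \is a fin_num.
  rewrite ge0_fin_numE ?dirichlet_ge0//; apply: le_lt_trans (ltry E); apply: le_trans HE.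
  apply: lee_sum => i _; apply: (int_sub mu mD (mA j) _ (sq_ge0E _) (AD j)).
  by apply: meas_sq; exact: (Dn_measurable i (ltn0Sn m) pf).
have n0 : 0 <= #|J|%:R :> R by [].
have n1 : 0 < #|J|%:R + 1 :> R by rewrite ltr_wpDl.
exists (fun j => fine (dirichlet l f (A j)) + E / (#|J|%:R + 1)); split.
- by move=> j; rewrite ltr_wpDl ?fine_ge0 ?dirichlet_ge0// divr_gt0.
- rewrite big_split/= mulrDl mul1r; apply: lerD.
    rewrite -lee_fin -sumEFin; under eq_bigr do rewrite fineK//.
    apply: le_trans (dirichlet_overlap pf lm mD mA AD N0 HN) _.
    by rewrite EFinM; apply: lee_wpmul2l.
  rewrite sumr_const -[leLHS]mulr_natl mulrA ler_pdivrMr// mulrC ler_wpM2l ?(ltW E0)//.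
  by rewrite lerDl.
move=> j i; apply: (@le_trans _ _ (dirichlet l f (A j))).
  rewrite /dirichlet (bigD1 i)//=; apply: leeDl; apply: sume_ge0 => k _.
  by apply: integral_ge0 => x _; exact: sq_ge0E.
rewrite -[leLHS]fineK// lee_fin lerDl; apply: ltW; exact: divr_gt0.
Qed.

Lemma span_nat p (T : finType) (vec : T -> 'rV[R]_p) (D : nat) : (#|T| <= D)%N ->
  exists b : nat -> 'rV[R]_p, forall c : T -> R, exists c' : nat -> R,
    \sum_t c t *: vec t = \sum_(k < D) c' k *: b k.
Proof.
move=> TD; exists (fun k => if insub k is Some i then vec (enum_val (i : 'I_#|T|)) else 0) => c.
exists (fun k => if insub k is Some i then c (enum_val (i : 'I_#|T|)) else 0).
pose G (k : nat) := (if insub k is Some i then c (enum_val (i : 'I_#|T|)) else 0) *: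
  (if insub k is Some i then vec (enum_val (i : 'I_#|T|)) else 0).
rewrite -[RHS]/(\sum_(k < D) G k).
have GE (i : 'I_#|T|) : G i = c (enum_val i) *: vec (enum_val i) by rewrite /G valK.
transitivity (\sum_(i < #|T|) G i).
  rewrite (reindex_onto (@enum_val T T) enum_rank)/=; last by move=> t _; rewrite enum_rankK.
  by apply: eq_big => i; rewrite ?enum_valK ?eqxx// GE.
rewrite (big_ord_widen _ G TD) big_mkcond; apply: eq_bigr => k _.
by case: ifP => // kT; rewrite /G insubF// scale0r.
Qed.
End Approximation.

Section ApproximationBounds.
Variables (R : realType) (d : nat) (mu : {measure set Rd R d -> \bar R}).
Hypothesis leb : is_lebesgue_Rd mu.
Hypothesis d0 : (0 < d)%N.
Variable m : nat.
Hypothesis md : (d + 2 <= 2 * m.+1)%N.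
Variables (a0 : 'rV[R]_d) (H0 Cd : R).
Hypotheses (H00 : 0 < H0) (Cd0 : 0 <= Cd).

Definition span_const : R :=
  sup_const R d m * Cd * (1 + (H0 ^+ d)^-1) * (2 ^+ d + 1) * H0 ^+ (2 * m.+1) + 1.

Lemma span_const_gt0 : 0 < span_const.
Proof.
have s0 : 0 <= sup_const R d m by exact: sqr_ge0.
rewrite ltr_wpDl// mulr_ge0 ?exprn_ge0 ?(ltW H00)// mulr_ge0 ?addr_ge0 ?exprn_ge0//.
by rewrite mulr_ge0 ?addr_ge0 ?invr_ge0 ?exprn_ge0 ?(ltW H00)// mulr_ge0.
Qed.

Section design.
Variables (p : nat) (t : 'I_p -> 'rV[R]_d).
Hypotheses (p0 : (0 < p)%N) (tQ : forall j, cube a0 H0 (t j)) (ts : well_spread Cd t).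

(** The subspace consists of samples of functions that are coordinatewise polynomial on each cell of
    the grid of [2^(kd)] cells; it depends on the design but not on [f]. The squared errors of the
    cells are summed through their energies, each cell being weighted by its number of design
    points. *)
Lemma approx_span k : exists b : nat -> 'rV[R]_p, forall f E, pdiff m.+1 f -> 0 < E ->
  (dirichlet mu m.+1 f (cube a0 H0) <= E%:E)%E ->
  exists c : nat -> R, nrm2 (\row_j f (t j) - \sum_(l < m.+1 ^ d * (2 ^ k) ^ d) c l *: b l) <=
    span_const * (2^-1) ^+ (2 * m.+1 * k) * E.
Proof.
set D := (m.+1 ^ d * (2 ^ k) ^ d)%N; set N := (2 ^ k)%N.
have N0 : (0 < N)%N by rewrite expn_gt0.
have rhs0 E : 0 < E -> 0 <= span_const * (2^-1) ^+ (2 * m.+1 * k) * E.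
  by move=> E0; rewrite !mulr_ge0 ?(ltW E0) ?(ltW span_const_gt0)// exprn_ge0// invr_ge0.
(* With fewer design points than cells, the coordinate vectors already span everything and the error
   is zero. *)
have [pN|pN] := ltnP p (N ^ d).
  have pD : (#|'I_p| <= D)%N.
    by rewrite card_ord; apply: (leq_trans (ltnW pN)); rewrite leq_pmull// expn_gt0.
  have [b Hb] := span_nat (fun j : 'I_p => delta_mx 0 j : 'rV[R]_p) pD.
  exists b => f E pf E0 _; have [c Hc] := Hb (fun j => f (t j)); exists c.
  rewrite -Hc (row_sum_delta (\row_j f (t j))).
  under eq_bigr do rewrite mxE.
  by rewrite subrr /nrm2 ip0l; exact: rhs0.
pose h := H0 / N%:R.
have NR0 : 0 < N%:R :> R by rewrite ltr0n.
have h0 : 0 < h by rewrite divr_gt0.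
have [T [phi [cT _ HP]]] := @cp_basis R d m d (leqnn d).
have /choice[z Hz] := fun j => grid_cover N0 (tQ j).
pose vec (zt : {ffun 'I_d -> 'I_N} * T) : 'rV[R]_p := \row_j (if z j == zt.1 then phi zt.2 (t j) else 0).
have cD : (#|{: {ffun 'I_d -> 'I_N} * T}| <= D)%N.
  by rewrite card_prod card_ffun !card_ord cT mulnC.
have [b Hb] := span_nat vec cD.
exists b => f E pf E0 HE.
pose A (z : {ffun 'I_d -> 'I_N}) := cube (corner a0 h z) h.
have [B [B0 sB HB]] : exists B : {ffun 'I_d -> 'I_N} -> R, [/\ forall j, 0 < B j, \sum_j B j <= (2 ^+ d + 1) * E &
    forall j i, (\int[mu]_(x in A j) ((Dn i m.+1 f x) ^+ 2)%:E <= (B j)%:E)%E].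
  apply: (local_bounds pf (leqnn _) (measurable_cube a0 H0) _ _ _ _ E0 HE) => //.
  - by move=> j; exact: measurable_cube.
  - by move=> j; exact: corner_cube.
  - by move=> x _; rewrite -natrX ler_nat; exact: grid_overlap.
have /choice[P HPz] := fun z => sup_bound leb d0 md pf (B0 z) h0 (HB z).
have /choice[c Hc] z' : exists c : T -> R, forall x, P z' x = \sum_t c t * phi t x.
  have [cP _ _ _] := HPz z'; have [c Hc] := HP _ cP 0; exists c => x.
  by rewrite -Hc mixd.
have [c' Hc'] := Hb (fun zt => c zt.1 zt.2); exists c'; rewrite -Hc'.
have Ej j : (\row_j f (t j) - \sum_t0 c t0.1 t0.2 *: vec t0) 0 j = f (t j) - P (z j) (t j).
  rewrite !mxE summxE; congr (_ - _); rewrite Hc.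
  rewrite -(pair_big xpredT xpredT (fun z1 t1 => (c z1 t1 *: vec (z1, t1)) 0 j))/=.
  rewrite (bigD1 (z j))//= [X in _ + X]big1 ?addr0; last first.
    move=> z1 z1j; rewrite big1// => t1 _; rewrite !mxE/= eq_sym (negbTE z1j) mulr0//.
  by apply: eq_bigr => t1 _; rewrite !mxE/= eqxx.
set S := sup_const R d m in HPz.
have S0 : 0 <= S by exact: sqr_ge0.
rewrite nrm2_sum_sqr; under eq_bigr do rewrite Ej.
set r := (2 * m.+1 - d)%N in HPz.
apply: (@le_trans _ _ (p%:R^-1 * (S * h ^+ r * \sum_j B (z j)))).
  rewrite ler_wpM2l ?invr_ge0// mulr_sumr; apply: ler_sum => j _.
  have [_ _ _ H] := HPz (z j); apply: le_trans (H _ (Hz j)) _.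
  by rewrite le_eqVlt; apply/orP; left; apply/eqP; ring.
have hd0 : 0 < h ^+ d by rewrite exprn_gt0.
have HH0 : 0 < H0 ^+ d by rewrite exprn_gt0.
have pR : 0 < p%:R :> R by rewrite ltr0n.
have sum1 : \sum_j B (z j) <= Cd * (1 + p%:R * h ^+ d) * ((2 ^+ d + 1) * E).
  rewrite (partition_big z xpredT)//=.
  apply: (@le_trans _ _ (\sum_z1 Cd * (1 + p%:R * h ^+ d) * B z1)).
    apply: ler_sum => z1 _; rewrite (eq_bigr (fun=> B z1)); last by move=> j /eqP->.
    rewrite sumr_const -[leLHS]mulr_natl ler_wpM2r ?(ltW (B0 z1))//.
    apply: le_trans (ts (corner a0 h z1) h0); rewrite ler_nat.
    by apply/subset_leq_card/fintype.subsetP => j Hj; have /eqP <- : z j == z1 := Hj; rewrite !inE; exact: Hz.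
  have q0 : 0 <= 1 + p%:R * h ^+ d by rewrite addr_ge0// mulr_ge0// (ltW hd0).
  by rewrite -mulr_sumr ler_wpM2l// mulr_ge0.
(* There are at least as many points as cells here, so the additive one in [well_spread] is absorbed
   by [p h^d]. *)
have one : 1 <= p%:R * h ^+ d * (H0 ^+ d)^-1.
  have Nd0 : 0 < N%:R ^+ d :> R by rewrite exprn_gt0.
  have -> : p%:R * h ^+ d * (H0 ^+ d)^-1 = p%:R / N%:R ^+ d.
    rewrite /h expr_div_n; move: HH0 Nd0; move: (H0 ^+ d) (N%:R ^+ d) (p%:R) => x y z' x0 y0.
    by field; rewrite !gt_eqF.
  by rewrite ler_pdivlMr ?exprn_gt0// mul1r -natrX ler_nat.
apply: (@le_trans _ _ (p%:R^-1 * (S * h ^+ r * (Cd * (p%:R * h ^+ d * (1 + (H0 ^+ d)^-1)) * ((2 ^+ d + 1) * E))))).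
  rewrite ler_wpM2l ?invr_ge0// ler_wpM2l ?mulr_ge0 ?exprn_ge0 ?(ltW h0)//.
  apply: le_trans sum1 _; rewrite ler_wpM2r ?mulr_ge0 ?addr_ge0 ?exprn_ge0 ?(ltW E0)//.
  by rewrite ler_wpM2l// mulrDr mulr1 addrC lerD2l.
have hrd : h ^+ r * h ^+ d = H0 ^+ (2 * m.+1) * (2^-1) ^+ (2 * m.+1 * k).
  have rd : (r + d)%N = (2 * m.+1)%N by rewrite /r subnK// (leq_trans _ md)// leq_addr.
  rewrite -exprD rd /h expr_div_n /N natrX -exprM exprVn.
  by rewrite [(k * _)%N]mulnC.
have -> : p%:R^-1 * (S * h ^+ r * (Cd * (p%:R * h ^+ d * (1 + (H0 ^+ d)^-1)) * ((2 ^+ d + 1) * E))) =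
  (span_const - 1) * (2^-1) ^+ (2 * m.+1 * k) * E.
  rewrite /span_const addrK -/S.
  rewrite -[_ * H0 ^+ (2 * m.+1) * _]mulrA -hrd.
  move: hd0 pR; move: (h ^+ d) (h ^+ r) (p%:R) (1 + _) (2 ^+ d + 1) => x y z' u1 u2 x0 z0.
  by field; rewrite gt_eqF.
rewrite ler_wpM2r ?(ltW E0)// ler_wpM2r ?exprn_ge0 ?invr_ge0//.
by rewrite gerBl.
Qed.
End design.

Hypothesis m0 : (0 < m)%N.

(** [oscillation] on cubes centred at the design points, summed by counting overlaps. The constant
    depends on [f], through its first order energy, but neither on the design nor on [h]. *)
Lemma oscillation_sum f (v E : R) : pdiff m.+1 f -> 0 < v -> (dirichlet mu m.+1 f setT <= E%:E)%E ->
  exists C, 0 < C /\ forall p (t : 'I_p -> 'rV[R]_d) (h : R), (0 < p)%N ->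
   (forall j, cube a0 H0 (t j)) -> well_spread Cd t -> 0 < h -> h <= H0 -> v <= p%:R * (2 * h) ^+ d ->
   exists o : 'I_p -> R, [/\ forall j, 0 <= o j,
     forall j x, cube (t j - const_mx h) (2 * h) x -> (f x - f (t j)) ^+ 2 <= o j &
     v / p%:R * \sum_j o j <= C * h ^+ 2].
Proof.
move=> pf v0 HE0.
(* Enlarged so as to contain every cube of half side [h <= H0] centred in the original one. *)
pose K := cube (a0 - const_mx H0) (3 * H0).
have mK : measurable K by exact: measurable_cube.
have mDn i l : (l <= m.+1)%N -> measurable_fun setT (fun x : Rd R d => ((Dn i l f x) ^+ 2)%:E).
  by move=> lm; apply: meas_sq; exact: (Dn_measurable i (ltn0Sn m) pf).
pose EE := `|E| + 1.
have EE0 : 0 < EE by rewrite ltr_wpDl.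
have HE : (dirichlet mu m.+1 f K <= EE%:E)%E.
  apply: (@le_trans _ _ E%:E); last by rewrite lee_fin (le_trans (ler_norm _))// lerDl.
  apply: le_trans HE0; apply: lee_sum => i _.
  exact: (int_sub mu measurableT mK (mDn i m.+1 (leqnn _)) (sq_ge0E _)).
have K0 : 0 < 3 * H0 by rewrite mulr_gt0.
have HEi i : (energy mu m i f (a0 - const_mx H0) (3 * H0) <= EE%:E)%E.
  apply: le_trans HE; rewrite /dirichlet (bigD1 i)//=; apply: leeDl; apply: sume_ge0 => k _.
  by apply: integral_ge0 => x _; exact: sq_ge0E.
have [bf Hbf] := energy_bounded leb d0 md pf K0 HEi.
have [B1 [B10 HB1]] := first_energy_finite leb d0 m0 pf K0 HEi Hbf.
pose E1 := d%:R * B1.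
have E10 : 0 < E1 by rewrite mulr_gt0// ltr0n.
have HE1 : (dirichlet mu 1 f K <= E1%:E)%E.
  apply: (@le_trans _ _ (\sum_(i < d) B1%:E)%E); first by apply: lee_sum => i _; exact: HB1.
  by rewrite sumEFin sumr_const card_ord lee_fin -[leLHS]mulr_natl.
pose os := osc_const R d m.
have os0 : 0 <= os.
  have s0 : 0 <= sup_const R d m by exact: sqr_ge0.
  rewrite /os /osc_const addr_ge0 ?mulr_ge0 ?addr_ge0 ?(ltW (bh_const_gt0 _ _ _)) ?(ltW (inv_const_gt0 _ _ _))//.
pose C0 := 16 * os * (Cd * (1 + v) + 1) * ((2 * H0) ^+ (2 * m) * EE + E1).
have C00 : 0 <= C0.
  rewrite /C0 mulr_ge0//; last by rewrite addr_ge0 ?(ltW E10)// mulr_ge0 ?(ltW EE0)// exprn_ge0// mulr_ge0// ltW.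
  by rewrite mulr_ge0 ?mulr_ge0// addr_ge0// mulr_ge0// addr_ge0// ltW.
exists (C0 + 1); split; first by rewrite ltr_wpDl.
move=> p t h p0 tQ ts h0 hH vp.
have h20 : 0 < 2 * h by rewrite mulr_gt0.
pose Q j := cube (t j - const_mx h) (2 * h).
have QK j : Q j `<=` K.
  move=> x Hx i; have := Hx i; have := tQ j i; rewrite !mxE => /andP[] + + /andP[].
  by move: (x 0 i) (t j 0 i) (a0 0 i) => *; apply/andP; split; lra.
have mQ j : measurable (Q j) by exact: measurable_cube.
pose q := p%:R * (2 * h) ^+ d.
have q0 : 0 < q by exact: lt_le_trans vp.
pose N := Cd * (1 + q).
have N0 : 0 <= N by rewrite mulr_ge0// addr_ge0// ltW.
have HN x : K x -> #|[pred j | x \in Q j]|%:R <= N.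
  move=> _; apply: le_trans (ts (x - const_mx h) (2 * h) h20); rewrite ler_nat.
  apply/subset_leq_card/fintype.subsetP => j; rewrite !inE => Hx i; have := Hx i; rewrite !mxE => /andP[].
  by move: (x 0 i) (t j 0 i) => *; apply/andP; split; lra.
have [B [Bp sB HB]] := local_bounds pf (leqnn _) mK mQ QK N0 HN EE0 HE.
have [B' [Bp' sB' HB']] := local_bounds pf (ltn0Sn m) mK mQ QK N0 HN E10 HE1.
pose o j := os * (((2 * h) ^+ (2 * m.+1) * B j + (2 * h) ^+ 2 * B' j) / (2 * h) ^+ d).
have Ho j : exists c, forall x, Q j x -> (f x - c) ^+ 2 <= o j.
  exact: (oscillation leb d0 md pf h20 (Bp j) (Bp' j) (HB j) (HB' j)).
have tjQ j : Q j (t j).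
  by move=> i; rewrite !mxE; move: (t j 0 i) => u; apply/andP; split; lra.
have o0 j : 0 <= o j by have [c /(_ _ (tjQ j))] := Ho j; apply: le_trans; exact: sqr_ge0.
exists (fun j => 4 * o j); split.
- by move=> j; rewrite mulr_ge0.
- move=> j x Qx; have [c Hc] := Ho j.
  have -> : f x - f (t j) = (f x - c) + - (f (t j) - c) by ring.
  apply: le_trans (sqrD_le2 _ _) _; rewrite sqrrN.
  by have := Hc x Qx; have := Hc _ (tjQ j); move: ((f x - c) ^+ 2) ((f (t j) - c) ^+ 2) (o j) => *; lra.
have -> : \sum_j 4 * o j = 4 * os * ((2 * h) ^+ (2 * m.+1) * \sum_j B j + (2 * h) ^+ 2 * \sum_j B' j) / (2 * h) ^+ d.
  rewrite !mulr_sumr -big_split/= !mulr_sumr mulr_suml; apply: eq_bigr => j _; rewrite /o; ring.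
have hd0 : 0 < (2 * h) ^+ d by rewrite exprn_gt0.
have pR : 0 < p%:R :> R by rewrite ltr0n.
have hpow : (2 * h) ^+ (2 * m.+1) <= (2 * H0) ^+ (2 * m) * (2 * h) ^+ 2.
  rewrite mulnS addnC exprD ler_wpM2r ?sqr_ge0// lerXn2r ?nnegrE ?mulr_ge0 ?(ltW h0) ?(ltW H00)//.
  by rewrite ler_pM2l.
apply: (@le_trans _ _ (v / p%:R * (4 * os * ((2 * H0) ^+ (2 * m) * (2 * h) ^+ 2 * ((N + 1) * EE) + (2 * h) ^+ 2 * ((N + 1) * E1)) / (2 * h) ^+ d))).
  rewrite ler_wpM2l ?divr_ge0 ?(ltW v0)// ler_wpM2r ?invr_ge0 ?(ltW hd0)// ler_wpM2l ?mulr_ge0//.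
  apply: lerD; last by rewrite ler_wpM2l ?sqr_ge0.
  apply: ler_pM => //; first by rewrite exprn_ge0// ltW.
  by apply: sumr_ge0 => j _; exact: ltW.
(* Here [v <= p (2 h)^d] enters: the overlap number, normalised by [q], stays bounded. *)
have fac : v * (N + 1) / q <= Cd * (1 + v) + 1.
  rewrite ler_pdivrMr// /N.
  have h1 : v * Cd <= q * Cd by rewrite ler_wpM2r.
  rewrite -subr_ge0.
  have -> : (Cd * (1 + v) + 1) * q - v * (Cd * (1 + q) + 1) = (q * Cd - v * Cd) + (q - v) by ring.
  by rewrite addr_ge0 ?subr_ge0.
have -> : v / p%:R * (4 * os * ((2 * H0) ^+ (2 * m) * (2 * h) ^+ 2 * ((N + 1) * EE) + (2 * h) ^+ 2 * ((N + 1) * E1)) / (2 * h) ^+ d) =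
  v * (N + 1) / q * (16 * os * ((2 * H0) ^+ (2 * m) * EE + E1) * h ^+ 2).
  by rewrite /q; field; rewrite !gt_eqF// mulr_gt0.
apply: (@le_trans _ _ (C0 * h ^+ 2)); last by rewrite ler_wpM2r ?sqr_ge0// lerDl.
have -> : C0 * h ^+ 2 = (Cd * (1 + v) + 1) * (16 * os * ((2 * H0) ^+ (2 * m) * EE + E1) * h ^+ 2) by rewrite /C0; ring.
apply: ler_wpM2r fac; rewrite mulr_ge0 ?sqr_ge0// mulr_ge0 ?mulr_ge0// addr_ge0 ?(ltW E10)//.
by rewrite mulr_ge0 ?(ltW EE0)// exprn_ge0// mulr_ge0// ltW.
Qed.
End ApproximationBounds.

(** * Growth of a convex risk, and an exponential inequality *)

Section GProps.
Variable R : realType.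
Variable g : R -> R.

(** Convexity continues quadratic growth on [[-e, e]] as linear growth outside. On [|x| <= T] linear
    growth dominates a quadratic of curvature proportional to [1/T]. *)
Lemma growth_bound e T x : convex_real_fun g -> 0 < e ->
  (forall u, `|u| <= e -> e * u ^+ 2 <= g u - g 0) -> e <= T -> `|x| <= T ->
  e ^+ 2 * x ^+ 2 / T <= g x - g 0.
Proof.
move=> cg e0 ge eT xT.
have T0 : 0 < T by exact: lt_le_trans eT.
have [xe|xe] := leP `|x| e.
  apply: le_trans (ge _ xe); rewrite ler_pdivrMr//.
  have -> : e ^+ 2 * x ^+ 2 = e * x ^+ 2 * e by ring.
  by rewrite ler_wpM2l// mulr_ge0 ?sqr_ge0// ltW.
have x0 : 0 < `|x| by exact: lt_trans xe.
pose s := e / `|x|.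
have s0 : 0 < s by rewrite divr_gt0.
have s1 : s <= 1 by rewrite ler_pdivrMr// mul1r ltW.
have sx : `|s * x| = e by rewrite normrM (gtr0_norm s0) /s divfK// gt_eqF.
have c1 : g (s * x) <= s * g x + (1 - s) * g 0.
  by have := cg x 0 s; rewrite mulr0 addr0; apply; rewrite ltW.
have c2 : e * e ^+ 2 <= g (s * x) - g 0.
  have := ge (s * x); rewrite sx lexx => /(_ isT).
  by rewrite -[(s * x) ^+ 2]real_normK ?num_real// sx.
have c3 : e * e ^+ 2 <= s * (g x - g 0) by rewrite mulrBr; lra.
apply: le_trans (_ : e ^+ 2 * `|x| <= _).
  rewrite ler_pdivrMr// -[x ^+ 2]real_normK ?num_real//.
  have -> : e ^+ 2 * `|x| ^+ 2 = e ^+ 2 * `|x| * `|x| by ring.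
  by rewrite ler_wpM2l// mulr_ge0 ?sqr_ge0.
rewrite -(ler_pM2l s0); apply: le_trans c3.
by rewrite /s le_eqVlt; apply/orP; left; apply/eqP; field; rewrite gt_eqF.
Qed.

(** The derivative vanishes at the minimiser, and the mean value theorem is used twice, which gives
    [M] in place of [M / 2]. *)
Lemma quadratic_upper_bound M x : (forall u, u != 0 -> g 0 < g u) ->
  (forall u, derivable g u 1) -> (forall u, derivable (derive1 g) u 1) ->
  (forall u, `|derive1 (derive1 g) u| <= M) -> g x - g 0 <= M * x ^+ 2.
Proof.
move=> gmin dg dg2 HM.
have M0 : 0 <= M by exact: le_trans (HM 0).
have cont (f : R -> R) : (forall u, derivable f u 1) -> continuous f.
  by move=> df u; apply: differentiable_continuous; exact/derivable1_diffP.
have isd (f : R -> R) : (forall u, derivable f u 1) -> forall u : R, is_derive u (1 : R) f (derive1 f u).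
  by move=> df u; apply: DeriveDef => //; rewrite derive1E.
have g'0 : derive1 g 0 = 0.
  have H := @derive1_at_min R g (-1) 1 0 _ _ _ _.
  have [] := H.
  - lra.
  - by move=> t _; exact: dg.
  - by rewrite in_itv/= ltrN10 ltr01.
  - move=> t _; have [->//|t0] := eqVneq t 0; exact/ltW/gmin.
  by move=> _; rewrite derive1E.
have mvt (f : R -> R) (y : R) : (forall u, derivable f u 1) -> exists2 c, `|c| <= `|y| & f y - f 0 = derive1 f c * y.
  move=> df; case: (leP 0 y) => y0.
    have [c Hc E] := MVT_segment y0 (fun u _ => isd _ df u) (continuous_subspaceT (cont _ df)).
    exists c; last by rewrite E subr0.
    by move: Hc; rewrite in_itv/= => /andP[c0 cy]; rewrite !ger0_norm//.
  have [c Hc E] := MVT_segment (ltW y0) (fun u _ => isd _ df u) (continuous_subspaceT (cont _ df)).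
  exists c; last by apply/eqP; rewrite -eqr_opp opprB E sub0r mulrN.
  move: Hc; rewrite in_itv/= => /andP[c0 cy]; rewrite (ltr0_norm y0) ler0_norm//; lra.
have [c cx ->] := mvt g x dg.
have [c' _ ] := mvt (derive1 g) c dg2; rewrite g'0 subr0 => ->.
apply: le_trans (ler_norm _) _; rewrite !normrM -[x ^+ 2]real_normK ?num_real// expr2 -mulrA.
by apply: ler_pM => //; rewrite ?mulr_ge0// ler_wpM2r.
Qed.

(** The linear term disappears on integrating a centred variable. For [x < 1], from
    [1 - x/2 <= exp (- x/2)] follows [exp x (1 - x/2)^2 <= 1], and a polynomial inequality
    remains. *)
Lemma expR_le_quadratic (x : R) : expR x <= x + expR (2 * x ^+ 2).
Proof.
have H2 := expR_ge1Dx (2 * x ^+ 2).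
have [x1|x1] := leP 1 x.
  apply: le_trans (_ : expR (2 * x ^+ 2) <= _); last by rewrite lerDr; lra.
  rewrite ler_expR; apply: le_trans (_ : x * x <= _); first by rewrite ler_peMr//; lra.
  by have := sqr_ge0 x; rewrite expr2; lra.
suff : expR x <= 1 + x + 2 * x ^+ 2 by lra.
have q0 : 0 < 1 - x / 2 by lra.
have h1 : 1 - x / 2 <= expR (- (x / 2)) by rewrite -[leLHS]/(1 + - (x / 2)); exact: expR_ge1Dx.
have h2 : expR x * (1 - x / 2) ^+ 2 <= 1.
  have e1 : expR x * expR (- (x / 2)) ^+ 2 = 1.
    by rewrite expr2 -!expRD -[RHS]expR0; congr expR; lra.
  by rewrite -[leRHS]e1 ler_pM2l ?expR_gt0// lerXn2r ?nnegrE ?expR_ge0// ?e1 ltW.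
have h3 : 1 <= (1 + x + 2 * x ^+ 2) * (1 - x / 2) ^+ 2.
  rewrite -subr_ge0.
  have -> : (1 + x + 2 * x ^+ 2) * (1 - x / 2) ^+ 2 - 1 = x ^+ 2 * ((1 - x) * (5 / 4 - x / 2)) by field.
  by rewrite mulr_ge0 ?sqr_ge0// mulr_ge0; lra.
by rewrite -(ler_pM2r (exprn_gt0 2 q0)); exact: le_trans h2 h3.
Qed.
End GProps.

(** * Independence and integration in two stages *)

Section IndepIntegral.
Variables (R : realType) (dO : measure_display) (Omega : measurableType dO).
Variable P : probability Omega R.
Variables (G1 G2 : set (set Omega)).
Hypothesis mG1 : G1 `<=` measurable.
Hypothesis mG2 : G2 `<=` measurable.
Hypothesis G1I : setI_closed G1.
Hypothesis G1T : G1 setT.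
Hypothesis G12 : forall A B, G1 A -> <<s G2 >> B -> P (A `&` B) = (P A * P B)%E.

Let T1 := g_sigma_algebraType G1.
Let T2 := g_sigma_algebraType G2.

Let sG1 : <<s G1 >> `<=` @measurable _ Omega.
Proof. by apply: smallest_sub => //; exact: sigma_algebra_measurable. Qed.
Let sG2 : <<s G2 >> `<=` @measurable _ Omega.
Proof. by apply: smallest_sub => //; exact: sigma_algebra_measurable. Qed.

Let id1 : Omega -> T1 := fun w => w.
Let id2 : Omega -> T2 := fun w => w.
Let mid1 : measurable_fun setT id1.
Proof. by move=> _ A mA; rewrite setTI; exact: sG1. Qed.
Let mid2 : measurable_fun setT id2.
Proof. by move=> _ A mA; rewrite setTI; exact: sG2. Qed.
HB.instance Definition _ := isMeasurableFun.Build _ _ _ _ id1 mid1.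
HB.instance Definition _ := isMeasurableFun.Build _ _ _ _ id2 mid2.
Let P1 := distribution P id1.
Let P2 := distribution P id2.

Let indep_sigma A B : <<s G1 >> A -> <<s G2 >> B -> P (A `&` B) = (P A * P B)%E.
Proof.
move=> sA sB; have mB := sG2 sB.
have PBf : P B \is a fin_num by exact: fin_num_measure.
pose c : {nonneg R} := NngNum (fine_ge0 (measure_ge0 P B)).
pose m1 := measure_function_pushforward__canonical__measure_function_Measure (mrestr P mB) mid1.
pose m2 : {measure set T1 -> \bar R} := mscale c P1.
suff : m1 A = m2 A.
  rewrite -[m1 A]/(P (A `&` B)) => ->; rewrite -[m2 A]/((fine (P B))%:E * P A)%E.
  by rewrite fineK// muleC.
apply: (@measure_unique _ R T1 G1 (fun=> setT) _ _ _ _ m1 m2) => //.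
- by apply/seteqP; split => // x _; exists 0%N.
- move=> A' GA'; rewrite -[m1 A']/(P (A' `&` B)) -[m2 A']/((fine (P B))%:E * P A')%E.
  rewrite fineK// muleC; apply: G12 => //; exact: sB.
- move=> n; rewrite -[m1 setT]/(P (setT `&` B)) setTI.
  by rewrite (le_lt_trans (probability_le1 P mB))// ltry.
Qed.

(** Under independence the diagonal map sends [P] to the product of its restrictions to the two
    sigma-algebras, so Tonelli applies to functions measurable for their product. Independence is
    assumed on the intersection-stable class [G1] and extends by uniqueness of measures. *)
Lemma indep_integral (F : T1 * T2 -> \bar R) : measurable_fun setT F -> (forall z, (0 <= F z)%E) ->
  (\int[P]_w F (w, w) = \int[P]_w \int[P]_w' F (w, w'))%E.
Proof.
move=> mF F0.
pose D : Omega -> T1 * T2 := fun w => (w, w).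
have mD : measurable_fun setT D by apply: measurable_fun_pair; [exact: mid1|exact: mid2].
pose Q := measure_function_pushforward__canonical__measure_function_Measure P mD.
have QE A : measurable A -> (P1 \x P2)%E A = Q A.
  apply: product_measure_unique => B C mB mC.
  rewrite -[Q _]/(P (B `&` C)); exact: indep_sigma.
transitivity (\int[Q]_z F z)%E.
  by rewrite -[RHS]/(\int[pushforward P D]_z F z)%E (@ge0_integral_pushforward _ _ _ _ _ _ mD).
rewrite -(@eq_measure_integral _ _ _ _ _ (P1 \x P2)%E); last by move=> A mA _; exact: QE.
rewrite (fubini_tonelli1 (m1 := P1) (m2 := P2))//.
have mFF : measurable_fun setT (fubini_F P2 F).
  exact: (@measurable_fun_fubini_tonelli_F _ _ _ _ _ P2 F).
rewrite -[LHS]/(\int[pushforward P id1]_x (fubini_F P2 F) x)%E.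
rewrite (@ge0_integral_pushforward _ _ _ _ _ _ mid1)//; last first.
  by move=> x _; apply: integral_ge0.
apply: eq_integral => w _ /=; rewrite /fubini_F.
rewrite -[LHS]/(\int[pushforward P id2]_y F (w, y))%E.
rewrite (@ge0_integral_pushforward _ _ _ _ _ _ mid2)//.
exact: (measurableT_comp mF (measurable_fun_pair (measurable_cst (w : T1)) (@measurable_id _ T2 setT))).
Qed.
End IndepIntegral.

Lemma bigsetI_seqP (T : Type) (I : eqType) (s : seq I) (E : I -> set T) x :
  (\big[setI/setT]_(q <- s) E q) x <-> forall q, q \in s -> E q x.
Proof.
elim: s => [|q s IH]; first by rewrite big_nil; split.
rewrite big_cons; split => [[Eq /IH H] q'|H].
  by rewrite inE => /orP[/eqP->|/H].
split; first by apply: H; rewrite mem_head.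
by apply/IH => q' q's; apply: H; rewrite inE q's orbT.
Qed.

Lemma integral_cst_prob (R : realType) d (T : measurableType d) (P : probability T R) (c : R) :
  (\int[P]_w c%:E = c%:E)%E.
Proof. by rewrite integral_cst//= probability_setT mule1. Qed.

(** * Conditional exponential moments of loss increments *)

Section ExpMoment.
Variables (R : realType) (d : nat) (dO : measure_display) (Omega : measurableType dO).
Variable P : probability Omega R.
Variables (X : Omega -> 'rV[R]_d -> R) (Xs : nat -> Omega -> 'rV[R]_d -> R) (eps : nat -> Omega -> R).
Hypothesis iid : iid_data P X Xs eps.

Let mXs i t : measurable_fun setT (fun w => Xs i w t).
Proof.
have [mX _] := iid.
rewrite (_ : (Xs i)^~ t = (fun z : Omega * Rd R d => Xs i z.1 z.2) \o (fun w => (w, t : Rd R d)))//.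
apply: measurableT_comp; first exact: mX.
exact: pair2_measurable.
Qed.

Let meps i : measurable_fun setT (eps i).
Proof. by have [_ [me _]] := iid; exact: me. Qed.

Lemma data_sigma_measurable q : data_sigma Xs eps q `<=` @measurable _ Omega.
Proof.
case: q => i; apply: smallest_sub; try exact: sigma_algebra_measurable.
  by move=> _ [t _ [B mB <-]]; rewrite -[X in measurable X]setTI; exact: mXs.
by move=> _ [B mB <-]; rewrite -[X in measurable X]setTI; exact: meps.
Qed.

Lemma data_sigma_algebra q : sigma_algebra setT (data_sigma Xs eps q).
Proof. by case: q => i; exact: smallest_sigma_algebra. Qed.

(** An intersection-stable class generating everything except the noise [eps k]. Finite lists are
    used because mutual independence is stated for finite families of events. *)
Definition rest_system (k : nat) : set (set Omega) :=
  [set A | exists s E, [/\ uniq s, inr k \notin s,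
     forall q, q \in s -> data_sigma Xs eps q (E q) & A = \big[setI/setT]_(q <- s) E q]].

Lemma rest_systemI k : setI_closed (rest_system k).
Proof.
move=> _ _ [s [E [us ks HE ->]]] [s' [E' [us' ks' HE' ->]]].
pose E'' q := (if q \in s then E q else setT) `&` (if q \in s' then E' q else setT).
exists (undup (s ++ s')), E''; split.
- exact: undup_uniq.
- by rewrite mem_undup mem_cat negb_or ks.
- move=> q _; have [H0 HC HU] := data_sigma_algebra q.
  have HT : data_sigma Xs eps q setT by rewrite -(setD0 setT); exact: HC.
  have HI A B : data_sigma Xs eps q A -> data_sigma Xs eps q B -> data_sigma Xs eps q (A `&` B).
    by case: (q) => j sA sB; exact: (@measurableI _ (g_sigma_algebraType _) A B sA sB).
  by apply: HI; case: ifP => // ?; [exact: HE|exact: HE'].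
apply/seteqP; split => x.
  move=> [/bigsetI_seqP H /bigsetI_seqP H']; apply/bigsetI_seqP => q _.
  by split; case: ifP => // ?; [exact: H|exact: H'].
move=> /bigsetI_seqP H; split; apply/bigsetI_seqP => q qs.
  by have := H q; rewrite mem_undup mem_cat qs => /(_ isT); rewrite /E'' qs => -[].
by have := H q; rewrite mem_undup mem_cat qs orbT => /(_ isT); rewrite /E'' qs => -[].
Qed.

Lemma rest_system_indep k A B : rest_system k A -> data_sigma Xs eps (inr k) B ->
  P (A `&` B) = (P A * P B)%E.
Proof.
have [_ [_ [_ [_ indep]]]] := iid.
move=> [s [E [us ks HE ->]]] HB.
pose E' q := if q == inr k then B else E q.
have EE q : q \in s -> E' q = E q.
  by move=> qs; rewrite /E'; case: eqP qs ks => // -> ->.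
have us' : uniq (inr k :: s) by rewrite /= ks us.
have HE' q : q \in inr k :: s -> data_sigma Xs eps q (E' q).
  rewrite inE => /orP[/eqP->|qs]; first by rewrite /E' eqxx.
  by rewrite EE//; exact: HE.
have := indep _ _ us' HE'; rewrite !big_cons.
have -> : E' (inr k) = B by rewrite /E' eqxx.
have -> : \big[setI/setT]_(q <- s) E' q = \big[setI/setT]_(q <- s) E q.
  by apply: eq_big_seq => q qs; exact: EE.
have -> : (\prod_(q <- s) P (E' q) = \prod_(q <- s) P (E q))%E.
  by apply: eq_big_seq => q qs; rewrite EE.
by rewrite setIC => ->; rewrite (indep _ _ us HE) muleC.
Qed.

Variables (rho : R -> R) (C2 : R).
Hypothesis rho0 : forall x, 0 <= rho x.
Hypothesis rhoL : forall x y, `|rho x - rho y| <= C2 * `|x - y|.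
Hypothesis rhoI : forall u : R, P.-integrable [set: Omega] (fun w => (rho (eps 0%N w + u))%:E).
Let g := fun u : R => fine (\int[P]_w (rho (eps 0%N w + u))%:E).

Lemma lipschitz_measurable (f : R -> R) (C : R) : (forall x y, `|f x - f y| <= C * `|x - y|) ->
  measurable_fun setT f.
Proof.
move=> fL; apply: continuous_measurable_fun => x; apply/cvgrPdist_le => e e0.
have C0 : 0 < `|C| + 1 by rewrite ltr_wpDl.
exists (e / (`|C| + 1)) => /=; first by rewrite divr_gt0.
move=> y /= xy; apply: le_trans (fL _ _) _.
apply: le_trans (_ : (`|C| + 1) * `|x - y| <= _).
  by rewrite ler_wpM2r// ler_wpDr ?ler_norm.
by rewrite mulrC -ler_pdivlMr// ltW.
Qed.

Lemma rho_meas : measurable_fun setT rho. Proof. exact: lipschitz_measurable rhoL. Qed.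

Lemma int_eps_k k (u : R) : (\int[P]_w (rho (eps k w + u))%:E = (g u)%:E)%E.
Proof.
have [_ [_ [_ [law _]]]] := iid.
pose f (x : R) : \bar R := (rho (x + u))%:E.
have mf : measurable_fun setT f.
  apply/measurable_EFinP; apply: (measurableT_comp rho_meas); exact: measurable_funD.
have f0 x : (0 <= f x)%E by rewrite lee_fin.
have E j : (\int[P]_w f (eps j w) = \int[pushforward P (eps j)]_x f x)%E.
  by rewrite (@ge0_integral_pushforward _ _ _ _ _ _ (meps j)).
have -> : (\int[P]_w (rho (eps k w + u))%:E = \int[P]_w (rho (eps 0%N w + u))%:E)%E.
  rewrite -[LHS]/(\int[P]_w f (eps k w))%E -[RHS]/(\int[P]_w f (eps 0%N w))%E !E.
  by apply: eq_measure_integral => B mB _; rewrite /pushforward; exact: law.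
by rewrite fineK//; apply: integrable_fin_num.
Qed.

Lemma g_lipschitz x y : `|g x - g y| <= C2 * `|x - y|.
Proof.
have If u : P.-integrable setT (EFin \o (fun w => rho (eps 0%N w + u))) by exact: rhoI.
have -> : g x - g y = fine (\int[P]_w ((rho (eps 0%N w + x) - rho (eps 0%N w + y))%:E))%E.
  have := integralB measurableT (If x) (If y); rewrite /g => H.
  rewrite -fineB ?integrable_fin_num//; congr fine.
  by rewrite -H//.
apply: (@le_trans _ _ (fine (\int[P]_w (C2 * `|x - y|)%:E))); last first.
  by rewrite integral_cst_prob.
have Id : P.-integrable setT (EFin \o (fun w => rho (eps 0%N w + x) - rho (eps 0%N w + y))).
  exact: integrableB (If x) (If y).
rewrite -lee_fin -abse_EFin fineK ?integrable_fin_num// fineK; last first.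
  by rewrite integral_cst_prob.
apply: le_trans (le_abse_integral _ _ _) _ => //; first by case/integrableP: Id.
apply: ge0_le_integral => //.
- by apply: measurableT_comp => //; case/integrableP: Id.
- by move=> w _; rewrite lee_fin; apply: le_trans (rhoL _ _) _; rewrite opprD addrACA subrr add0r.
Qed.

(** The centred increment [W] satisfies [|W| <= 2 C2 |a - b|], and [expR_le_quadratic] replaces
    [exp (theta W)] by [theta W + exp (2 theta^2 W^2)]. The constant 8 is 2 times the square of that
    2. *)
Lemma exp_moment k (a b theta : R) :
  (\int[P]_w (expR (theta * (rho (eps k w + a) - rho (eps k w + b) - (g a - g b))
      - 8 * theta ^+ 2 * C2 ^+ 2 * (a - b) ^+ 2))%:E <= 1)%E.
Proof.
pose W w := rho (eps k w + a) - rho (eps k w + b) - (g a - g b).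
pose c := 8 * theta ^+ 2 * C2 ^+ 2 * (a - b) ^+ 2.
have mr u : measurable_fun setT (fun w => rho (eps k w + u)).
  by apply: (measurableT_comp rho_meas); apply: measurable_funD => //; exact: meps.
have Ir u : P.-integrable setT (EFin \o (fun w => rho (eps k w + u))).
  apply/integrableP; split; first by apply/measurable_EFinP; exact: mr.
  rewrite (_ : (\int[P]_x _ = (g u)%:E)%E) ?ltry// -(int_eps_k k u).
  by apply: eq_integral => w _ /=; rewrite ger0_norm.
have mW : measurable_fun setT W by apply: measurable_funB => //; apply: measurable_funB; exact: mr.
have IW : P.-integrable setT (EFin \o W).
  apply: (@integrableB _ _ _ P setT measurableT (EFin \o (fun w => rho (eps k w + a) - rho (eps k w + b)))
    (EFin \o cst (g a - g b))).
    exact: integrableB (Ir a) (Ir b).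
  exact: finite_measure_integrable_cst.
have W0 : (\int[P]_w (W w)%:E = 0)%E.
  have I1 := integrableB measurableT (Ir a) (Ir b).
  have I2 : P.-integrable setT (EFin \o cst (g a - g b)) by exact: finite_measure_integrable_cst.
  have := integralB measurableT I1 I2.
  rewrite (integralB measurableT (Ir a) (Ir b)) /= !int_eps_k integral_cst_prob.
  by rewrite -!EFinB subrr => H; rewrite -[RHS]H; apply: eq_integral.
have WB w : (theta * W w) ^+ 2 <= 4 * theta ^+ 2 * C2 ^+ 2 * (a - b) ^+ 2.
  have h1 : `|W w| <= 2 * (C2 * `|a - b|).
    apply: le_trans (ler_normB _ _) _; rewrite mulr2n mulrDl mul1r; apply: lerD.
      by apply: le_trans (rhoL _ _) _; rewrite opprD addrACA subrr add0r.
    exact: g_lipschitz.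
  have h2 : (W w) ^+ 2 <= (2 * (C2 * `|a - b|)) ^+ 2.
    by rewrite -[leLHS]real_normK ?num_real// lerXn2r ?nnegrE// (le_trans _ h1).
  rewrite exprMn; apply: le_trans (_ : theta ^+ 2 * (2 * (C2 * `|a - b|)) ^+ 2 <= _).
    by rewrite ler_wpM2l// sqr_ge0.
  by rewrite !exprMn real_normK ?num_real// le_eqVlt; apply/orP; left; apply/eqP; ring.
apply: le_trans (_ : \int[P]_w ((expR (- c) * theta * W w + 1)%:E) <= _)%E.
  apply: ge0_le_integral => //.
  - by apply/measurable_EFinP; apply: measurableT_comp => //; apply: measurable_funB => //; exact: measurable_funM.
  - by apply/measurable_EFinP; apply: measurable_funD => //; exact: measurable_funM.
  move=> w _; rewrite lee_fin -/c -/(W w) addrC expRD.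
  apply: le_trans (_ : expR (- c) * (theta * W w + expR c) <= _).
    rewrite ler_pM2l ?expR_gt0//; apply: le_trans (expR_le_quadratic _) _.
    rewrite lerD2l ler_expR; have := WB w; rewrite /c; lra.
  by rewrite mulrDr mulrA lerD2l -expRD addNr expR0.
have I1 : P.-integrable setT (fun w => ((expR (- c) * theta)%:E * (W w)%:E)%E) by exact: integrableZl.
have I2 : P.-integrable setT (fun w => (1%:E : \bar R)) by exact: finite_measure_integrable_cst.
under eq_integral do rewrite EFinD EFinM.
rewrite (integralD measurableT I1 I2) (integralZl measurableT IW) W0 mule0 add0e.
by rewrite integral_cst_prob.
Qed.

(** The variance bound is subtracted inside the exponent since [x] and [y] will be functions of the
    random covariates. *)
Definition exp_incr (theta e x y : R) : R :=
  theta * (rho (e + x) - rho (e + y) - (g x - g y)) - 8 * theta ^+ 2 * C2 ^+ 2 * (x - y) ^+ 2.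

Lemma measurable_exp_incr d1 (T : measurableType d1) theta (e x y : T -> R) :
  measurable_fun setT e -> measurable_fun setT x -> measurable_fun setT y ->
  measurable_fun setT (fun t => exp_incr theta (e t) (x t) (y t)).
Proof.
move=> me mx my.
have mg : measurable_fun setT g by exact: lipschitz_measurable g_lipschitz.
have mr (z : T -> R) : measurable_fun setT z -> measurable_fun setT (fun t => rho (e t + z t)).
  by move=> mz; apply: (measurableT_comp rho_meas); exact: measurable_funD.
apply: measurable_funB.
  apply: measurable_funM => //; apply: measurable_funB.
    by apply: measurable_funB; exact: mr.
  by apply: measurable_funB; exact: (measurableT_comp mg).
by apply: measurable_funM => //; apply: measurable_funX; exact: measurable_funB.
Qed.

Section product.
Variables (a b : nat -> Omega -> R) (theta : R).
Hypothesis ma : forall i (B : set R), measurable B -> data_sigma Xs eps (inl i) (a i @^-1` B).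
Hypothesis mb : forall i (B : set R), measurable B -> data_sigma Xs eps (inl i) (b i @^-1` B).

Let in_rest k q A : q != inr k -> data_sigma Xs eps q A -> rest_system k A.
Proof.
move=> qk HA; exists [:: q], (fun=> A); split => //.
- by rewrite inE eq_sym.
- by move=> q'; rewrite inE => /eqP->.
by rewrite big_cons big_nil setIT.
Qed.

Let rest_measurable k : rest_system k `<=` @measurable _ Omega.
Proof.
move=> _ [s [E [_ _ HE ->]]].
elim: s HE => [|q s IH] HE; first by rewrite big_nil.
rewrite big_cons; apply: measurableI.
  by apply: (@data_sigma_measurable q); apply: HE; rewrite mem_head.
by apply: IH => q' q's; apply: HE; rewrite inE q's orbT.
Qed.

(** The last noise is independent of all covariates and of the earlier noises. Integrating it first
    leaves a factor at most one by [exp_moment], as for a supermartingale. *)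
Lemma exp_product n :
  (\int[P]_w (\prod_(i < n) expR (exp_incr theta (eps i w) (a i w) (b i w)))%:E <= 1)%E.
Proof.
elim: n => [|n IH].
  under eq_integral do rewrite big_ord0.
  by rewrite integral_cst_prob.
pose G1 := rest_system n; pose G2 := data_sigma Xs eps (inr n).
pose T1 := g_sigma_algebraType G1; pose T2 := g_sigma_algebraType G2.
have m1 q (f : Omega -> R) : q != inr n -> (forall B, measurable B -> data_sigma Xs eps q (f @^-1` B)) ->
    measurable_fun setT (f : T1 -> R).
  move=> qn Hf _ B mB; rewrite setTI; apply: sub_sigma_algebra; apply: (in_rest qn); exact: Hf.
have meps_sigma i (B : set R) : measurable B -> data_sigma Xs eps (inr i) (eps i @^-1` B).
  by move=> mB; apply: sub_sigma_algebra; exists B.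
(* Covariates and earlier noises are read from the first copy of the sample space, the noise [eps n]
   from the second. *)
pose F (z : T1 * T2) : \bar R := ((\prod_(i < n) expR (exp_incr theta (eps i z.1) (a i z.1) (b i z.1))) *
   expR (exp_incr theta (eps n z.2) (a n z.1) (b n z.1)))%:E.
have mF : measurable_fun setT F.
  apply/measurable_EFinP; apply: measurable_funM.
    apply: measurable_prod => i _; apply: measurableT_comp => //; apply: measurable_exp_incr.
    - apply: measurableT_comp measurable_fst; apply: (m1 (inr (i : nat))); last exact: meps_sigma.
      by apply/eqP => -[E]; move: (ltn_ord i); rewrite E ltnn.
    - by apply: measurableT_comp measurable_fst; apply: (m1 (inl (i : nat))) => //; exact: ma.
    - by apply: measurableT_comp measurable_fst; apply: (m1 (inl (i : nat))) => //; exact: mb.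
  apply: measurableT_comp => //; apply: measurable_exp_incr.
  - apply: measurableT_comp measurable_snd => _ B mB; rewrite setTI.
    by apply: sub_sigma_algebra; exact: meps_sigma.
  - by apply: measurableT_comp measurable_fst; apply: (m1 (inl n)) => //; exact: ma.
  - by apply: measurableT_comp measurable_fst; apply: (m1 (inl n)) => //; exact: mb.
have F0 z : (0 <= F z)%E.
  by rewrite lee_fin mulr_ge0 ?expR_ge0// prodr_ge0// => i _; exact: expR_ge0.
have G1T : G1 setT.
  by exists [::], (fun=> setT); split => //; rewrite big_nil.
have G12 A B : G1 A -> <<s G2 >> B -> P (A `&` B) = (P A * P B)%E.
  move=> HA HB; apply: (rest_system_indep HA).
  apply: (smallest_sub _ _ HB) => //; exact: data_sigma_algebra.
have := indep_integral (@rest_measurable n) (@data_sigma_measurable (inr n)) (@rest_systemI n) G1T G12 mF F0.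
rewrite /F/= => E.
under eq_integral do rewrite big_ord_recr/=.
rewrite E; apply: le_trans IH.
have ma' i : measurable_fun setT (a i).
  by move=> _ B mB; rewrite setTI; apply: (@data_sigma_measurable (inl i)); exact: ma.
have mb' i : measurable_fun setT (b i).
  by move=> _ B mB; rewrite setTI; apply: (@data_sigma_measurable (inl i)); exact: mb.
have mprod : measurable_fun setT (fun w => \prod_(i < n) expR (exp_incr theta (eps i w) (a i w) (b i w))).
  apply: measurable_prod => i _; apply: measurableT_comp => //.
  by apply: measurable_exp_incr; [exact: meps|exact: ma'|exact: mb'].
apply: (@le_trans _ _ (\int[P]_w ((\prod_(i < n) expR (exp_incr theta (eps i w) (a i w) (b i w)))%:E * 1))%E); last first.
  by under eq_integral do rewrite mule1.
have inner w : (\int[P]_w' ((\prod_(i < n) expR (exp_incr theta (eps i w) (a i w) (b i w)) *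
     expR (exp_incr theta (eps n w') (a n w) (b n w)))%:E) <=
     (\prod_(i < n) expR (exp_incr theta (eps i w) (a i w) (b i w)))%:E * 1)%E.
  under eq_integral do rewrite EFinM.
  have p0 : 0 <= \prod_(i < n) expR (exp_incr theta (eps i w) (a i w) (b i w)).
    by rewrite prodr_ge0// => i _; exact: expR_ge0.
  have mi : measurable_fun setT (fun w' => (expR (exp_incr theta (eps n w') (a n w) (b n w)))%:E).
    apply/measurable_EFinP; apply: measurableT_comp => //.
    by apply: measurable_exp_incr => //; exact: meps.
  have i0 w' : (0 <= (expR (exp_incr theta (eps n w') (a n w) (b n w)))%:E)%E by rewrite lee_fin expR_ge0.
  rewrite (int_scale P measurableT p0 mi i0).
  by apply: lee_wpmul2l; [rewrite lee_fin|exact: exp_moment].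
have iprod0 w : (0 <= \int[P]_w' ((\prod_(i < n) expR (exp_incr theta (eps i w) (a i w) (b i w)) *
     expR (exp_incr theta (eps n w') (a n w) (b n w)))%:E))%E.
  by apply: integral_ge0 => w' _; exact: (F0 (w, w')).
have mF2 : measurable_fun setT (fun z : Omega * Omega => ((\prod_(i < n) expR (exp_incr theta (eps i z.1) (a i z.1) (b i z.1))) *
   expR (exp_incr theta (eps n z.2) (a n z.1) (b n z.1)))%:E).
  apply/measurable_EFinP; apply: measurable_funM.
    exact: (measurableT_comp mprod measurable_fst).
  apply: measurableT_comp => //; apply: measurable_exp_incr.
  - exact: (measurableT_comp (meps n) measurable_snd).
  - exact: (measurableT_comp (ma' n) measurable_fst).
  - exact: (measurableT_comp (mb' n) measurable_fst).
apply: ge0_le_integral => //.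
- pose F2 (z : Omega * Omega) := ((\prod_(i < n) expR (exp_incr theta (eps i z.1) (a i z.1) (b i z.1))) *
   expR (exp_incr theta (eps n z.2) (a n z.1) (b n z.1)))%:E.
  have F20 z : (0 <= F2 z)%E.
    by rewrite lee_fin mulr_ge0 ?expR_ge0// prodr_ge0// => i _; exact: expR_ge0.
  exact: (@measurable_fun_fubini_tonelli_F _ _ _ _ _ P F2).
- by under eq_fun do rewrite mule1; apply/measurable_EFinP.
Qed.

Lemma exp_tail n (x : R) : measurable [set w | x < \sum_(i < n) exp_incr theta (eps i w) (a i w) (b i w)] /\
  (P [set w | (x < \sum_(i < n) exp_incr theta (eps i w) (a i w) (b i w))%R] <= (expR (- x)%R)%:E)%E.
Proof.
have ma' i : measurable_fun setT (a i).
  by move=> _ B mB; rewrite setTI; apply: (@data_sigma_measurable (inl i)); exact: ma.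
have mb' i : measurable_fun setT (b i).
  by move=> _ B mB; rewrite setTI; apply: (@data_sigma_measurable (inl i)); exact: mb.
pose S w := \sum_(i < n) exp_incr theta (eps i w) (a i w) (b i w).
have mS : measurable_fun setT S.
  by apply: measurable_sum => i; apply: measurable_exp_incr; [exact: meps|exact: ma'|exact: mb'].
have mA : measurable [set w | x < S w].
  rewrite (_ : mkset _ = S @^-1` `]x, +oo[%classic).
    by rewrite -[X in measurable X]setTI; exact: mS.
  by apply/seteqP; split => w /=; rewrite in_itv/= andbT.
split => //.
have e0 : 0 < expR x by exact: expR_gt0.
have : ((expR x)%:E * P [set w | (x < S w)%R] <= 1)%E.
  apply: le_trans (exp_product n).
  rewrite -integral_cst//.
  apply: le_trans (_ : \int[P]_(w in [set w | (x < S w)%R]) (expR (S w))%:E <= _)%E.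
    apply: ge0_le_integral => //.
    - by move=> w _; rewrite lee_fin ltW.
    - by apply: measurable_funTS; apply/measurable_EFinP; exact: measurableT_comp.
    by move=> w /= xw; rewrite lee_fin ler_expR ltW.
  apply: le_trans (_ : \int[P]_w (expR (S w))%:E <= _)%E.
    have mE : measurable_fun setT (fun w => (expR (S w))%:E).
      by apply/measurable_EFinP; exact: measurableT_comp.
    have E0 w : (0 <= (expR (S w))%:E)%E by rewrite lee_fin expR_ge0.
    exact: (int_sub P measurableT mA mE E0 (@subsetT _ _)).
  rewrite le_eqVlt; apply/orP; left; apply/eqP; apply: eq_integral => w _.
  by rewrite /S expR_sum.
by rewrite expRN -[(expR x)^-1]mulr1 EFinM lee_pdivlMl.
Qed.
End product.
End ExpMoment.

(** * Pure derivatives and the penalty *)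

Section PureDerivatives.
Variables (R : realType) (d m : nat) (mu : {measure set Rd R d -> \bar R}).

Definition pure_index (i : 'I_d) : {ffun 'I_d -> 'I_m.+1} := [ffun j => if j == i then ord_max else ord0].

Lemma mi_seq_pure i : mi_seq (fun j => pure_index i j : nat) = nseq m i.
Proof.
rewrite /mi_seq.
have H (s : seq 'I_d) : uniq s ->
    flatten [seq nseq (pure_index i j) j | j <- s] = if i \in s then nseq m i else [::].
  elim: s => //= j s IH /andP[js us]; rewrite ffunE inE IH//.
  have [jE|ji] := eqVneq j i; first by rewrite -jE (negbTE js)/= cats0.
  by [].
by rewrite H ?enum_uniq// mem_enum.
Qed.

Lemma sum_pure i : (\sum_j (pure_index i j : nat) = m)%N.
Proof.
rewrite (bigD1 i)//= ffunE eqxx big1 ?addn0// => j ji.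
by rewrite ffunE (negbTE ji).
Qed.

Lemma inHm_pdiff f : inHm mu m f -> pdiff m f.
Proof. by move=> [H _] i; rewrite -mi_seq_pure; apply: H; exact: sum_pure. Qed.

Lemma Im2_ge0 f : (0 <= Im2 mu m f)%E.
Proof.
apply: sume_ge0 => a _; apply: mule_ge0.
  by rewrite lee_fin /multinom divr_ge0.
by apply: integral_ge0 => x _; rewrite lee_fin sqr_ge0.
Qed.

Lemma pure_le_Im2 f i : (\int[mu]_(x in [set: Rd R d]) ((Dn i m f x) ^+ 2)%:E <= Im2 mu m f)%E.
Proof.
rewrite /Im2 (bigD1 (pure_index i))/=; last by apply/eqP; exact: sum_pure.
have -> : multinom R m (fun j => pure_index i j) = 1.
  rewrite /multinom (bigD1 i)//= ffunE eqxx/= big1 ?muln1 ?divff ?pnatr_eq0 -?lt0n ?fact_gt0//.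
  by move=> j ji; rewrite ffunE (negbTE ji).
rewrite mul1e mi_seq_pure; apply: leeDl.
apply: sume_ge0 => a _; apply: mule_ge0.
  by rewrite lee_fin /multinom divr_ge0.
by apply: integral_ge0 => x _; rewrite lee_fin sqr_ge0.
Qed.

Lemma dirichlet_le_Im2 f : (dirichlet mu m f setT <= d%:R%:E * Im2 mu m f)%E.
Proof.
have := sum_const_ge0 ('I_d : {pred 'I_d}) (Im2_ge0 f); rewrite card_ord => <-.
by apply: lee_sum => i _; exact: pure_le_Im2.
Qed.

Lemma dirichlet_sub f g : (0 < m)%N -> inHm mu m f -> inHm mu m g ->
  (dirichlet mu m (f - g)%R setT <= (2 * d%:R * (fine (Im2 mu m f) + fine (Im2 mu m g)))%:E)%E.
Proof.
move=> m0 Hf Hg; have pf := inHm_pdiff Hf; have pg := inHm_pdiff Hg.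
have mD (k : 'rV[R]_d -> R) i : pdiff m k -> measurable_fun setT (Dn i m k : Rd R d -> R).
  by move=> pk; exact: (Dn_measurable i m0 pk (leqnn _)).
have fI k : inHm mu m k -> Im2 mu m k \is a fin_num.
  by move=> [_ Hk]; rewrite ge0_fin_numE ?Im2_ge0.
have two0 : (0 <= 2%:E :> \bar R)%E by [].
apply: (@le_trans _ _ (\sum_(i < d) (2%:E * Im2 mu m f + 2%:E * Im2 mu m g))%E).
  apply: lee_sum => i _.
  have [_ ->] := DnB i pf pg; last exact: leqnn.
  have mN : measurable_fun setT (fun x : Rd R d => - Dn i m g x) by apply: measurableT_comp => //; exact: mD.
  apply: le_trans (int_sqrD_le mu measurableT (mD f i pf) mN) _.
  apply: leeD; apply: lee_wpmul2l => //; first exact: pure_le_Im2.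
  by under eq_integral do rewrite sqrrN; exact: pure_le_Im2.
rewrite -(fineK (fI _ Hf)) -(fineK (fI _ Hg)) -!EFinM -EFinD sumEFin sumr_const card_ord lee_fin /=.
by rewrite -[leLHS]mulr_natl le_eqVlt; apply/orP; left; apply/eqP; ring.
Qed.
End PureDerivatives.

(** * Quantisation of an integral against a bounded function *)

Section Quantizer.
Context d1 (T : measurableType d1).

(** The first set of the list containing the point decides, which is a measurable choice even when
    the sets overlap. *)
Lemma quantizer (J : eqType) (j0 : J) (s : seq (set T * J)) : (forall e, e \in s -> measurable e.1) ->
  exists sigma : T -> J, (forall j, measurable [set t | sigma t = j]) /\
    forall t, (exists2 e, e \in s & e.1 t) -> exists2 A, (A, sigma t) \in s & A t.
Proof.
elim: s => [_|[A j] s IH HA].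
  exists (fun=> j0); split; last by move=> t [].
  move=> j; have [<-|j0j] := eqVneq j0 j.
    by rewrite (_ : mkset _ = setT)//; apply/seteqP; split.
  by rewrite (_ : mkset _ = set0)//; apply/seteqP; split => // t /= /eqP; rewrite (negbTE j0j).
have [sigma [ms Hs]] : exists sigma : T -> J, (forall j, measurable [set t | sigma t = j]) /\
    forall t, (exists2 e, e \in s & e.1 t) -> exists2 A, (A, sigma t) \in s & A t.
  by apply: IH => e es; apply: HA; rewrite inE es orbT.
have mA : measurable A by apply: (HA (A, j)); rewrite mem_head.
exists (fun t => if t \in A then j else sigma t); split.
  move=> k; have [jk|jk] := eqVneq j k.
    rewrite (_ : mkset _ = A `|` [set t | sigma t = k]); first exact: measurableU.
    apply/seteqP; split => t /=; first by case: ifPn => [|_]; [rewrite inE; left|right].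
    by move=> [At|tk]; [rewrite mem_set|case: ifP].
  rewrite (_ : mkset _ = ~` A `&` [set t | sigma t = k]); first by apply: measurableI => //; exact: measurableC.
  apply/seteqP; split => t /=; first by case: ifPn => [_ /eqP|]; rewrite ?(negbTE jk)// notin_setE.
  by move=> [At <-]; rewrite memNset.
move=> t Ht; case: ifPn => [|/negP]; rewrite inE => At; first by exists A => //; rewrite mem_head.
have [|B Bs Bt] := Hs t; last by exists B => //; rewrite inE Bs orbT.
by have [e] := Ht; rewrite inE => /orP[/eqP->//|es et]; exists e.
Qed.

Variables (R : realType) (mu : {measure set T -> \bar R}).

Lemma markov_ge0 (f : T -> \bar R) (c : R) : measurable_fun setT f -> (forall x, 0 <= f x)%E -> 0 < c ->
  measurable [set x | (c%:E < f x)%E] /\ (mu [set x | (c%:E < f x)%E] <= (c^-1)%:E * \int[mu]_x f x)%E.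
Proof.
move=> mf f0 c0.
have mS : measurable [set x | (c%:E < f x)%E].
  by have := emeasurable_fun_o_infty measurableT mf c%:E; rewrite setTI.
split => //; rewrite lee_pdivlMl//.
apply: (@le_trans _ _ (\int[mu]_(x in [set x | (c%:E < f x)%E]) f x)%E).
  rewrite -integral_cst//; apply: le_int => //.
  - by move=> x _; rewrite lee_fin ltW.
  - by move=> x /= /ltW.
exact: (int_sub mu measurableT mS mf f0 (@subsetT _ _)).
Qed.

Variables (I : set T) (v : R).
Hypotheses (mI : measurable I) (vI : mu I = v%:E) (v0 : 0 < v).

Let fin_cst (c : R) : mu.-integrable I (EFin \o cst c).
Proof.
apply/integrableP; split; first by apply/measurable_EFinP; exact: measurable_cst.
under eq_integral do rewrite /= .
by rewrite integral_cst//= vI -EFinM ltry.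
Qed.

Lemma bounded_integrable_I (f : T -> R) (b : R) : measurable_fun setT f -> (forall t, I t -> `|f t| <= b) ->
  mu.-integrable I (EFin \o f).
Proof.
move=> mf fb; apply: (le_integrable mI _ _ (fin_cst b)).
  by apply/measurable_EFinP; exact: measurable_funTS.
by move=> t It; rewrite /= lee_fin; apply: le_trans (fb t It) (ler_norm _).
Qed.

Lemma L1_le_L2 (g : T -> R) (q : R) : measurable_fun setT g -> 0 < q ->
  (\int[mu]_(t in I) ((g t) ^+ 2)%:E <= q%:E)%E ->
  (\int[mu]_(t in I) `|g t|%:E <= (Num.sqrt (v * q))%:E)%E.
Proof.
move=> mg q0 Hq.
pose r := Num.sqrt (q / v).
have r0 : 0 < r by rewrite sqrtr_gt0 divr_gt0.
have r2 : r ^+ 2 = q / v by rewrite sqr_sqrtr// divr_ge0// ltW.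
have mg2 := meas_sq mg.
have c0 : 0 <= (2 * r)^-1 by rewrite invr_ge0 mulr_ge0// ltW.
have c1 (t : T) : (0 <= (r / 2)%:E)%E by rewrite lee_fin divr_ge0// ltW.
have p1 t : (0 <= (2 * r)^-1%:E * ((g t) ^+ 2)%:E)%E by rewrite -EFinM lee_fin mulr_ge0// sqr_ge0.
apply: (@le_trans _ _ (\int[mu]_(t in I) ((r / 2)%:E + (2 * r)^-1%:E * ((g t) ^+ 2)%:E))%E).
  apply: le_int => //.
  - by apply/measurable_EFinP; exact: measurableT_comp.
  - by apply: emeasurable_funD => //; exact: emeasurable_funM.
  move=> t _; rewrite -EFinM -EFinD lee_fin.
  have -> : r / 2 + (2 * r)^-1 * g t ^+ 2 = (2 * r)^-1 * (r ^+ 2 + g t ^+ 2) by field; rewrite gt_eqF.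
  rewrite mulrC ler_pdivlMr ?mulr_gt0// -(real_normK (num_real (g t))) -subr_ge0.
  have -> : r ^+ 2 + `|g t| ^+ 2 - `|g t| * (2 * r) = (r - `|g t|) ^+ 2 by ring.
  exact: sqr_ge0.
rewrite (int_add mu mI (measurable_cst _) (emeasurable_funM (measurable_cst _) mg2) c1 p1).
rewrite (int_scale mu mI c0 mg2 (sq_ge0E _)) integral_cst//= vI.
apply: (@le_trans _ _ ((r / 2)%:E * v%:E + (2 * r)^-1%:E * q%:E)%E).
  by apply: leeD2l; apply: lee_wpmul2l.
rewrite -!EFinM -EFinD lee_fin.
have -> : v * q = (v * r) ^+ 2 by rewrite exprMn r2; field; rewrite gt_eqF.
have -> : q = r ^+ 2 * v by rewrite r2 divfK// gt_eqF.
have vr0 : 0 <= v * r by rewrite mulr_ge0// ltW.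
rewrite sqrtr_sqr (ger0_norm vr0) le_eqVlt; apply/orP; left; apply/eqP.
by field; rewrite gt_eqF.
Qed.

Variables (J : finType) (sigma : T -> J).
Hypothesis ms : forall j, measurable [set t | sigma t = j].
Variables (s : J -> T) (beta : T -> R) (b : R).
Hypotheses (mb : measurable_fun setT beta) (bb : forall t, I t -> `|beta t| <= b).

Definition cell_ind (j : J) : T -> R := \1_[set t | sigma t = j].
Definition cell_weight (j : J) : R := fine (\int[mu]_(t in I) (cell_ind j t * beta t)%:E).

Lemma measurable_cell_ind j : measurable_fun setT (cell_ind j).
Proof. exact: measurable_indic. Qed.

Lemma sum_cell_ind (y : J -> R) t : y (sigma t) = \sum_j y j * cell_ind j t.
Proof.
rewrite (bigD1 (sigma t))//= /cell_ind indicE mem_set//= mulr1 big1 ?addr0// => j js.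
by rewrite indicE memNset ?mulr0//= => /esym /eqP; rewrite (negbTE js).
Qed.

Lemma measurable_quantized (y : J -> R) : measurable_fun setT (fun t => y (sigma t)).
Proof.
under eq_fun do rewrite sum_cell_ind.
by apply: measurable_sum => j; apply: measurable_funM => //; exact: measurable_cell_ind.
Qed.

Let cell_ind_le j t : `|cell_ind j t| <= 1.
Proof. by rewrite /cell_ind indicE; case: (_ \in _); rewrite ?normr1 ?normr0. Qed.

Let icell j : mu.-integrable I (EFin \o (fun t => cell_ind j t * beta t)).
Proof.
apply: (@bounded_integrable_I _ b); first by apply: measurable_funM => //; exact: measurable_cell_ind.
by move=> t It; rewrite normrM -[leRHS]mul1r; apply: ler_pM => //; exact: bb.
Qed.

Lemma int_quantized (y : J -> R) :
  (\int[mu]_(t in I) (y (sigma t) * beta t)%:E = (\sum_j y j * cell_weight j)%:E)%E.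
Proof.
have E t : ((y (sigma t) * beta t)%:E = \sum_j (y j)%:E * (cell_ind j t * beta t)%:E)%E.
  rewrite sum_cell_ind mulr_suml -sumEFin; apply: eq_bigr => j _; by rewrite -EFinM mulrA.
under eq_integral do rewrite E.
rewrite integral_sum//; last by move=> j; exact: integrableZl (icell j).
rewrite -sumEFin; apply: eq_bigr => j _.
rewrite integralZl//; last exact: icell.
rewrite EFinM /cell_weight fineK//; apply: integrable_fin_num => //; exact: icell.
Qed.

(** Cauchy--Schwarz against the bounded [beta]. The function [x] may be unbounded on [I]:
    integrability of [x * beta], on which the value of [fine] depends, is derived from the quantised
    function and the square integrable difference. *)
Lemma quadrature (x : T -> R) (q : R) : measurable_fun setT x -> 0 <= q -> 0 <= b ->
  (\int[mu]_(t in I) ((x t - x (s (sigma t))) ^+ 2)%:E <= q%:E)%E ->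
  (fine (\int[mu]_(t in I) (x t * beta t)%:E) - \sum_j x (s j) * cell_weight j) ^+ 2 <= b ^+ 2 * (v * q).
Proof.
move=> mx q0 b0 Hq; apply/ler_addgt0Pr => e e0.
(* [L1_le_L2] asks for a strictly positive bound; the increment is sized so as to cost at most [e]
   in the end. *)
pose q' := q + e / (b ^+ 2 * v + 1).
have bv : 0 < b ^+ 2 * v + 1 by rewrite ltr_wpDl// mulr_ge0 ?sqr_ge0// ltW.
have q'0 : 0 < q' by rewrite ltr_wpDl// divr_gt0.
pose xs t := x (s (sigma t)).
have mxs : measurable_fun setT xs by exact: (measurable_quantized (fun j => x (s j))).
pose g t := x t - xs t.
have mg : measurable_fun setT g by exact: measurable_funB.
have Hq' : (\int[mu]_(t in I) ((g t) ^+ 2)%:E <= q'%:E)%E.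
  by apply: le_trans Hq _; rewrite lee_fin lerDl divr_ge0// ltW.
have L1 := L1_le_L2 mg q'0 Hq'.
have Ig : mu.-integrable I (EFin \o g).
  apply/integrableP; split; first by apply/measurable_EFinP; exact: measurable_funTS.
  by apply: le_lt_trans L1 (ltry _).
have Igb : mu.-integrable I (EFin \o (fun t => g t * beta t)).
  apply: (le_integrable mI _ _ (integrableZl mI b Ig)).
    by apply/measurable_EFinP; apply: measurable_funTS; exact: measurable_funM.
  move=> t It; rewrite /= lee_fin !normrM mulrC ler_wpM2r//.
  exact: le_trans (bb It) (ler_norm _).
have Ixs : mu.-integrable I (EFin \o (fun t => xs t * beta t)).
  apply: (@bounded_integrable_I _ ((\sum_j `|x (s j)|) * b)); first exact: measurable_funM.
  move=> t It; rewrite normrM; apply: ler_pM => //; last exact: bb.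
  by rewrite /xs (bigD1 (sigma t))//= lerDl sumr_ge0.
have -> : (\int[mu]_(t in I) (x t * beta t)%:E =
   \int[mu]_(t in I) (g t * beta t)%:E + \int[mu]_(t in I) (xs t * beta t)%:E)%E.
  rewrite -(integralD mI Igb Ixs); apply: eq_integral => t _ /=.
  by rewrite -EFinD -mulrDl subrK.
rewrite [X in (_ + X)%E](int_quantized (fun j => x (s j))) fineD//; last exact: integrable_fin_num.
rewrite addrK.
have : `|fine (\int[mu]_(t in I) (g t * beta t)%:E)| <= b * Num.sqrt (v * q').
  rewrite -lee_fin -abse_EFin fineK; last exact: integrable_fin_num.
  apply: le_trans (le_abse_integral _ mI _) _; first by case/integrableP: Igb.
  rewrite EFinM; apply: le_trans (lee_wpmul2l _ L1); last by rewrite lee_fin.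
  have mng : measurable_fun setT (fun t => `|g t|%:E) by apply/measurable_EFinP; exact: measurableT_comp.
  have ng0 t : (0 <= `|g t|%:E)%E by rewrite lee_fin.
  rewrite -(int_scale mu mI b0 mng ng0); apply: le_int => //.
  - by apply/measurable_EFinP; apply: measurableT_comp => //; exact: measurable_funM.
  - exact: emeasurable_funM.
  by move=> t It; rewrite /= -EFinM lee_fin normrM mulrC ler_wpM2r//; exact: bb.
move=> H; rewrite -[leLHS]real_normK ?num_real//.
apply: (@le_trans _ _ ((b * Num.sqrt (v * q')) ^+ 2)).
  by rewrite lerXn2r ?nnegrE ?mulr_ge0 ?sqrtr_ge0.
rewrite exprMn sqr_sqrtr; last by rewrite mulr_ge0// ltW.
rewrite /q' !mulrDr lerD2l mulrA.
have -> : b ^+ 2 * v * (e / (b ^+ 2 * v + 1)) = e * (b ^+ 2 * v / (b ^+ 2 * v + 1)) by ring.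
by rewrite ger_pMr// ler_pdivrMr// mul1r lerDl.
Qed.
End Quantizer.

(** * Transfer of laws to the copies, and tails of the covariates *)

Section FiniteDimensional.
Variables (R : realType) (d : nat) (dO : measure_display) (Omega : measurableType dO).
Variable P : probability Omega R.
Implicit Types X Y : Omega -> 'rV[R]_d -> R.

Lemma pair_law X Y (s s' : 'rV[R]_d) (F : R * R -> \bar R) :
  (forall u, measurable_fun setT (X ^~ u)) -> (forall u, measurable_fun setT (Y ^~ u)) ->
  same_fdd P X Y -> measurable_fun setT F -> (forall z, (0 <= F z)%E) ->
  (\int[P]_w F (X w s, X w s') = \int[P]_w F (Y w s, Y w s'))%E.
Proof.
move=> mX mY fdd mF F0.
pose D Z (w : Omega) : R * R := (Z w s, Z w s').
have mD Z : (forall u, measurable_fun setT (Z ^~ u)) -> measurable_fun setT (D Z).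
  by move=> mZ; apply: measurable_fun_pair; exact: mZ.
pose Q Z (mZ : forall u, measurable_fun setT (Z ^~ u)) :=
  measure_function_pushforward__canonical__measure_function_Measure P (mD Z mZ).
have E Z (mZ : forall u, measurable_fun setT (Z ^~ u)) : (\int[P]_w F (Z w s, Z w s') = \int[Q Z mZ]_z F z)%E.
  by rewrite -[RHS]/(\int[pushforward P (D Z)]_z F z)%E (@ge0_integral_pushforward _ _ _ _ _ _ (mD Z mZ)).
rewrite (E X mX) (E Y mY); apply: eq_measure_integral => A mA _.
pose G : set (set (R * R)) := [set B `*` C | B in measurable & C in measurable].
apply: (@measure_unique _ R (R * R)%type G (fun=> setT) _ _ _ _ (Q X mX) (Q Y mY)) => //.
- exact: measurable_prod_measurableType.
- move=> _ _ [B mB [C mC <-]] [B' mB' [C' mC' <-]].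
  exists (B `&` B'); first exact: measurableI.
  by exists (C `&` C'); [exact: measurableI|rewrite setXI].
- by move=> n; exists setT => //; exists setT => //; rewrite setXTT.
- by apply/seteqP; split => // x _; exists 0%N.
- move=> _ [B mB [C mC <-]].
  have := fdd [:: (s, B); (s', C)]; rewrite /= !big_cons !big_nil/= !setIT => H.
  by apply: H; apply/andP; split; [apply/asboolP|rewrite andbT; apply/asboolP].
- move=> n; rewrite -[Q X mX setT]/(P (D X @^-1` setT)) preimage_setT.
  by rewrite probability_setT ltry.
Qed.

Lemma finite_sup_fdd X Y (S : seq 'rV[R]_d) (y : R) :
  (forall u, measurable_fun setT (X ^~ u)) -> (forall u, measurable_fun setT (Y ^~ u)) ->
  same_fdd P X Y ->
  measurable [set w | exists2 u, u \in S & y < X w u ^+ 2] /\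
  P [set w | exists2 u, u \in S & y < X w u ^+ 2] = P [set w | exists2 u, u \in S & y < Y w u ^+ 2].
Proof.
move=> mX mY fdd.
pose B : set R := [set r | r ^+ 2 <= y].
have mB : measurable B.
  have mf : measurable_fun setT (fun r : R => r ^+ 2) by exact: measurable_funX.
  rewrite (_ : B = (fun r => r ^+ 2) @^-1` `]-oo, y]%classic).
    by rewrite -[X in measurable X]setTI; exact: mf.
  by apply/seteqP; split => r /=; rewrite in_itv.
pose good (Z : Omega -> 'rV[R]_d -> R) : set Omega := \big[setI/setT]_(u <- S) [set w | B (Z w u)].
have goodE (Z : Omega -> 'rV[R]_d -> R) : [set w | exists2 u, u \in S & y < Z w u ^+ 2] = ~` good Z.
  apply/seteqP; split => w /=.
    by move=> [u uS yu] /bigsetI_seqP /(_ u uS); rewrite /B/= leNgt yu.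
  move=> H; apply: contrapT => no; apply: H; apply/bigsetI_seqP => u uS.
  by rewrite /B/= leNgt; apply/negP => yu; apply: no; exists u.
have mgood (Z : Omega -> 'rV[R]_d -> R) : (forall u, measurable_fun setT (Z ^~ u)) -> measurable (good Z).
  move=> mZ; rewrite /good; elim: (S) => [|u S' IH]; first by rewrite big_nil.
  rewrite big_cons; apply: measurableI => //.
  by have := mZ u measurableT B mB; rewrite setTI.
split; first by rewrite goodE; apply: measurableC; exact: mgood.
rewrite !goodE !probability_setC; [|exact: mgood|exact: mgood].
congr (_ - _)%E; have := fdd [seq (u, B) | u <- S].
rewrite !big_map/=; apply; apply/allP => _ /mapP[u _ ->]; exact/asboolP.
Qed.

Variables (I : set 'rV[R]_d) (X : Omega -> 'rV[R]_d -> R) (tau : R).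
Hypotheses (mX : forall u, measurable_fun setT (X ^~ u)) (tau0 : 0 < tau).
Let supX := fun w : Omega => (ereal_sup [set (`|X w s|)%:E | s in I] : \bar R).
Hypothesis msup : measurable_fun setT (fun w => (expeR (tau%:E * supX w * supX w)%E : \bar R)).
Hypothesis isup : (\int[P]_w expeR (tau%:E * supX w * supX w)%E < +oo)%E.

(** The exponential moment is assumed for [X] and its supremum over [I], while the copies share only
    finite dimensional laws. Events about a finite set [S] transfer, and the bound involves neither
    [S] nor its size. *)
Lemma sup_tail : exists A : R, 0 < A /\ forall (Y : Omega -> 'rV[R]_d -> R) (S : seq 'rV[R]_d) (y : R), 0 <= y ->
  (forall u, measurable_fun setT (Y ^~ u)) -> same_fdd P Y X -> (forall u, u \in S -> I u) ->
  measurable [set w | exists2 u, u \in S & y < Y w u ^+ 2] /\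
  (P [set w | exists2 u, u \in S & (y < Y w u ^+ 2)%R] <= (A * expR (- (tau * y)))%:E)%E.
Proof.
have e0 w : (0 <= expeR (tau%:E * supX w * supX w) :> \bar R)%E by exact: expeR_ge0.
pose M := (\int[P]_w expeR (tau%:E * supX w * supX w))%E.
have Moo : (M < +oo)%E := isup.
have M0 : (0 <= M)%E by apply: integral_ge0.
exists (fine M + 1); split; first by rewrite ltr_wpDl// fine_ge0.
move=> Y S y y0 mY fdd SI.
have [mS ->] := finite_sup_fdd S y mY mX fdd; split => //.
have c0 : 0 < expR (tau * y) by exact: expR_gt0.
have [mB PB] := markov_ge0 P msup e0 c0.
apply: (@le_trans _ _ (P [set w | ((expR (tau * y))%:E < expeR (tau%:E * supX w * supX w))%E])).
  apply: le_meas => //; first by have [] := finite_sup_fdd S y mX mX (fun s _ => erefl).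
  move=> w [u uS yu] /=.
  have : (`|X w u|%:E <= supX w)%E by apply: ereal_sup_ubound; exists u => //; exact: SI.
  case: (supX w) => [r| |]//.
    rewrite lee_fin => ar; rewrite -!EFinM /= lte_fin ltr_expR -mulrA ltr_pM2l//.
    apply: (lt_le_trans yu); rewrite -expr2 -[leLHS]real_normK ?num_real//.
    by rewrite lerXn2r ?nnegrE// (le_trans _ ar).
  by move=> _; rewrite (@gt0_muley _ tau%:E) ?lte_fin// mulyy/= ltry.
apply: le_trans PB _; rewrite -/M -(fineK (_ : M \is a fin_num)); last by rewrite ge0_fin_numE.
rewrite -EFinM lee_fin -expRN mulrC ler_wpM2r ?expR_ge0//.
by rewrite lerDl.
Qed.
End FiniteDimensional.

Section ExpectedQuantization.
Variables (R : realType) (d : nat) (dO : measure_display) (Omega : measurableType dO).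
Variables (P : probability Omega R) (mu : {measure set Rd R d -> \bar R}).
Variables (I : set 'rV[R]_d) (v : R).
Hypotheses (mI : measurable (I : set (Rd R d))) (vI : mu I = v%:E).
Variables (X : Omega -> 'rV[R]_d -> R) (C1 kappa : R).
Hypotheses (jX : joint_random_field X) (C10 : 0 < C1) (k0 : 0 < kappa).
Hypothesis hX : forall s s' : 'rV[R]_d, I s -> I s' ->
  (\int[P]_w ((X w s - X w s') ^+ 2)%:E <= (C1 * powR (eucl_dist s s') (2 * kappa))%:E)%E.
Variables (J : finType) (sigma : Rd R d -> J) (s : J -> 'rV[R]_d).
Hypotheses (ms : forall j, measurable [set t | sigma t = j]) (sI : forall j, I (s j)).

Definition quant_err (w : Omega) : \bar R :=
  (\int[mu]_(t in (I : set (Rd R d))) ((X w t - X w (s (sigma t))) ^+ 2)%:E)%E.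

Lemma section_measurable u : measurable_fun setT (X ^~ u).
Proof.
rewrite (_ : X ^~ u = (fun z : Omega * Rd R d => X z.1 z.2) \o (fun w => (w, u : Rd R d)))//.
by apply: measurableT_comp; [exact: jX|exact: pair2_measurable].
Qed.

(** Tonelli moves the expectation inside the integral over [I], where the Hoelder bound applies at
    each [t] and its representative. *)
Lemma quant_err_bound (h : R) : 0 <= h -> (forall t, I t -> eucl_dist t (s (sigma t)) <= h) ->
  [/\ measurable_fun setT quant_err, forall w, (0 <= quant_err w)%E &
   (\int[P]_w quant_err w <= (v * (C1 * powR h (2 * kappa)))%:E)%E].
Proof.
move=> h0 Hs.
have Ioo : (mu I < +oo)%E by rewrite vI ltry.
pose muI := mfrestr mI Ioo.
pose G (z : Omega * Rd R d) : \bar R := ((X z.1 z.2 - X z.1 (s (sigma z.2))) ^+ 2)%:E.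
have G0 z : (0 <= G z)%E by rewrite lee_fin sqr_ge0.
have mG : measurable_fun setT G.
  apply: meas_sq; apply: measurable_funB; first exact: jX.
  under eq_fun => z do rewrite (sum_cell_ind sigma (fun j => X z.1 (s j)) z.2).
  apply: measurable_sum => j; apply: measurable_funM.
    exact: (measurableT_comp (section_measurable (s j)) measurable_fst).
  exact: (measurableT_comp (measurable_cell_ind ms j) measurable_snd).
have mGw w : measurable_fun setT (fun t => G (w, t)) by exact: (measurableT_comp mG (pair1_measurable w)).
have E w : quant_err w = (\int[muI]_t G (w, t))%E.
  by rewrite integral_mfrestr//.
have mE : measurable_fun setT (fun w => \int[muI]_t G (w, t))%E.
  exact: (@measurable_fun_fubini_tonelli_F _ _ _ _ _ muI G).
split.
- by rewrite (_ : quant_err = fun w => \int[muI]_t G (w, t))%E//; exact/funext.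
- by move=> w; rewrite E; apply: integral_ge0 => t _; exact: G0.
under eq_integral do rewrite E.
rewrite (@fubini_tonelli _ _ _ _ _ P muI G)// integral_mfrestr; first last.
- by move=> t; apply: integral_ge0 => w _; exact: (G0 (w, t)).
- exact: (@measurable_fun_fubini_tonelli_G _ _ _ _ _ P G).
apply: (@le_trans _ _ (\int[mu]_(t in (I : set (Rd R d))) (C1 * powR h (2 * kappa))%:E)%E).
  apply: le_int => //.
  - exact: (@measurable_fun_fubini_tonelli_G _ _ _ _ _ P G).
  - by move=> t _; apply: integral_ge0 => w _; exact: (G0 (w, t)).
  move=> t It; apply: (@le_trans _ _ (C1 * powR (eucl_dist t (s (sigma t))) (2 * kappa))%:E).
    have H := @hX t (s (sigma t)) It (sI (sigma t)).
    exact: H.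
  rewrite lee_fin ler_wpM2l ?(ltW C10)//.
  by apply: ge0_ler_powR; rewrite ?nnegrE ?mulr_ge0 ?(ltW k0)// ?sqrtr_ge0//; exact: Hs.
by rewrite integral_cst//= vI -EFinM mulrC.
Qed.
End ExpectedQuantization.

(** * Geometry of the domain and of the design *)

Section Designs.
Variables (R : realType) (d : nat) (mu : {measure set Rd R d -> \bar R}).
Hypothesis leb : is_lebesgue_Rd mu.
Hypothesis d0 : (0 < d)%N.
Variable I : set 'rV[R]_d.
Hypotheses (oI : open I) (bI : bounded_Rd I).

Lemma measurable_domain : measurable (I : set (Rd R d)).
Proof. exact: sub_sigma_algebra. Qed.

Lemma domain_in_cube : exists (a : 'rV[R]_d) (H : R), 0 < H /\ I `<=` cube a H.
Proof.
have [M HM] := bI; exists (const_mx (- (`|M| + 1))), (2 * (`|M| + 1)).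
have M0 : 0 < `|M| + 1 by rewrite ltr_wpDl.
split; first by rewrite mulr_gt0.
move=> x Ix i; rewrite mxE; have := le_trans (coord_le_eucl x i) (HM x Ix).
by have := ler_norm M; rewrite ler_norml; move: (x 0 i) (`|M|) => u w *; apply/andP; split; lra.
Qed.

Lemma domain_measure : I !=set0 -> exists v : R, 0 < v /\ mu I = v%:E.
Proof.
move=> [x Ix].
have [a [H [H0 sI]]] := domain_in_cube.
have mI := measurable_domain.
have Ioo : (mu I < +oo)%E.
  apply: le_lt_trans (le_meas mu mI (measurable_cube a H) sI) _.
  by rewrite (cube_measure leb)// ?ltry// ltW.
have I0 : (0 < mu I)%E.
  have /nbhs_ballP[e /= e0 He] : nbhs x I by apply: open_nbhs_nbhs; split.
  have e2 : 0 < e / 2 by rewrite divr_gt0.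
  have e4 : 0 < e / 4 by rewrite divr_gt0.
  apply: (@lt_le_trans _ _ (mu (cube (x - const_mx (e / 4)) (e / 2)))).
    by rewrite (cube_measure leb)// ?(ltW e2)// lte_fin exprn_gt0.
  apply: le_meas => //; first exact: measurable_cube.
  move=> y Hy; apply: He; rewrite /ball/=; split => // k i; rewrite (ord1 k) /ball/=.
  have := Hy i; rewrite !mxE => /andP[].
  by move: (x 0 i) (y 0 i) => u w h1 h2; rewrite ltr_norml; apply/andP; split; lra.
exists (fine (mu I)); split; first by apply: fine_gt0; rewrite I0 Ioo.
by rewrite fineK// ge0_fin_numE.
Qed.

Lemma measure_mod_null (S S' N : set (Rd R d)) : measurable S -> measurable S' -> measurable N ->
  mu N = 0%E -> S `\` N = S' `\` N -> mu S = mu S'.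
Proof.
move=> mS mS' mN N0 E.
suff H S1 S2 : measurable S1 -> measurable S2 -> S1 `\` N = S2 `\` N -> (mu S1 <= mu S2)%E.
  by apply/eqP; rewrite eq_le !H.
move=> m1 m2 E12; apply: (@le_trans _ _ (mu (S2 `|` N))).
  apply: le_meas => //; first exact: measurableU.
  move=> x S1x; have [Nx|Nx] := pselect (N x); [by right|left].
  by have : (S1 `\` N) x by []; rewrite E12 => -[].
apply: (@le_trans _ _ (mu S2 + mu N)%E); first exact: measureU2.
by rewrite N0 adde0.
Qed.

Lemma measurable_near (u : 'rV[R]_d) (h : R) : 0 <= h ->
  measurable ([set x | eucl_dist x u <= h] : set (Rd R d)).
Proof.
move=> h0.
have mf : measurable_fun setT (fun x : Rd R d => \sum_i (x 0 i - u 0 i) ^+ 2).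
  apply: measurable_sum => i; apply: measurable_funX; apply: measurable_funB => //.
  exact: measurable_coord.
rewrite (_ : mkset _ = (fun x : Rd R d => \sum_i (x 0 i - u 0 i) ^+ 2) @^-1` `]-oo, h ^+ 2]%classic).
  by rewrite -[X in measurable X]setTI; exact: mf.
apply/seteqP; split => x /=; rewrite in_itv/= /eucl_dist /eucl_norm.
  move=> H; have s0 : 0 <= \sum_i (x 0 i - u 0 i) ^+ 2 by apply: sumr_ge0 => i _; exact: sqr_ge0.
  rewrite -[leLHS]sqr_sqrtr// lerXn2r ?nnegrE ?sqrtr_ge0//.
  by apply: le_trans H; rewrite le_eqVlt; apply/orP; left; apply/eqP; congr Num.sqrt; apply: eq_bigr => i _; rewrite !mxE.
move=> H; rewrite -(ger0_norm h0) -sqrtr_sqr; apply: ler_wsqrtr.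
by apply: le_trans H; rewrite le_eqVlt; apply/orP; left; apply/eqP; apply: eq_bigr => i _; rewrite !mxE.
Qed.

(** A mesh at an arbitrary scale, unrelated to the design. Representatives are taken inside [I],
    where the covariates are controlled. *)
Lemma fine_quantizer (eta : R) : I !=set0 -> 0 < eta ->
  exists (J : finType) (s : J -> 'rV[R]_d) (sigma : Rd R d -> J),
  [/\ forall j, I (s j), forall j, measurable [set x | sigma x = j] &
      forall x, I x -> eucl_dist x (s (sigma x)) <= eta].
Proof.
move=> [x0 Ix0] eta0; have [a [H [H0 sI]]] := domain_in_cube.
have dR : 0 < d%:R :> R by rewrite ltr0n.
pose N := (Num.truncn (d%:R * H / eta)).+1.
have NR : 0 < N%:R :> R by rewrite ltr0n.
pose h := H / N%:R; have h0 : 0 < h by rewrite divr_gt0.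
have dh : d%:R * h <= eta.
  rewrite /h mulrA ler_pdivrMr// [eta * _]mulrC -ler_pdivrMr//; apply: ltW; exact: truncnS_gt.
have /choice[s Hs] : forall z : {ffun 'I_d -> 'I_N}, exists y, I y /\ ((exists2 x, I x & cube (corner a h z) h x) -> cube (corner a h z) h y).
  move=> z; have [[x Ix Qx]|no] := pselect (exists2 x, I x & cube (corner a h z) h x); first by exists x.
  by exists x0.
pose l := [seq (cube (corner a h z) h, z) | z <- enum {: {ffun 'I_d -> 'I_N}}].
have [|sigma [ms Hsg]] := quantizer [ffun => ord0] (s := l).
  by move=> e /mapP[z _ ->]; exact: measurable_cube.
exists {ffun 'I_d -> 'I_N}, s, sigma; split => //; first by move=> j; have [] := Hs j.
move=> x Ix.
have [|Q + Qx] := Hsg x.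
  have [z Hz] := grid_cover (N := N) isT (sI x Ix).
  by exists (cube (corner a h z) h, z) => //; apply/mapP; exists z => //; rewrite mem_enum.
move=> /mapP[z _ [QE zE]]; move: Qx; rewrite QE -zE => Qx.
have [_ /(_ (ex_intro2 _ _ x Ix Qx)) Qs] := Hs (sigma x).
apply: le_trans dh; apply: eucl_le_coord => //; first exact: ltW.
move=> i; have := Qx i; have := Qs i; rewrite !mxE => /andP[] + + /andP[].
by move: (x 0 i) (s (sigma x) 0 i) (a 0 i + _) => *; rewrite ler_norml; apply/andP; split; lra.
Qed.

Variables (p : nat) (t : 'I_p -> 'rV[R]_d) (A : 'I_p -> set 'rV[R]_d).
Hypothesis des : design_np mu I t A.
Let p0 : (0 < p)%N. Proof. by have [] := des. Qed.

Lemma design_points j : I (t j).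
Proof. by have [_ [_ [<- [At _]]]] := des; exists j => //; exact: At. Qed.

Lemma maxdiam_ge0 : 0 <= maxdiam A.
Proof. exact: bigmax_ge_id. Qed.

Lemma dist_maxdiam j x : A j x -> eucl_dist x (t j) <= maxdiam A.
Proof.
move=> Ax; have [_ [_ [AI [At _]]]] := des.
have [a [H [H0 sI]]] := domain_in_cube.
have AjI y : A j y -> I y by move=> Ay; rewrite -AI; exists j.
apply: (@le_trans _ _ (set_diam (A j))); last exact: le_bigmax.
apply: ub_le_sup; last by exists x => //; exists (t j) => //; exact: At.
exists (d%:R * H) => _ [y Ay [z Az <-]]; apply: eucl_le_coord => //; first exact: ltW.
move=> i; have := sI y (AjI y Ay) i; have := sI z (AjI z Az) i; rewrite !mxE => /andP[] + + /andP[].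
by move: (y 0 i) (z 0 i) (a 0 i) => *; rewrite ler_norml; apply/andP; split; lra.
Qed.

(** The cells [A j] are Borel only up to null sets. Off a common null set [NN] the map [s1] follows
    the Borel versions and gives the exact cell volumes; on [NN] the map [s2] picks any near design
    point, so that the distance bound holds at every point of [I]. *)
Lemma design_quantizer : exists sigma : Rd R d -> 'I_p,
  [/\ forall j, measurable [set x | sigma x = j],
      forall x, I x -> eucl_dist x (t (sigma x)) <= maxdiam A &
      forall j, mu (I `&` [set x | sigma x = j]) = (fine (mu I) / p%:R)%:E].
Proof.
have [_ [disj [AI [At Am]]]] := des.
have /choice[B HB] := Am.
have {HB} /choice[N HN] := HB.
have mB j : measurable (B j) by have [] := HN j.
have mN j : measurable (N j) by have [_ []] := HN j.
have N0 j : mu (N j) = 0%E by have [_ [_ []]] := HN j.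
have AB j x : ~ N j x -> (A j x <-> B j x).
  move=> nN; have [_ [_ [_ [sub _]]]] := HN j; split => H; apply: contrapT => no; apply: nN; apply: sub.
    by left.
  by right.
pose NN : set (Rd R d) := \big[setU/set0]_(j < p) N j.
have mNN : measurable NN by exact: bigsetU_measurable.
have NN0 : mu NN = 0%E.
  apply/eqP; rewrite eq_le measure_ge0 andbT.
  apply: (@le_trans _ _ (\sum_(j < p) mu (N j))%E).
    apply: measure_cover => // x; rewrite /NN; elim/big_rec: _ => [//|j S _ IH [Nx|Sx]]; last exact: IH.
    by exists j.
  by rewrite big1.
have nNN x j : ~ NN x -> ~ N j x by move=> nN Nx; apply: nN; rewrite /NN (bigD1 j)//; left.
pose j0 := Ordinal p0.
have [|s1 [ms1 H1]] := quantizer j0 (s := [seq (B j `\` NN, j) | j <- enum 'I_p]).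
  by move=> e /mapP[j _ ->]; exact: measurableD.
have [|s2 [ms2 H2]] := quantizer j0 (s := [seq ([set x : Rd R d | eucl_dist x (t j) <= maxdiam A], j) | j <- enum 'I_p]).
  by move=> e /mapP[j _ ->]; exact: measurable_near maxdiam_ge0.
pose sigma x := if x \in NN then s2 x else s1 x.
have IA x : I x -> exists j, A j x by rewrite -AI => -[j _ Ax]; exists j.
have S1 x j : ~ NN x -> B j x -> A (s1 x) x.
  move=> nx Bx; have [|Q] := H1 x.
    by exists (B j `\` NN, j) => //; apply/mapP; exists j => //; rewrite mem_enum.
  by move=> /mapP[k _ [-> ->]] [Bk _]; apply/(AB k _ (nNN _ _ nx)).
have mS j : measurable [set x | sigma x = j].
  rewrite (_ : mkset _ = (NN `&` [set x | s2 x = j]) `|` (~` NN `&` [set x | s1 x = j])).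
    by apply: measurableU; apply: measurableI => //; exact: measurableC.
  apply/seteqP; split => x; rewrite /sigma /=.
    by case: ifPn; [rewrite inE; left|rewrite notin_setE; right].
  by move=> [[Nx <-]|[Nx <-]]; [rewrite mem_set|rewrite memNset].
exists sigma; split => //.
  move=> x Ix; have [j Ax] := IA x Ix; rewrite /sigma; case: ifPn; rewrite ?inE ?notin_setE => Nx.
    have [|Q] := H2 x.
      exists ([set y : Rd R d | eucl_dist y (t j) <= maxdiam A], j); last exact: dist_maxdiam.
      by apply/mapP; exists j => //; rewrite mem_enum.
    by move=> /mapP[k _ [-> ->]].
  by apply: dist_maxdiam; apply: (S1 x j) => //; apply/(AB j _ (nNN _ _ Nx)).
move=> j; have [_ [_ [_ [_ <-]]]] := HN j.
apply: (measure_mod_null _ (mB j) mNN NN0); first exact: measurableI measurable_domain (mS j).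
apply/seteqP; split => x [].
  move=> [Ix]; rewrite /= /sigma => + nx; rewrite memNset// => sx; split => //.
  have [k Ak] := IA x Ix; have Bk : B k x by apply/(AB k _ (nNN _ _ nx)).
  by have := S1 x k nx Bk; rewrite sx => Aj; apply/(AB j _ (nNN _ _ nx)).
move=> Bx nx; split => //.
have Ax : A j x by apply/(AB j _ (nNN _ _ nx)).
split; first by rewrite -AI; exists j.
rewrite /= /sigma memNset//; apply/eqP/negPn/negP => sj.
have := disj _ _ sj; move=> /seteqP[/(_ x) + _]; apply; split => //; exact: S1 Bx.
Qed.

(** A single cell has volume [v / p] and fits in a cube of side [2 * maxdiam A]. This forces the
    diameter to be positive and supplies the volume hypothesis of [oscillation_sum]. *)
Lemma maxdiam_volume : fine (mu I) <= p%:R * (2 * maxdiam A) ^+ d.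
Proof.
have [sigma [ms near vol]] := design_quantizer.
have pR : 0 < p%:R :> R by rewrite ltr0n.
rewrite mulrC -ler_pdivrMr// -lee_fin -(vol (Ordinal p0)).
have h0 := maxdiam_ge0; have h20 : 0 <= 2 * maxdiam A by rewrite mulr_ge0.
rewrite -(cube_measure leb (t (Ordinal p0) - const_mx (maxdiam A)) d0 h20).
apply: le_meas; [exact: measurableI measurable_domain (ms _)|exact: measurable_cube|].
move=> x [Ix /= sx] i; have := near x Ix; rewrite sx => H.
have := le_trans (coord_le_eucl (x - t (Ordinal p0)) i) H; rewrite !mxE ler_norml => /andP[].
by move: (x 0 i) (t _ 0 i) (maxdiam A) => *; apply/andP; split; lra.
Qed.
End Designs.

(** * Replacing the integral response by the sum over the design *)

Section LinearFunctional.
Variables (R : realType) (p : nat) (c : R).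
Implicit Types u w : 'rV[R]_p.

Definition lin (x : 'I_p -> R) w : R := \sum_j x j * w 0 j * c.

Lemma linD x u w : lin x (u + w) = lin x u + lin x w.
Proof. by rewrite /lin -big_split; apply: eq_bigr => j _; rewrite mxE mulrDr mulrDl. Qed.
Lemma linZ x a w : lin x (a *: w) = a * lin x w.
Proof. by rewrite /lin mulr_sumr; apply: eq_bigr => j _; rewrite mxE; ring. Qed.
Lemma linN x w : lin x (- w) = - lin x w.
Proof. by rewrite -scaleN1r linZ mulN1r. Qed.
Lemma linB x u w : lin x (u - w) = lin x u - lin x w.
Proof. by rewrite linD linN. Qed.
Lemma lin0 x : lin x 0 = 0.
Proof. by rewrite -(scale0r (0 : 'rV[R]_p)) linZ mul0r. Qed.

Lemma lin_bound x w (xi : R) : (0 < p)%N -> (forall j, `|x j| <= xi) ->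
  (lin x w) ^+ 2 <= (p%:R * c) ^+ 2 * xi ^+ 2 * nrm2 w.
Proof.
move=> p0 Hx; have pR : 0 < p%:R :> R by rewrite ltr0n.
rewrite /lin (eq_bigr (fun j => x j * (w 0 j * c))); last by move=> j _; rewrite mulrA.
apply: le_trans (sum_sqr_le _ Hx) _.
rewrite nrm2_sum_sqr (eq_bigr (fun j => c ^+ 2 * (w 0 j) ^+ 2)); last by move=> j _; rewrite exprMn mulrC.
rewrite -mulr_sumr le_eqVlt; apply/orP; left; apply/eqP; field; exact: lt0r_neq0.
Qed.
End LinearFunctional.

Section ResponseError.
Context d1 (T : measurableType d1) (R : realType) (mu : {measure set T -> \bar R}).
Variables (I : set T) (v : R).
Hypotheses (mI : measurable I) (vI : mu I = v%:E) (v0 : 0 < v).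
Variables (p : nat) (sigma : T -> 'I_p).
Hypotheses (p0 : (0 < p)%N) (ms : forall j, measurable [set t | sigma t = j]).
Hypothesis vol : forall j, mu (I `&` [set x | sigma x = j]) = (v / p%:R)%:E.
Variables (s : 'I_p -> T) (beta : T -> R) (b : R).
Hypotheses (mb : measurable_fun setT beta) (bb : forall t, I t -> `|beta t| <= b) (b0 : 0 <= b).
Hypothesis sI : forall j, I (s j).
Variable o : 'I_p -> R.
Hypotheses (o0 : forall j, 0 <= o j) (Ho : forall t, I t -> (beta t - beta (s (sigma t))) ^+ 2 <= o (sigma t)).
Let c := v / p%:R.
Let pR : 0 < p%:R :> R. Proof. by rewrite ltr0n. Qed.
Let c0 : 0 < c. Proof. exact: divr_gt0. Qed.

(** On a cell of measure [c] the function [beta] differs from its value at the design point by at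
    most the root of [o j]. *)
Lemma cell_weight_error j : (cell_weight mu I sigma beta j - c * beta (s j)) ^+ 2 <= c ^+ 2 * o j.
Proof.
have mS : measurable (I `&` [set x | sigma x = j]) by exact: measurableI.
have mind : measurable_fun setT (cell_ind R sigma j) by exact: measurable_cell_ind.
have ind1 t : `|cell_ind R sigma j t| <= 1.
  by rewrite /cell_ind indicE; case: (_ \in _); rewrite ?normr1 ?normr0.
have Iind : mu.-integrable I (EFin \o cell_ind R sigma j).
  exact: (bounded_integrable_I mI vI mind (fun t _ => ind1 t)).
have Eind : (\int[mu]_(t in I) (cell_ind R sigma j t)%:E = c%:E)%E.
  rewrite /cell_ind integral_indic//.
  by rewrite setIC vol.
have Ib : mu.-integrable I (EFin \o (fun t => cell_ind R sigma j t * beta t)).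
  apply: (bounded_integrable_I mI vI (b := b)); first exact: measurable_funM.
  by move=> t It; rewrite normrM -[leRHS]mul1r; apply: ler_pM => //; exact: bb.
pose e t := cell_ind R sigma j t * (beta t - beta (s j)).
have me : measurable_fun setT e by apply: measurable_funM => //; exact: measurable_funB.
have ebound t : I t -> `|e t| <= Num.sqrt (o j) * cell_ind R sigma j t.
  move=> It; rewrite /e /cell_ind indicE; case: (boolP (t \in _)) => [|_]; last by rewrite mul0r mulr0 normr0.
  rewrite inE /= => st; rewrite mul1r mulr1 -sqrtr_sqr; apply: ler_wsqrtr.
  by have := Ho It; rewrite st.
have s0 : 0 <= Num.sqrt (o j) by exact: sqrtr_ge0.
have Ie : mu.-integrable I (EFin \o e).
  apply: (bounded_integrable_I mI vI me (b := b + b)) => t It.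
  rewrite normrM -[leRHS]mul1r; apply: ler_pM => //.
  by apply: le_trans (ler_normB _ _) _; apply: lerD; exact: bb.
have -> : cell_weight mu I sigma beta j - c * beta (s j) = fine (\int[mu]_(t in I) (e t)%:E)%E.
  have EE : (\int[mu]_(t in I) (cell_ind R sigma j t * beta t)%:E =
     \int[mu]_(t in I) (e t)%:E + \int[mu]_(t in I) ((beta (s j))%:E * (cell_ind R sigma j t)%:E))%E.
    rewrite -(integralD mI Ie (integrableZl mI (beta (s j)) Iind)); apply: eq_integral => t _.
    by rewrite /= -EFinD /e; congr EFin; ring.
  rewrite /cell_weight EE (integralZl mI Iind) Eind -EFinM fineD//; last exact: integrable_fin_num.
  by rewrite /= mulrC addrK.
have : `|fine (\int[mu]_(t in I) (e t)%:E)%E| <= c * Num.sqrt (o j).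
  rewrite -lee_fin -abse_EFin fineK; last exact: integrable_fin_num.
  apply: le_trans (le_abse_integral _ mI _) _; first by case/integrableP: Ie.
  have mE : measurable_fun setT (fun t => (cell_ind R sigma j t)%:E) by apply/measurable_EFinP.
  have E0 t : (0 <= (cell_ind R sigma j t)%:E)%E by rewrite lee_fin /cell_ind indicE.
  rewrite mulrC EFinM -Eind -(int_scale mu mI s0 mE E0); apply: le_int => //.
  - by apply/measurable_EFinP; apply: measurableT_comp => //.
  - exact: emeasurable_funM.
move=> H; rewrite -[leLHS]real_normK ?num_real//.
apply: (@le_trans _ _ ((c * Num.sqrt (o j)) ^+ 2)).
  by rewrite lerXn2r ?nnegrE ?mulr_ge0// ltW.
by rewrite exprMn sqr_sqrtr.
Qed.

(** Two replacements: the covariate by its value at the design point of the cell ([quadrature]),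
    then the integral of [beta] over the cell by [c] times a point value ([cell_weight_error]). *)
Lemma response_error (x : T -> R) (q xi : R) : measurable_fun setT x -> 0 <= q ->
  (forall j, `|x (s j)| <= xi) ->
  (\int[mu]_(t in I) ((x t - x (s (sigma t))) ^+ 2)%:E <= q%:E)%E ->
  (fine (\int[mu]_(t in I) (x t * beta t)%:E) - lin c (fun j => x (s j)) (\row_j beta (s j))) ^+ 2 <=
    2 * (b ^+ 2 * (v * q)) + 2 * (xi ^+ 2 * (v * (c * \sum_j o j))).
Proof.
move=> mx q0 Hxi Hq.
have H1 := quadrature mI vI v0 ms (s := s) mb bb mx q0 b0 Hq.
set W := fine _ in H1 *.
have -> : W - lin c (fun j => x (s j)) (\row_j beta (s j)) =
  (W - \sum_j x (s j) * cell_weight mu I sigma beta j) +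
  \sum_j x (s j) * (cell_weight mu I sigma beta j - c * beta (s j)).
  rewrite -addrA; congr (_ + _); rewrite /lin -!sumrN -big_split/=; apply: eq_bigr => j _.
  by rewrite mxE; ring.
apply: le_trans (sqrD_le2 _ _) _; apply: lerD; first by rewrite ler_pM2l.
rewrite ler_pM2l//; apply: le_trans (sum_sqr_le _ Hxi) _.
apply: (@le_trans _ _ (p%:R * xi ^+ 2 * \sum_j c ^+ 2 * o j)).
  have ge : 0 <= p%:R * xi ^+ 2 by rewrite mulr_ge0// sqr_ge0.
  by rewrite (ler_wpM2l ge)//; apply: ler_sum => j _; exact: cell_weight_error.
rewrite -mulr_sumr le_eqVlt; apply/orP; left; apply/eqP; rewrite /c; field; exact: lt0r_neq0.
Qed.
End ResponseError.

(** * Chaining *)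

Section Links.
Variables (R : realType) (d : nat) (dO : measure_display) (Omega : measurableType dO).
Variables (P : probability Omega R) (X : Omega -> 'rV[R]_d -> R) (Xs : nat -> Omega -> 'rV[R]_d -> R)
  (eps : nat -> Omega -> R).
Hypothesis iid : iid_data P X Xs eps.
Variables (rho : R -> R) (C2 : R).
Hypotheses (rho0 : forall x, 0 <= rho x) (rhoL : forall x y, `|rho x - rho y| <= C2 * `|x - y|).
Hypothesis rhoI : forall u : R, P.-integrable setT (fun w => (rho (eps 0%N w + u))%:E).
Variables (p n : nat) (t : 'I_p -> 'rV[R]_d) (c : R) (Rt : nat -> Omega -> R).
Hypothesis mRt : forall i (B : set R), measurable B -> data_sigma Xs eps (inl i) (Rt i @^-1` B).

Let g (u : R) : R := fine (\int[P]_w (rho (eps 0%N w + u))%:E).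
(** Centring by [g] evaluated at the random argument is centring given the covariates; [Rt] is the
    measurable substitute for the discretisation error. *)
Definition emp (w : Omega) (u : 'rV[R]_p) : R :=
  \sum_(i < n) (rho (eps i w + (Rt i w - lin c (fun j => Xs i w (t j)) u)) -
    g (Rt i w - lin c (fun j => Xs i w (t j)) u)).

Lemma lincomb_sigma i (J : finType) (s : J -> 'rV[R]_d) (y : J -> R) (B : set R) : measurable B ->
  data_sigma Xs eps (inl i) ((fun w => \sum_j Xs i w (s j) * y j) @^-1` B).
Proof.
move=> mB.
pose T1 := g_sigma_algebraType [set [set w | B (Xs i w t)] | t in [set: 'rV[R]_d] & B in [set B : set R | measurable B]].
have mX u : measurable_fun setT (fun w : T1 => Xs i w u).
  by move=> _ C mC; rewrite setTI; apply: sub_sigma_algebra; exists u => //; exists C.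
have mf : measurable_fun setT (fun w : T1 => \sum_j Xs i w (s j) * y j).
  by apply: measurable_sum => j; apply: measurable_funM.
by have := mf measurableT B mB; rewrite setTI.
Qed.

Lemma sub_sigma i (h1 h2 : Omega -> R) :
  (forall B : set R, measurable B -> data_sigma Xs eps (inl i) (h1 @^-1` B)) ->
  (forall B : set R, measurable B -> data_sigma Xs eps (inl i) (h2 @^-1` B)) ->
  forall B : set R, measurable B -> data_sigma Xs eps (inl i) ((fun w => h1 w - h2 w) @^-1` B).
Proof.
move=> H1 H2 B mB.
pose T1 := g_sigma_algebraType [set [set w | B (Xs i w t)] | t in [set: 'rV[R]_d] & B in [set B : set R | measurable B]].
have m1 : measurable_fun setT (h1 : T1 -> R) by move=> _ C mC; rewrite setTI; exact: H1.
have m2 : measurable_fun setT (h2 : T1 -> R) by move=> _ C mC; rewrite setTI; exact: H2.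
have mf : measurable_fun setT (fun w : T1 => h1 w - h2 w) by exact: measurable_funB.
by have := mf measurableT B mB; rewrite setTI.
Qed.

Lemma lin_sigma i (u : 'rV[R]_p) (B : set R) : measurable B ->
  data_sigma Xs eps (inl i) ((fun w => lin c (fun j => Xs i w (t j)) u) @^-1` B).
Proof.
move=> mB; have := @lincomb_sigma i _ t (fun j => u 0 j * c) B mB.
by rewrite (_ : (fun w => \sum_j _) = (fun w => lin c (fun j => Xs i w (t j)) u))//;
  apply/funext => w; apply: eq_bigr => j _; rewrite mulrA.
Qed.

(** A link is [((theta, x), (u, u'))]. The union bound costs the sum of the [exp (- x)]; the
    variance term stays random, as the sum of squares over the observed covariates, so no
    concentration of the design matrix is involved. *)
Lemma links_event (links : seq ((R * R) * ('rV[R]_p * 'rV[R]_p))) :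
  exists E : set Omega, [/\ measurable E, (P E <= (\sum_(l <- links) expR (- l.1.2))%:E)%E &
    forall w, ~ E w -> forall l, l \in links ->
      l.1.1 * (emp w l.2.1 - emp w l.2.2) <=
      8 * l.1.1 ^+ 2 * C2 ^+ 2 * (\sum_(i < n) (lin c (fun j => Xs i w (t j)) (l.2.1 - l.2.2)) ^+ 2) + l.1.2].
Proof.
elim: links => [|[[th x] [u u']] links [E [mE PE HE]]].
  by exists set0; split => //; rewrite ?big_nil ?measure0.
pose a (v : 'rV[R]_p) i w := Rt i w - lin c (fun j => Xs i w (t j)) v.
have ma v i (B : set R) : measurable B -> data_sigma Xs eps (inl i) (a v i @^-1` B).
  by move=> mB; apply: sub_sigma => // ? ?; [exact: mRt|exact: lin_sigma].
have [mT PT] := exp_tail iid rho0 rhoL rhoI th (ma u) (ma u') n x.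
set T := (X in measurable X) in mT.
exists (T `|` E); split; first exact: measurableU.
  apply: (@le_trans _ _ (P T + P E)%E); first exact: measureU2.
  by rewrite big_cons EFinD; apply: leeD.
move=> w /not_orP[nT nE] l; rewrite inE => /orP[/eqP ->|]; last exact: HE.
have : \sum_(i < n) exp_incr P eps rho C2 th (eps i w) (a u i w) (a u' i w) <= x.
  by rewrite leNgt; apply/negP.
rewrite /exp_incr sumrB -!mulr_sumr /= lerBlDl => H.
have -> : emp w u - emp w u' = \sum_(i < n)
       (rho (eps i w + a u i w) - rho (eps i w + a u' i w) - (g (a u i w) - g (a u' i w))).
  by rewrite /emp -sumrB; apply: eq_bigr => i _; rewrite /a; ring.
have -> : \sum_(i < n) lin c (fun j => Xs i w (t j)) (u - u') ^+ 2 = \sum_(i < n) (a u i w - a u' i w) ^+ 2.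
  by apply: eq_bigr => i _; rewrite linB /a -sqrrN; congr (_ ^+ 2); ring.
by [].
Qed.
End Links.

Section Chain.
Variables (R : realType) (p n : nat) (S : 'rV[R]_p -> R) (f : 'I_n -> 'rV[R]_p -> R).
Variables (A2 C th0 X0 H2 : R) (d M k0 : nat) (v : 'rV[R]_p) (a : nat -> 'rV[R]_p).
Hypotheses (fB : forall i u w, f i (u - w) = f i u - f i w).
Hypotheses (fA : forall i u, (f i u) ^+ 2 <= A2 * nrm2 u).
Hypotheses (A20 : 0 <= A2) (C0 : 0 <= C) (th00 : 0 < th0) (X00 : 0 <= X0) (H20 : 0 <= H2).
Hypothesis dM : (d + 2 <= 2 * M)%N.
Let z : R := 2^-1.
(** [th j] grows faster than the entropy factor [2^(j d)] but slower than [eta j] decays, thanks to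
    [d + 2 <= 2 * M]. Both [th j * eta j] and [x j / th j] then gain a factor one half per level,
    and the chain sums geometrically. *)
Let eta j := H2 * z ^+ (2 * M * (k0 + j)).
Let th j := th0 * 2 ^+ (j * d.+1).
Let x j := X0 * 2 ^+ ((k0 + j) * d).
Let Q u := \sum_(i < n) (f i u) ^+ 2.
Hypothesis va : forall j, (j <= k0)%N -> nrm2 (v - a j) <= 4 * eta j.
Hypothesis link0 : th 0 * (S 0 - S (a 0%N)) <= 8 * (th 0) ^+ 2 * C ^+ 2 * Q (0 - a 0%N) + x 0.
Hypothesis linkS : forall j, (j < k0)%N ->
  th j * (S (a j) - S (a j.+1)) <= 8 * (th j) ^+ 2 * C ^+ 2 * Q (a j - a j.+1) + x j.
Hypothesis lip : forall u w, `|S u - S w| <= 2 * C * \sum_(i < n) `|f i (u - w)|.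

Let z0 : 0 <= z. Proof. by rewrite invr_ge0. Qed.
Let z1 : z <= 1. Proof. by rewrite invf_le1 ?ler1n. Qed.
Let eta0 j : 0 <= eta j. Proof. by rewrite mulr_ge0// exprn_ge0. Qed.
Let th_gt0 j : 0 < th j. Proof. by rewrite mulr_gt0// exprn_gt0. Qed.
Let Q_le u (e : R) : nrm2 u <= e -> Q u <= n%:R * A2 * e.
Proof.
move=> ue; apply: (@le_trans _ _ (\sum_(i < n) A2 * e)).
  by apply: ler_sum => i _; apply: le_trans (fA i u) _; rewrite ler_wpM2l.
by rewrite sumr_const card_ord -[leLHS]mulr_natl mulrA.
Qed.
Let f0 i : f i 0 = 0. Proof. by rewrite -(subrr 0) fB subrr. Qed.

Let etaS j : eta j.+1 <= eta j.
Proof. by rewrite ler_wpM2l// ler_wiXn2l// leq_mul// leq_add2l. Qed.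

Let T := 128 * C ^+ 2 * n%:R * A2 * th0 * eta 0 + X0 * 2 ^+ (k0 * d) / th0.
Let T0 : 0 <= T.
Proof.
by rewrite addr_ge0// ?divr_ge0 ?mulr_ge0 ?exprn_ge0 ?(ltW th00)// ?mulr_ge0 ?sqr_ge0.
Qed.

Let th_eta j : th j * eta j <= th0 * eta 0 * z ^+ j.
Proof.
have -> : th j * eta j = th0 * eta 0 * (2 ^+ (j * d.+1) * z ^+ (2 * M * j)).
  by rewrite /th /eta addn0 mulnDr exprD; ring.
have te0 : 0 <= th0 * eta 0 by rewrite mulr_ge0 ?(eta0 0)// ltW.
apply: (ler_wpM2l te0).
have -> : z ^+ j = 2 ^+ (j * d.+1) * (z ^+ (j * d.+1) * z ^+ j).
  by rewrite mulrA -exprMn /z divff// expr1n mul1r.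
rewrite ler_wpM2l ?exprn_ge0// -exprD ler_wiXn2l//.
by move: (leq_mul (leqnn j) dM); clear; lia.
Qed.

Let x_th j : x j / th j = X0 * 2 ^+ (k0 * d) / th0 * z ^+ j.
Proof.
rewrite /x /th /z exprVn mulnDl exprD mulnS exprD.
have := lt0r_neq0 th00; move: th0 => t0 t00.
have : (2 : R) ^+ j != 0 by rewrite expf_neq0.
have : (2 : R) ^+ (j * d) != 0 by rewrite expf_neq0.
move: (2 ^+ (j * d)) (2 ^+ j) (2 ^+ (k0 * d)) => u1 u2 u3 u10 u20.
by field; rewrite u10 u20 t00.
Qed.

Let step j : (j < k0)%N -> S (a j) - S (a j.+1) <= T * z ^+ j.
Proof.
move=> jk; have := linkS jk; rewrite -ler_pdivlMl// => H; apply: le_trans H _.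
(* Both ends are within [4 eta j] of [v] in squared norm, and the sum of the two distances doubles
   each. *)
have nn : nrm2 (a j - a j.+1) <= 16 * eta j.
  have -> : a j - a j.+1 = (v - a j.+1) - (v - a j) by rewrite opprB [RHS]addrC addrA subrK.
  apply: le_trans (nrm2D_le _ _) _; rewrite nrm2N.
  have := va (ltnW jk); have := va jk; have := etaS j; lra.
have -> : (th j)^-1 * (8 * th j ^+ 2 * C ^+ 2 * Q (a j - a j.+1) + x j) =
   8 * th j * C ^+ 2 * Q (a j - a j.+1) + x j / th j by field; exact: lt0r_neq0.
rewrite x_th /T [leRHS]mulrDl lerD2r.
apply: (@le_trans _ _ (8 * th j * C ^+ 2 * (n%:R * A2 * (16 * eta j)))).
  by rewrite ler_wpM2l ?Q_le// mulr_ge0 ?sqr_ge0// mulr_ge0// ltW.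
have -> : 8 * th j * C ^+ 2 * (n%:R * A2 * (16 * eta j)) = 128 * C ^+ 2 * n%:R * A2 * (th j * eta j) by ring.
have -> : 128 * C ^+ 2 * n%:R * A2 * th0 * eta 0 * z ^+ j = 128 * C ^+ 2 * n%:R * A2 * (th0 * eta 0 * z ^+ j) by ring.
by rewrite ler_wpM2l ?th_eta// !mulr_ge0// sqr_ge0.
Qed.

Let telescope j : (j <= k0)%N -> S (a 0%N) - S (a j) <= T * (2 - 2 * z ^+ j).
Proof.
elim: j => [|j IH] jk; first by rewrite subrr expr0 mulr1 subrr mulr0.
have H1 := IH (ltnW jk); have H2' := step jk.
have -> : S (a 0%N) - S (a j.+1) = (S (a 0%N) - S (a j)) + (S (a j) - S (a j.+1)) by ring.
apply: le_trans (lerD H1 H2') _; rewrite exprS /z le_eqVlt; apply/orP; left; apply/eqP; by field.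
Qed.

(** The first link, from 0, pays the variance [Q v] of the perturbation itself; later links are
    geometric with sum at most [2 T], whence [320 = 64 + 2 * 128] and [3 = 1 + 2]. The chain runs
    from level [k0] to level [2 k0], because the final Lipschitz step involves the root of [eta],
    which at double depth is comparable with [eta 0]. *)
Lemma chain_bound : S 0 - S v <= 16 * th0 * C ^+ 2 * Q v + 320 * C ^+ 2 * n%:R * A2 * th0 * eta 0 +
  3 * (X0 * 2 ^+ (k0 * d) / th0) + 4 * C * n%:R * Num.sqrt (A2 * eta k0).
Proof.
have -> : S 0 - S v = (S 0 - S (a 0%N)) + (S (a 0%N) - S (a k0)) + (S (a k0) - S v) by ring.
have first : S 0 - S (a 0%N) <= 16 * th0 * C ^+ 2 * Q v + 64 * C ^+ 2 * n%:R * A2 * th0 * eta 0 +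
    X0 * 2 ^+ (k0 * d) / th0.
  have := link0; rewrite -ler_pdivlMl// => H; apply: le_trans H _.
  have -> : (th 0)^-1 * (8 * th 0 ^+ 2 * C ^+ 2 * Q (0 - a 0%N) + x 0) =
    8 * th 0 * C ^+ 2 * Q (0 - a 0%N) + x 0 / th 0 by field; exact: lt0r_neq0.
  rewrite x_th expr0 mulr1 lerD2r.
  have -> : th 0 = th0 by rewrite /th mul0n expr0 mulr1.
  have QQ : Q (0 - a 0%N) <= 2 * Q v + 2 * (n%:R * A2 * (4 * eta 0)).
    apply: (@le_trans _ _ (2 * Q v + 2 * Q (v - a 0%N))); last first.
      by rewrite lerD2l ler_pM2l//; apply: Q_le; exact: va.
    rewrite /Q !mulr_sumr -big_split/=; apply: ler_sum => i _.
    have -> : f i (0 - a 0%N) = - f i v + f i (v - a 0%N) by rewrite !fB f0; ring.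
    by apply: le_trans (sqrD_le2 _ _) _; rewrite sqrrN.
  apply: (@le_trans _ _ (8 * th0 * C ^+ 2 * (2 * Q v + 2 * (n%:R * A2 * (4 * eta 0))))).
    by rewrite ler_wpM2l// mulr_ge0 ?sqr_ge0// mulr_ge0// ltW.
  by rewrite le_eqVlt; apply/orP; left; apply/eqP; ring.
have mid : S (a 0%N) - S (a k0) <= 2 * T.
  apply: le_trans (telescope (leqnn k0)) _; rewrite mulrC ler_wpM2r//.
  by rewrite gerBl mulr_ge0// exprn_ge0.
have final : S (a k0) - S v <= 4 * C * n%:R * Num.sqrt (A2 * eta k0).
  apply: le_trans (ler_norm _) _; rewrite distrC; apply: le_trans (lip _ _) _.
  have -> : 4 * C * n%:R * Num.sqrt (A2 * eta k0) = 2 * C * (n%:R * (2 * Num.sqrt (A2 * eta k0))) by ring.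
  rewrite ler_wpM2l ?mulr_ge0//.
  have -> : n%:R * (2 * Num.sqrt (A2 * eta k0)) = \sum_(i < n) 2 * Num.sqrt (A2 * eta k0).
    by rewrite sumr_const card_ord -[RHS]mulr_natl.
  apply: ler_sum => i _; rewrite -sqrtr_sqr.
  have -> : 2 * Num.sqrt (A2 * eta k0) = Num.sqrt (A2 * (4 * eta k0)).
    have -> : A2 * (4 * eta k0) = 2 ^+ 2 * (A2 * eta k0) by ring.
    have -> : Num.sqrt (2 ^+ 2 * (A2 * eta k0)) = Num.sqrt ((2 : R) ^+ 2) * Num.sqrt (A2 * eta k0).
      by rewrite sqrtrM// sqr_ge0.
    by rewrite sqrtr_sqr ger0_norm.
  apply: ler_wsqrtr; apply: le_trans (fA _ _) _; rewrite ler_wpM2l//; exact: va.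
move: first mid final; rewrite /T.
move: (S 0) (S v) (S (a 0%N)) (S (a k0)) (16 * _ * _ * _) (4 * C * _ * _) (X0 * _ / _) => s0 s1 s2 s3 w1 w2 w3.
have -> : 320 * C ^+ 2 * n%:R * A2 * th0 * eta 0 = 320 * (C ^+ 2 * n%:R * A2 * th0 * eta 0) by ring.
have -> : 64 * C ^+ 2 * n%:R * A2 * th0 * eta 0 = 64 * (C ^+ 2 * n%:R * A2 * th0 * eta 0) by ring.
have -> : 128 * C ^+ 2 * n%:R * A2 * th0 * eta 0 = 128 * (C ^+ 2 * n%:R * A2 * th0 * eta 0) by ring.
move: (C ^+ 2 * _ * _ * _ * _) => w4; lra.
Qed.
End Chain.

Lemma pow2_le_expR (R : realType) (n : nat) : (2 ^ n)%:R <= expR (n%:R : R).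
Proof.
rewrite -[n%:R]mulr1 expRM_natl natrX lerXn2r ?nnegrE ?expR_ge0//.
by have := expR_ge1Dx (1 : R); apply: le_trans; rewrite -natr1.
Qed.

Lemma sum_const_seq (R : realType) (T : eqType) (s : seq T) (F : T -> R) (y : R) :
  (forall l, l \in s -> F l = y) -> \sum_(l <- s) F l = (size s)%:R * y.
Proof.
move=> H; rewrite (eq_big_seq (fun=> y))//.
by rewrite big_const_seq count_predT iter_addr_0 mulr_natl.
Qed.

(** * Entropy of the penalty ball and a uniform deviation bound *)

Section Nets.
Variables (R : realType) (d : nat) (mu : {measure set Rd R d -> \bar R}).
Hypothesis leb : is_lebesgue_Rd mu.
Hypothesis d0 : (0 < d)%N.
Variable m : nat.
Hypothesis md : (d + 2 <= 2 * m.+1)%N.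
Variables (a0 : 'rV[R]_d) (H0 Cd : R).
Hypotheses (H00 : 0 < H0) (Cd0 : 0 <= Cd).
Let CA : R := span_const d m H0 Cd.
Let CA0 : 0 < CA. Proof. exact: span_const_gt0. Qed.
Let D1 := (m.+1 ^ d)%N.
Let z : R := 2^-1.
(** Large enough for [D1 <= CA * net_const], which the condition of [subspace_net] reduces to. *)
Definition net_const : nat := (Num.truncn (D1%:R / CA)).+1.
(** Dimension times the binary logarithm of the number of grid values per coordinate. The factor
    linear in [k] is the source of one [log n] in the remainder. *)
Definition net_exponent (k : nat) : nat :=
  ((4 * net_const + k * (d + m.+1)) * (D1 * 2 ^ (k * d)))%N.

Variables (p : nat) (t : 'I_p -> 'rV[R]_d).
Hypotheses (p0 : (0 < p)%N) (tQ : forall j, cube a0 H0 (t j)) (ts : well_spread Cd t).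

(** The scale [r] is kept apart from [f], so that contracting a perturbation changes [r] alone. *)
Definition in_class (K : R) (v : 'rV[R]_p) := nrm2 v <= K ^+ 2 /\
  exists f E r, [/\ pdiff m.+1 f, 0 < E, (dirichlet mu m.+1 f (cube a0 H0) <= E%:E)%E,
    r ^+ 2 * E <= K ^+ 2 & v = r *: \row_j f (t j)].

Lemma class_net (K : R) k : 0 < K -> exists s : seq 'rV[R]_p,
  (size s)%:R <= expR ((net_exponent k)%:R : R) /\
  forall v, in_class K v -> exists2 a, a \in s & nrm2 (v - a) <= 4 * (CA * K ^+ 2 * z ^+ (2 * m.+1 * k)).
Proof.
move=> K0; have [b Hb] := approx_span leb d0 md H00 Cd0 p0 tQ ts k.
set D := (_ * _)%N in Hb.
(* The exponent cancels the decay [2^(- m.+1 * k)] of [eta] and leaves [2^(k d)], whose square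
   dominates the dimension. *)
pose Z := (net_const * 2 ^ (k * (d + m.+1)))%N.
pose eta := Num.sqrt CA * K * z ^+ (m.+1 * k).
have z0 : 0 < z by rewrite invr_gt0.
have eta0 : 0 <= eta by rewrite !mulr_ge0 ?sqrtr_ge0 ?(ltW K0)// exprn_ge0// ltW.
have eta2 : eta ^+ 2 = CA * K ^+ 2 * z ^+ (2 * m.+1 * k).
  by rewrite /eta !exprMn sqr_sqrtr ?(ltW CA0)// -exprM [(m.+1 * k * 2)%N]mulnC mulnA.
have Z0 : (0 < Z)%N by rewrite muln_gt0 expn_gt0.
have a'1 : 1 <= net_const%:R :> R by rewrite ler1n.
have a'D : D1%:R <= CA * net_const%:R.
  by rewrite -ler_pdivrMl// mulrC; apply: ltW; exact: truncnS_gt.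
have etaZ : eta * Z%:R = Num.sqrt CA * K * net_const%:R * 2 ^+ (k * d).
  rewrite /eta /Z natrM natrX mulnDr exprD [(k * m.+1)%N]mulnC.
  have -> : Num.sqrt CA * K * z ^+ (m.+1 * k) * (net_const%:R * (2 ^+ (k * d) * 2 ^+ (m.+1 * k))) =
    Num.sqrt CA * K * net_const%:R * 2 ^+ (k * d) * (z ^+ (m.+1 * k) * 2 ^+ (m.+1 * k)) by ring.
  by rewrite -exprMn /z mulVf// expr1n mulr1.
have cond : D%:R * K ^+ 2 <= (eta * Z%:R) ^+ 2.
  rewrite etaZ !exprMn sqr_sqrtr ?(ltW CA0)//.
  have -> : D%:R = D1%:R * 2 ^+ (k * d) :> R.
    by rewrite /D natrM; congr (_ * _); rewrite -expnM natrX.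
  set u : R := 2 ^+ (k * d).
  have u1 : 1 <= u by rewrite exprn_ege1// ler1n.
  have -> : CA * K ^+ 2 * net_const%:R ^+ 2 * u ^+ 2 = (CA * net_const%:R) * (net_const%:R * (u * u)) * K ^+ 2 by ring.
  rewrite ler_wpM2r ?sqr_ge0//; apply: ler_pM => //; first by apply: le_trans u1.
  rewrite -[leLHS]mul1r; apply: ler_pM => //; first by apply: le_trans u1.
  by rewrite ler_peMl// (le_trans _ u1).
have [s [ss Hs]] := subspace_net p0 b K0 eta0 Z0 cond.
exists s; split.
  apply: le_trans (pow2_le_expR R (net_exponent k)); rewrite ler_nat; apply: leq_trans ss _.
  rewrite /net_exponent expnM.
  have -> : (D1 * 2 ^ (k * d))%N = D by rewrite /D -expnM.
  have dD : (0 < D)%N by rewrite /D muln_gt0 !expn_gt0.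
  rewrite leq_exp2r//; apply: (@leq_trans (4 * net_const * 2 ^ (k * (d + m.+1)))%N).
    by move: Z0; rewrite /Z; clear; lia.
  by rewrite expnD leq_mul2r; apply/orP; right; apply: ltnW; exact: ltn_expl.
move=> v [nv [f [E [r [pf E0 HE rE vE]]]]].
have [|a as_ Ha] := Hs v nv; last by exists a => //; rewrite -eta2.
have [c Hc] := Hb f E pf E0 HE.
exists (fun l => r * c l).
have -> : v - \sum_(l < D) (r * c l) *: b l = r *: (\row_j f (t j) - \sum_(l < D) c l *: b l).
  by rewrite vE scalerBr scaler_sumr; congr (_ - _); apply: eq_bigr => l _; rewrite scalerA.
rewrite nrm2Z eta2; apply: (@le_trans _ _ (r ^+ 2 * (CA * z ^+ (2 * m.+1 * k) * E))).
  by rewrite ler_wpM2l ?sqr_ge0.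
have -> : r ^+ 2 * (CA * z ^+ (2 * m.+1 * k) * E) = CA * z ^+ (2 * m.+1 * k) * (r ^+ 2 * E) by ring.
have -> : CA * K ^+ 2 * z ^+ (2 * m.+1 * k) = CA * z ^+ (2 * m.+1 * k) * K ^+ 2 by ring.
by rewrite ler_wpM2l// mulr_ge0 ?(ltW CA0)// exprn_ge0// ltW.
Qed.

Variables (dO : measure_display) (Omega : measurableType dO).
Variables (P : probability Omega R) (X : Omega -> 'rV[R]_d -> R) (Xs : nat -> Omega -> 'rV[R]_d -> R)
  (eps : nat -> Omega -> R).
Hypothesis iid : iid_data P X Xs eps.
Variables (rho : R -> R) (C2 : R).
Hypotheses (rho0 : forall x, 0 <= rho x) (rhoL : forall x y, `|rho x - rho y| <= C2 * `|x - y|).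
Hypothesis rhoI : forall u : R, P.-integrable setT (fun w => (rho (eps 0%N w + u))%:E).
Variables (n : nat) (c : R) (Rt : nat -> Omega -> R).
Hypothesis mRt : forall i (B : set R), measurable B -> data_sigma Xs eps (inl i) (Rt i @^-1` B).
Let fi i w u := lin c (fun j => Xs i w (t j)) u.
Let S w u := emp P Xs eps rho n t c Rt w u.

Lemma emp_lipschitz w u u' : `|S w u - S w u'| <= 2 * C2 * \sum_(i < n) `|fi i w (u - u')|.
Proof.
rewrite /S /emp -sumrB mulr_sumr; apply: le_trans (ler_norm_sum _ _ _) _; apply: ler_sum => i _.
set x := Rt i w - _; set y := Rt i w - _.
have xy : `|fi i w (u - u')| = `|x - y|.
  by rewrite /fi linB -normrN /x /y; congr (`| _ |); ring.
rewrite xy.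
have h1 := rhoL (eps i w + x) (eps i w + y).
have h2 := g_lipschitz rhoL rhoI x y.
rewrite /= in h2.
have e1 : eps i w + x - (eps i w + y) = x - y by ring.
rewrite e1 in h1.
have -> : forall r1 r2 g1 g2 : R, r1 - g1 - (r2 - g2) = (r1 - r2) - (g1 - g2) by move=> *; ring.
apply: le_trans (ler_normB _ _) _; apply: le_trans (lerD h1 h2) _.
by rewrite le_eqVlt; apply/orP; left; apply/eqP; ring.
Qed.

(** Counts pairs of points in consecutive nets: the finer net has [2^d] times the dimension of the
    coarser one, hence [2^d + 1]. The factor linear in the level is taken at the deepest level
    [2 * k0 + 1], and [L] is the confidence level. *)
Definition link_level (k0 : nat) (L : R) : R :=
  ((2 ^ d + 1) * ((4 * net_const + (2 * k0 + 1) * (d + m.+1)) * D1))%:R + L.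

Let exponent_le k0 k : (k <= 2 * k0 + 1)%N ->
  (net_exponent k)%:R <= ((4 * net_const + (2 * k0 + 1) * (d + m.+1)) * D1)%:R * 2 ^+ (k * d) :> R.
Proof.
move=> kk; rewrite -natrX -natrM ler_nat /net_exponent mulnA leq_mul2r; apply/orP; right.
by rewrite leq_mul2r; apply/orP; right; rewrite leq_add2l leq_mul2r kk orbT.
Qed.

(** At each of the [k0 + 1] levels the number of links is beaten by [exp (- x j)], which leaves
    [exp (- L)]. The class element [v] and the bound [A2] are quantified after the event, since the
    bounds on the links hold for each outcome. *)
Lemma uniform_emp (K th0 L : R) k0 : 0 < K -> 0 < th0 -> 0 <= L ->
  exists E : set Omega, [/\ measurable E, (P E <= (k0.+1%:R * expR (- L))%:E)%E &
   forall w A2 v, ~ E w -> 0 <= A2 -> (forall (i : 'I_n) u, (fi i w u) ^+ 2 <= A2 * nrm2 u) -> in_class K v ->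
    S w 0 - S w v <= 16 * th0 * C2 ^+ 2 * (\sum_(i < n) (fi i w v) ^+ 2) +
      320 * C2 ^+ 2 * n%:R * A2 * th0 * (CA * K ^+ 2 * z ^+ (2 * m.+1 * k0)) +
      3 * (link_level k0 L * 2 ^+ (k0 * d) / th0) +
      4 * C2 * n%:R * Num.sqrt (A2 * (CA * K ^+ 2 * z ^+ (2 * m.+1 * (k0 + k0))))].
Proof.
move=> K0 th00 L0.
have C20 : 0 <= C2 by have := le_trans (normr_ge0 _) (rhoL 1 0); rewrite subr0 normr1 mulr1.
have /choice[net Hnet] := fun k => class_net k K0.
pose X0 := link_level k0 L.
have X00 : 0 <= X0 by rewrite addr_ge0.
pose th j := th0 * 2 ^+ (j * d.+1).
pose x j := X0 * 2 ^+ ((k0 + j) * d).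
pose L1 : seq ((R * R) * ('rV[R]_p * 'rV[R]_p)) := [seq ((th 0%N, x 0%N), (0, u)) | u <- net k0].
pose L2 j : seq ((R * R) * ('rV[R]_p * 'rV[R]_p)) :=
  [seq ((th j, x j), (u, u')) | u <- net (k0 + j)%N, u' <- net (k0 + j).+1].
pose links := L1 ++ flatten [seq L2 j | j <- iota 0 k0].
have [E [mE PE HE]] := links_event iid rho0 rhoL rhoI n t c mRt links.
have pw j : 1 <= 2 ^+ ((k0 + j) * d) :> R by rewrite exprn_ege1// ler1n.
have xge j : (j <= k0)%N -> (net_exponent (k0 + j))%:R + L <= x j.
  move=> jk; have h1 := @exponent_le k0 (k0 + j) _.
  rewrite /x /X0 /link_level mulrDl; apply: lerD; last by rewrite ler_peMr.
  apply: le_trans (h1 _) _; first by move: jk; clear; lia.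
  rewrite ler_wpM2r ?(le_trans _ (pw j))// ler_nat leq_pmull// addn1.
  by [].
have xge2 j : (j < k0)%N -> (net_exponent (k0 + j))%:R + (net_exponent (k0 + j).+1)%:R + L <= x j.
  move=> jk; have h1 := @exponent_le k0 (k0 + j) _; have h2 := @exponent_le k0 (k0 + j).+1 _.
  rewrite /x /X0 /link_level; set Y := ((4 * net_const + _) * D1)%N in h1 h2 *.
  rewrite mulrDl; apply: lerD; last by rewrite ler_peMr.
  apply: le_trans (lerD (h1 _) (h2 _)) _; [by move: jk; clear; lia|by move: jk; clear; lia|].
  rewrite (mulSn (k0 + j)) exprD natrM natrD natrX.
  move: Y%:R (2 ^+ d) (2 ^+ ((k0 + j) * d)) => y1 y2 y3.
  by rewrite le_eqVlt; apply/orP; left; apply/eqP; ring.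
have P1 : \sum_(l <- L1) expR (- l.1.2) <= expR (- L).
  rewrite (@sum_const_seq _ _ _ _ (expR (- x 0%N))); last by move=> l /mapP[u _ ->].
  rewrite size_map; apply: (@le_trans _ _ (expR (net_exponent k0)%:R * expR (- x 0%N))).
    by rewrite ler_wpM2r ?expR_ge0//; have [] := Hnet k0.
  rewrite -expRD ler_expR; have := xge 0%N isT; rewrite addn0; lra.
have P2 j : (j < k0)%N -> \sum_(l <- L2 j) expR (- l.1.2) <= expR (- L).
  move=> jk; rewrite (@sum_const_seq _ _ _ _ (expR (- x j))); last by move=> l /allpairsP[[u u'] [_ _ ->]].
  rewrite size_allpairs natrM.
  apply: (@le_trans _ _ (expR (net_exponent (k0 + j))%:R * expR (net_exponent (k0 + j).+1)%:R * expR (- x j))).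
    rewrite ler_wpM2r ?expR_ge0//; apply: ler_pM => //.
      by have [] := Hnet (k0 + j)%N.
    by have [] := Hnet (k0 + j).+1.
  rewrite -!expRD ler_expR; have := xge2 j jk; lra.
exists E; split => //.
  apply: le_trans PE _; rewrite lee_fin /links big_cat/= -natr1 mulrDl mul1r addrC; apply: lerD => //.
  rewrite big_flatten big_map.
  have -> : k0%:R * expR (- L) = \sum_(j <- iota 0 k0) expR (- L) :> R.
    by rewrite (sum_const_seq (y := expR (- L)))// size_iota.
  rewrite big_seq [leRHS]big_seq; apply: ler_sum => j; rewrite mem_iota add0n => /andP[_ jk].
  exact: P2.
move=> w A2 v nE A20 HA Hv.
have /choice[a Ha] : forall j, exists a, a \in net (k0 + j)%N /\ nrm2 (v - a) <= 4 * (CA * K ^+ 2 * z ^+ (2 * m.+1 * (k0 + j))).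
  by move=> j; have [_ H] := Hnet (k0 + j)%N; have [a ? ?] := H v Hv; exists a.
have := @chain_bound R p n (S w) (fun i => fi i w) A2 C2 th0 X0 (CA * K ^+ 2) d m.+1 k0 v a.
rewrite /= addn0; apply => //.
- by move=> i u u'; exact: linB.
- by rewrite mulr_ge0 ?(ltW CA0)// sqr_ge0.
- by move=> j _; have [] := Ha j.
- have := HE w nE ((th 0%N, x 0%N), (0, a 0%N)); rewrite /= /x addn0; apply.
  rewrite mem_cat; apply/orP; left; apply/mapP; exists (a 0%N) => //.
    by have [] := Ha 0%N; rewrite addn0.
  by rewrite /x addn0.
- move=> j jk; have := HE w nE ((th j, x j), (a j, a j.+1)); rewrite /=; apply.
  rewrite mem_cat; apply/orP; right; apply/flattenP; exists (L2 j).
    by apply/mapP; exists j => //; rewrite mem_iota add0n.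
  apply/allpairsP; exists (a j, a j.+1); split => //=; first by have [] := Ha j.
  by have [] := Ha j.+1; rewrite addnS.
- exact: emp_lipschitz.
Qed.
End Nets.

Lemma finite_union_event (R : realType) (dO : measure_display) (Omega : measurableType dO) (P : probability Omega R)
    (J : finType) (E : J -> set Omega) (e : R) : (forall j, measurable (E j)) -> (forall j, (P (E j) <= e%:E)%E) ->
  exists F, [/\ measurable F, (P F <= (#|J|%:R * e)%:E)%E & forall j, E j `<=` F].
Proof.
move=> mE PE; exists (\big[setU/set0]_(j : J) E j).
have mF : measurable (\big[setU/set0]_(j : J) E j) by exact: bigsetU_measurable.
split => //; last by move=> j w Ew; rewrite (bigD1 j)//; left.
apply: (@le_trans _ _ (\sum_(j : J) P (E j))%E).
  apply: measure_cover => // w; elim/big_rec: _ => [//|j S _ IH [Ew|Sw]]; last exact: IH.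
  by exists j.
apply: (@le_trans _ _ (\sum_(j : J) e%:E)%E); first by apply: lee_sum => j _; exact: PE.
by rewrite sumEFin sumr_const lee_fin -[leLHS]mulr_natl.
Qed.

(** * Discretised responses *)

Section DataEvent.
Variables (R : realType) (d : nat) (mu : {measure set Rd R d -> \bar R}).
Hypothesis leb : is_lebesgue_Rd mu.
Hypothesis d0 : (0 < d)%N.
Variables (I : set 'rV[R]_d) (v : R).
Hypotheses (oI : open I) (bI : bounded_Rd I) (vI : mu I = v%:E) (v0 : 0 < v) (I0 : I !=set0).
Variables (dO : measure_display) (Omega : measurableType dO).
Variables (P : probability Omega R) (X : Omega -> 'rV[R]_d -> R) (Xs : nat -> Omega -> 'rV[R]_d -> R)
  (eps : nat -> Omega -> R).
Hypotheses (jX : joint_random_field X) (iid : iid_data P X Xs eps).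
Variables (kappa C1 tau A : R).
Hypotheses (k0 : 0 < kappa) (C10 : 0 < C1).
Hypothesis hX : forall s s' : 'rV[R]_d, I s -> I s' ->
  (\int[P]_w ((X w s - X w s') ^+ 2)%:E <= (C1 * powR (eucl_dist s s') (2 * kappa))%:E)%E.
Hypothesis tail : forall (Y : Omega -> 'rV[R]_d -> R) (S : seq 'rV[R]_d) (y : R), 0 <= y ->
  (forall u, measurable_fun setT (Y ^~ u)) -> same_fdd P Y X -> (forall u, u \in S -> I u) ->
  measurable [set w | exists2 u, u \in S & y < Y w u ^+ 2] /\
  (P [set w | exists2 u, u \in S & (y < Y w u ^+ 2)%R] <= (A * expR (- (tau * y)))%:E)%E.
Variables (beta : 'rV[R]_d -> R) (b : R).
Hypotheses (mb : measurable_fun setT (beta : Rd R d -> R)) (bb : forall u, I u -> `|beta u| <= b) (b0 : 0 <= b).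
Variables (p : nat) (t : 'I_p -> 'rV[R]_d) (Aj : 'I_p -> set 'rV[R]_d).
Hypothesis des : design_np mu I t Aj.
Let p0 : (0 < p)%N. Proof. by have [] := des. Qed.
Let h := maxdiam Aj.
Hypothesis h0 : 0 < h.
Variables (o : 'I_p -> R) (Co : R).
Hypotheses (o0 : forall j, 0 <= o j)
  (Ho : forall j u, I u -> eucl_dist u (t j) <= h -> (beta u - beta (t j)) ^+ 2 <= o j)
  (so : v / p%:R * \sum_j o j <= Co).
Let mI : measurable (I : set (Rd R d)). Proof. exact: measurable_domain. Qed.
Let mXs i u : measurable_fun setT (Xs i ^~ u).
Proof. by have [jXs _] := iid; exact: section_measurable. Qed.
Let mX u : measurable_fun setT (X ^~ u). Proof. exact: section_measurable. Qed.
Let fdd i : same_fdd P (Xs i) X. Proof. by have [_ [_ [H _]]] := iid. Qed.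

Let hXs i (s s' : 'rV[R]_d) : I s -> I s' ->
  (\int[P]_w ((Xs i w s - Xs i w s') ^+ 2)%:E <= (C1 * powR (eucl_dist s s') (2 * kappa))%:E)%E.
Proof.
move=> Is Is'; apply: le_trans (hX Is Is').
pose F (z : R * R) : \bar R := ((z.1 - z.2) ^+ 2)%:E.
have mF : measurable_fun setT F.
  by apply: meas_sq; apply: measurable_funB; [exact: measurable_fst|exact: measurable_snd].
have F0 z : (0 <= F z)%E by rewrite lee_fin sqr_ge0.
by rewrite -[leLHS]/(\int[P]_w F (Xs i w s, Xs i w s'))%E (pair_law s s' (mXs i) mX (fdd i) mF F0).
Qed.

Definition integral_response (i : nat) (w : Omega) : R :=
  fine (\int[mu]_(u in (I : set (Rd R d))) (Xs i w u * beta u)%:E).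
Let fb i w := lin (v / p%:R) (fun j => Xs i w (t j)) (\row_j beta (t j)).

Lemma mXsw i w : measurable_fun setT (Xs i w : Rd R d -> R).
Proof. by have [jXs _] := iid; exact: (measurableT_comp (jXs i) (pair1_measurable w)). Qed.

(** Two quantisations work together. A mesh much finer than the design turns each integral response,
    up to [1/n], into a finite combination of evaluations, which makes [Rt] measurable for the right
    sigma-algebra; the design cells give the size of [Rt]. The exceptional events are a large
    covariate value, a fine quantisation error beyond its bound, and a large total design error. *)
Lemma data_event (n : nat) (xi del : R) : (0 < n)%N -> 0 <= xi -> 0 < del ->
  exists (Rt : nat -> Omega -> R) (E : set Omega),
  [/\ forall i (B : set R), measurable B -> data_sigma Xs eps (inl i) (Rt i @^-1` B),
      measurable E,
      (P E <= (n%:R * (A * expR (- (tau * xi ^+ 2))) + n%:R^-1 + del)%:E)%E &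
      forall w, ~ E w ->
      [/\ forall (i : 'I_n) j, `|Xs i w (t j)| <= xi,
          forall i : 'I_n, `|Rt i w| <= 2 * (b * v) * xi,
          forall i : 'I_n, `|integral_response i w - fb i w - Rt i w| <= n%:R^-1 &
          \sum_(i < n) (Rt i w) ^+ 2 <= n%:R * (4 * b ^+ 2 * v * (v * C1 * powR h (2 * kappa) / del) +
             4 * xi ^+ 2 * v * Co + 2 * n%:R^-1 ^+ 2)]].
Proof.
move=> n0 xi0 del0.
have nR : 0 < n%:R :> R by rewrite ltr0n.
have pR : 0 < p%:R :> R by rewrite ltr0n.
(* Makes [b^2 v qg <= n^-2], so that each response moves by at most [1/n]. *)
pose qg := (n%:R ^+ 2 * (b ^+ 2 * v + 1))^-1.
have bv1 : 0 < b ^+ 2 * v + 1 by rewrite ltr_wpDl// mulr_ge0 ?sqr_ge0// ltW.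
have qg0 : 0 < qg by rewrite invr_gt0 mulr_gt0// exprn_gt0.
have bq : b ^+ 2 * (v * qg) <= n%:R^-1 ^+ 2.
  have -> : b ^+ 2 * (v * qg) = n%:R^-1 ^+ 2 * (b ^+ 2 * v / (b ^+ 2 * v + 1)).
    by rewrite /qg; field; rewrite !gt_eqF.
  by rewrite ger_pMr ?exprn_gt0 ?invr_gt0// ler_pdivrMr// mul1r lerDl.
(* The mesh is so fine that Markov's inequality gives probability at most [n^-2] per observation,
   hence [1/n] over the sample. *)
pose ex := qg / (n%:R ^+ 2 * (v * C1)).
have vC0 : 0 < v * C1 by rewrite mulr_gt0.
have ex0 : 0 < ex by rewrite divr_gt0// mulr_gt0// exprn_gt0.
pose eta := powR ex (2 * kappa)^-1.
have eta0 : 0 < eta by exact: powR_gt0.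
have etaE : powR eta (2 * kappa) = ex.
  by rewrite /eta -powRrM mulVf ?powRr1 ?(ltW ex0)// gt_eqF// mulr_gt0.
have [J [s [sg [sI msg near]]]] := fine_quantizer d0 bI I0 eta0.
have [sd [msd neard vold]] := design_quantizer d0 oI bI des.
have tI := design_points des.
have jXs i : joint_random_field (Xs i) by have [] := iid.
pose Qg i := quant_err mu I (Xs i) sg s.
pose Qd i := quant_err mu I (Xs i) sd t.
have HQg i := quant_err_bound mI vI (jXs i) C10 k0 (hXs i) msg sI (ltW eta0) near.
have HQd i := quant_err_bound mI vI (jXs i) C10 k0 (hXs i) msd tI (ltW h0) neard.
pose wt := cell_weight mu I sg beta.
pose Wt i w := \sum_j Xs i w (s j) * wt j.
pose Rt i w := Wt i w - fb i w.
(* Finitely many points suffice: the design points and the representatives of the fine mesh. *)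
pose S := [seq t j | j <- enum 'I_p] ++ [seq s j | j <- enum J].
have SI u : u \in S -> I u.
  by rewrite mem_cat => /orP[/mapP[j _ ->]|/mapP[j _ ->]]; [exact: tI|exact: sI].
have T1 i := tail (sqr_ge0 xi) (mXs i) (fdd i) SI.
have [F1 [mF1 PF1 sF1]] := finite_union_event (fun j : 'I_n => (T1 j).1) (fun j : 'I_n => (T1 j).2).
have M2 (i : 'I_n) : measurable [set w | (qg%:E < Qg i w)%E] /\ (P [set w | (qg%:E < Qg i w)%E] <= (n%:R^-1 ^+ 2)%:E)%E.
  have [mQ Q0 IQ] := HQg i; have [mM PM] := markov_ge0 P mQ Q0 qg0; split => //.
  apply: le_trans PM _; apply: (@le_trans _ _ ((qg^-1)%:E * (v * (C1 * powR eta (2 * kappa)))%:E)%E).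
    by apply: lee_wpmul2l => //; rewrite lee_fin invr_ge0 ltW.
  rewrite -EFinM lee_fin etaE /ex le_eqVlt; apply/orP; left; apply/eqP.
  by field; rewrite !gt_eqF.
have [F2 [mF2 PF2 sF2]] := finite_union_event (fun j : 'I_n => (M2 j).1) (fun j : 'I_n => (M2 j).2).
pose SQ w := (\sum_(i < n) Qd i w)%E.
have mSQ : measurable_fun setT SQ by apply: emeasurable_sum => i; have [] := HQd i.
have Qd0 i w : (0 <= Qd i w)%E by have [_ Q0 _] := HQd i; exact: Q0.
have SQ0 w : (0 <= SQ w)%E by apply: sume_ge0.
have hk : 0 < powR h (2 * kappa) by exact: powR_gt0.
(* The expected total error divided by [del], so that Markov's inequality leaves probability at most
   [del]. *)
pose q3 := n%:R * (v * C1 * powR h (2 * kappa)) / del.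
have q30 : 0 < q3 by rewrite divr_gt0// mulr_gt0// mulr_gt0.
have [mF3 PF3] := markov_ge0 P mSQ SQ0 q30.
set F3 := [set w | _] in mF3 PF3.
exists Rt, (F1 `|` F2 `|` F3); split.
- move=> i B mB; apply: sub_sigma => // C mC; first exact: lincomb_sigma.
  exact: lin_sigma.
- by apply: measurableU => //; exact: measurableU.
- apply: (@le_trans _ _ (P (F1 `|` F2) + P F3)%E); first by apply: measureU2 => //; exact: measurableU.
  rewrite EFinD; apply: leeD.
    apply: (@le_trans _ _ (P F1 + P F2)%E); first exact: measureU2.
    rewrite EFinD; apply: leeD; first by move: PF1; rewrite card_ord.
    apply: le_trans PF2 _; rewrite card_ord lee_fin le_eqVlt; apply/orP; left; apply/eqP.
    by field; rewrite gt_eqF.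
  apply: le_trans PF3 _.
  have -> : (\int[P]_w SQ w = \sum_(i < n) \int[P]_w Qd i w)%E.
    by rewrite (int_sum P measurableT (index_enum 'I_n) (f := fun (i : 'I_n) => Qd i))// => i; have [] := HQd i.
  apply: (@le_trans _ _ ((q3^-1)%:E * (\sum_(i < n) (v * (C1 * powR h (2 * kappa)))%:E))%E).
    apply: lee_wpmul2l; first by rewrite lee_fin invr_ge0 ltW.
    by apply: lee_sum => i _; have [] := HQd i.
  rewrite sumEFin sumr_const card_ord -EFinM lee_fin -[X in _ * X]mulr_natl /q3 le_eqVlt; apply/orP; left; apply/eqP.
  by field; rewrite !gt_eqF.
move=> w /not_orP[/not_orP[nF1 nF2] nF3].
have xiS (i : 'I_n) u : u \in S -> `|Xs i w u| <= xi.
  move=> uS; rewrite leNgt; apply/negP => H; apply: nF1; apply: (sF1 i); exists u => //.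
  by rewrite -[ltRHS]real_normK ?num_real// ltrXn2r ?nnegrE ?xi0.
have xit (i : 'I_n) j : `|Xs i w (t j)| <= xi.
  by apply: xiS; rewrite mem_cat; apply/orP; left; apply/mapP; exists j => //; rewrite mem_enum.
have xis (i : 'I_n) j : `|Xs i w (s j)| <= xi.
  by apply: xiS; rewrite mem_cat; apply/orP; right; apply/mapP; exists j => //; rewrite mem_enum.
have gridE (i : 'I_n) : (integral_response i w - Wt i w) ^+ 2 <= n%:R^-1 ^+ 2.
  apply: le_trans bq; apply: (quadrature mI vI v0 msg mb bb (mXsw i w) (ltW qg0) b0).
  by rewrite leNgt; apply/negP => H; apply: nF2; exact: (sF2 i).
have gridN (i : 'I_n) : `|integral_response i w - Wt i w| <= n%:R^-1.
  rewrite -(@ler_pXn2r _ 2)// ?nnegrE ?invr_ge0// real_normK ?num_real//; exact: gridE.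
have Qfin (i : 'I_n) : Qd i w \is a fin_num.
  rewrite ge0_fin_numE//; have : (SQ w <= q3%:E)%E by rewrite leNgt; apply/negP.
  move=> H; apply: le_lt_trans (ltry q3); apply: le_trans H.
  by rewrite /SQ (bigD1 i)//=; apply: leeDl; apply: sume_ge0.
have sumQ : \sum_(i < n) fine (Qd i w) <= q3.
  rewrite -lee_fin -sumEFin; under eq_bigr do rewrite fineK//.
  by rewrite leNgt; apply/negP.
have vol j : mu (I `&` [set x | sd x = j]) = (v / p%:R)%:E by rewrite vold vI.
have Ho' u : I u -> (beta u - beta (t (sd u))) ^+ 2 <= o (sd u).
  by move=> Iu; apply: Ho => //; exact: neard.
have RE (i : 'I_n) : (integral_response i w - fb i w) ^+ 2 <=
    2 * (b ^+ 2 * (v * fine (Qd i w))) + 2 * (xi ^+ 2 * (v * Co)).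
  apply: (@le_trans _ _ (2 * (b ^+ 2 * (v * fine (Qd i w))) + 2 * (xi ^+ 2 * (v * (v / p%:R * \sum_j o j))))).
    apply: (response_error mI vI v0 p0 msd vol mb bb b0 tI o0 Ho' (mXsw i w)) => //.
    - by rewrite fine_ge0.
    - by rewrite fineK//; exact: lexx.
  by rewrite lerD2l ler_pM2l// ler_wpM2l ?sqr_ge0// ler_pM2l.
split => //.
- move=> i; rewrite /Rt; apply: le_trans (ler_normB _ _) _.
  have -> : 2 * (b * v) * xi = xi * b * v + xi * b * v by ring.
  apply: lerD.
    have := int_quantized mI vI msg mb bb (fun j => Xs i w (s j)).
    rewrite -/wt -/(Wt i w) => HW.
    rewrite -lee_fin -abse_EFin -HW; apply: le_trans (le_abse_integral _ mI _) _.
      by apply/measurable_EFinP; apply: measurable_funTS; apply: measurable_funM => //; exact: (measurable_quantized msg (fun j => Xs i w (s j))).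
    apply: (@le_trans _ _ (\int[mu]_(u in (I : set (Rd R d))) (xi * b)%:E)%E); last by rewrite integral_cst//= vI -EFinM.
    apply: ge0_le_integral => //.
    - apply: measurableT_comp => //; apply/measurable_EFinP; apply: measurable_funTS; apply: measurable_funM => //.
      exact: (measurable_quantized msg (fun j => Xs i w (s j))).
    - by move=> u Iu; rewrite /= lee_fin normrM; exact: (ler_pM (normr_ge0 _) (normr_ge0 _) (xis _ _) (bb Iu)).
  rewrite /fb /lin; apply: le_trans (ler_norm_sum _ _ _) _.
  apply: (@le_trans _ _ (\sum_(j < p) xi * b * (v / p%:R))).
    apply: ler_sum => j _; rewrite mxE 2!normrM (gtr0_norm (divr_gt0 v0 pR)) ler_wpM2r ?(ltW (divr_gt0 v0 pR))//.
    exact: (ler_pM (normr_ge0 _) (normr_ge0 _) (xit _ _) (bb (tI _))).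
  rewrite sumr_const card_ord -[leLHS]mulr_natl le_eqVlt; apply/orP; left; apply/eqP.
  by field; rewrite gt_eqF.
- move=> i; rewrite /Rt.
  have -> : integral_response i w - fb i w - (Wt i w - fb i w) = integral_response i w - Wt i w by ring.
  exact: gridN.
apply: (@le_trans _ _ (\sum_(i < n) (4 * b ^+ 2 * v * fine (Qd i w) + (4 * xi ^+ 2 * v * Co + 2 * n%:R^-1 ^+ 2)))).
  apply: ler_sum => i _.
  have -> : Rt i w = (integral_response i w - fb i w) + - (integral_response i w - Wt i w) by rewrite /Rt; ring.
  apply: le_trans (sqrD_le2 _ _) _; rewrite sqrrN.
  have h1 := RE i; have h2 := gridE i.
  have -> : 4 * b ^+ 2 * v * fine (Qd i w) + (4 * xi ^+ 2 * v * Co + 2 * n%:R^-1 ^+ 2) =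
    2 * (2 * (b ^+ 2 * (v * fine (Qd i w))) + 2 * (xi ^+ 2 * (v * Co))) + 2 * n%:R^-1 ^+ 2 by ring.
  by apply: lerD; rewrite ler_pM2l.
rewrite big_split/= -mulr_sumr sumr_const card_ord -[X in _ + X]mulr_natl.
rewrite -[in leRHS]addrA [leRHS]mulrDr lerD2r.
have -> : n%:R * (4 * b ^+ 2 * v * (v * C1 * powR h (2 * kappa) / del)) = 4 * b ^+ 2 * v * q3 by rewrite /q3; ring.
by rewrite ler_wpM2l// mulr_ge0 ?(ltW v0)// mulr_ge0// sqr_ge0.
Qed.
End DataEvent.

(** * Deterministic inequalities for the excess loss *)

Section DeterministicBounds.
Variable R : realType.

(** [Rr] is the true discretisation error and [Rt] its measurable substitute: exchanging them twice
    per observation costs [2 C2] in all. The centred part is the hypothesis on the empirical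
    process, and the means are bounded below by the curvature of [g]. *)
Lemma excess_lower_bound n (rho g : R -> R) (C2 e T M th D : R) (ep Rt Rr fv : 'I_n -> R) :
  (0 < n)%N -> (forall x y, `|rho x - rho y| <= C2 * `|x - y|) -> 0 <= C2 -> 0 < e -> 1 <= T -> 0 <= M ->
  (forall x, `|x| <= T -> e ^+ 2 * x ^+ 2 / T <= g x - g 0) -> (forall x, g x - g 0 <= M * x ^+ 2) ->
  (forall i, `|Rt i| + `|fv i| <= T) -> (forall i, `|Rr i - Rt i| <= n%:R^-1) ->
  0 <= th -> 64 * th * C2 ^+ 2 * T <= e ^+ 2 ->
  \sum_i (rho (ep i + Rt i) - g (Rt i)) - \sum_i (rho (ep i + (Rt i - fv i)) - g (Rt i - fv i)) <=
    16 * th * C2 ^+ 2 * (\sum_i fv i ^+ 2) + D ->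
  e ^+ 2 / (4 * T) * (\sum_i fv i ^+ 2) - (e ^+ 2 + M) * (\sum_i Rt i ^+ 2) - D - 2 * C2 <=
    \sum_i (rho (ep i + (Rr i - fv i)) - rho (ep i + Rr i)).
Proof.
move=> n0 rhoL C20 e0 T1 M0 gl gu HT HR th0 Hth Hemp.
have T0 : 0 < T by apply: lt_le_trans T1.
have nR : 0 < n%:R :> R by rewrite ltr0n.
have F0 : 0 <= \sum_i fv i ^+ 2 by apply: sumr_ge0 => i _; exact: sqr_ge0.
have H : \sum_i (rho (ep i + (Rt i - fv i)) - g (Rt i - fv i)) - \sum_i (rho (ep i + Rt i) - g (Rt i)) +
    e ^+ 2 / (2 * T) * (\sum_i fv i ^+ 2) - (e ^+ 2 + M) * (\sum_i Rt i ^+ 2) - 2 * C2 <=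
    \sum_i (rho (ep i + (Rr i - fv i)) - rho (ep i + Rr i)).
  have -> : 2 * C2 = \sum_(i < n) (2 * C2 * n%:R^-1).
    by rewrite sumr_const card_ord -[RHS]mulr_natl; field; rewrite gt_eqF.
  rewrite !mulr_sumr -!sumrB -big_split/= -!sumrB; apply: ler_sum => i _.
  have b1 : rho (ep i + (Rt i - fv i)) - rho (ep i + (Rr i - fv i)) <= C2 * n%:R^-1.
    apply: le_trans (ler_norm _) _; apply: le_trans (rhoL _ _) _; apply: ler_wpM2l => //.
    have -> : ep i + (Rt i - fv i) - (ep i + (Rr i - fv i)) = - (Rr i - Rt i) by ring.
    by rewrite normrN.
  have b2 : rho (ep i + Rr i) - rho (ep i + Rt i) <= C2 * n%:R^-1.
    apply: le_trans (ler_norm _) _; apply: le_trans (rhoL _ _) _; apply: ler_wpM2l => //.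
    by have -> : ep i + Rr i - (ep i + Rt i) = Rr i - Rt i by ring.
  have b3 : e ^+ 2 * (Rt i - fv i) ^+ 2 / T <= g (Rt i - fv i) - g 0.
    by apply: gl; apply: le_trans (HT i); exact: ler_normB.
  have b4 := gu (Rt i).
  (* From [(Rt - fv)^2 >= fv^2 / 2 - Rt^2]; the factor [1/T] in front of [Rt^2] is dropped as
     [1 <= T]. *)
  have b5 : e ^+ 2 / (2 * T) * fv i ^+ 2 - e ^+ 2 * Rt i ^+ 2 <= e ^+ 2 * (Rt i - fv i) ^+ 2 / T.
    have -> : e ^+ 2 / (2 * T) * fv i ^+ 2 = e ^+ 2 / T * (fv i ^+ 2 / 2) by field; rewrite gt_eqF.
    have -> : e ^+ 2 * (Rt i - fv i) ^+ 2 / T = e ^+ 2 / T * (Rt i - fv i) ^+ 2 by field; rewrite gt_eqF.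
    have q0 : 0 <= e ^+ 2 / T by rewrite divr_ge0 ?sqr_ge0// ltW.
    have q1 : e ^+ 2 / T * Rt i ^+ 2 <= e ^+ 2 * Rt i ^+ 2.
      by rewrite ler_wpM2r ?sqr_ge0// ler_pdivrMr// ler_peMr ?sqr_ge0.
    have q2 : fv i ^+ 2 / 2 - Rt i ^+ 2 <= (Rt i - fv i) ^+ 2.
      by have := sqr_ge0 (2 * Rt i - fv i); nra.
    have := ler_wpM2l q0 q2; rewrite mulrBr; lra.
  have -> : 2 * C2 / n%:R = 2 * (C2 / n%:R) by ring.
  have -> : (e ^+ 2 + M) * Rt i ^+ 2 = e ^+ 2 * Rt i ^+ 2 + M * Rt i ^+ 2 by ring.
  lra.
(* Half of the curvature pays for the empirical variance; this fixes the admissible size of [th]. *)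
have q : 16 * th * C2 ^+ 2 * (\sum_i fv i ^+ 2) <= e ^+ 2 / (4 * T) * (\sum_i fv i ^+ 2).
  apply: ler_wpM2r => //; rewrite ler_pdivlMr ?mulr_gt0//; apply: le_trans Hth.
  by rewrite le_eqVlt; apply/orP; left; apply/eqP; ring.
have q' : e ^+ 2 / (2 * T) * (\sum_i fv i ^+ 2) =
    e ^+ 2 / (4 * T) * (\sum_i fv i ^+ 2) + e ^+ 2 / (4 * T) * (\sum_i fv i ^+ 2) by field; rewrite gt_eqF.
rewrite q' in H; lra.
Qed.

Lemma excess_convex n (rho : R -> R) (ep Rr fv : 'I_n -> R) (s : R) : convex_real_fun rho -> 0 <= s <= 1 ->
  \sum_i (rho (ep i + (Rr i - s * fv i)) - rho (ep i + Rr i)) <=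
  s * \sum_i (rho (ep i + (Rr i - fv i)) - rho (ep i + Rr i)).
Proof.
move=> rc s01; rewrite mulr_sumr; apply: ler_sum => i _.
have := rc (ep i + (Rr i - fv i)) (ep i + Rr i) s s01.
have -> : s * (ep i + (Rr i - fv i)) + (1 - s) * (ep i + Rr i) = ep i + (Rr i - s * fv i) by ring.
by rewrite mulrBr; lra.
Qed.

(* If [Jt] exceeded [K], contracting the perturbation to size [K] would contradict convexity. *)
Lemma localization (Aj J0 Jh lam Jt K q F B G : R) (LD : R -> R) :
  0 <= Aj -> 0 <= J0 -> 0 <= Jh -> 0 < lam -> 0 <= q -> 0 <= F -> 0 <= G -> 0 < Jt ->
  Jt ^+ 2 = Aj * (J0 + Jh) + 1 ->
  (forall s, 0 <= s <= 1 -> s * Jt <= K -> q * (s ^+ 2 * F) - B <= LD s) ->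
  (forall s, 0 <= s <= 1 -> LD s <= s * LD 1) ->
  LD 1 <= lam * (J0 - Jh) -> B <= G * K * lam -> Aj * G + 2 * (Aj * J0) + 1 < K ->
  Jt <= K /\ q * F <= lam * J0 + B.
Proof.
move=> Aj0 J00 Jh0 lam0 q0 F0 G0 Jt0 JtE low conv up HB HK.
have K0 : 0 < K by apply: le_lt_trans HK; rewrite !addr_ge0// ?mulr_ge0// mulr_ge0.
suff JK : Jt <= K.
  split => //; have := low 1; rewrite ler01 lexx mul1r expr1n mul1r => /(_ isT JK) H.
  by have : lam * (J0 - Jh) <= lam * J0 by [rewrite ler_pM2l//; lra]; lra.
rewrite leNgt; apply/negP => KJ.
pose s := K / Jt.
have s0 : 0 < s by rewrite divr_gt0.
have s1 : s <= 1 by rewrite ler_pdivrMr// mul1r ltW.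
have sJ : s * Jt = K by rewrite /s divfK// gt_eqF.
have s01 : 0 <= s <= 1 by rewrite s1 ltW.
have h1 := low s s01; rewrite sJ in h1; have {}h1 := h1 (lexx _).
have h2 := conv s s01.
have h3 : s * LD 1 <= s * (lam * (J0 - Jh)) by rewrite ler_pM2l.
have h4 : 0 <= q * (s ^+ 2 * F) by rewrite mulr_ge0// mulr_ge0// sqr_ge0.
have h5 : - (G * K * lam) <= s * (lam * (J0 - Jh)) by lra.
(* Since [K = s * Jt], division by [s * lam] turns the remainder, which is linear in [K], into
   [Jh <= J0 + G * Jt]. As [Jt^2] is affine in [Jh], this yields [Jt^2 <= const * Jt] with a
   constant smaller than [K]. *)
have h6 : - (G * Jt) <= J0 - Jh.
  rewrite -(ler_pM2l (mulr_gt0 s0 lam0)).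
  have -> : s * lam * - (G * Jt) = - (G * (s * Jt) * lam) by ring.
  by rewrite sJ -[s * lam * _]mulrA.
have h7 : Aj * Jh <= Aj * (J0 + G * Jt) by rewrite ler_wpM2l//; lra.
have Jt1 : 1 <= Jt.
  rewrite leNgt; apply/negP => J1.
  have : Jt ^+ 2 < 1 by rewrite expr_lt1// ltW.
  have : 0 <= Aj * (J0 + Jh) by rewrite mulr_ge0// addr_ge0.
  by rewrite JtE; lra.
have h8 : Jt * Jt <= (Aj * G + 2 * (Aj * J0) + 1) * Jt.
  have a1 : Aj * J0 <= Aj * J0 * Jt by rewrite ler_peMr// mulr_ge0.
  rewrite -expr2 JtE.
  have -> : Aj * (J0 + Jh) = Aj * J0 + Aj * Jh by ring.
  have -> : (Aj * G + 2 * (Aj * J0) + 1) * Jt = Aj * G * Jt + 2 * (Aj * J0 * Jt) + Jt by ring.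
  have h7' : Aj * (J0 + G * Jt) = Aj * J0 + Aj * G * Jt by ring.
  rewrite h7' in h7; lra.
by move: h8; rewrite ler_pM2r// => h8; lra.
Qed.

(* The cells of the chaining net have side [2^-k], balanced against [n]. *)
Lemma rate_scale (n M d : nat) : (0 < n)%N -> (0 < M)%N -> (0 < d)%N ->
  exists (y : R) (k : nat), [/\ 1 <= y, y ^+ (2 * M + d) = n%:R, 2 ^+ k <= y /\ y <= 2 ^+ k.+1,
    powR n%:R (- (2 * M)%:R / (2 * M + d)%:R) = (y ^+ (2 * M))^-1 &
    powR n%:R (- M%:R / (2 * M + d)%:R) = (y ^+ M)^-1].
Proof.
move=> n0 M0 d0; have nR : 0 < n%:R :> R by rewrite ltr0n.
have s0 : 0 < (2 * M + d)%:R :> R by rewrite ltr0n addn_gt0 d0 orbT.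
pose y : R := powR n%:R ((2 * M + d)%:R)^-1.
have y0 : 0 < y by exact: powR_gt0.
have yE : y ^+ (2 * M + d) = n%:R.
  by rewrite -powR_mulrn ?(ltW y0)// /y -powRrM mulVf ?powRr1 ?ltW// gt_eqF.
have pw k : powR n%:R (- k%:R / (2 * M + d)%:R) = (y ^+ k)^-1.
  have -> : y ^+ k = powR n%:R (k%:R / (2 * M + d)%:R).
    by rewrite -[LHS]powR_mulrn ?(ltW y0)// /y -powRrM mulrC.
  by rewrite -powRN mulNr.
have y1 : 1 <= y.
  have := @ler_powR R n%:R; rewrite ler1n => /(_ n0 0 (2 * M + d)%:R^-1).
  by rewrite powRr0; apply; rewrite invr_ge0 ltW.
have ty : (0 < Num.truncn y)%N by rewrite truncn_gt0.
have /andP[ty1 ty2] := truncn_itv (ltW y0).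
exists y, (trunc_log 2 (Num.truncn y)); split => //; split.
  by apply: le_trans ty1; rewrite -natrX ler_nat; exact: trunc_logP.
by apply: le_trans (ltW ty2) _; rewrite -natrX ler_nat; exact: trunc_log_ltn.
Qed.
End DeterministicBounds.

Ltac nneg := repeat first
  [ assumption | exact: sqr_ge0 | exact: ler0n | exact: sqrtr_ge0 | solve [apply: ltW; assumption]
  | apply: addr_ge0 | apply: mulr_ge0 ].

(** With [th] proportional to [1 / (K sL)], each of [K^2 th zk], [X0 W / th] and the Lipschitz term
    carries a single factor [K] and at most [L * sL = log^(3/2) n]. The constant [CB] is chosen
    before [K]. *)
Lemma remainder_bound (R : realType) (C2 e M v CA Cxi CT cX c1 c2 c4 : R) :
  0 <= C2 -> 0 < e -> 0 <= M -> 0 < v -> 0 <= CA -> 0 < Cxi -> 0 < CT -> 0 <= cX -> 0 <= c1 -> 0 <= c2 -> 0 <= c4 ->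
  exists CB, 0 < CB /\ forall (K L sL N r hk zk W X0 sR th : R), 1 <= K -> 1 <= sL -> L = sL ^+ 2 -> 0 < N ->
    N^-1 <= r -> r <= 1 -> 0 <= hk -> 0 <= zk -> zk <= c4 * r -> 0 <= W -> W <= N * r -> 0 <= X0 -> X0 <= cX * L ->
    sR <= N * (c1 * hk + c2 * (Cxi * sL) ^+ 2 * hk + 2 * N^-1 ^+ 2) ->
    th = e ^+ 2 / (64 * (C2 ^+ 2 + 1)) / (CT * K * sL) ->
    (e ^+ 2 + M) * sR + (320 * C2 ^+ 2 * N * (v ^+ 2 * (Cxi * sL) ^+ 2) * th * (CA * K ^+ 2 * zk) +
      3 * (X0 * W / th) + 4 * C2 * N * Num.sqrt (v ^+ 2 * (Cxi * sL) ^+ 2 * (CA * K ^+ 2 * zk ^+ 2))) + 2 * C2 <=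
    N * (CB * (K * (L * sL) * (r + hk))).
Proof.
move=> C20 e0 M0 v0 CA0 Cx0 CT0 cX0 c10 c20 c40.
pose a := e ^+ 2 / (64 * (C2 ^+ 2 + 1)).
have C21 : 0 < C2 ^+ 2 + 1 by rewrite ltr_wpDl ?sqr_ge0.
have a0 : 0 < a by rewrite divr_gt0 ?exprn_gt0 ?mulr_gt0.
have eM : 0 < e ^+ 2 + M by rewrite ltr_wpDr ?exprn_gt0.
pose sA := Num.sqrt CA.
have sA0 : 0 <= sA by exact: sqrtr_ge0.
pose B1 := (e ^+ 2 + M) * (c1 + c2 * Cxi ^+ 2 + 2).
pose B2 := 320 * C2 ^+ 2 * (v ^+ 2 * Cxi ^+ 2) * (a / CT) * CA * c4.
pose B3 := 3 * (cX * (CT / a)).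
pose B4 := 4 * C2 * (v * Cxi * sA * c4).
have s2 (x : R) : 0 <= x ^+ 2 by exact: sqr_ge0.
have aC : 0 < a / CT by exact: divr_gt0.
have Ca : 0 < CT / a by exact: divr_gt0.
have B10 : 0 <= B1 by rewrite /B1; nneg.
have B20 : 0 <= B2 by rewrite /B2; nneg.
have B30 : 0 <= B3 by rewrite /B3; nneg.
have B40 : 0 <= B4 by rewrite /B4; nneg.
exists (B1 + B2 + B3 + B4 + 2 * C2 + 1); split.
  by rewrite ltr_wpDl//; nneg.
move=> K L sL N r hk zk W X0 sR th K1 sL1 LE N0 Nr r1 hk0 zk0 zkr W0 Wr X00 X0L HsR thE.
have K0 : 0 < K by apply: lt_le_trans K1.
have sL0 : 0 < sL by apply: lt_le_trans sL1.
have r0 : 0 < r by apply: lt_le_trans Nr; rewrite invr_gt0.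
have L1 : 1 <= L by rewrite LE exprn_ege1.
have L0 : 0 < L by apply: lt_le_trans L1.
pose U := K * (L * sL) * (r + hk).
have rh0 : 0 <= r + hk by rewrite addr_ge0// ltW.
have uprod (x y : R) : 1 <= x -> 0 <= y -> y <= x * y by move=> x1 y0; rewrite ler_peMl.
have KLs : K <= K * (L * sL) by rewrite ler_peMr ?(ltW K0)// -[1]mulr1 ler_pM.
have KsLs : K * sL <= K * (L * sL) by rewrite ler_pM2l// ler_peMl// ltW.
have LKL : L <= K * (L * sL) by rewrite -[leLHS]mul1r ler_pM ?(ltW L0)// ler_peMr// ltW.
have K1s : 1 <= K * (L * sL) by exact: le_trans K1 KLs.
have KLs0 : 0 <= K * (L * sL) by rewrite ltW// !mulr_gt0.
have rrh : r <= r + hk by rewrite lerDl.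
have hrh : hk <= r + hk by rewrite lerDr ltW.
have u1 : r <= U by rewrite -[leLHS]mul1r /U ler_pM// ltW.
have u2 : hk <= U by rewrite -[leLHS]mul1r /U ler_pM.
have u3 : L * hk <= U by rewrite /U ler_pM// ltW.
have u4 : K * sL * r <= U by rewrite /U ler_pM// ?ltW// mulr_gt0.
have u5 : K * (L * sL) * r <= U by rewrite /U ler_wpM2l.
have U0 : 0 < U by apply: lt_le_trans u1.
have t1 : (e ^+ 2 + M) * sR <= N * (B1 * U).
  have -> : N * (B1 * U) = (e ^+ 2 + M) * (N * ((c1 + c2 * Cxi ^+ 2 + 2) * U)) by rewrite /B1; ring.
  rewrite ler_pM2l//; apply: le_trans HsR _; rewrite ler_pM2l//.
  have -> : c1 * hk + c2 * (Cxi * sL) ^+ 2 * hk + 2 * N^-1 ^+ 2 =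
     c1 * hk + c2 * Cxi ^+ 2 * (L * hk) + 2 * N^-1 ^+ 2 by rewrite LE; ring.
  have -> : (c1 + c2 * Cxi ^+ 2 + 2) * U = c1 * U + c2 * Cxi ^+ 2 * U + 2 * U by ring.
  apply: lerD; first by apply: lerD; rewrite ler_wpM2l// mulr_ge0.
  rewrite ler_pM2l//; apply: (le_trans _ u1); apply: (le_trans _ Nr); rewrite expr2 ger_pMl ?invr_gt0//.
  exact: le_trans Nr r1.
have t2 : 320 * C2 ^+ 2 * N * (v ^+ 2 * (Cxi * sL) ^+ 2) * th * (CA * K ^+ 2 * zk) <= N * (B2 * U).
  have -> : 320 * C2 ^+ 2 * N * (v ^+ 2 * (Cxi * sL) ^+ 2) * th * (CA * K ^+ 2 * zk) =
     N * (320 * C2 ^+ 2 * (v ^+ 2 * Cxi ^+ 2) * (a / CT) * CA * (K * sL * zk)).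
    by rewrite thE -/a; move: (a) (C2 ^+ 2) => a' c; field; rewrite !gt_eqF.
  rewrite ler_pM2l// /B2 -[leRHS]mulrA; apply: ler_wpM2l; first by nneg.
  apply: (@le_trans _ _ (K * sL * (c4 * r))); first by apply: ler_wpM2l => //; nneg.
  have -> : K * sL * (c4 * r) = c4 * (K * sL * r) by ring.
  exact: ler_wpM2l.
have t3 : 3 * (X0 * W / th) <= N * (B3 * U).
  have -> : X0 * W / th = X0 * W * (CT / a * (K * sL)).
    by rewrite thE -/a; move: (a) a0 => a' a0'; field; rewrite !gt_eqF.
  have -> : N * (B3 * U) = 3 * (cX * N * U * (CT / a)) by rewrite /B3; move: (CT / a) => q; ring.
  rewrite ler_pM2l//.
  apply: (@le_trans _ _ (cX * L * (N * r) * (CT / a * (K * sL)))).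
    by apply: ler_wpM2r; [nneg|apply: ler_pM => //; nneg].
  have -> : cX * L * (N * r) * (CT / a * (K * sL)) = cX * N * (K * (L * sL) * r) * (CT / a).
    by move: (CT / a) => q; ring.
  by rewrite ler_pM2r//; apply: ler_wpM2l => //; nneg.
have t4 : 4 * C2 * N * Num.sqrt (v ^+ 2 * (Cxi * sL) ^+ 2 * (CA * K ^+ 2 * zk ^+ 2)) <= N * (B4 * U).
  have -> : v ^+ 2 * (Cxi * sL) ^+ 2 * (CA * K ^+ 2 * zk ^+ 2) = (v * Cxi * sA * (K * sL * zk)) ^+ 2.
    have -> : CA = sA ^+ 2 by rewrite sqr_sqrtr.
    by ring.
  rewrite sqrtr_sqr ger0_norm; last by nneg.
  have -> : 4 * C2 * N * (v * Cxi * sA * (K * sL * zk)) = N * (4 * C2 * (v * Cxi * sA * (K * sL * zk))) by ring.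
  rewrite ler_pM2l// /B4 -[leRHS]mulrA; apply: ler_wpM2l; first by nneg.
  rewrite -[leRHS]mulrA; apply: ler_wpM2l; first by nneg.
  apply: (@le_trans _ _ (K * sL * (c4 * r))); first by apply: ler_wpM2l => //; nneg.
  have -> : K * sL * (c4 * r) = c4 * (K * sL * r) by ring.
  exact: ler_wpM2l.
have t5 : 2 * C2 <= N * (2 * C2 * U).
  have -> : N * (2 * C2 * U) = 2 * C2 * (N * U) by ring.
  rewrite ler_peMr//; first by nneg.
  by rewrite -(mulfV (lt0r_neq0 N0)) ler_pM2l//; exact: le_trans Nr u1.
have -> : N * ((B1 + B2 + B3 + B4 + 2 * C2 + 1) * U) =
  N * (B1 * U) + (N * (B2 * U) + N * (B3 * U) + N * (B4 * U)) + N * (2 * C2 * U) + N * U by ring.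
have NU : 0 < N * U by exact: mulr_gt0.
by move: t1 t2 t3 t4 t5 NU; clear; lra.
Qed.

(** * Bounds on the domain and orders of magnitude *)

Section DomainBounds.
Variables (R : realType) (d m : nat) (mu : {measure set Rd R d -> \bar R}).
Hypotheses (leb : is_lebesgue_Rd mu) (d0 : (0 < d)%N) (md : (d + 2 <= 2 * m.+1)%N).

Lemma maxdiam_le (I : set 'rV[R]_d) (a : 'rV[R]_d) (H : R) p (t : 'I_p -> 'rV[R]_d) A :
  0 < H -> I `<=` cube a H -> design_np mu I t A -> maxdiam A <= d%:R * H.
Proof.
move=> H0 sI [_ [_ [AI [At _]]]].
have dH : 0 <= d%:R * H by rewrite mulr_ge0// ltW.
apply: bigmax_le => // j _; apply: ge_sup.
  by exists (eucl_dist (t j) (t j)); exists (t j) => //; exists (t j).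
have AjI y : A j y -> I y by move=> Ay; rewrite -AI; exists j.
move=> _ [x Ax [y Ay <-]]; apply: eucl_le_coord => //; first exact: ltW.
move=> i; rewrite !mxE; have := sI _ (AjI _ Ax) i; have := sI _ (AjI _ Ay) i.
by rewrite ler_norml; lra.
Qed.

Lemma inHm_bounded (f : 'rV[R]_d -> R) (a : 'rV[R]_d) (H : R) : inHm mu m.+1 f -> 0 < H ->
  exists2 b, 0 <= b & forall x, cube a H x -> `|f x| <= b.
Proof.
move=> Hf H0; have pf := inHm_pdiff Hf; have [_ If] := Hf.
have Ifin : Im2 mu m.+1 f \is a fin_num by rewrite ge0_fin_numE ?Im2_ge0.
have [|C HC] := energy_bounded leb d0 md (a := a) (h := H) (B := fine (Im2 mu m.+1 f)) pf H0.
  move=> i; rewrite fineK//; apply: le_trans; last exact: (@pure_le_Im2 _ _ _ _ f i).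
  rewrite /energy.
  apply: ge0_subset_integral => //.
  - exact: measurable_cube.
  - by apply: meas_sq; exact: (Dn_measurable i (ltn0Sn m) pf).
  - by move=> x _; rewrite lee_fin sqr_ge0.
exists `|C|; first exact: normr_ge0.
by move=> x Cx; apply: le_trans (HC x Cx) _; exact: ler_norm.
Qed.
End DomainBounds.

(** [2^k <= n] forces [k <= log n / log 2], so the chaining level, affine in [k], is of order
    [log n]. *)
Lemma link_level_le (R : realType) (d m : nat) (H0 Cd : R) : exists cX : R, 0 <= cX /\
  forall (k : nat) (L : R), 1 <= L -> 2 ^+ k <= expR L -> link_level d m H0 Cd k L <= cX * L.
Proof.
pose a : R := ((2 ^ d + 1) * m.+1 ^ d)%:R.
pose N0 : R := (4 * net_const d m H0 Cd)%:R.
pose D : R := (d + m.+1)%:R.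
have l2 : 0 < ln (2 : R) by rewrite ln_gt0// ltr1n.
exists (a * (N0 + D + 2 * D / ln 2) + 1); split.
  by rewrite !addr_ge0// mulr_ge0// !addr_ge0// divr_ge0 ?mulr_ge0// ltW.
move=> k L L1 Hk; have L0 : 0 < L by apply: lt_le_trans L1.
have kL : k%:R <= L / ln 2.
  rewrite ler_pdivlMr// mulr_natl -lnXn// -[leRHS]expRK ler_ln ?posrE ?exprn_gt0 ?expR_gt0//.
rewrite /link_level; have -> : ((2 ^ d + 1) * ((4 * net_const d m H0 Cd + (2 * k + 1) * (d + m.+1)) * m.+1 ^ d))%:R =
    a * (N0 + (2 * k%:R + 1) * D) :> R.
  by rewrite /a /N0 /D !(natrM, natrD); ring.
have -> : (a * (N0 + D + 2 * D / ln 2) + 1) * L = a * ((N0 + D) * L + 2 * D * (L / ln 2)) + L.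
  by move: (ln 2) l2 => q q0; field; rewrite gt_eqF.
rewrite lerD2r; apply: ler_wpM2l => //.
have h1 : N0 + D <= (N0 + D) * L by rewrite ler_peMr// addr_ge0.
have h2 : 2 * D * k%:R <= 2 * D * (L / ln 2) by rewrite ler_wpM2l// mulr_ge0.
have -> : N0 + (2 * k%:R + 1) * D = N0 + D + 2 * D * k%:R by ring.
lra.
Qed.

(** Since [kappa <= 1] and diameters are bounded, the oscillation of [beta0], of order [h^2], is
    absorbed by the Hoelder rate of the covariates. *)
Lemma sqr_le_powR (R : realType) (H0 h kappa : R) : 0 < h -> h <= H0 -> kappa <= 1 ->
  h ^+ 2 <= powR H0 (2 - 2 * kappa) * powR h (2 * kappa).
Proof.
move=> h0 hH k1; have -> : h ^+ 2 = powR h (2 - 2 * kappa) * powR h (2 * kappa).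
  rewrite -powRD; last by rewrite (gt_eqF h0) implybT.
  by rewrite subrK powR_mulrn// ltW.
apply: ler_wpM2r; first exact: powR_ge0.
apply: ge0_ler_powR; rewrite ?nnegrE ?(ltW h0)//; first by lra.
by apply: le_trans hH; exact: ltW.
Qed.

(** * The excess loss on a penalty ball *)

Section EstimatorEvent.
Variables (R : realType) (d m : nat) (mu : {measure set Rd R d -> \bar R}).
Hypotheses (leb : is_lebesgue_Rd mu) (d0 : (0 < d)%N) (md : (d + 2 <= 2 * m.+1)%N).
Variables (I : set 'rV[R]_d) (v : R).
Hypotheses (oI : open I) (bI : bounded_Rd I) (vI : mu I = v%:E) (v0 : 0 < v) (I0 : I !=set0).
Variables (a0 : 'rV[R]_d) (H0 Cd : R).
Hypotheses (H00 : 0 < H0) (IQ : I `<=` cube a0 H0) (Cd0 : 0 <= Cd).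
Variables (dO : measure_display) (Omega : measurableType dO).
Variables (P : probability Omega R) (X : Omega -> 'rV[R]_d -> R) (Xs : nat -> Omega -> 'rV[R]_d -> R)
  (eps : nat -> Omega -> R).
Hypotheses (jX : joint_random_field X) (iid : iid_data P X Xs eps).
Variables (kappa C1 tau A : R).
Hypotheses (k0 : 0 < kappa) (k1 : kappa <= 1) (C10 : 0 < C1) (tau0 : 0 < tau) (A0 : 0 < A).
Hypothesis hX : forall s s' : 'rV[R]_d, I s -> I s' ->
  (\int[P]_w ((X w s - X w s') ^+ 2)%:E <= (C1 * powR (eucl_dist s s') (2 * kappa))%:E)%E.
Hypothesis tail : forall (Y : Omega -> 'rV[R]_d -> R) (S : seq 'rV[R]_d) (y : R), 0 <= y ->
  (forall u, measurable_fun setT (Y ^~ u)) -> same_fdd P Y X -> (forall u, u \in S -> I u) ->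
  measurable [set w | exists2 u, u \in S & y < Y w u ^+ 2] /\
  (P [set w | exists2 u, u \in S & (y < Y w u ^+ 2)%R] <= (A * expR (- (tau * y)))%:E)%E.
Variable (beta : 'rV[R]_d -> R).
Hypothesis Hbeta : inHm mu m.+1 beta.
Variables (rho : R -> R) (C2 e M2 : R).
Let g := fun u : R => fine (\int[P]_w (rho (eps 0%N w + u))%:E).
Hypotheses (rho0 : forall x, 0 <= rho x) (rhoL : forall x y, `|rho x - rho y| <= C2 * `|x - y|)
  (rhoI : forall u : R, P.-integrable [set: Omega] (fun w => (rho (eps 0%N w + u))%:E)).
Hypotheses (gC : convex_real_fun g) (gU : forall x, g x - g 0 <= M2 * x ^+ 2) (M20 : 0 <= M2)
  (e0 : 0 < e) (gL : forall u, `|u| <= e -> e * u ^+ 2 <= g u - g 0).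

Definition fitted p (t : 'I_p -> 'rV[R]_d) (i : nat) (w : Omega) (u : 'rV[R]_p) : R :=
  lin (v / p%:R) (fun j => Xs i w (t j)) u.
Definition discretization_error p (t : 'I_p -> 'rV[R]_d) (i : nat) (w : Omega) : R :=
  integral_response mu I Xs beta i w - fitted t i w (\row_j beta (t j)).

Let M := (2 * m.+1)%N.

(** [CB] and [CT] are fixed before [n], the design and [K], as the localisation requires: [K] will
    be chosen from [CB]. *)
Lemma estimator_event (del : R) : 0 < del -> exists CB CT, [/\ 0 < CB, 0 < CT &
  forall n p (t : 'I_p -> 'rV[R]_d) (Aj : 'I_p -> set 'rV[R]_d) (K y : R) (k : nat),
   (0 < n)%N -> (expR 1 <= n%:R :> R) -> 1 <= y -> y ^+ (M + d) = n%:R -> 2 ^+ k <= y -> y <= 2 ^+ k.+1 ->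
   design_np mu I t Aj -> maxdiam Aj <= H0 -> well_spread Cd t -> 1 <= K ->
   exists E : set Omega, [/\ measurable E, (P E <= (del + (A + 2) / y)%:E)%E &
    forall w u, ~ E w -> in_class mu m a0 H0 t K u ->
      e ^+ 2 / (4 * (CT * K * Num.sqrt (ln n%:R))) * (n%:R^-1 * \sum_(i < n) (fitted t i w u) ^+ 2) -
      CB * (K * (ln n%:R * Num.sqrt (ln n%:R)) * ((y ^+ M)^-1 + powR (maxdiam Aj) (2 * kappa))) <=
      n%:R^-1 * \sum_(i < n) (rho (eps i w + (discretization_error t i w - fitted t i w u)) -
                              rho (eps i w + discretization_error t i w))]].
Proof.
move=> del0.
have C20 : 0 <= C2 by have := le_trans (normr_ge0 _) (rhoL 1 0); rewrite subr0 normr1 mulr1.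
have m0 : (0 < m)%N by move: md d0; clear; lia.
have pb := inHm_pdiff Hbeta.
have Ifin : Im2 mu m.+1 beta \is a fin_num by rewrite ge0_fin_numE ?Im2_ge0//; have [] := Hbeta.
have HE : (dirichlet mu m.+1 beta setT <= (d%:R * fine (Im2 mu m.+1 beta))%:E)%E.
  by rewrite EFinM fineK//; exact: dirichlet_le_Im2.
have [Co [Co0 Hosc]] := oscillation_sum leb d0 md a0 H00 Cd0 m0 pb v0 HE.
have [b b0 Hb] := inHm_bounded leb d0 md a0 Hbeta H00.
have bb u : I u -> `|beta u| <= b by move=> Iu; apply: Hb; exact: IQ.
have mb : measurable_fun setT (beta : Rd R d -> R).
  by have := Dn_measurable (Ordinal d0) (ltn0Sn m) pb (leq0n _).
have [cX [cX0 HcX]] := link_level_le d m H0 Cd.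
pose cH := powR H0 (2 - 2 * kappa).
have cH0 : 0 <= cH by exact: powR_ge0.
(* Ensures [tau * Cxi^2 >= 2], so that a tail at [xi = Cxi sqrt(log n)] is at most [A n^-2] and
   survives the union over [n] observations. *)
pose Cxi := 1 + 2 / tau.
have Cxi0 : 0 < Cxi by rewrite ltr_wpDr// divr_ge0// ltW.
(* [T = CT * K * sL] has to exceed [e], 1, and the sum of the bounds [2 b v xi] on [Rt] and [v xi K]
   on the fitted perturbation. *)
pose CT := e + 1 + (2 * b + 1) * v * Cxi.
have bvC : 0 <= (2 * b + 1) * v * Cxi.
  by rewrite !mulr_ge0 ?(ltW v0) ?(ltW Cxi0)// addr_ge0// mulr_ge0.
have CTe : e + 1 <= CT by rewrite lerDl.
have CTb : (2 * b + 1) * v * Cxi <= CT by rewrite lerDr addr_ge0// ltW.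
have CT0 : 0 < CT by apply: lt_le_trans CTe; exact: addr_gt0.
have c10 : 0 <= 4 * b ^+ 2 * v * (v * C1 / del).
  by rewrite mulr_ge0 ?divr_ge0 ?mulr_ge0 ?(ltW v0) ?(ltW C10) ?(ltW del0) ?sqr_ge0.
have c20 : 0 <= 4 * v * Co * cH by rewrite !mulr_ge0 ?(ltW v0) ?(ltW Co0).
have c40 : 0 <= 2 ^+ M :> R by rewrite exprn_ge0.
have CA0 : 0 <= span_const d m H0 Cd by rewrite ltW// span_const_gt0.
have [CB [CB0 HCB]] := remainder_bound C20 e0 M20 v0 CA0 Cxi0 CT0 cX0 c10 c20 c40.
exists CB, CT; split => // n p t Aj K y k n0 en y1 yn ky yk des hH ts K1.
pose L := ln (n%:R : R); pose sL := Num.sqrt L; pose h := maxdiam Aj.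
have nR : 0 < n%:R :> R by rewrite ltr0n.
have y0 : 0 < y by apply: lt_le_trans y1.
have K0 : 0 < K by apply: lt_le_trans K1.
have L1 : 1 <= L by rewrite /L -[leLHS]expRK ler_ln ?posrE ?expR_gt0.
have sL2 : sL ^+ 2 = L by rewrite sqr_sqrtr//; apply: le_trans L1.
have sL1 : 1 <= sL by rewrite -[leLHS]sqrtr1; exact: ler_wsqrtr.
have eL : expR L = n%:R by rewrite /L lnK// posrE.
have p0 : (0 < p)%N by have [] := des.
have pR : 0 < p%:R :> R by rewrite ltr0n.
have tI := design_points des.
have tQ j : cube a0 H0 (t j) by apply: IQ; exact: tI.
have vol := maxdiam_volume leb d0 oI bI des; rewrite vI/= -/h in vol.
have h0 : 0 < h.
  rewrite lt_neqAle maxdiam_ge0 andbT; apply/eqP => h0; move: vol.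
  by rewrite -h0 mulr0 expr0n gtn_eqF// mulr0 leNgt v0.
have [ o [ o0 Ho so]] := Hosc p t h p0 tQ ts h0 hH vol.
have Ho' j u : I u -> eucl_dist u (t j) <= h -> (beta u - beta (t j)) ^+ 2 <= o j.
  move=> Iu ut; apply: Ho => i; rewrite !mxE.
  have := le_trans (coord_le_eucl (u - t j) i) ut; rewrite !mxE ler_norml => /andP[lo hi].
  rewrite (_ : _ + 2 * h = h + t j 0 i); last by ring.
  by rewrite [_ - h]addrC -lerBrDr lo -lerBlDr.
pose xi := Cxi * sL.
have xi0 : 0 < xi by rewrite mulr_gt0//; apply: lt_le_trans sL1.
have [Rt [E1 [mRt mE1 PE1 HE1]]] := data_event d0 oI bI vI v0 I0 jX iid k0 C10 hX tail mb bb b0 des h0 o0 Ho' so n0 (ltW xi0) del0.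
pose T := CT * K * sL.
have T0 : 0 < T by rewrite mulr_gt0 ?mulr_gt0//; apply: lt_le_trans sL1.
pose th := e ^+ 2 / (64 * (C2 ^+ 2 + 1)) / T.
have C21 : 0 < C2 ^+ 2 + 1 by rewrite ltr_wpDl ?sqr_ge0.
have th0 : 0 < th by apply: divr_gt0 => //; apply: divr_gt0; [exact: exprn_gt0|exact: mulr_gt0].
have [E2 [mE2 PE2 HE2]] := uniform_emp leb d0 md H00 Cd0 p0 tQ ts iid rho0 rhoL rhoI n (v / p%:R) mRt k K0 th0 (le_trans ler01 L1).
have yle j : (0 < j)%N -> y <= y ^+ j by move=> j0; rewrite -[leLHS]expr1; apply: ler_weXn2l.
have yn1 : y <= n%:R by rewrite -yn; apply: yle; rewrite addn_gt0 d0 orbT.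
have yn2 : y ^+ 2 <= n%:R by rewrite -yn; apply: ler_weXn2l => //; rewrite /M; clear; lia.
exists (E1 `|` E2); split; first exact: measurableU.
  apply: le_trans (measureU2 _ _ _) _ => //; apply: le_trans (leeD PE1 PE2) _.
  rewrite -EFinD lee_fin.
  have i1 : n%:R^-1 <= y^-1 by rewrite lef_pV2 ?posrE.
  have i2 : k.+1%:R * expR (- L) <= y^-1.
    rewrite expRN eL ler_pdivrMr// mulrC ler_pdivlMr//.
    apply: le_trans yn2; rewrite expr2 ler_pM2r//; apply: le_trans ky.
    by rewrite -natrX ler_nat; exact: ltn_expl.
  have i3 : n%:R * (A * expR (- (tau * xi ^+ 2))) <= A * y^-1.
    have q : expR (- (tau * xi ^+ 2)) <= n%:R^-1 * n%:R^-1.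
      rewrite -eL -expRN -expRD ler_expR.
      have -> : tau * xi ^+ 2 = tau * Cxi ^+ 2 * L by rewrite /xi exprMn sL2 mulrA.
      have q1 : 2 <= tau * Cxi ^+ 2.
        have -> : tau * Cxi ^+ 2 = tau + 4 + 4 / tau by rewrite /Cxi; field; rewrite gt_eqF.
        have q0 : 0 < 4 / tau by exact: divr_gt0.
        apply: (@le_trans _ _ 4); first by rewrite ler_nat.
        by rewrite -addrA addrCA lerDl addr_ge0// ltW.
      by rewrite -opprD lerN2 -mulr2n -mulr_natl; apply: ler_wpM2r => //; exact: le_trans L1.
    apply: (@le_trans _ _ (n%:R * (A * (n%:R^-1 * n%:R^-1)))); first by rewrite ler_pM2l// ler_pM2l.
    have -> : n%:R * (A * (n%:R^-1 * n%:R^-1)) = A * n%:R^-1 by field; rewrite gt_eqF.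
    by rewrite ler_pM2l.
  rewrite [leRHS](_ : _ = del + (A * y^-1 + y^-1 + y^-1)); last by ring.
  rewrite [leLHS](_ : _ = del + (n%:R * (A * expR (- (tau * xi ^+ 2))) + n%:R^-1 + k.+1%:R * expR (- L))); last by ring.
  by rewrite lerD2l; apply: lerD i2; exact: lerD.
move=> w u /not_orP[nE1 nE2] uK.
have [xb Rb Rr sR] := HE1 w nE1.
pose r := (y ^+ M)^-1; pose hk := powR h (2 * kappa).
have rn : n%:R * r = y ^+ d by rewrite /r -yn exprD mulrAC mulfV ?mul1r// gt_eqF// exprn_gt0.
pose zk : R := 2^-1 ^+ (M * k).
have fb i' u' : (fitted t (i' : 'I_n) w u') ^+ 2 <= v ^+ 2 * xi ^+ 2 * nrm2 u'.
  have -> : v ^+ 2 = (p%:R * (v / p%:R)) ^+ 2 by rewrite mulrC divfK// gt_eqF.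
  by apply: lin_bound => // j; exact: xb.
have nu : nrm2 u <= K ^+ 2 by case: uK.
have fT (i : 'I_n) : `|fitted t i w u| <= v * xi * K.
  rewrite -(@ler_pXn2r _ 2)// ?nnegrE//; last by nneg.
  rewrite real_normK ?num_real//; apply: le_trans (fb i u) _.
  have -> : (v * xi * K) ^+ 2 = v ^+ 2 * xi ^+ 2 * K ^+ 2 by ring.
  by apply: ler_wpM2l => //; nneg.
have T1 : e <= T /\ 1 <= T.
  have CTT : e + 1 <= T.
    by apply: le_trans CTe _; rewrite /T -mulrA ler_peMr ?(ltW CT0)// -[1]mulr1 ler_pM.
  by split; apply: le_trans CTT; [rewrite lerDl|rewrite lerDr ltW].
have RT (i : 'I_n) : `|Rt i w| + `|fitted t i w u| <= T.
  apply: (@le_trans _ _ (2 * (b * v) * xi + v * xi * K)); first by apply: lerD.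
  apply: (@le_trans _ _ ((2 * b + 1) * v * Cxi * (K * sL))).
    have -> : (2 * b + 1) * v * Cxi * (K * sL) = 2 * (b * v) * xi * K + v * xi * K by rewrite /xi; ring.
    by rewrite lerD2r ler_peMr//; nneg.
  by rewrite /T -[leRHS]mulrA ler_pM2r// mulr_gt0//; apply: lt_le_trans sL1.
have emp_bound := HE2 w (v ^+ 2 * xi ^+ 2) u nE2 (mulr_ge0 (sqr_ge0 _) (sqr_ge0 _)) fb uK.
pose D := 320 * C2 ^+ 2 * n%:R * (v ^+ 2 * xi ^+ 2) * th * (span_const d m H0 Cd * K ^+ 2 * zk) +
  3 * (link_level d m H0 Cd k L * 2 ^+ (k * d) / th) +
  4 * C2 * n%:R * Num.sqrt (v ^+ 2 * xi ^+ 2 * (span_const d m H0 Cd * K ^+ 2 * zk ^+ 2)).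
have zk2 : 2^-1 ^+ (2 * m.+1 * (k + k)) = zk ^+ 2 :> R by rewrite -exprM addnn -muln2 mulnA.
have key := @excess_lower_bound R n rho g C2 e T M2 th D (fun i => eps i w) (fun i => Rt i w)
  (fun i => discretization_error t i w) (fun i => fitted t i w u) n0 rhoL C20 e0 T1.2 M20.
have {}key : e ^+ 2 / (4 * T) * (\sum_(i < n) fitted t i w u ^+ 2) - (e ^+ 2 + M2) * (\sum_(i < n) Rt i w ^+ 2) - D - 2 * C2 <=
    \sum_(i < n) (rho (eps i w + (discretization_error t i w - fitted t i w u)) - rho (eps i w + discretization_error t i w)).
  apply: key => //.
  - by move=> x xT; apply: growth_bound => //; exact: T1.1.
  - exact: ltW.
  - have -> : 64 * th * C2 ^+ 2 * T = e ^+ 2 * (C2 ^+ 2 / (C2 ^+ 2 + 1)).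
      by rewrite /th; move: (C2 ^+ 2) C21 (T) T0 => c c0 T' T'0; field; rewrite !gt_eqF.
    by rewrite ger_pMr ?exprn_gt0// ler_pdivrMr// mul1r lerDl.
  - move: emp_bound; rewrite zk2 -/zk -/M /D !addrA; apply: le_trans.
    rewrite le_eqVlt; apply/orP; left; apply/eqP; congr (_ - _); apply: eq_bigr => i _.
    by rewrite lin0 subr0.
have rem := HCB K L sL n%:R r hk zk (2 ^+ (k * d)) (link_level d m H0 Cd k L) (\sum_(i < n) Rt i w ^+ 2) th K1 sL1 (esym sL2) nR.
have {}rem : (e ^+ 2 + M2) * (\sum_(i < n) Rt i w ^+ 2) + D + 2 * C2 <= n%:R * (CB * (K * (L * sL) * (r + hk))).
  apply: rem => //.
  - rewrite -(ler_pM2l nR) mulfV ?gt_eqF// rn; exact: exprn_ege1.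
  - by rewrite /r invf_le1 ?exprn_gt0// exprn_ege1.
  - exact: powR_ge0.
  - by rewrite /zk exprn_ge0.
  (* From [2^-k <= 2 / y], raised to the power [2 * m.+1]. *)
  - rewrite /zk /r exprVn mulnC exprM -exprVn -[(y ^+ M)^-1]exprVn -exprMn.
    apply: lerXn2r; rewrite ?nnegrE ?invr_ge0 ?exprn_ge0 ?divr_ge0 ?(ltW y0)//.
    rewrite ler_pdivlMr// mulrC ler_pdivrMr ?exprn_gt0//; apply: le_trans yk _.
    by rewrite exprS.
  - rewrite rn exprM; apply: lerXn2r; rewrite ?nnegrE ?exprn_ge0 ?(ltW y0)//.
  - by rewrite /link_level addr_ge0//; exact: le_trans L1.
  - apply: HcX => //; rewrite eL; exact: le_trans ky yn1.
  - apply: le_trans sR _; rewrite ler_pM2l// lerD2r; apply: lerD.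
      by rewrite -/hk le_eqVlt; apply/orP; left; apply/eqP; move: (hk) => q; field; rewrite gt_eqF.
    have -> : 4 * v * Co * cH * (Cxi * sL) ^+ 2 * hk = 4 * xi ^+ 2 * v * (Co * (cH * hk)) by rewrite /xi; ring.
    apply: ler_wpM2l; first by nneg.
    by rewrite ler_pM2l//; exact: sqr_le_powR.
rewrite -(ler_pM2l nR); move: key rem; rewrite -/L -/sL -/h -/r -/hk -/T.
set S1 := \sum_(i < n) _ ^+ 2; set S2 := \sum_(i < n) (_ - _); set S3 := \sum_(i < n) Rt i w ^+ 2.
set U := CB * _ => key rem.
have -> : n%:R * (n%:R^-1 * S2) = S2 by rewrite mulrA mulfV ?mul1r// gt_eqF.
have -> : n%:R * (e ^+ 2 / (4 * T) * (n%:R^-1 * S1) - U) = e ^+ 2 / (4 * T) * S1 - n%:R * U.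
  by move: (e ^+ 2 / (4 * T)) => q; field; rewrite gt_eqF.
by apply: le_trans key; rewrite -!addrA -!opprD lerD2l lerN2 addrA; exact: rem.
Qed.
End EstimatorEvent.

Lemma g_convex (R : realType) (dO : measure_display) (Omega : measurableType dO) (P : probability Omega R)
    (eps : nat -> Omega -> R) (rho : R -> R) : convex_real_fun rho ->
  (forall u : R, P.-integrable setT (fun w => (rho (eps 0%N w + u))%:E)) ->
  convex_real_fun (fun u : R => fine (\int[P]_w (rho (eps 0%N w + u))%:E)).
Proof.
move=> rc rI x y a a01; have /andP[a0 a1] := a01.
have fin u : (\int[P]_w (rho (eps 0%N w + u))%:E)%E \is a fin_num by exact: integrable_fin_num.
have IZ (b u : R) : P.-integrable setT (fun w => (b%:E * (rho (eps 0%N w + u))%:E)%E) by exact: integrableZl.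
rewrite -lee_fin EFinD !EFinM !fineK// -!integralZl//; try exact: rI.
rewrite -integralD//; try exact: IZ.
apply: le_integral => //; try exact: rI.
  by apply: integrableD => //; exact: IZ.
move=> w _; rewrite -!EFinM -EFinD lee_fin.
have := rc (eps 0%N w + x) (eps 0%N w + y) a a01.
by have -> : a * (eps 0%N w + x) + (1 - a) * (eps 0%N w + y) = eps 0%N w + (a * x + (1 - a) * y) by ring.
Qed.

(** * The estimator as a perturbation of the true slope *)

Section Perturbation.
Variables (R : realType) (d m : nat) (mu : {measure set Rd R d -> \bar R}).
Hypotheses (d0 : (0 < d)%N).
Variables (I : set 'rV[R]_d) (v : R).
Hypotheses (vI : mu I = v%:E) (v0 : 0 < v).
Variables (a0 : 'rV[R]_d) (H0 : R).
Variables (dO : measure_display) (Omega : measurableType dO).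
Variables (Xs : nat -> Omega -> 'rV[R]_d -> R) (eps : nat -> Omega -> R).
Variables (f beta : 'rV[R]_d -> R).
Hypotheses (Hf : inHm mu m.+1 f) (Hbeta : inHm mu m.+1 beta).
Variables (p : nat) (t : 'I_p -> 'rV[R]_d).
Hypothesis p0 : (0 < p)%N.
Let pR : 0 < p%:R :> R. Proof. by rewrite ltr0n. Qed.
Let c0 : 0 < v / p%:R. Proof. exact: divr_gt0. Qed.

Definition penalty (h : 'rV[R]_d -> R) : R := \sum_j h (t j) ^+ 2 * (v / p%:R) + fine (Im2 mu m.+1 h).

Lemma Jm2_penalty h : inHm mu m.+1 h -> Jm2 mu I m.+1 t h = (penalty h)%:E.
Proof.
move=> [_ Ih]; rewrite /Jm2 /penalty /cellvol vI/= EFinD fineK// ge0_fin_numE//; exact: Im2_ge0.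
Qed.

Lemma penalty_ge0 h : 0 <= penalty h.
Proof.
rewrite addr_ge0//; last by rewrite fine_ge0// Im2_ge0.
by apply: sumr_ge0 => j _; rewrite mulr_ge0 ?sqr_ge0// ltW.
Qed.

Lemma penalty_le h b : (forall j, `|h (t j)| <= b) -> penalty h <= v * b ^+ 2 + fine (Im2 mu m.+1 h).
Proof.
move=> hb; rewrite lerD2r; apply: (@le_trans _ _ (\sum_(j < p) b ^+ 2 * (v / p%:R))).
  apply: ler_sum => j _; rewrite ler_pM2r// -[h _ ^+ 2]real_normK ?num_real//.
  by apply: lerXn2r; rewrite ?nnegrE//; exact: le_trans (hb j).
rewrite sumr_const card_ord -[leLHS]mulr_natl le_eqVlt; apply/orP; left; apply/eqP.
by field; rewrite gt_eqF.
Qed.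

(** [2 / v] serves the mean square at the design points, weighted by [v / p] in the penalty; [2 d]
    serves the energy of the difference, over [d] directions. *)
Definition class_const : R := 2 / v + 2 * d%:R.
Lemma class_const_gt0 : 0 < class_const. Proof. by rewrite ltr_wpDr ?mulr_ge0// divr_gt0. Qed.

Let u : 'rV[R]_p := \row_j (f - beta) (t j).

(** [Jt^2] dominates both the mean square and the energy of [f - beta], and is the energy bound
    handed to the class; the added one keeps it positive. *)
Lemma perturbation_in_class (s Jt K : R) : 0 <= s -> 0 < Jt -> 0 <= K ->
  Jt ^+ 2 = class_const * (penalty beta + penalty f) + 1 -> s * Jt <= K -> in_class mu m a0 H0 t K (s *: u).
Proof.
move=> s0 J0 K0 JE sJ.
have sJ2 : s ^+ 2 * Jt ^+ 2 <= K ^+ 2.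
  by rewrite -exprMn; apply: lerXn2r; rewrite ?nnegrE// mulr_ge0// ltW.
have If0 h : 0 <= fine (Im2 mu m.+1 h) by rewrite fine_ge0// Im2_ge0.
have S0 h : 0 <= \sum_j h (t j) ^+ 2 * (v / p%:R).
  by apply: sumr_ge0 => j _; rewrite mulr_ge0 ?sqr_ge0// ltW.
have pp : 0 <= penalty beta + penalty f by rewrite addr_ge0// penalty_ge0.
have nu : nrm2 u <= Jt ^+ 2.
  apply: (@le_trans _ _ (2 / v * (penalty beta + penalty f))); last first.
    rewrite JE /class_const.
    have -> : (2 / v + 2 * d%:R) * (penalty beta + penalty f) + 1 =
      2 / v * (penalty beta + penalty f) + (2 * d%:R * (penalty beta + penalty f) + 1) by ring.
    by rewrite lerDl addr_ge0// mulr_ge0// mulr_ge0.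
  apply: (@le_trans _ _ (2 / v * (\sum_j beta (t j) ^+ 2 * (v / p%:R) + \sum_j f (t j) ^+ 2 * (v / p%:R)))).
    rewrite nrm2_sum_sqr -big_split/= !mulr_sumr; apply: ler_sum => j _; rewrite mxE.
    have -> : 2 / v * (beta (t j) ^+ 2 * (v / p%:R) + f (t j) ^+ 2 * (v / p%:R)) =
      p%:R^-1 * (2 * f (t j) ^+ 2 + 2 * beta (t j) ^+ 2) by field; rewrite !gt_eqF.
    rewrite ler_pM2l ?invr_gt0//.
    have -> : (f - beta) (t j) = f (t j) + - beta (t j) by [].
    by have := sqrD_le2 (f (t j)) (- beta (t j)); rewrite sqrrN.
  by rewrite ler_pM2l ?divr_gt0// lerD// lerDl.
split.
  by rewrite nrm2Z; apply: le_trans sJ2; rewrite ler_wpM2l// sqr_ge0.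
exists (f - beta), (Jt ^+ 2), s; split => //.
- exact: pdiffB (inHm_pdiff Hf) (inHm_pdiff Hbeta).
- exact: exprn_gt0.
- apply: (@le_trans _ _ (dirichlet mu m.+1 (f - beta) setT)).
    apply: lee_sum => i _; apply: ge0_subset_integral => //.
    + exact: measurable_cube.
    + apply: meas_sq; apply: (Dn_measurable i (ltn0Sn m) _ (leqnn _)).
      exact: pdiffB (inHm_pdiff Hf) (inHm_pdiff Hbeta).
    + by move=> x _; rewrite lee_fin sqr_ge0.
  apply: le_trans (dirichlet_sub (ltn0Sn m) Hf Hbeta) _; rewrite lee_fin JE.
  apply: (@le_trans _ _ (2 * d%:R * (penalty beta + penalty f))).
    rewrite ler_wpM2l ?mulr_ge0// /penalty; have := S0 f; have := S0 beta; lra.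
  rewrite /class_const.
  have -> : (2 / v + 2 * d%:R) * (penalty beta + penalty f) + 1 =
    2 * d%:R * (penalty beta + penalty f) + (2 / v * (penalty beta + penalty f) + 1) by ring.
  by rewrite lerDl addr_ge0// mulr_ge0// divr_ge0// ltW.
Qed.

Lemma residualE i w : response mu I Xs eps beta i w - \sum_(j < p) Xs i w (t j) * f (t j) * cellvol mu I p =
  eps i w + (discretization_error mu I v Xs beta t i w - fitted v Xs t i w u).
Proof.
rewrite /response /discretization_error /integral_response /fitted /cellvol vI/=.
have -> : \sum_(j < p) Xs i w (t j) * f (t j) * (v / p%:R) = lin (v / p%:R) (fun j => Xs i w (t j)) (\row_j f (t j)).
  by apply: eq_bigr => j _; rewrite mxE.
have -> : u = \row_j f (t j) - \row_j beta (t j) by apply/rowP => j; rewrite !mxE.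
by rewrite linB; ring.
Qed.

Lemma excess_le_penalty (rho : R -> R) (lam : R) n w :
  (objective mu I rho m.+1 n t Xs (response mu I Xs eps beta) lam w f <=
   objective mu I rho m.+1 n t Xs (response mu I Xs eps beta) lam w beta)%E ->
  n%:R^-1 * \sum_(i < n) (rho (eps i w + (discretization_error mu I v Xs beta t i w - fitted v Xs t i w u)) -
                          rho (eps i w + discretization_error mu I v Xs beta t i w)) <=
  lam * (penalty beta - penalty f).
Proof.
rewrite /objective !Jm2_penalty// -!EFinM -!EFinD lee_fin.
under eq_bigr do rewrite residualE.
have E i : response mu I Xs eps beta i w - \sum_(j < p) Xs i w (t j) * beta (t j) * cellvol mu I p =
    eps i w + discretization_error mu I v Xs beta t i w.
  rewrite /response /discretization_error /integral_response /fitted /cellvol vI/=.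
  have -> : \sum_(j < p) Xs i w (t j) * beta (t j) * (v / p%:R) =
      lin (v / p%:R) (fun j => Xs i w (t j)) (\row_j beta (t j)).
    by apply: eq_bigr => j _; rewrite mxE.
  by ring.
under [X in _ <= _ * X + _]eq_bigr do rewrite E.
by rewrite sumrB mulrBr [lam * (_ - _)]mulrBr; lra.
Qed.

Lemma norm_npE n w : norm_np mu I n t Xs w (f - beta) =
  Num.sqrt (v^-1 * (n%:R^-1 * \sum_(i < n) (fitted v Xs t i w u) ^+ 2)).
Proof.
rewrite /norm_np vI/=; congr Num.sqrt.
have E i : (fitted v Xs t i w u) ^+ 2 = (v / p%:R) ^+ 2 * (\sum_j Xs i w (t j) * (f - beta) (t j)) ^+ 2.
  rewrite -exprMn; congr (_ ^+ 2); rewrite /fitted /lin mulr_sumr; apply: eq_bigr => j _.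
  by rewrite mxE mulrC.
under [X in _ = _ * (_ * X)]eq_bigr do rewrite E.
rewrite -mulr_sumr; set S := \sum_(i < n) _; rewrite !mulrA; congr (_ * S).
have [->|n0] := eqVneq (n%:R : R) 0; first by rewrite !mul0r !invr0 !(mulr0, mul0r).
by field; rewrite n0 !gt_eqF.
Qed.
End Perturbation.

(** Dividing by the curvature, of order [1 / (K sL)], gives [F] of order [L^2 (a^2 + hh^2)]. Its
    root is of order [L (a + hh)], and [1 <= L] gives the stated power [L^2]. *)
Lemma rate_of_excess (R : realType) (e v CT CB K sL L a hh F lam J0 J0m Mu : R) :
  0 < e -> 0 < v -> 0 < CT -> 0 < CB -> 1 <= K -> 1 <= sL -> L = sL ^+ 2 -> 0 <= a -> 0 <= hh -> 0 <= Mu -> 0 <= J0 ->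
  J0 <= J0m -> lam <= Mu * (L * sL * (a ^+ 2 + hh ^+ 2)) ->
  e ^+ 2 / (4 * (CT * K * sL)) * F <= lam * J0 + CB * (K * (L * sL) * (a ^+ 2 + hh ^+ 2)) ->
  Num.sqrt (v^-1 * F) <= Num.sqrt (4 * (CT * K) / e ^+ 2 * (Mu * J0m + CB * K) / v) * (L ^+ 2 * (a + hh)).
Proof.
move=> e0 v0 CT0 CB0 K1 sL1 LE a0 hh0 Mu0 J00 J0J lamU HF.
have K0 : 0 < K by apply: lt_le_trans K1.
have sL0 : 0 < sL by apply: lt_le_trans sL1.
have L1 : 1 <= L by rewrite LE exprn_ege1.
have L0 : 0 < L by apply: lt_le_trans L1.
have J0m0 : 0 <= J0m by exact: le_trans J0J.
pose r2 := a ^+ 2 + hh ^+ 2.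
have r20 : 0 <= r2 by rewrite addr_ge0 ?sqr_ge0.
have e20 : 0 < e ^+ 2 by exact: exprn_gt0.
pose Q := 4 * (CT * K) / e ^+ 2 * (Mu * J0m + CB * K).
have Q0 : 0 <= Q by rewrite /Q mulr_ge0// ?divr_ge0//; nneg.
have B1 : lam * J0 + CB * (K * (L * sL) * r2) <= (Mu * J0m + CB * K) * (L * sL * r2).
  have s1 : lam * J0 <= Mu * (L * sL * r2) * J0m.
    apply: (@le_trans _ _ (Mu * (L * sL * r2) * J0)); first by rewrite ler_wpM2r.
    by apply: ler_wpM2l => //; nneg.
  have -> : (Mu * J0m + CB * K) * (L * sL * r2) = Mu * (L * sL * r2) * J0m + CB * (K * (L * sL) * r2) by ring.
  by rewrite lerD2r.
have FQ : F <= Q * (L ^+ 2 * r2).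
  have q0 : 0 < e ^+ 2 / (4 * (CT * K * sL)) by rewrite divr_gt0// !mulr_gt0.
  rewrite -(ler_pM2l q0); apply: le_trans HF _; apply: le_trans B1 _.
  have -> : e ^+ 2 / (4 * (CT * K * sL)) * (Q * (L ^+ 2 * r2)) = (Mu * J0m + CB * K) * (L * (L / sL) * r2).
    by rewrite /Q; move: (Mu * J0m + CB * K) => q; field; rewrite !gt_eqF.
  by have -> : L / sL = sL by [rewrite LE expr2 mulfK// gt_eqF].
have z0 : 0 <= L ^+ 2 * (a + hh) by rewrite mulr_ge0 ?sqr_ge0// addr_ge0.
have -> : Num.sqrt (Q / v) * (L ^+ 2 * (a + hh)) = Num.sqrt (Q / v * (L ^+ 2 * (a + hh)) ^+ 2).
  by rewrite [RHS](sqrtrM _ (divr_ge0 Q0 (ltW v0))) sqrtr_sqr ger0_norm.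
apply: ler_wsqrtr; have -> : Q / v * (L ^+ 2 * (a + hh)) ^+ 2 = v^-1 * (Q * (L ^+ 2 * (a + hh)) ^+ 2) by ring.
rewrite ler_pM2l ?invr_gt0//; apply: le_trans FQ _; apply: ler_wpM2l => //.
have -> : (L ^+ 2 * (a + hh)) ^+ 2 = L ^+ 4 * (r2 + 2 * (a * hh)) by rewrite /r2; ring.
apply: ler_pM => //; first exact: sqr_ge0.
  exact: ler_weXn2l.
by rewrite lerDl mulr_ge0// mulr_ge0.
Qed.

Unset Implicit Arguments.
Theorem theorem1
  (R : realType) (d m : nat) (dO : measure_display) (Omega : measurableType dO)
  (P : probability Omega R)
  (mu : {measure set Rd R d -> \bar R})
  (I : set 'rV[R]_d)
  (X : Omega -> 'rV[R]_d -> R) (Xs : nat -> Omega -> 'rV[R]_d -> R) (eps : nat -> Omega -> R)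
  (beta0 : 'rV[R]_d -> R) (rho : R -> R) (kappa : R)
  (p : nat -> nat) (t : forall n, 'I_(p n) -> 'rV[R]_d)
  (A : forall n, 'I_(p n) -> set 'rV[R]_d)
  (lam : nat -> Omega -> R) (bhat : nat -> Omega -> 'rV[R]_d -> R) :
  (* setting *)
  (1 <= d)%N -> (1 <= m)%N ->
  is_lebesgue_Rd mu ->
  joint_random_field X ->
  (\int[P]_w (\int[mu]_(s in (I : set (Rd R d))) ((X w s) ^+ 2)%:E) < +oo)%E ->
  iid_data P X Xs eps ->
  inHm mu m beta0 ->
  (forall n, design_np mu I (t n) (A n)) ->
  (* 2m > d + 1 *)
  (d + 1 < 2 * m)%N ->
  (* (A1) *)
  open I -> bounded_Rd I -> uniform_cone_condition I ->
  (* (A2) *)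
  (exists B : R, exists N : nat, forall n, (N <= n)%N ->
     (hmax I (t n) <= B%:E * hmin (t n))%E) ->
  (* (A3) *)
  (exists tau : R, 0 < tau < 1 /\
     let supX := fun w : Omega => (ereal_sup [set (`|X w s|)%:E | s in I] : \bar R) in
     measurable_fun [set: Omega] (fun w => (expeR (tau%:E * supX w * supX w)%E : \bar R)) /\
     (\int[P]_w expeR (tau%:E * supX w * supX w)%E < +oo)%E) ->
  (exists C1 : R, 0 < C1 /\ 0 < kappa <= 1 /\
     forall s s' : 'rV[R]_d, I s -> I s' ->
       (\int[P]_w ((X w s - X w s') ^+ 2)%:E <= (C1 * powR (eucl_dist s s') (2 * kappa))%:E)%E) ->
  (* (A4) *)
  (forall x, 0 <= rho x) -> convex_real_fun rho ->
  (exists C2 : R, forall x y, `|rho x - rho y| <= C2 * `|x - y|) ->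
  (* (A5) *)
  (forall u : R, P.-integrable [set: Omega] (fun w => (rho (eps 0%N w + u))%:E)) ->
  (let g := fun u : R => fine (\int[P]_w (rho (eps 0%N w + u))%:E) in
   (forall u, u != 0 -> g 0 < g u) /\
   (forall u, derivable g u 1) /\ (forall u, derivable (derive1 g) u 1) /\
   (exists M2 : R, forall u, `|derive1 (derive1 g) u| <= M2) /\
  (* (A6) *)
   (exists e : R, 0 < e /\ forall u, `|u| <= e -> e * u ^+ 2 <= g u - g 0)) ->
  (* penalty parameters *)
  (forall n w, 0 < lam n w) ->
  (let r2 := fun n : nat => powR n%:R (- (2 * m)%:R / (2 * m + d)%:R)
                             + powR (maxdiam (A n)) (2 * kappa) in
   bigO_in_prob P lam (fun n => powR (ln n%:R) (3 / 2) * r2 n) /\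
   bigO_in_prob P (fun n w => (lam n w)^-1 * powR (ln n%:R) (3 / 2) * r2 n) (fun _ => 1)) ->
  (* the estimator *)
  (forall n, (0 < n)%N -> forall w,
     inHm mu m (bhat n w) /\
     forall beta, inHm mu m beta ->
       (objective mu I rho m n (t n) Xs (response mu I Xs eps beta0) (lam n w) w (bhat n w)
        <= objective mu I rho m n (t n) Xs (response mu I Xs eps beta0) (lam n w) w beta)%E) ->
  (* conclusion *)
  bigO_in_prob P (fun n w => norm_np mu I n (t n) Xs w (bhat n w - beta0))
          (fun n => ln n%:R ^+ 2 * (powR n%:R (- m%:R / (2 * m + d)%:R)
                                    + powR (maxdiam (A n)) kappa)) /\
  bigO_in_prob P (fun n w => Jm mu I m (t n) (bhat n w)) (fun _ => 1).
Proof.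
move=> d0 m1 leb jX _ iid Hbeta0 des dm oI bI _ [B [NB HB]] [tau [/andP[tau0 _] [msup isup]]] [C1 [C10 [/andP[kap0 kap1] hX]]].
move=> rho0 rhoC [C2 rhoL] rhoI [gmin [dg [ddg [[M2 HM2] [e [e0 He]]]]]] lam0 [lamU lamL] est.
case: m => [//|m'] in m1 Hbeta0 dm lamU lamL est *.
have md : (d + 2 <= 2 * m'.+1)%N by move: dm; rewrite addn1 addn2.
set m := m'.+1 in m1 Hbeta0 dm lamU lamL est md *.
have I0 : I !=set0.
  have [p0 _] := des 0%N; exists (t 0%N (Ordinal p0)); exact: design_points (des 0%N) _.
have [v [v0 vI]] := domain_measure leb d0 oI bI I0.
have mI : measurable (I : set (Rd R d)) by exact: measurable_domain.
have [a0 [H [H0 IH]]] := domain_in_cube bI.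
(* Large enough for the enclosing cube and also for every cell diameter. *)
pose H1 := d%:R * H + H.
have H10 : 0 < H1 by rewrite ltr_wpDl// mulr_ge0// ltW.
have IQ : I `<=` cube a0 H1.
  move=> x /IH Hx i; have /andP[h1 h2] := Hx i; rewrite h1/=; apply: le_trans h2 _.
  by rewrite lerD2l lerDr mulr_ge0// ltW.
have mxd n : maxdiam (A n) <= H1.
  by apply: le_trans (maxdiam_le d0 H0 IH (des n)) _; rewrite lerDl ltW.
have [At [At0 tail]] := sup_tail (section_measurable jX) tau0 msup isup.
have gC := g_convex rhoC rhoI.
have gU x := quadratic_upper_bound x gmin dg ddg HM2.
have M20 : 0 <= M2 by exact: le_trans (HM2 0).
have C20 : 0 <= C2 by have := le_trans (normr_ge0 _) (rhoL 1 0); rewrite subr0 normr1 mulr1.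
have Cd0 : 0 <= spread_const d v B by exact/ltW/spread_const_gt0.
have [b b0 Hb] := inHm_bounded leb d0 md a0 Hbeta0 H10.
pose Aj := class_const d v.
have Aj0 : 0 < Aj by exact: class_const_gt0.
pose J0m := v * b ^+ 2 + fine (Im2 mu m beta0).
have J0m0 : 0 <= J0m.
  by rewrite addr_ge0//; [rewrite mulr_ge0 ?sqr_ge0// ltW|rewrite fine_ge0// Im2_ge0].
(* One exceptional event and one constant serve both conclusions. *)
suff main : forall ez : R, 0 < ez -> exists Mz, 0 < Mz /\ exists N, forall n, (N <= n)%N ->
    exists E : set Omega, [/\ measurable E, (P E <= ez%:E)%E & forall w, ~ E w ->
      `|norm_np mu I n (t n) Xs w (bhat n w - beta0)| <=
        Mz * (ln n%:R ^+ 2 * (powR n%:R (- m%:R / (2 * m + d)%:R) + powR (maxdiam (A n)) kappa)) /\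
      `|Jm mu I m (t n) (bhat n w)| <= Mz * 1].
  split=> ez ez0; have [Mz [Mz0 [N HN]]] := main ez ez0; exists Mz; split => //; exists N => n nN;
    have [E [mE PE HE]] := HN n nN; exists E; split => //; split => // w /= Hw; apply: contrapT => nE;
    have [h1 h2] := HE w nE; by [move: h1; rewrite leNgt Hw|move: h2; rewrite leNgt Hw].
(* Four contributions: the design errors, the term [(At + 2) / y], and the two bounds on [lam]. *)
move=> ez ez0; pose del := ez / 4.
have del0 : 0 < del by rewrite divr_gt0.
have [CB [CT [CB0 CT0 Hev]]] := estimator_event leb d0 md oI bI vI v0 I0 H10 IQ Cd0 jX iid kap0 kap1 C10 tau0 At0 hX tail Hbeta0 rho0 rhoL rhoI gC gU M20 e0 He del0.
have [Ml [Ml0 [Nl HNl]]] := lamL del del0.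
have [Mu [Mu0 [Nu HNu]]] := lamU del del0.
(* The lower bound on [lam] turns the remainder of order [CB * K] times the rate into
   [G * K * lam]. *)
pose G := CB * Ml.
have G0 : 0 < G by exact: mulr_gt0.
(* Exceeds the threshold of [localization], with the penalty of [beta0] replaced by its bound [J0m],
   valid for all designs. *)
pose K := Aj * G + 2 * (Aj * J0m) + 2.
have K2 : 2 <= K by rewrite /K lerDr addr_ge0// ?mulr_ge0// ?mulr_ge0// ltW.
have K1 : 1 <= K by apply: le_trans K2; rewrite ler1n.
have K0 : 0 < K by exact: lt_le_trans K1.
pose Mz := 1 + Num.sqrt (4 * (CT * K) / e ^+ 2 * (Mu * J0m + CB * K) / v) + Num.sqrt (K ^+ 2 / Aj).
have s0 x : 0 <= Num.sqrt x :> R by exact: sqrtr_ge0.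
exists Mz; split; first by rewrite /Mz ltr_wpDr// ltr_wpDr.
pose yb := (At + 2) / del.
have yb0 : 0 < yb by rewrite divr_gt0// addr_gt0.
(* From these indices on, [log n >= 1] and [y >= (At + 2) / del]. *)
pose Ne := (Num.truncn (expR 1 : R)).+1; pose Ny := (Num.truncn (yb ^+ (2 * m + d))).+1.
exists (maxn (maxn NB (maxn Nl Nu)) (maxn Ne Ny)) => n.
rewrite !geq_max => /andP[/andP[nB /andP[nl nu]] /andP[ne ny]].
have n0 : (0 < n)%N by exact: leq_trans ne.
have nR : 0 < n%:R :> R by rewrite ltr0n.
have up (x : R) k : ((Num.truncn x).+1 <= k)%N -> x <= k%:R.
  by move=> xk; apply: le_trans (ltW (truncnS_gt x)) _; rewrite ler_nat.
have en : (expR 1 : R) <= n%:R by exact: up.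
have [y [k [y1 yn [ky yk] rE aE]]] := rate_scale R n0 m1 d0.
have y0 : 0 < y by apply: lt_le_trans y1.
have ybn : yb <= y.
  rewrite leNgt; apply/negP => ylt; have : n%:R <= yb ^+ (2 * m + d) -> False.
    by move=> _; have := up _ _ ny; rewrite -yn leNgt ltrXn2r ?(ltW y0) ?(ltW yb0)// addn_eq0 negb_and (gtn_eqF d0) orbT.
  by apply; rewrite -yn; apply: lerXn2r; rewrite ?nnegrE ?(ltW y0) ?(ltW yb0)// ltW.
have ts := design_spread leb d0 mI vI v0 (proj1 (des n)) (design_points (des n)) (HB n nB).
have [E0 [mE0 PE0 HE0]] := Hev n (p n) (t n) (A n) K y k n0 en y1 yn ky yk (des n) (mxd n) ts K1.
have [El [mEl [sEl PEl]]] := HNl n nl.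
have [Eu [mEu [sEu PEu]]] := HNu n nu.
exists (E0 `|` El `|` Eu); split; first by apply: measurableU => //; exact: measurableU.
  apply: le_trans (measureU2 _ _ _) _ => //; first exact: measurableU.
  apply: le_trans (leeD (measureU2 _ mE0 mEl) (lexx _)) _.
  apply: le_trans (leeD (leeD PE0 PEl) PEu) _; rewrite -!EFinD lee_fin.
  have : (At + 2) / y <= del by rewrite ler_pdivrMr// mulrC -ler_pdivrMr.
  have -> : ez = del + del + del + del by rewrite /del; field.
  by rewrite !lerD2r lerD2l.
move=> w /not_orP[/not_orP[nE0 nEl] nEu].
pose L := ln (n%:R : R); pose sL := Num.sqrt L.
have L1 : 1 <= L by rewrite /L -[leLHS]expRK ler_ln ?posrE ?expR_gt0.
have L0 : 0 < L by apply: lt_le_trans L1.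
have sL2 : L = sL ^+ 2 by rewrite sqr_sqrtr// ltW.
have sL1 : 1 <= sL by rewrite -[leLHS]sqrtr1; exact: ler_wsqrtr.
have L32 : powR L (3 / 2) = L * sL.
  have -> : 3 / 2 = 1 + 2^-1 :> R by field.
  by rewrite powRD ?(gt_eqF L0) ?implybT// powRr1 ?(ltW L0)// powR12_sqrt// ltW.
pose hh := powR (maxdiam (A n)) kappa; pose a := (y ^+ m)^-1.
have hh0 : 0 <= hh by exact: powR_ge0.
have aa0 : 0 <= a by rewrite invr_ge0 exprn_ge0// ltW.
have hkE : powR (maxdiam (A n)) (2 * kappa) = hh ^+ 2.
  by rewrite mulrC powRrM powR_mulrn// powR_ge0.
have rE2 : (y ^+ (2 * m))^-1 = a ^+ 2 by rewrite mulnC exprM exprVn.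
have r20 : 0 <= a ^+ 2 + hh ^+ 2 by rewrite addr_ge0 ?sqr_ge0.
have LsL0 : 0 < L * sL by rewrite mulr_gt0//; apply: lt_le_trans sL1.
have lmU : lam n w <= Mu * (L * sL * (a ^+ 2 + hh ^+ 2)).
  have : ~ (Mu * (powR (ln n%:R) (3 / 2) * (powR n%:R (- (2 * m)%:R / (2 * m + d)%:R) + powR (maxdiam (A n)) (2 * kappa))) < `|lam n w|).
    by move=> Hc; apply: nEu; exact: sEu.
  by move/negP; rewrite -leNgt ger0_norm ?(ltW (lam0 n w))// -/L L32 rE rE2 hkE.
have lmL : L * sL * (a ^+ 2 + hh ^+ 2) <= Ml * lam n w.
  have : ~ (Ml * 1 < `|(lam n w)^-1 * powR (ln n%:R) (3 / 2) * (powR n%:R (- (2 * m)%:R / (2 * m + d)%:R) + powR (maxdiam (A n)) (2 * kappa))|).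
    by move=> Hc; apply: nEl; exact: sEl.
  move/negP; rewrite -leNgt -/L L32 rE rE2 hkE mulr1 -mulrA ger0_norm; last first.
    apply: mulr_ge0; first by rewrite invr_ge0 (ltW (lam0 n w)).
    by rewrite mulr_ge0// ltW.
  by rewrite mulrC ler_pdivrMr.
have [Hf opt] := est n n0 w.
set f := bhat n w in Hf opt *.
have {}opt := excess_le_penalty vI Hf Hbeta0 (opt beta0 Hbeta0).
have pn0 : (0 < p n)%N := proj1 (des n).
pose J0 := penalty m' mu v (t n) beta0; pose Jh := penalty m' mu v (t n) f.
have J00 : 0 <= J0 by exact: penalty_ge0.
have Jh0 : 0 <= Jh by exact: penalty_ge0.
have J0J : J0 <= J0m.
  by apply: (penalty_le _ _ v0 pn0) => j; apply: Hb; apply: IQ; exact: design_points (des n) _.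
pose Jt := Num.sqrt (Aj * (J0 + Jh) + 1).
have Jr : 0 < Aj * (J0 + Jh) + 1 by rewrite ltr_wpDl// mulr_ge0 ?(ltW Aj0)// addr_ge0.
have JtE : Jt ^+ 2 = Aj * (J0 + Jh) + 1 by rewrite sqr_sqrtr// ltW.
have Jt0 : 0 < Jt by rewrite sqrtr_gt0.
pose u : 'rV[R]_(p n) := \row_j (f - beta0) (t n j).
pose de i := discretization_error mu I v Xs beta0 (t n) i w.
pose fu (x : 'rV[R]_(p n)) i := fitted v Xs (t n) i w x.
pose LD (s : R) := n%:R^-1 * \sum_(i < n) (rho (eps i w + (de i - s * fu u i)) - rho (eps i w + de i)).
pose F := n%:R^-1 * \sum_(i < n) (fu u i) ^+ 2.
pose q := e ^+ 2 / (4 * (CT * K * sL)).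
pose Bn := CB * (K * (L * sL) * (a ^+ 2 + hh ^+ 2)).
have F0 : 0 <= F by rewrite mulr_ge0 ?invr_ge0// sumr_ge0// => i _; exact: sqr_ge0.
(* The same event covers the whole segment from [beta0] to the estimator, as long as the contracted
   perturbation stays in the ball of radius [K]. *)
have low s : 0 <= s <= 1 -> s * Jt <= K -> q * (s ^+ 2 * F) - Bn <= LD s.
  move=> /andP[s0' _] sJ; have uK := perturbation_in_class v0 a0 H1 Hf Hbeta0 pn0 s0' Jt0 (ltW K0) JtE sJ.
  have := HE0 w _ nE0 uK; rewrite -/L -/sL -/q rE2 hkE -/Bn.
  have -> : n%:R^-1 * (\sum_(i < n) fitted v Xs (t n) i w (s *: u) ^+ 2) = s ^+ 2 * F.
    rewrite /F mulrCA; congr (_ * _); rewrite mulr_sumr; apply: eq_bigr => i _.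
    by rewrite /fitted linZ exprMn.
  move=> H'; apply: le_trans H' _; rewrite /LD le_eqVlt; apply/orP; left; apply/eqP; congr (_ * _).
  by apply: eq_bigr => i _; rewrite /fitted linZ.
have conv s : 0 <= s <= 1 -> LD s <= s * LD 1.
  move=> s01; rewrite /LD mulrCA ler_pM2l ?invr_gt0//.
  apply: le_trans (excess_convex (fun i : 'I_n => eps i w) (fun i => de i) (fun i => fu u i) rhoC s01) _.
  by under [X in _ <= _ * X]eq_bigr do rewrite mul1r.
have LD1 : LD 1 <= lam n w * (J0 - Jh).
  by rewrite /LD; under eq_bigr do rewrite mul1r; exact: opt.
have BG : Bn <= G * K * lam n w.
  have -> : Bn = CB * K * (L * sL * (a ^+ 2 + hh ^+ 2)) by rewrite /Bn; ring.
  have -> : G * K * lam n w = CB * K * (Ml * lam n w) by rewrite /G; ring.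
  by rewrite ler_pM2l// mulr_gt0.
have sL0 : 0 < sL by apply: lt_le_trans sL1.
have q0 : 0 <= q by apply: divr_ge0; nneg.
have HK : Aj * G + 2 * (Aj * J0) + 1 < K.
  have H' : Aj * J0 <= Aj * J0m by rewrite ler_pM2l.
  by rewrite /K; move: H'; clear; lra.
have [JK qF] := localization (ltW Aj0) J00 Jh0 (lam0 n w) q0 F0 (ltW G0) Jt0 JtE low conv LD1 BG HK.
split.
  rewrite (norm_npE vI v0 Xs f beta0 (t n) pn0 n w) -/F aE -/hh -/a -/L ger0_norm//.
  have := rate_of_excess e0 v0 CT0 CB0 K1 sL1 sL2 aa0 hh0 (ltW Mu0) J00 J0J lmU qF.
  move=> /le_trans; apply; apply: ler_wpM2r; first by rewrite mulr_ge0 ?sqr_ge0// addr_ge0.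
  by rewrite /Mz addrAC lerDr addr_ge0.
rewrite mulr1 /Jm (Jm2_penalty vI (t n) Hf)/= -/Jh ger0_norm//.
(* [Jt^2] contains [Aj * Jh], so [Jt <= K] bounds the penalty [Jh] by [K^2 / Aj]. *)
apply: (@le_trans _ _ (Num.sqrt (K ^+ 2 / Aj))); last by rewrite /Mz lerDr addr_ge0.
apply: ler_wsqrtr; rewrite ler_pdivlMr// mulrC.
have KJ : Jt ^+ 2 <= K ^+ 2 by apply: lerXn2r; rewrite ?nnegrE ?(ltW Jt0) ?(ltW K0).
apply: (le_trans _ KJ); rewrite JtE.
have -> : Aj * (J0 + Jh) + 1 = Aj * Jh + (Aj * J0 + 1) by ring.
by rewrite lerDl addr_ge0// mulr_ge0// ltW.
Qed.
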